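(* Let $N\ge 1$ and let $\mathcal L:\mathrm{Dom}(\mathcal L)\subset L^2(\mathbb R^N)\to L^2(\mathbb R^N)$ be a self-adjoint Fourier multiplier with symbol $\hat L$ and with $\mathcal S(\mathbb R^N)\subset \mathrm{Dom}(\mathcal L)$. Assume that there exists $K\le 0$ such that $\hat L(\xi)\ge K$ for a.e. $\xi\in\mathbb R^N$. Let $f\in L^1_{loc}((0,+\infty)\times\mathbb R^N)$ be such that, for every small enough $\varepsilon>0$, $$\int_0^{+\infty}e^{-t/\varepsilon}\|f(t,\cdot)\|_{L^2(\mathbb R^N)}^2\,dt<+\infty .$$ Let $u_0\in V_{\mathcal L}$. Then there exists $\varepsilon_0>0$ such that for every $\varepsilon\in(0,\varepsilon_0)$ there exists a unique function $u_\varepsilon\in H^{\mathcal L}_\varepsilon$ which is a minimizer of $$\mathcal F_\varepsilon(u)=\int_{0}^{+\infty}\int_{\mathbb R^N}e^{-t/\varepsilon}\left(\frac\varepsilon2|u'|^2+\frac12 u\,\mathcal L u-fu\right)dx\,dt$$ over the set $\{u\in H^{\mathcal L}_\varepsilon:\ u(0,x)=u_0(x)\text{ for a.e. }x\in\mathbb R^N\}$. Moreover, letting $u$ denote the unique solution in $C^0([0,+\infty);L^2(\mathbb R^N))$ of the initial value problem $$u'+\mathcal L u=f\ \text{ in }(0,+\infty)\times\mathbb R^N,\qquad u(0)=u_0\ \text{ in }\mathbb R^N,$$ as $\varepsilon\to0$ we have $u_\varepsilon\to u$ a.e. in $(0,+\infty)\times\mathbb R^N$ and, for every $T>0$, $$u_\varepsilon\to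 u\quad\text{in } C^0([0,T];V_{\mathcal L}).$$
   Context: Conventions. Functions $u,f,u_0$ are real-valued. The prime $'$ denotes the time derivative. The hat on a function denotes the unitary Fourier transform in the space variable $x\in\mathbb R^N$ (so that Plancherel's theorem holds without constants). A self-adjoint Fourier multiplier with symbol $\hat L$ is the operator $\widehat{\mathcal L v}(\xi)=\hat L(\xi)\hat v(\xi)$, where $\hat L:\mathbb R^N\to\mathbb R$ is measurable, with domain $\mathrm{Dom}(\mathcal L)=\{v\in L^2(\mathbb R^N):\hat L\hat v\in L^2(\mathbb R^N)\}$. It is understood that $\mathcal L$ maps real-valued functions to real-valued functions, i.e. $\hat L(-\xi)=\hat L(\xi)$ for a.e. $\xi$. Spaces. $$V_{\mathcal L}:=\Big\{v\in L^2(\mathbb R^N):\int_{\mathbb R^N}|\hat L(\xi)||\hat v(\xi)|^2\,d\xi<+\infty\Big\},\qquad \|v\|_{V_{\mathcal L}}:=\Big(\int_{\mathbb R^N}(1+|\hat L(\xi)|)|\hat v(\xi)|^2\,d\xi\Big)^{1/2}.$$ $$H_\varepsilon:=\Big\{u\in W^{1,1}_{loc}((0,+\infty);L^2(\mathbb R^N)):\int_0^{+\infty}e^{-t/\varepsilon}\|u'(t,\cdot)\|_{L^2(\mathbb R^N)}^2\,dt<+\infty\Big\}.$$ $$H^{\mathcal L}_\varepsilon:=\Big\{u\in H_\varepsilon:\int_0^{+\infty}e^{-t/\varepsilon}\int_{\mathbb R^N}|\hat L(\xi)||\hat u(t,\xi)|^2\,d\xi\,dt<+\infty\Big\}.$$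 Each $u\in H_\varepsilon$ has a representative in $C^0([0,+\infty);L^2(\mathbb R^N))$, which is always used; $u(0,\cdot)$ is its value at $t=0$. In $\mathcal F_\varepsilon(u)$, for $u\in H^{\mathcal L}_\varepsilon$, the term $\int_{\mathbb R^N}u\,\mathcal L u\,dx$ is the quadratic form $\int_{\mathbb R^N}\hat L(\xi)|\hat u(t,\xi)|^2\,d\xi$. Solution of the initial value problem: a function $u\in C^0([0,+\infty);L^2(\mathbb R^N))$ with $u(0)=u_0$ whose spatial Fourier transform satisfies, for a.e. $\xi$, the ODE $\hat u'+\hat L(\xi)\hat u=\hat f$ in $t>0$ (in integrated form). It is given by $\hat u(t,\xi)=e^{-\hat L(\xi)t}\big(\hat u_0(\xi)+\int_0^te^{\hat L(\xi)s}\hat f(s,\xi)\,ds\big)$. Since the $u_\varepsilon$ are equivalence classes of functions, a.e. convergence as $\varepsilon\to0$ means a.e. convergence along every sequence $\varepsilon_n\to0^+$. *)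

(* Defs.v *)
From HB Require Import structures.
From mathcomp Require Import all_boot all_order all_algebra.
From mathcomp Require Import complex.
From mathcomp Require Import all_classical all_reals all_analysis.

Set Implicit Arguments.
Unset Strict Implicit.
Unset Printing Implicit Defensive.

Import Order.TTheory GRing.Theory Num.Theory.
Import numFieldNormedType.Exports.

Local Open Scope classical_set_scope.
Local Open Scope ring_scope.

(* The product sigma-algebra on row vectors; over the reals it is the Borel
   sigma-algebra of R^N. *)

Definition measure_rV_display : measure_display -> measure_display.
Proof. exact. Qed.

Section measurable_rV.
Context {d} {T : measurableType d}.
Variable n : nat.

Let coors : 'I_n -> 'rV[T]_n -> T := fun i x => x ord0 i.

Let rV_set0 : g_sigma_preimage coors set0.
Proof. exact: sigma_algebra0. Qed.

Let rV_setC A : g_sigma_preimage coors A -> g_sigma_preimage coors (~` A).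
Proof. exact: sigma_algebraC. Qed.

Let rV_bigcup (F : _^nat) : (forall i, g_sigma_preimage coors (F i)) ->
  g_sigma_preimage coors (\bigcup_i (F i)).
Proof. exact: sigma_algebra_bigcup. Qed.

HB.instance Definition _ := @isMeasurable.Build (measure_rV_display d)
  'rV[T]_n (g_sigma_preimage coors) rV_set0 rV_setC rV_bigcup.

End measurable_rV.


Lemma measurable_fun_rVP d1 d2 (T1 : measurableType d1)
    (T2 : measurableType d2) n (f : T1 -> 'rV[T2]_n) :
  (forall i, measurable_fun [set: T1] (fun x => f x ord0 i)) ->
  measurable_fun [set: T1] f.
Proof.
move=> mf; have S : g_sigma_preimage
    (fun i => (fun x : 'rV[T2]_n => x ord0 i) \o f) `<=` measurable.
  apply: smallest_sub; first exact: sigma_algebra_measurable.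
  case: n => [|n] in f mf *; first by rewrite big_ord0.
  by rewrite -bigcup_mkord_ord; apply: bigcup_sub => i _ A [B mB <-]; exact: mf.
by move: S; rewrite g_sigma_preimage_comp => S _ A mA; apply: S; exists A.
Qed.

Lemma measurable_rV_coord d (T : measurableType d) n (i : 'I_n) :
  measurable_fun [set: 'rV[T]_n] (fun x => x ord0 i).
Proof.
move=> _ Y mY; rewrite setTI; apply: sub_sigma_algebra => /=.
rewrite -bigcup_seq/=; exists i => /=; first by rewrite mem_index_enum.
by exists Y => //; rewrite setTI.
Qed.

Section lebesgue_rV_step.
Context {R : realType} {n : nat}.
Variable m : {sigma_finite_measure set 'rV[R]_n -> \bar R}.

Definition consrV (p : measurableTypeR R * 'rV[R]_n) : 'rV[R]_n.+1 :=
  row_mx (const_mx p.1) p.2 : 'rV[R]_(1 + n).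

Definition lebesgue_rV_step := pushforward (lebesgue_measure \x m)%E consrV.

Lemma measurable_consrV : measurable_fun [set: _] consrV.
Proof.
apply: measurable_fun_rVP => i.
have [j ij|j ij] := split_ordP (i : 'I_(1 + n)).
  rewrite (_ : (fun _ => _) = fst); first exact: measurable_fst.
  by apply/funext => x; rewrite ij; apply: etrans (row_mxEl _ _ _ _) _; rewrite mxE.
rewrite (_ : (fun _ => _) = (fun x : 'rV[R]_n => x ord0 j) \o snd).
  by apply: measurableT_comp => //; exact: measurable_rV_coord.
by apply/funext => x; rewrite ij; exact: row_mxEr.
Qed.

Let unconsrV (x : 'rV[R]_n.+1) : measurableTypeR R * 'rV[R]_n :=
  (x ord0 ord0, rsubmx (x : 'rV[R]_(1 + n))).

Let measurable_unconsrV : measurable_fun [set: _] unconsrV.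
Proof.
apply/measurable_fun_pairP; split.
  exact: (@measurable_rV_coord _ (measurableTypeR R) n.+1 ord0).
apply: measurable_fun_rVP => i /=.
rewrite (_ : (fun _ => _) = (fun x : 'rV[R]_n.+1 => x ord0 (rshift 1 i))).
  exact: measurable_rV_coord.
by apply/funext => x /=; rewrite mxE.
Qed.

Let consrVK : cancel consrV unconsrV.
Proof.
move=> [a x]; rewrite /unconsrV /consrV row_mxKr; congr pair.
by rewrite mxE; case: splitP => // j _; rewrite mxE.
Qed.

Let step0 : lebesgue_rV_step set0 = 0%E.
Proof. by rewrite /lebesgue_rV_step /pushforward preimage_set0 measure0. Qed.

Let step_ge0 A : (0 <= lebesgue_rV_step A)%E.
Proof. by apply: integral_ge0 => x _; exact: measure_ge0. Qed.

Let step_sigma_additive : semi_sigma_additive lebesgue_rV_step.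
Proof.
have mP A : measurable A -> measurable (consrV @^-1` A).
  by move=> mA; rewrite -[X in measurable X]setTI; exact: measurable_consrV.
move=> F mF tF mUF; rewrite /lebesgue_rV_step /pushforward preimage_bigcup.
apply: measure_semi_sigma_additive.
- by move=> k; exact: mP.
- apply/trivIsetP => /= i j _ _ ij; rewrite -preimage_setI.
  by move/trivIsetP : tF => /(_ _ _ _ _ ij) ->//; rewrite preimage_set0.
- by rewrite -preimage_bigcup; exact: mP.
Qed.

Let step_sigma_finite : sigma_finite setT lebesgue_rV_step.
Proof.
have /sigma_finiteP[F [TF ndF Foo]] := sigma_finiteT (@lebesgue_measure R).
have /sigma_finiteP[G [TG ndG Goo]] := sigma_finiteT m.
exists (fun k => unconsrV @^-1` (F k `*` G k)).
  rewrite -preimage_bigcup (_ : \bigcup_k _ = setT) ?preimage_setT//.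
  rewrite -setXTT TF TG predeqE => -[x y]; split.
    by move=> [k _ []/= ? ?]; split; exists k.
  move=> [/= [k _ Fkx] [l _ Gly]]; exists (maxn k l) => //; split.
  - by move: x Fkx; exact/subsetPset/ndF/leq_maxl.
  - by move: y Gly; exact/subsetPset/ndG/leq_maxr.
move=> k; have [? ?] := Foo k; have [? ?] := Goo k; split.
  rewrite -[X in measurable X]setTI; apply: measurable_unconsrV => //.
  exact: measurableX.
rewrite /lebesgue_rV_step /pushforward -comp_preimage.
rewrite (_ : _ \o _ = id) ?preimage_id; last exact/funext/consrVK.
by rewrite product_measure1E// lte_mul_pinfty// ge0_fin_numE.
Qed.

HB.instance Definition _ := isMeasure.Build _ _ _ lebesgue_rV_step
  step0 step_ge0 step_sigma_additive.
HB.instance Definition _ := Measure_isSigmaFinite.Build _ _ _ lebesgue_rV_step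
  step_sigma_finite.

End lebesgue_rV_step.

(* Lebesgue measure on R^n, as the n-fold product of the one-dimensional one. *)
Fixpoint lebesgue_rV (R : realType) n :
    {sigma_finite_measure set 'rV[R]_n -> \bar R} :=
  match n return {sigma_finite_measure set 'rV[R]_n -> \bar R} with
  | 0 => dirac (0 : 'rV[R]_0)
  | n'.+1 => lebesgue_rV_step (lebesgue_rV R n')
  end.

Section spaces.
Context {R : realType} {N : nat}.
Local Notation E := 'rV[R]_N.
Local Notation mu := (@lebesgue_measure R).
Local Notation leb := (lebesgue_rV R N).
Local Notation cabs := (@Normc.normc R).
Implicit Types (v : E -> R) (w : E -> R[i]) (u g f : R -> E -> R).

Definition inL2 v := v \in Lfun leb 2%:E.

Definition L2norm v : \bar R := 'N[leb]_2%:E[EFin \o v]%E.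

Definition inL2C w := inL2 (fun xi => complex.Re (w xi)) /\
                      inL2 (fun xi => complex.Im (w xi)).

Definition dotp (x xi : E) : R := \sum_(i < N) x ord0 i * xi ord0 i.

(* (2 pi)^(-N/2) * \int v(x) e^(-i x.xi) dx, for v real-valued and integrable *)
Definition fourier_integral v (xi : E) : R[i] :=
  (Num.sqrt (2 * pi) ^- N)%:C%C *
  ((\int[leb]_x (v x * cos (dotp x xi)))%R +i*
   (- \int[leb]_x (v x * sin (dotp x xi)))%R)%C.

(* The L2 Fourier transform: extension by continuity from L1 `&` L2. *)
Definition is_fourier v w := [/\ inL2 v, inL2C w &
  exists vn : nat -> E -> R,
  [/\ forall n, vn n \in Lfun leb 1 /\ inL2 (vn n),
      L2norm (vn n \- v) @[n --> \oo] --> 0%E &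
      L2norm (fun xi => cabs (fourier_integral (vn n) xi - w xi)) @[n --> \oo]
        --> 0%E]].

(* A representative of the a.e. class of the transform of v (0 if v is not in
   L2). For a time-dependent v it is chosen separately at each time, hence is
   not jointly measurable in time and frequency. *)
Definition fourier v : E -> R[i] := xget (fun=> 0) [set w | is_fourier v w].

(* Since L maps real functions to real functions, its symbol is even. *)
Definition multiplier_symbol (Lhat : E -> R) :=
  measurable_fun [set: E] Lhat /\ {ae leb, forall xi, Lhat (- xi) = Lhat xi}.

Definition multiplier_dom (Lhat : E -> R) v :=
  inL2 v /\ inL2C (fun xi => (Lhat xi)%:C%C * fourier v xi).

Definition iter_partial (s : seq 'I_N) v : E -> R :=
  foldr (fun i (h : E -> R) x => 'D_(delta_mx ord0 i) h x) v s.

(* The boundedness of all the iterated partial derivatives makes v of class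
   C^infty. *)
Definition schwartz v :=
  (forall s i x, derivable (iter_partial s v) x (delta_mx ord0 i)) /\
  (forall s (k : nat), exists C : R, forall x,
     `|x| ^+ k * `|iter_partial s v x| <= C).

Definition inV (Lhat : E -> R) v := inL2 v /\
  (\int[leb]_xi (`|Lhat xi| * cabs (fourier v xi) ^+ 2)%:E < +oo)%E.

Definition Vnorm (Lhat : E -> R) v : \bar R :=
  sqrte (\int[leb]_xi ((1 + `|Lhat xi|) * cabs (fourier v xi) ^+ 2)%:E)%E.

Definition CV (Lhat : E -> R) (T : R) u :=
  (forall t, t \in `[0, T] -> inV Lhat (u t)) /\
  (forall t, t \in `[0, T] ->
     Vnorm Lhat (u s \- u t) @[s --> within `[0, T] (nbhs t)] --> 0%E).

(* Functions of time with values in L2(R^N) are represented by functions of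
   (t, x) that are jointly measurable. *)
Definition CL2 u :=
  [/\ measurable_fun [set z : R * E | 0 <= z.1] (fun z : R * E => u z.1 z.2),
      forall t, 0 <= t -> inL2 (u t) &
      forall t, 0 <= t ->
        L2norm (u s \- u t) @[s --> within `[0, +oo[ (nbhs t)] --> 0%E].

Definition L1locL2 u :=
  measurable_fun [set z : R * E | 0 < z.1] (fun z : R * E => u z.1 z.2) /\
  (forall a b, 0 < a -> (\int[mu]_(t in `[a, b]) L2norm (u t) < +oo)%E).

(* C_c^infty of the open half-line *)
Definition test_fun (phi : R -> R) :=
  (forall n t, derivable (derive1n n phi) t 1) /\
  (exists a b, 0 < a /\ forall t, phi t != 0 -> a <= t <= b).

Definition weak_dt u g := L1locL2 g /\
  (forall phi, test_fun phi -> {ae leb, forall x : E,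
    (\int[mu]_(t in `]0, +oo[) (derive1 phi t * u t x))%R =
    (- \int[mu]_(t in `]0, +oo[) (phi t * g t x))%R}).

Definition W11locL2 u := L1locL2 u /\ exists g, weak_dt u g.

(* A representative of the a.e. class of the weak time derivative *)
Definition dt u : R -> E -> R := xget (fun _ _ => 0) [set g | weak_dt u g].

(* The members of H_eps are given by their continuous representative on
   [0, +oo[. *)
Definition inH (eps : R) u := [/\ CL2 u, W11locL2 u &
  (\int[mu]_(t in `]0%R, +oo[) ((expR (- t / eps))%:E * L2norm (dt u t) ^+ 2)
    < +oo)%E].

Definition inHL (Lhat : E -> R) (eps : R) u := inH eps u /\
  (\int[mu]_(t in `]0%R, +oo[) ((expR (- t / eps))%:E *
     \int[leb]_xi (`|Lhat xi| * cabs (fourier (u t) xi) ^+ 2)%:E) < +oo)%E.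

Definition quad_form (Lhat : E -> R) v : \bar R :=
  (\int[leb]_xi (Lhat xi * cabs (fourier v xi) ^+ 2)%:E)%E.

Definition functional (Lhat : E -> R) f (eps : R) u : \bar R :=
  (\int[mu]_(t in `]0%R, +oo[) ((expR (- t / eps))%:E *
     ((eps / 2)%:E * \int[leb]_x (dt u t x ^+ 2)%:E
      + (2^-1)%:E * quad_form Lhat (u t)
      - \int[leb]_x (f t x * u t x)%:E)))%E.

Definition admissible (Lhat : E -> R) (u0 : E -> R) (eps : R) u :=
  inHL Lhat eps u /\ {ae leb, forall x, u 0 x = u0 x}.

Definition minimizer (Lhat : E -> R) f (u0 : E -> R) (eps : R) u :=
  admissible Lhat u0 eps u /\
  (forall g, admissible Lhat u0 eps g ->
     (functional Lhat f eps u <= functional Lhat f eps g)%E).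

Definition L1loc f :=
  measurable_fun [set z : R * E | 0 < z.1] (fun z : R * E => f z.1 z.2) /\
  (forall K : set (R * E), compact K -> K `<=` [set z | 0 < z.1] ->
     (\int[mu \x leb]_(z in K) `|f z.1 z.2|%:E < +oo)%E).

Definition Cmeasurable_fun d (T : measurableType d) (D : set T)
    (h : T -> R[i]) :=
  measurable_fun D (fun z => complex.Re (h z)) /\
  measurable_fun D (fun z => complex.Im (h z)).

Definition Cintegrable (A : set R) (h : R -> R[i]) :=
  mu.-integrable A (fun s => (complex.Re (h s))%:E) /\
  mu.-integrable A (fun s => (complex.Im (h s))%:E).

Definition Cintegral (A : set R) (h : R -> R[i]) : R[i] :=
  ((\int[mu]_(s in A) complex.Re (h s))%R +i*
   (\int[mu]_(s in A) complex.Im (h s))%R)%C.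

(* U and F are jointly measurable versions of the spatial Fourier transforms of
   u and f; the equation U' + Lhat U = F holds in integrated form. *)
Definition solution (Lhat : E -> R) f (u0 : E -> R) u :=
  [/\ CL2 u, {ae leb, forall x, u 0 x = u0 x} &
   exists U F : R -> E -> R[i],
   [/\ Cmeasurable_fun [set z : R * E | 0 <= z.1]
         (fun z : R * E => U z.1 z.2),
       Cmeasurable_fun [set z : R * E | 0 < z.1]
         (fun z : R * E => F z.1 z.2),
       forall t, 0 <= t -> {ae leb, forall xi, U t xi = fourier (u t) xi},
       {ae mu, forall t, 0 < t ->
          {ae leb, forall xi, F t xi = fourier (f t) xi}} &
       {ae leb, forall xi, forall t, 0 <= t ->
         [/\ Cintegrable `[0, t] (fun s => U s xi),
             Cintegrable `]0, t] (fun s => F s xi) &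
             U t xi + (Lhat xi)%:C%C * Cintegral `[0, t] (fun s => U s xi) =
             fourier u0 xi + Cintegral `]0, t] (fun s => F s xi)]}]].

End spaces.

(* Main.v *)
(* The real Hartley transform [hart v = Re (fourier v) - Im (fourier v)] is an
   isometric involution of L2, and it diagonalizes the problem: its isometry is
   proved by damping with [expR (- dl |xi|_1)], the transform of which is a
   Poisson kernel, and letting [dl] tend to 0.

   At a fixed frequency, of symbol [L], let [e a = 1 + e b], [e b^2 + b = L] and
   let [g] be the solution of [g' = a g - F / e] that does not grow at infinity.
   Up to the derivative of a function that vanishes at infinity, the density
     [expR (- t / e) (e / 2 v'^2 + L / 2 v^2 - F v)]
   equals [expR (- t / e) (e / 2) (v' + b v - g)^2], minus the same expression
   for [g] alone. So the functional is a constant depending on the initial datum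
   plus the integral of a square, and the minimizer solves [v' + b v = g], a
   perturbation of [v' + L v = F].

   Its distance to the limit is bounded by [sqrt e] times an L2 function of the
   frequency; together with a bound in V that is uniform in [e], this gives
   the uniform convergence in V by domination. Convergence almost everywhere
   along an arbitrary sequence needs more: in L2, the minimizers depend on
   [sqrt e] in a Lipschitz way, so that along any finite part of the sequence,
   sorted by [e], the increments telescope and the maximal function is bounded
   in L2 by the largest [sqrt e]. *)

From HB Require Import structures.
Require Import Defs.
From mathcomp Require Import all_boot all_order all_algebra.
From mathcomp Require Import complex.
From mathcomp Require Import all_classical all_reals all_analysis.
From mathcomp Require Import measurable_realfun ring lra.

Import Order.TTheory GRing.Theory Num.Theory.
Import numFieldNormedType.Exports.

Local Open Scope classical_set_scope.
Local Open Scope ring_scope.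

Set Implicit Arguments.
Unset Strict Implicit.
Unset Printing Implicit Defensive.

(** The Hartley transform replaces the Fourier transform because the data are real-valued: each
    frequency then carries one real scalar problem instead of a complex one tied to the opposite
    frequency. The quadratic quantities of the statement are integrals of [|fourier v|^2] against
    weights that are even in the frequency, and for such weights [|fourier v|^2] may be replaced by
    [hart v ^+ 2].

    All estimates hold under one smallness condition, [2 * e * rate <= 1]. It bounds the
    discriminant [1 + 4 e L] away from 0 for every [L >= K], and it makes the weight
    [expR (- t / e)] stronger than the growth [expR (rate * t)] of the squares of the solutions.
    This fixes the threshold [eps0].

    In the statement transforms are taken time by time, hence are not jointly measurable. The remedy
    is L2 of the product of time and space, in which jointly measurable versions are built as
    limits. For the same reason [y' = z] is encoded at a fixed frequency by integrals, which do not
    see the choice of a representative of [z]. *)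

Lemma sqr_normr (R : realDomainType) (x : R) : `|x| ^+ 2 = x ^+ 2.
Proof. exact/real_normK/num_real. Qed.

(** * Square-integrable functions *)

Section L2.
Context d (T : measurableType d) (R : realType).
Variable m : {measure set T -> \bar R}.
Implicit Types (f g h v w : T -> R).

(** Extended-real, so that it can be estimated and passed to the limit before finiteness is known.
    [ip] and [nrm] are real and have their usual meaning on [L2] only. *)
Definition sqint v : \bar R := (\int[m]_x (v x ^+ 2)%:E)%E.
Arguments sqint v%_R.
Definition L2 v := measurable_fun [set: T] v /\ (sqint v < +oo)%E.
Definition ip f g : R := (\int[m]_x (f x * g x))%R.
Definition nrm f : R := Num.sqrt (ip f f).
Arguments L2 v%_R.
Arguments ip (f g)%_R.
Arguments nrm f%_R.

Lemma measurable_sq (D : set T) v : measurable_fun D v ->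
  measurable_fun D (fun x => (v x ^+ 2)%:E).
Proof. by move=> mv; apply/measurable_EFinP/measurable_funX. Qed.

Lemma sqint_ge0 v : (0 <= sqint v)%E.
Proof. by apply: integral_ge0 => x _; rewrite lee_fin sqr_ge0. Qed.

Lemma L2_integrable v : L2 v -> m.-integrable [set: T] (fun x => (v x ^+ 2)%:E).
Proof.
move=> [mv foo]; apply/integrableP; split; first exact: measurable_sq.
rewrite (eq_integral (fun x => (v x ^+ 2)%:E))// => x _.
by rewrite gee0_abs// lee_fin sqr_ge0.
Qed.

Lemma sqint_le v w : measurable_fun [set: T] v -> measurable_fun [set: T] w ->
  (forall x, `|v x| <= `|w x|) -> (sqint v <= sqint w)%E.
Proof.
move=> mv mw vw; apply: ge0_le_integral => //.
- by move=> x _; rewrite lee_fin sqr_ge0.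
- exact: measurable_sq.
- exact: measurable_sq.
- by move=> x _; rewrite lee_fin -[leLHS]sqr_normr -[leRHS]sqr_normr lerXn2r ?nnegrE.
Qed.

Lemma L2_le v w : measurable_fun [set: T] v -> L2 w ->
  (forall x, `|v x| <= `|w x|) -> L2 v.
Proof. by move=> mv [mw woo] vw; split => //; apply: le_lt_trans woo; exact: sqint_le. Qed.

Lemma sqintZ a v : measurable_fun [set: T] v ->
  sqint (fun x => a * v x) = ((a ^+ 2)%:E * sqint v)%E.
Proof.
move=> mv; rewrite /sqint -ge0_integralZl//; last 3 first.
- exact: measurable_sq.
- by move=> x _; rewrite lee_fin sqr_ge0.
- by rewrite lee_fin sqr_ge0.
by apply: eq_integral => x _; rewrite exprMn EFinM.
Qed.

Lemma sqintN v : sqint (\- v) = sqint v.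
Proof. by apply: eq_integral => x _; rewrite /= sqrrN. Qed.

Lemma sqintBC v w : sqint (v \- w) = sqint (w \- v).
Proof. by apply: eq_integral => x _; rewrite /= -sqrrN opprB. Qed.

Lemma sqintD_le v w : measurable_fun [set: T] v -> measurable_fun [set: T] w ->
  (sqint (v \+ w) <= 2%:E * sqint v + 2%:E * sqint w)%E.
Proof.
move=> mv mw; rewrite /sqint -!ge0_integralZl//; last 4 first.
- exact: measurable_sq.
- by move=> x _; rewrite lee_fin sqr_ge0.
- exact: measurable_sq.
- by move=> x _; rewrite lee_fin sqr_ge0.
rewrite -ge0_integralD//; last 4 first.
- by move=> x _; rewrite -EFinM lee_fin mulr_ge0// sqr_ge0.
- by apply: measurable_funeM; exact: measurable_sq.
- by move=> x _; rewrite -EFinM lee_fin mulr_ge0// sqr_ge0.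
- by apply: measurable_funeM; exact: measurable_sq.
apply: ge0_le_integral => //.
- by move=> x _; rewrite lee_fin sqr_ge0.
- by apply: measurable_sq; exact: measurable_funD.
- apply: emeasurable_funD; apply: measurable_funeM; exact: measurable_sq.
- move=> x _; rewrite -!EFinM -EFinD lee_fin /=.
  by have := sqr_ge0 (v x - w x); nra.
Qed.

Lemma L2D v w : L2 v -> L2 w -> L2 (v \+ w).
Proof.
move=> [mv voo] [mw woo]; split; first exact: measurable_funD.
apply: le_lt_trans (sqintD_le mv mw) _.
by rewrite lte_add_pinfty// lte_mul_pinfty//= ?lee_fin.
Qed.

Lemma L2Z a v : L2 v -> L2 (fun x => a * v x).
Proof.
move=> [mv voo]; split; first exact: measurable_funM.
by rewrite sqintZ// lte_mul_pinfty// lee_fin sqr_ge0.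
Qed.

Lemma L2N v : L2 v -> L2 (\- v).
Proof. by move=> [mv voo]; split; [exact: measurableT_comp | rewrite sqintN]. Qed.

Lemma L2B v w : L2 v -> L2 w -> L2 (v \- w).
Proof. by move=> Lv Lw; exact: (L2D Lv (L2N Lw)). Qed.

Lemma L2_0 : L2 (fun=> 0).
Proof.
split; first exact: measurable_cst.
rewrite /sqint (eq_integral (cst 0%E)) ?integral0// => x _.
by rewrite expr0n.
Qed.

Lemma L2_abs v : L2 v -> L2 (fun x => `|v x|).
Proof.
move=> Lv; apply: (L2_le _ Lv) => [|x]; last by rewrite normr_id.
by apply: measurableT_comp => //; exact: Lv.1.
Qed.

Lemma L2_mul f g : L2 f -> L2 g ->
  m.-integrable [set: T] (fun x => (f x * g x)%:E).
Proof.
move=> Lf Lg; have iD := integrableD measurableT (L2_integrable Lf) (L2_integrable Lg).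
apply: (le_integrable _ _ _ iD) => //.
  by apply/measurable_EFinP; apply: measurable_funM; [exact: Lf.1|exact: Lg.1].
move=> x _; rewrite /= -?EFinD !lee_fin (@ger0_norm _ (_ + _)) ?addr_ge0 ?sqr_ge0//.
rewrite normrM; have := sqr_ge0 (`|f x| - `|g x|).
by rewrite -[f x ^+ 2]sqr_normr -[g x ^+ 2]sqr_normr; nra.
Qed.

Lemma ipE f g : L2 f -> L2 g -> (ip f g)%:E = (\int[m]_x (f x * g x)%:E)%E.
Proof. by move=> Lf Lg; rewrite /ip /Rintegral fineK// integrable_fin_num//; exact: L2_mul. Qed.

Lemma sqintE f : L2 f -> sqint f = (ip f f)%:E.
Proof. by move=> Lf; rewrite ipE//; apply: eq_integral => x _; rewrite expr2. Qed.

Lemma ipC f g : ip f g = ip g f.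
Proof. by apply: eq_Rintegral => x _; rewrite mulrC. Qed.

Lemma ipDl f g h : L2 f -> L2 g -> L2 h -> ip (f \+ g) h = ip f h + ip g h.
Proof.
move=> Lf Lg Lh; rewrite -RintegralD//; [|exact: L2_mul|exact: L2_mul].
by apply: eq_Rintegral => x _; rewrite mulrDl.
Qed.

Lemma ipZl a f g : L2 f -> L2 g -> ip (fun x => a * f x) g = a * ip f g.
Proof.
move=> Lf Lg; rewrite /ip -RintegralZl//; last exact: L2_mul.
by apply: eq_Rintegral => x _; rewrite mulrA.
Qed.

Lemma ipBl f g h : L2 f -> L2 g -> L2 h -> ip (f \- g) h = ip f h - ip g h.
Proof.
move=> Lf Lg Lh; rewrite -RintegralB//; [|exact: L2_mul|exact: L2_mul].
by apply: eq_Rintegral => x _; rewrite mulrBl.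
Qed.

Lemma ip_ge0 f : 0 <= ip f f.
Proof. by apply: Rintegral_ge0 => x _; rewrite -expr2 sqr_ge0. Qed.

Lemma nrm_ge0 f : 0 <= nrm f. Proof. exact: sqrtr_ge0. Qed.

Lemma nrm_sq f : nrm f ^+ 2 = ip f f.
Proof. by rewrite sqr_sqrtr// ip_ge0. Qed.

Lemma sqint_nrm f : L2 f -> sqint f = (nrm f ^+ 2)%:E.
Proof. by move=> Lf; rewrite nrm_sq sqintE. Qed.

Lemma nrm_le f c : 0 <= c -> L2 f -> (sqint f <= (c ^+ 2)%:E)%E -> nrm f <= c.
Proof. by move=> c0 Lf; rewrite sqint_nrm// lee_fin ler_sqr// nnegrE nrm_ge0. Qed.

Lemma ip_sqD f g a : L2 f -> L2 g ->
  ip (f \+ (fun x => a * g x)) (f \+ (fun x => a * g x)) =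
  ip f f + 2 * a * ip f g + a ^+ 2 * ip g g.
Proof.
move=> Lf Lg; have Lag := L2Z a Lg; have Ls := L2D Lf Lag.
have E w : L2 w -> ip (f \+ (fun x => a * g x)) w = ip f w + a * ip g w.
  by move=> Lw; rewrite ipDl// ipZl.
rewrite E// ![ip _ (f \+ _)]ipC !E// [ip g f]ipC; ring.
Qed.

Lemma cauchy_schwarz f g : L2 f -> L2 g -> `|ip f g| <= nrm f * nrm g.
Proof.
move=> Lf Lg; rewrite -(@ler_pXn2r _ 2) ?nnegrE ?mulr_ge0 ?nrm_ge0//.
rewrite exprMn !nrm_sq real_normK ?num_real//.
have A0 := ip_ge0 f; have C0 := ip_ge0 g.
have key a : 0 <= ip f f + 2 * a * ip f g + a ^+ 2 * ip g g.
  by rewrite -ip_sqD// ip_ge0.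
have [C_eq0|C_neq0] := eqVneq (ip g g) 0.
  have [->|B_neq0] := eqVneq (ip f g) 0; first by rewrite expr0n/= mulr_ge0.
  (* When [ip g g = 0] the quadratic polynomial is affine in [a]; at this [a] it would take the
     value -1. *)
  have := key (- (ip f f + 1) / (2 * ip f g)); rewrite C_eq0 mulr0 addr0.
  have -> : 2 * (- (ip f f + 1) / (2 * ip f g)) * ip f g = - (ip f f + 1) by field.
  lra.
have Cp : 0 < ip g g by rewrite lt_neqAle eq_sym C_neq0.
have := key (- ip f g / ip g g).
have -> : ip f f + 2 * (- ip f g / ip g g) * ip f g + (- ip f g / ip g g) ^+ 2 * ip g g
  = (ip f f * ip g g - ip f g ^+ 2) / ip g g by field.
by rewrite pmulr_lge0 ?invr_gt0// subr_ge0.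
Qed.

Lemma nrmD f g : L2 f -> L2 g -> nrm (f \+ g) <= nrm f + nrm g.
Proof.
move=> Lf Lg; have Lfg := L2D Lf Lg.
rewrite -(@ler_pXn2r _ 2) ?nnegrE ?addr_ge0 ?nrm_ge0// sqrrD !nrm_sq.
have -> : f \+ g = f \+ (fun x => 1 * g x) by apply/funext => x /=; rewrite mul1r.
rewrite ip_sqD//; have := cauchy_schwarz Lf Lg; rewrite ler_norml => /andP[_].
by rewrite expr1n mul1r mulr1 mulr2n; lra.
Qed.

Lemma nrmN f : nrm (\- f) = nrm f.
Proof. by congr Num.sqrt; apply: eq_Rintegral => x _; rewrite /= mulrNN. Qed.

Lemma nrmB f g : L2 f -> L2 g -> nrm (f \- g) <= nrm f + nrm g.
Proof. by move=> Lf Lg; rewrite -(nrmN g); apply: (nrmD Lf (L2N Lg)). Qed.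

Lemma sqint_eq0 f : measurable_fun [set: T] f -> sqint f = 0%E ->
  {ae m, forall x, f x = 0}.
Proof.
move=> mf f0; have : (\int[m]_x `|(f x ^+ 2)%:E| = 0)%E.
  by rewrite -[RHS]f0; apply: eq_integral => x _; rewrite gee0_abs// lee_fin sqr_ge0.
move/(ae_eq_integral_abs m measurableT (measurable_sq mf)).
by apply: filterS => x /= /(_ I)[] /eqP; rewrite sqrf_eq0 => /eqP.
Qed.

Lemma eq_sqint f g : measurable_fun [set: T] f -> measurable_fun [set: T] g ->
  {ae m, forall x, f x = g x} -> sqint f = sqint g.
Proof.
move=> mf mg fg; apply: ge0_ae_eq_integral => //; try exact: measurable_sq.
- by move=> x _; rewrite lee_fin sqr_ge0.
- by move=> x _; rewrite lee_fin sqr_ge0.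
- by apply: filterS fg => x /= ->.
Qed.

Lemma sqint_sub_eq0 f g : measurable_fun [set: T] f -> measurable_fun [set: T] g ->
  sqint (f \- g) = 0%E -> {ae m, forall x, f x = g x}.
Proof.
move=> mf mg /sqint_eq0 H; have := H (measurable_funB mf mg).
by apply: filterS => x /= /eqP; rewrite subr_eq0 => /eqP.
Qed.

Lemma eq_ip f f' g g' : L2 f -> L2 f' -> L2 g -> L2 g' ->
  {ae m, forall x, f x = f' x} -> {ae m, forall x, g x = g' x} -> ip f g = ip f' g'.
Proof.
move=> Lf Lf' Lg Lg' ff' gg'; apply: EFin_inj; rewrite !ipE//.
apply: ae_eq_integral => //.
- by have /measurable_int := L2_mul Lf Lg.
- by have /measurable_int := L2_mul Lf' Lg'.
- by apply: filterS2 ff' gg' => x /= -> ->.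
Qed.

Lemma ip_eq f g : L2 f -> L2 g -> (forall h, L2 h -> ip f h = ip g h) ->
  {ae m, forall x, f x = g x}.
Proof.
move=> Lf Lg fg; apply: sqint_sub_eq0; [exact: Lf.1|exact: Lg.1|].
by rewrite sqintE ?ipBl ?fg ?subrr//; exact: L2B.
Qed.

End L2.
Arguments sqint {d T R} m v%_R.
Arguments L2 {d T R} m v%_R.
Arguments ip {d T R} m (f g)%_R.
Arguments nrm {d T R} m f%_R.

(** With this form, estimates between extended reals give convergence without a separate proof of
    finiteness. *)
Lemma cvge0P (R : realType) (I : Type) (F : set_system I) (FF : ProperFilter F)
    (f : I -> \bar R) : (forall x, 0 <= f x)%E ->
  (forall e : R, 0 < e -> \forall x \near F, (f x <= e%:E)%E) <->
  f x @[x --> F] --> 0%E.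
Proof.
move=> f0; split=> [H|].
- apply/fine_cvgP; split.
    by apply: filterS (H 1 ltr01) => x fx; rewrite ge0_fin_numE// (le_lt_trans fx)// ltry.
  apply/cvgrPdist_le => e e0; apply: filterS (H e e0) => x fx.
  rewrite sub0r normrN ger0_norm ?fine_ge0// -lee_fin fineK//.
  by rewrite ge0_fin_numE// (le_lt_trans fx)// ltry.
- move=> /fine_cvgP[ffin /cvgrPdist_le H] e e0.
  apply: filterS2 ffin (H e e0) => x fx.
  by rewrite sub0r normrN /= ger0_norm ?fine_ge0// -lee_fin fineK.
Qed.

(** * Completeness of L2 *)

Section L2_complete.
Context d (T : measurableType d) (R : realType).
Variable m : {measure set T -> \bar R}.

(** The weights force [|u k.+1 - u k| <= sqrt M / 2 ^ k], so the telescoping series converges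
    absolutely. *)
Lemma cvg_weighted_increments (u : nat -> R) (M : R) :
  (forall k, 4 ^+ k * (u k.+1 - u k) ^+ 2 <= M) -> cvgn u.
Proof.
move=> H; have M0 : 0 <= M.
  by apply: le_trans (H 0); rewrite mulr_ge0// sqr_ge0.
have le k : `|u k.+1 - u k| <= geometric (Num.sqrt M) 2^-1 k.
  rewrite /geometric /= -(@ler_pXn2r _ 2) ?nnegrE// ?mulr_ge0 ?sqrtr_ge0 ?exprn_ge0//.
  rewrite sqr_normr exprMn sqr_sqrtr// -exprM mulnC exprM -(@ler_pM2l _ (4 ^+ k)) ?exprn_gt0//.
  rewrite [leRHS]mulrCA -exprMn (_ : 4 * 2^-1 ^+ 2 = 1 :> R); last by field.
  by rewrite expr1n mulr1.
have cs : cvgn (series (fun k => u k.+1 - u k)).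
  apply: normed_cvg; apply: (@series_le_cvg _ _ (geometric (Num.sqrt M) 2^-1)) => //.
  - by move=> k; exact: normr_ge0.
  - by move=> k; rewrite /geometric /= mulr_ge0 ?sqrtr_ge0 ?exprn_ge0.
  - by apply: is_cvg_geometric_series; rewrite ger0_norm// invf_lt1// ltr1n.
have -> : u = (fun k => u 0 + series (fun k => u k.+1 - u k) k).
  apply/funext => k; rewrite /series /= telescope_sumr// addrC subrK//.
by apply: is_cvgD => //; exact: is_cvg_cst.
Qed.

Lemma fatou_sqint (v_ : nat -> T -> R) (v : T -> R) (e : \bar R) :
  (forall n, measurable_fun [set: T] (v_ n)) -> measurable_fun [set: T] v ->
  {ae m, forall x, v_ n x @[n --> \oo] --> v x} ->
  (\forall n \near \oo, sqint m (v_ n) <= e)%E -> (sqint m v <= e)%E.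
Proof.
move=> mv_ mv v_v ve.
have mv2 n := measurable_sq (mv_ n).
have v0 n x : [set: T] x -> (0 <= (v_ n x ^+ 2)%:E)%E by rewrite lee_fin sqr_ge0.
have := fatou m measurableT mv2 v0.
rewrite -(@ae_eq_integral _ _ _ m [set: T] (fun x => limn_einf (fun n => (v_ n x ^+ 2)%:E)) (fun x => (v x ^+ 2)%:E)) //.
- move=> /le_trans; apply; rewrite limn_einf_lim.
  apply: lime_le; first exact: is_cvg_einfs.
  near=> N; apply: ge_ereal_inf; near \oo => K.
  exists (sqint m (v_ K)); last by near: K.
  by exists K => //=; near: K; exact: nbhs_infty_ge.
- exact: measurable_sq.
- rewrite (_ : (fun x => _) = (fun x => - limn_esup (fun n => - (v_ n x ^+ 2)%:E))%E).
    apply: measurableT_comp => //; apply: measurable_fun_limn_esup => n.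
    exact: measurableT_comp.
  by apply/funext => x; rewrite (limn_esupN (fun n => (v_ n x ^+ 2)%:E)) oppeK.
- apply: filterS v_v => x cx _; apply/esym.
  have : (v_ n x ^+ 2)%:E @[n --> \oo] --> (v x ^+ 2)%:E.
    by apply: cvg_EFin; [exact: nearW|exact: cvgM].
  by move/cvg_limn_einf_sup => -[].
Unshelve. all: by end_near. Qed.

Lemma L2_complete (g : nat -> T -> R) : (forall n, L2 m (g n)) ->
  (forall e : R, 0 < e -> exists N, forall p q, (N <= p)%N -> (N <= q)%N ->
     (sqint m (g p \- g q) <= e%:E)%E) ->
  exists h, L2 m h /\ sqint m (g n \- h) @[n --> \oo] --> 0%E.
Proof.
move=> Lg cau.
(* The factor [(4 ^+ k)^-1] cancels the weight in [D] below, and the remaining factors sum to 1: the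
   integral of [D] is at most 1. *)
pose tol k : R := (4 ^+ k)^-1 * (1 / (2 ^ k.+1)%:R).
have tol0 k : 0 < tol k by rewrite mulr_gt0// ?invr_gt0 ?exprn_gt0// divr_gt0// ltr0n expn_gt0.
have [N HN] := choice (fun k => cau _ (tol0 k)).
(* A sum rather than a maximum: it dominates every [N j] with [j <= k], and the successors make it
   at least [k]. *)
pose n_ k := (\sum_(j < k.+1) (N j).+1)%N.
have nN j k : (j <= k)%N -> (N j <= n_ k)%N.
  by move=> jk; rewrite /n_ (bigD1 (Ordinal (jk : (j < k.+1)%N)))//= (leq_trans (leqnSn _))// leq_addr.
have n_ge k : (k <= n_ k)%N.
  elim: k => // k IH; rewrite /n_ big_ord_recr/= (leq_trans (_ : _ <= n_ k + 1)%N)//.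
    by rewrite addn1 ltnS.
  by rewrite leq_add2l.
pose u k x := g (n_ k) x.
have mu_ k : measurable_fun [set: T] (u k) by exact: (Lg _).1.
pose D x : \bar R := (\sum_(0 <= k <oo) (4 ^+ k * (u k.+1 x - u k x) ^+ 2)%:E)%E.
have mt k : measurable_fun [set: T] (fun x => (4 ^+ k * (u k.+1 x - u k x) ^+ 2)%:E).
  apply/measurable_EFinP/measurable_funM => //; apply: measurable_funX.
  exact: measurable_funB.
have t0 k x : (0 <= (4 ^+ k * (u k.+1 x - u k x) ^+ 2)%:E)%E.
  by rewrite lee_fin mulr_ge0// sqr_ge0.
have mD : measurable_fun [set: T] D by apply: ge0_emeasurable_sum.
have iD : (\int[m]_x D x <= 1%:E)%E.
  rewrite /D integral_nneseries//.
  apply: le_trans (epsilon_trick0 xpredT ler01).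
  apply: lee_nneseries => k _; first by move=> _; apply: integral_ge0.
  under eq_integral do rewrite EFinM.
  rewrite ge0_integralZl//; last 2 first.
  - by apply: measurable_sq; exact: measurable_funB.
  - by move=> x _; rewrite lee_fin sqr_ge0.
  have := HN k _ _ (nN k k.+1 (leqnSn k)) (nN k k (leqnn k)).
  rewrite -(@lee_pmul2l _ (4 ^+ k)%:E)// ?lte_fin ?exprn_gt0// => /le_trans; apply.
  by rewrite -EFinM /tol mulVKf// expf_neq0.
have Dfin : {ae m, forall x, D x \is a fin_num}.
  have : m.-integrable [set: T] D.
    apply/integrableP; split => //; rewrite (eq_integral D) ?(le_lt_trans iD) ?ltry// => x _.
    by rewrite gee0_abs//; apply: nneseries_ge0 => k.
  by move/(integrable_ae measurableT); apply: filterS => x /(_ I).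
have cvgu : {ae m, forall x, cvgn (u ^~ x)}.
  apply: filterS Dfin => x Dx; apply: (@cvg_weighted_increments _ (fine (D x))) => k.
  rewrite -lee_fin fineK// /D (@nneseriesD1 _ _ k xpredT)// leeDl//.
  by apply: nneseries_ge0 => j.
(* An upper limit is measurable whether or not the sequence converges, and it is the limit where
   there is one. *)
pose h x := fine (limn_esup (fun k => (u k x)%:E)).
have hE x : cvgn (u ^~ x) -> u k x @[k --> \oo] --> h x.
  move=> cx; have : (u k x)%:E @[k --> \oo] --> (limn (u ^~ x))%:E.
    by apply: cvg_EFin cx; exact: nearW.
  move=> cE; rewrite /h; have [_ ->] := cvg_limn_einf_sup cE.
  exact: cx.
have mh : measurable_fun [set: T] h.
  apply: measurableT_comp => //.
  by apply: measurable_fun_limn_esup => k; exact/measurable_EFinP.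
have key p N0 (e : R) : (forall q, (N0 <= q)%N -> (sqint m (g p \- g q) <= e%:E)%E) ->
    (sqint m (g p \- h) <= e%:E)%E.
  move=> He; apply: (@fatou_sqint (fun k => g p \- u k)).
  - by move=> k; apply: measurable_funB => //; exact: (Lg p).1.
  - by apply: measurable_funB => //; exact: (Lg p).1.
  - by apply: filterS cvgu => x /hE cx; apply: cvgB => //; exact: cvg_cst.
  - by exists N0 => // k /= Nk; apply: He; exact: leq_trans (n_ge k).
have Lh : L2 m h.
  have [M HM] := cau 1 ltr01.
  have LM : L2 m (g M \- h).
    split; first by apply: measurable_funB => //; exact: (Lg M).1.
    by apply: le_lt_trans (ltry 1); apply: (key _ M) => q Mq; exact: HM.
  rewrite (_ : h = g M \- (g M \- h)); first exact: L2B.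
  by apply/funext => x /=; rewrite opprB addrC subrK.
exists h; split => //; apply/cvge0P => [n|e e0]; first exact: sqint_ge0.
have [M HM] := cau e e0; exists M => // p /= Mp.
by apply: (key _ M) => q Mq; exact: HM.
Qed.

End L2_complete.

(** * A monotone class argument in L2 *)

Section L2_density.
Import HBNNSimple.
Context d (T : measurableType d) (R : realType).
Variable m : {measure set T -> \bar R}.

Lemma L2_dominated (f_ : nat -> T -> R) (f g : T -> R) :
  (forall n, measurable_fun [set: T] (f_ n)) -> measurable_fun [set: T] f -> L2 m g ->
  {ae m, forall x, f_ n x @[n --> \oo] --> f x} ->
  (forall n, {ae m, forall x, `|f_ n x - f x| <= g x}) ->
  sqint m (f_ n \- f) @[n --> \oo] --> 0%E.
Proof.
move=> mf_ mf Lg f_f fg.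
have mfn n : measurable_fun [set: T] (fun x => ((f_ n x - f x) ^+ 2)%:E).
  by apply: measurable_sq; exact: measurable_funB.
have m0 : measurable_fun [set: T] (fun=> 0%:E : \bar R) by exact: measurable_cst.
have c0 : {ae m, forall x, [set: T] x ->
    ((f_ n x - f x) ^+ 2)%:E @[n --> \oo] --> (0 : R)%:E}.
  apply: filterS f_f => x fx _; apply: cvg_EFin; first exact: nearW.
  rewrite -[X in _ --> X](mul0r (0 : R)); apply: cvgM; rewrite -(subrr (f x));
    by apply: cvgB => //; exact: cvg_cst.
have dom : {ae m, forall x n, [set: T] x ->
    (`|((f_ n x - f x) ^+ 2)%:E| <= (g x ^+ 2)%:E)%E}.
  apply: filterS (ae_foralln fg) => x fgx n _.
  by rewrite gee0_abs ?lee_fin ?sqr_ge0// -sqr_normr lerXn2r ?nnegrE// (le_trans _ (fgx n)).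
have [_ _] := dominated_convergence measurableT mfn m0 c0 (L2_integrable Lg) dom.
by rewrite integral0.
Qed.

Lemma L2_indic A : measurable A -> (m A < +oo)%E -> L2 m (\1_A : T -> R).
Proof.
move=> mA Aoo; split; first exact: measurable_indic.
rewrite /sqint (eq_integral (fun x => (\1_A x)%:E)).
  by rewrite integral_indic// setIT.
by move=> x _; rewrite indicE; case: (_ \in _); rewrite ?expr1n ?expr0n.
Qed.

(** Dynkin induction, then simple functions, then positive and negative parts. Sets are intersected
    with the exhausting [B k], so that the induction, which takes complements and countable unions,
    stays among sets of finite measure. *)
Lemma L2_density (G : set (set T)) (B : nat -> set T) (P : (T -> R) -> Prop) :
  @measurable _ T = <<s G >> -> setI_closed G ->
  (forall k, G (B k)) -> nondecreasing_seq B -> \bigcup_k B k = setT ->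
  (forall k, m (B k) < +oo)%E ->
  (forall a f g, L2 m f -> L2 m g -> P f -> P g -> P (fun x => f x + a * g x)) ->
  (forall f_ f, (forall n, L2 m (f_ n)) -> L2 m f -> (forall n, P (f_ n)) ->
     sqint m (f_ n \- f) @[n --> \oo] --> 0%E -> P f) ->
  (forall A, G A -> (m A < +oo)%E -> P (\1_A)) ->
  forall f, L2 m f -> P f.
Proof.
move=> GE GI GB ndB UB Boo PD Plim PG.
have mB k : measurable (B k) by rewrite GE; exact: sub_gen_smallest.
have mG A : G A -> measurable A by move=> GA; rewrite GE; exact: sub_gen_smallest.
have AB k A : measurable A -> (m (A `&` B k) < +oo)%E.
  by move=> mA; apply: le_lt_trans (Boo k); apply: le_measure; rewrite ?inE//; exact: measurableI.
have LAB k A : measurable A -> L2 m (\1_(A `&` B k) : T -> R).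
  by move=> mA; apply: L2_indic; [exact: measurableI|exact: AB].
have LB k : L2 m (\1_(B k) : T -> R) by exact: L2_indic.
have PB k : P (\1_(B k)) by exact: PG.
have P0 : P (fun=> 0).
  have := PD (- 1) _ _ (LB 0) (LB 0) (PB 0) (PB 0); congr P.
  by apply/funext => x; rewrite mulN1r subrr.
have PZ a f : L2 m f -> P f -> P (fun x => a * f x).
  move=> Lf Pf; have := PD a _ _ (L2_0 m) Lf P0 Pf; congr P.
  by apply/funext => x; rewrite add0r.
have Psum n (c : nat -> R) (h : nat -> T -> R) :
    (forall i, (i < n)%N -> L2 m (h i) /\ P (h i)) ->
    L2 m (fun x => \sum_(i < n) c i * h i x) /\ P (fun x => \sum_(i < n) c i * h i x).
  elim: n => [|n IH] hP.
    rewrite (_ : (fun _ => _) = fun=> 0); first by split => //; exact: L2_0.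
    by apply/funext => x; rewrite big_ord0.
  rewrite (_ : (fun _ => _) = fun x => \sum_(i < n) c i * h i x + c n * h n x); last first.
    by apply/funext => x; rewrite big_ord_recr.
  have [L1 P1] := IH (fun i ilt => hP i (ltnW ilt)).
  have [Ln Pn] := hP n (ltnSn n).
  by split; [apply: L2D => //; exact: L2Z|exact: PD].
have PAB k A : measurable A -> P (\1_(A `&` B k)).
  rewrite GE => sA; move: A sA; apply: (dynkin_induction GE GI).
  - by rewrite setTI.
  - by move=> A GA; apply: PG; [exact: GI|apply: AB; exact: mG].
  - move=> S mS PS; have := PD (- 1) _ _ (LB k) (LAB k _ mS) (PB k) PS; congr P.
    apply/funext => x; rewrite !indicE !in_setI in_setC.
    by case: (x \in S); case: (x \in B k); rewrite /= ?mulN1r ?subrr ?subr0.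
  - move=> F mF tF PF.
    have mU n : measurable (\big[setU/set0]_(i < n) F i).
      by apply: bigsetU_measurable => i _.
    apply: (Plim (fun n => \1_(\big[setU/set0]_(i < n) F i `&` B k))).
    + by move=> n; exact: LAB.
    + by apply: LAB; exact: bigcup_measurable.
    + move=> n; have [_] := Psum n (fun=> 1) (fun i => \1_(F i `&` B k))
          (fun i _ => conj (LAB k _ (mF i)) (PF i)).
      congr P; apply/funext => x; elim: n => [|n IH].
        by rewrite !big_ord0 indicE set0I in_set0.
      rewrite !big_ord_recr/= IH !indicE mul1r !in_setI in_setU.
      have [xF|] := boolP (x \in F n); last by rewrite /= addr0 orbF.
      rewrite orbT/= (_ : x \in \big[setU/set0]_(i < n) F i = false) ?add0r//.
      apply/negP; rewrite inE -bigcup_mkord => -[i /= ilt xi].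
      have /trivIsetP/(_ n i I I) := tF.
      move=> H; have := H (_ : n != i); rewrite eq_sym neq_ltn ilt => /(_ isT).
      move/seteqP => -[] /(_ x) + _; apply; split => //; by rewrite inE in xF.
    + apply: (@L2_dominated _ _ (\1_(B k))).
      * by move=> n; apply: measurable_indic; exact: measurableI.
      * by apply: measurable_indic; apply: measurableI => //; exact: bigcup_measurable.
      * exact: LB.
      * apply: aeW => x; have [[i _ xi]|nx] := pselect ((\bigcup_k F k) x).
          apply: cvg_near_cst; exists i.+1 => // n /= ilt.
          rewrite !indicE !in_setI; congr ((_ && _)%:R); rewrite !mem_set//.
            by exists i.
          by rewrite -bigcup_mkord; exists i.
        apply: cvg_near_cst; apply: nearW => n.
        rewrite !indicE !in_setI; congr ((_ && _)%:R); rewrite !memNset//.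
        by rewrite -bigcup_mkord => -[i /= _ xi]; apply: nx; exists i.
      * move=> n; apply: aeW => x; rewrite !indicE !in_setI.
        by case: (x \in B k); rewrite ?andbT ?andbF ?subrr ?normr0//;
           case: (_ \in _); case: (_ \in _); rewrite ?subrr ?subr0 ?sub0r ?normrN ?normr1 ?normr0.
have Ppos f : L2 m f -> (forall x, 0 <= f x) -> P f.
  move=> Lf f0; have mf := Lf.1.
  have mEf : measurable_fun [set: T] (EFin \o f) by exact/measurable_EFinP.
  pose a n := nnsfun_approx measurableT mEf n.
  have a_f x : a n x @[n --> \oo] --> f x.
    suff /fine_cvgP[_] : (a n x)%:E @[n --> \oo] --> (f x)%:E by [].
    by apply: (cvg_nnsfun_approx measurableT mEf) => // y _; rewrite lee_fin.
  have a_le n x : a n x <= f x.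
    have nd := nd_nnsfun_approx measurableT mEf.
    have nx : nondecreasing_seq (fun n => a n x).
      by move=> i j ij; exact: (lefP _ _ (nd i j ij) x).
    rewrite -(cvg_lim _ (a_f x))//; apply: nondecreasing_cvgn_le => //.
    by apply/cvg_ex; exists (f x).
  pose h n x := a n x * \1_(B n) x.
  have mh n : measurable_fun [set: T] (h n).
    by apply: measurable_funM => //; exact: measurable_indic.
  have h0 n x : 0 <= h n x by rewrite mulr_ge0// indicE; case: (_ \in _).
  have hf n x : h n x <= f x.
    rewrite /h indicE; case: (_ \in _); rewrite ?mulr1 ?mulr0//.
  apply: (Plim h) => //.
  - by move=> n; apply: L2_le Lf _ => // x; rewrite !ger0_norm.
  - move=> n; pose s := finmap.enum_fset (fset_set (range (a n))).
    have ms i : measurable (a n @^-1` [set s`_i]).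
      by rewrite -[X in measurable X]setTI; apply: measurable_funP.
    have [_] := Psum (size s) (fun i => s`_i) (fun i => \1_(a n @^-1` [set s`_i] `&` B n))
      (fun i _ => conj (LAB n _ (ms i)) (PAB n _ (ms i))).
    congr P; apply/funext => x; rewrite /h fimfunE fsbig_finite//= (big_nth 0) big_mkord mulr_suml.
    apply: eq_bigr => i _; rewrite !indicE in_setI -mulrA; congr (_ * _).
    by case: (_ \in _); case: (_ \in _); rewrite ?mulr1 ?mulr0.
  - apply: (@L2_dominated _ _ f) => //.
    + apply: aeW => x; rewrite -[f x]mulr1; apply: cvgM => //.
      have : [set: T] x by []. rewrite -UB => -[K _ BK].
      apply: cvg_near_cst; exists K => // n /= Kn; rewrite indicE mem_set//.
      by have /subsetPset := ndB _ _ Kn; apply.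
    + by move=> n; apply: aeW => x; rewrite ler0_norm ?subr_le0// opprB gerBl.
move=> f Lf.
have L1 : L2 m (fun x => Num.max (f x) 0).
  apply: (L2_le _ Lf); first by apply: measurable_maxr => //; exact: Lf.1.
  by move=> x; case: (leP (f x) 0) => ?; rewrite ?normr0.
have L2' : L2 m (fun x => Num.max (- f x) 0).
  apply: (L2_le _ Lf); first by apply: measurable_maxr => //; apply: measurableT_comp => //; exact: Lf.1.
  by move=> x; case: (leP (- f x) 0) => ?; rewrite ?normr0 ?normrN.
have := PD (- 1) _ _ L1 L2' (Ppos _ L1 _) (Ppos _ L2' _); rewrite (_ : (fun _ => _) = f).
  by apply => x; rewrite le_max lexx orbT.
apply/funext => x; rewrite mulN1r; case: (leP (f x) 0) => ?; case: (leP (- f x) 0) => ?; lra.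
Qed.

End L2_density.

(** * Abel and Poisson kernels *)

Section FTC.
Context {R : realType}.
Local Notation mu := (@lebesgue_measure R).
Implicit Types f F : R -> R.

Lemma is_derive_continuous F (x y : R) : is_derive x 1 F y -> {for x, continuous F}.
Proof. by move=> d; apply: differentiable_continuous; apply/derivable1_diffP; case: d. Qed.

Lemma FTC2y f F (a l : R) : (forall x, 0 <= f x) -> continuous f ->
  (forall x : R, is_derive x 1 F (f x)) -> F x @[x --> +oo] --> l ->
  (\int[mu]_(x in `[a, +oo[) (f x)%:E)%E = (l - F a)%:E.
Proof.
move=> f0 cf dF Fl.
rewrite (@ge0_continuous_FTC2y _ f F a l) ?EFinB//.
- exact: continuous_subspaceT.
- by apply: cvg_at_right_filter; exact: is_derive_continuous (dF a).
- by move=> x _; rewrite derive1E; have [] := dF x.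
Qed.

Lemma FTC2 f F (a b : R) : a <= b -> continuous f ->
  (forall x : R, is_derive x 1 F (f x)) ->
  (\int[mu]_(x in `[a, b]) (f x)%:E)%E = (F b - F a)%:E.
Proof.
rewrite le_eqVlt => /predU1P[->|ab] cf dF.
  by rewrite set_itv1 integral_set1 subrr.
rewrite (@continuous_FTC2 _ f F a b) ?EFinB//.
- exact: continuous_subspaceT.
- split.
  + by move=> x _; have [] := dF x.
  + by apply: cvg_at_right_filter; exact: is_derive_continuous (dF a).
  + by apply: cvg_at_left_filter; exact: is_derive_continuous (dF b).
- by move=> x _; rewrite derive1E; have [] := dF x.
Qed.

End FTC.

(** * Abel integrals on the line *)

Section Abel1.
Context {R : realType}.
Local Notation mu := (@lebesgue_measure R).
Variable dl : R.
Hypothesis dl0 : 0 < dl.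

Let dl_neq0 : dl != 0. Proof. by rewrite gt_eqF. Qed.
Let pi_neq0 : pi != 0 :> R. Proof. by rewrite gt_eqF// pi_gt0. Qed.

Lemma is_derive_affine_comp (F : R -> R) (a b x y : R) :
  is_derive (a + b * x) 1 F y -> is_derive x 1 (fun x => F (a + b * x)) (b * y).
Proof.
move=> dF; have := @is_derive1_comp _ F (fun x => a + b * x) x y b.
rewrite [b * y]mulrC; apply => //.
apply: is_derive_eq; rewrite /GRing.scale /=; ring.
Qed.

Lemma is_derive_expRZ (a x : R) : is_derive x 1 (fun x => expR (a * x)) (a * expR (a * x)).
Proof.
have := @is_derive_affine_comp expR 0 a x (expR (0 + a * x)) (is_derive_expR _).
by rewrite add0r; under eq_fun do rewrite add0r.
Qed.

Lemma continuous_expRZ (a : R) : continuous (fun x : R => expR (a * x)).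
Proof. by move=> x; exact: is_derive_continuous (is_derive_expRZ a x). Qed.

Lemma cvg_expR_decay (a : R) : 0 < a -> expR (- a * x) @[x --> +oo] --> 0.
Proof.
move=> a0; rewrite (_ : (fun x => _) = (fun z => expR (- z)) \o (fun z => a * z)); last first.
  by apply: eq_fun => x; rewrite mulNr.
apply: (@cvg_comp _ _ _ _ _ _ (pinfty_nbhs R)); last exact: cvgr_expR.
exact: gt0_cvgMry.
Qed.

(** The added [1] makes the integrand nonnegative, as the fundamental theorem on a half-line and
    later Tonelli require. The phase [th] prepares the induction on the dimension in [abel_rV],
    where it absorbs the other coordinates. *)
Lemma abel_half (th z : R) :
  (\int[mu]_(s in `[0%R, +oo[) ((1 + cos (th + z * s)) * expR (- dl * s))%:E)%E =
  (dl^-1 + (dl * cos th - z * sin th) / (dl ^+ 2 + z ^+ 2))%:E.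
Proof.
have D0 : 0 < dl ^+ 2 + z ^+ 2 by rewrite ltr_pwDl ?exprn_gt0// sqr_ge0.
pose G (s : R) := - dl^-1 + (z * sin (th + z * s) - dl * cos (th + z * s)) / (dl ^+ 2 + z ^+ 2).
pose F (s : R) := expR (- dl * s) * G s.
have dsin (s : R) : is_derive s 1 (fun s => sin (th + z * s)) (z * cos (th + z * s)).
  exact: is_derive_affine_comp.
have dcos (s : R) : is_derive s 1 (fun s => cos (th + z * s)) (z * - sin (th + z * s)).
  exact: is_derive_affine_comp.
transitivity ((0 - F 0)%:E); last first.
  by rewrite /F /G !mulr0 expR0 mul1r addr0 sub0r opprD opprK -mulNr opprB.
apply: FTC2y.
- by move=> s; rewrite mulr_ge0 ?expR_ge0// -lerBlDl sub0r cos_geN1.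
- move=> s; apply: cvgM; last exact: continuous_expRZ.
  by apply: cvgD; [exact: cvg_cst|exact: is_derive_continuous (dcos s)].
- move=> s; have dE := is_derive_expRZ (- dl) s.
  have dG : is_derive s 1 G ((z * (z * cos (th + z * s)) - dl * (z * - sin (th + z * s))) / (dl ^+ 2 + z ^+ 2)).
    rewrite /G; apply: is_derive_eq.
    by rewrite /GRing.scale /=; field; rewrite ?gt_eqF.
  rewrite /F; apply: is_derive_eq; rewrite /GRing.scale /= /G; field.
  by rewrite gt_eqF//= gt_eqF.
- pose C := dl^-1 + (`|z| + dl) / (dl ^+ 2 + z ^+ 2).
  have GC s : `|G s| <= C.
    rewrite /G /C; apply: le_trans (ler_normD _ _) _.
    apply: lerD; first by rewrite normrN ger0_norm// invr_ge0 ltW.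
    rewrite normrM normfV [X in _ / X]gtr0_norm// ler_pM2r ?invr_gt0//.
    apply: le_trans (ler_normB _ _) _; rewrite !normrM [`|dl|]gtr0_norm//.
    have := ler_norml (sin (th + z * s)) 1; have := ler_norml (cos (th + z * s)) 1.
    rewrite sin_geN1 sin_le1 cos_geN1 cos_le1 /= => c1 s1.
    by rewrite lerD// ler_piMr// ltW.
  apply/norm_cvg0P; rewrite /F.
  apply: (@squeeze_cvgr _ _ _ _ (fun=> 0) (fun s => expR (- dl * s) * C)).
  + apply: nearW => s; rewrite normr_ge0 normrM ger0_norm ?expR_ge0//.
    by rewrite ler_wpM2l ?expR_ge0.
  + exact: cvg_cst.
  + rewrite -[X in _ --> X](mul0r C); apply: cvgM; last exact: cvg_cst.
    exact: cvg_expR_decay.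
Qed.

Lemma abel_line (th z : R) :
  (\int[mu]_s ((1 + cos (th + z * s)) * expR (- dl * `|s|))%:E)%E =
  (2 / dl + cos th * (2 * dl / (dl ^+ 2 + z ^+ 2)))%:E.
Proof.
pose f s := ((1 + cos (th + z * s)) * expR (- dl * `|s|))%:E.
have mf : measurable_fun [set: R] f.
  apply/measurable_EFinP/measurable_funM.
    apply: measurable_funD => //; apply: continuous_measurable_fun => s.
    have := @is_derive_affine_comp cos th z s _ (is_derive_cos _).
    exact: is_derive_continuous.
  apply: (@measurableT_comp _ _ _ _ _ _ expR) => //.
  by apply: measurable_funM => //; exact: measurableT_comp.
have f0 s : (0 <= f s)%E.
  by rewrite lee_fin mulr_ge0 ?expR_ge0// -lerBlDl sub0r cos_geN1.
rewrite -[LHS]/(\int[mu]_s f s)%E.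
have -> : [set: R] = `[0, +oo[%classic `|` `]-oo, 0[%classic.
  apply/seteqP; split => // x _ /=; rewrite !in_itv/= andbT.
  by case: (leP 0 x); [left|right].
rewrite ge0_integral_setU//; last 2 first.
- by apply: measurable_funTS.
- rewrite disj_set2E; apply/eqP/seteqP; split => // x [] /=; rewrite !in_itv/= andbT.
  by case: ltgtP.
have mfN : measurable_fun [set: R] (fun s => f (- s)) by apply: measurableT_comp.
have -> : (\int[mu]_(x in `]-oo, 0%R[) f x = \int[mu]_(s in `[0%R, +oo[) f (- s)%R)%E.
  rewrite (@ge0_integration_by_substitution0 R (fun s => f (- s)) mfN (fun s => f0 (- s))).
  rewrite integral_itv_bndo_bndc; last exact: measurable_funTS.
  by apply: eq_integral => x _; rewrite opprK.
have -> : (\int[mu]_(x in `[0%R, +oo[) f x)%E =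
    (dl^-1 + (dl * cos th - z * sin th) / (dl ^+ 2 + z ^+ 2))%:E.
  rewrite -abel_half; apply: eq_integral => s.
  by rewrite inE/= in_itv/= andbT => s0; rewrite /f ger0_norm.
have -> : (\int[mu]_(x in `[0%R, +oo[) f (- x)%R)%E =
    (dl^-1 + (dl * cos th - (- z) * sin th) / (dl ^+ 2 + (- z) ^+ 2))%:E.
  rewrite -abel_half; apply: eq_integral => s.
  rewrite inE/= in_itv/= andbT => s0; rewrite /f normrN ger0_norm//.
  by congr (((1 + cos (th + _)) * _)%:E); rewrite mulrN mulNr.
rewrite -EFinD; congr EFin; rewrite sqrrN; field.
have Dz : dl ^+ 2 + z ^+ 2 != 0 by rewrite gt_eqF// ltr_pwDl ?exprn_gt0// sqr_ge0.
have dz : dl != 0 by rewrite gt_eqF.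
by rewrite ?Dz ?dz.
Qed.

(** The Cauchy density of scale [dl], which is the Poisson kernel of the half-plane. *)
Definition poisson1 (t : R) : R := dl / (pi * (dl ^+ 2 + t ^+ 2)).

Lemma poisson1_gt0 t : 0 < poisson1 t.
Proof. by rewrite divr_gt0// mulr_gt0 ?pi_gt0// ltr_pwDl ?exprn_gt0// sqr_ge0. Qed.

Lemma poisson1_le t : poisson1 t <= (pi * dl)^-1.
Proof.
rewrite /poisson1 ler_pdivrMr ?mulr_gt0 ?pi_gt0// ?ltr_pwDl ?exprn_gt0 ?sqr_ge0//.
have -> : (pi * dl)^-1 * (pi * (dl ^+ 2 + t ^+ 2)) = dl + t ^+ 2 / dl.
  by move: pi pi_neq0 => p p0; field; rewrite dl_neq0.
by rewrite lerDl divr_ge0 ?sqr_ge0// ltW.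
Qed.

Lemma is_derive_atan_poisson (x y : R) :
  is_derive y 1 (fun y => atan ((y - x) / dl) / pi) (poisson1 (x - y)).
Proof.
have := @is_derive_affine_comp atan (- x / dl) dl^-1 y _ (is_derive1_atan _).
rewrite (_ : (fun y => atan (- x / dl + dl^-1 * y)) = (fun y => atan ((y - x) / dl))); last first.
  by apply/funext => t; congr atan; field.
move=> d; apply: is_derive_eq; rewrite /GRing.scale /= /poisson1.
have D0 : dl ^+ 2 + (x - y) ^+ 2 != 0 by rewrite gt_eqF// ltr_pwDl ?exprn_gt0// sqr_ge0.
have D1 : dl ^+ 2 + (- x + y) ^+ 2 != 0 by rewrite (_ : - x + y = - (x - y)) ?sqrrN//; ring.
by move: pi pi_neq0 => p p0; field; rewrite ?D0 ?D1 ?dl_neq0 ?p0.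
Qed.

Lemma continuous_poisson1 (x : R) : continuous (fun y => poisson1 (x - y)).
Proof.
move=> y; rewrite /poisson1; apply: cvgM; first exact: cvg_cst.
apply: cvgV; first by rewrite gt_eqF// mulr_gt0 ?pi_gt0// ltr_pwDl ?exprn_gt0// sqr_ge0.
apply: cvgM; first exact: cvg_cst.
apply: cvgD; first exact: cvg_cst.
have c : (x - z) @[z --> y] --> x - y by apply: cvgB; [exact: cvg_cst|exact: cvg_id].
exact: (cvgM c c).
Qed.

Lemma integral_poisson1 (x a b : R) : a <= b ->
  (\int[mu]_(y in `[a, b]) (poisson1 (x - y))%:E)%E =
  (atan ((b - x) / dl) / pi - atan ((a - x) / dl) / pi)%:E.
Proof.
move=> ab; apply: (@FTC2 _ _ (fun y => atan ((y - x) / dl) / pi)) => //.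
  exact: continuous_poisson1.
by move=> y; exact: is_derive_atan_poisson.
Qed.

Lemma integral_poisson1_le1 (x : R) : (\int[mu]_y (poisson1 (x - y))%:E <= 1)%E.
Proof.
have mp : measurable_fun [set: R] (fun y => (poisson1 (x - y))%:E).
  have := @continuous_measurable_fun R _ (@continuous_poisson1 x).
  by move/measurable_EFinP.
pose I (n : nat) : set R := `[- n%:R, n%:R]%classic.
have UI : \bigcup_n I n = [set: R].
  apply/seteqP; split => // y _; exists (Num.bound `|y|) => //=.
  by rewrite /I /= in_itv/= -ler_norml ltW// archi_boundP.
have H : (\int[mu]_(y in I n) (poisson1 (x - y))%:E)%E @[n --> \oo] -->
    (\int[mu]_y (poisson1 (x - y))%:E)%E.
  rewrite -UI; apply: ge0_nondecreasing_set_cvg_integral.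
  - move=> i j ij; apply/subsetPset => y /=; rewrite /I /= !in_itv/= => /andP[ny yn].
    by rewrite (le_trans _ ny) ?lerN2 ?ler_nat// (le_trans yn) ?ler_nat.
  - by move=> i; exact: measurable_itv.
  - by move=> i; exact: measurable_funTS.
  - by move=> i y _; rewrite lee_fin ltW// poisson1_gt0.
rewrite -(cvg_lim _ H)//; apply: lime_le; first by apply/cvg_ex; eexists; exact: H.
apply: nearW => n; rewrite integral_poisson1 ?lee_fin; last first.
  by rewrite (le_trans _ (ler0n _ _))// oppr_le0.
rewrite -mulrBl ler_pdivrMr ?pi_gt0// mul1r.
have := atan_ltpi2 ((n%:R - x) / dl); have := atan_gtNpi2 ((- n%:R - x) / dl).
lra.
Qed.

End Abel1.

(** * Integration over row vectors, one coordinate at a time *)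

Section rV_integral.
Context {R : realType}.
Local Notation mu := (@lebesgue_measure R).
Local Notation leb := (lebesgue_rV R).

Lemma consrV_ord0 n (a : R) (x : 'rV[R]_n) : consrV (a, x) ord0 ord0 = a.
Proof. by rewrite /consrV mxE; case: splitP => // j _; rewrite mxE. Qed.

Lemma consrV_lift n (a : R) (x : 'rV[R]_n) (i : 'I_n) :
  consrV (a, x) ord0 (lift ord0 i) = x ord0 i.
Proof.
rewrite /consrV (_ : lift ord0 i = rshift 1 i); last exact/val_inj.
exact: (row_mxEr (const_mx a : 'rV_1) x).
Qed.

Lemma dotp_consrV n (a b : R) (x y : 'rV[R]_n) :
  dotp (consrV (a, x)) (consrV (b, y)) = a * b + dotp x y.
Proof.
rewrite /dotp big_ord_recl !consrV_ord0; congr (_ + _).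
by apply: eq_bigr => i _; rewrite !consrV_lift.
Qed.

Lemma consrVN n (a : R) (x : 'rV[R]_n) : - consrV (a, x) = consrV (- a, - x).
Proof.
apply/rowP => i; rewrite mxE (_ : (0 : 'I_1) = ord0); last exact/val_inj.
case: (unliftP ord0 i) => [j ->|->]; last by rewrite !consrV_ord0.
by rewrite !consrV_lift mxE.
Qed.

Lemma rV_consrV n (y : 'rV[R]_n.+1) : exists a x, y = consrV (a, x).
Proof.
exists (y ord0 ord0), (\row_i y ord0 (lift ord0 i)); apply/rowP => i; rewrite (_ : (0 : 'I_1) = ord0); last exact/val_inj.
case: (unliftP ord0 i) => [j ->|->]; last by rewrite consrV_ord0.
by rewrite consrV_lift mxE.
Qed.

Lemma ge0_integral_rVS n (phi : 'rV[R]_n.+1 -> \bar R) :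
  measurable_fun [set: 'rV[R]_n.+1] phi -> (forall x, 0 <= phi x)%E ->
  (\int[leb n.+1]_y phi y = \int[mu]_a \int[leb n]_x phi (consrV (a, x)))%E.
Proof.
move=> mphi phi0.
rewrite [LHS](ge0_integral_pushforward (@measurable_consrV R n) _ measurableT) //.
rewrite preimage_setT fubini_tonelli1//=.
by apply: measurableT_comp => //; exact: measurable_consrV.
Qed.

Lemma integral_rV0 (phi : 'rV[R]_0 -> \bar R) :
  measurable_fun [set: 'rV[R]_0] phi -> (\int[leb 0]_y phi y = phi 0%R)%E.
Proof. by move=> mphi; rewrite [LHS]integral_dirac// diracT mul1e. Qed.

Lemma measurable_coord n (i : 'I_n) : measurable_fun [set: 'rV[R]_n] (fun x => x ord0 i).
Proof. exact: (@measurable_rV_coord _ (measurableTypeR R)). Qed.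

Lemma measurable_fun_coord n (h : R -> R) (i : 'I_n) : measurable_fun [set: R] h ->
  measurable_fun [set: 'rV[R]_n] (fun x => h (x ord0 i)).
Proof. by move=> mh; apply: (measurableT_comp mh); exact: measurable_coord. Qed.

Lemma measurable_dotp n (z : 'rV[R]_n) : measurable_fun [set: 'rV[R]_n] (dotp z).
Proof.
by apply: measurable_sum => i; apply: measurable_funM => //; exact: measurable_coord.
Qed.

Lemma measurable_prod_coord n (h : 'I_n -> R -> R) :
  (forall i, measurable_fun [set: R] (h i)) ->
  measurable_fun [set: 'rV[R]_n] (fun x => \prod_i h i (x ord0 i)).
Proof.
by move=> mh; apply: measurable_prod => i _; exact: measurable_fun_coord.
Qed.

Lemma integral_prod_rV n (h : 'I_n -> R -> R) (c : 'I_n -> R) :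
  (forall i, measurable_fun [set: R] (h i)) -> (forall i t, 0 <= h i t) ->
  (forall i, \int[mu]_t (h i t)%:E = (c i)%:E)%E ->
  (\int[leb n]_x (\prod_i h i (x ord0 i))%:E = (\prod_i c i)%:E)%E.
Proof.
elim: n h c => [|n IH] h c mh h0 hc.
  rewrite integral_rV0; last by apply/measurable_EFinP; exact: measurable_prod_coord.
  by rewrite !big_ord0.
rewrite ge0_integral_rVS; last 2 first.
- by apply/measurable_EFinP; exact: measurable_prod_coord.
- by move=> x; rewrite lee_fin prodr_ge0.
rewrite big_ord_recl mulrC EFinM -hc -ge0_integralZl//; last 3 first.
- by apply/measurable_EFinP; exact: mh.
- by move=> t _; rewrite lee_fin.
- rewrite -(IH (fun i => h (lift ord0 i)) (fun i => c (lift ord0 i)))//.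
  by apply: integral_ge0 => x _; rewrite lee_fin prodr_ge0.
apply: eq_integral => a _.
transitivity (\int[leb n]_x ((h ord0 a)%:E * (\prod_i h (lift ord0 i) (x ord0 i))%:E))%E.
  apply: eq_integral => x _; rewrite big_ord_recl consrV_ord0 -EFinM; congr (_ * _)%:E.
  by apply: eq_bigr => i _; rewrite consrV_lift.
have mP : measurable_fun [set: 'rV[R]_n] (fun x => (\prod_i h (lift ord0 i) (x ord0 i))%:E).
  by apply/measurable_EFinP; apply: (measurable_prod_coord (h := fun i => h (lift ord0 i))).
rewrite (ge0_integralZl _ measurableT mP).
- by rewrite muleC (IH (fun i => h (lift ord0 i)) (fun i => c (lift ord0 i))).
- by move=> x _; rewrite lee_fin prodr_ge0.
- by rewrite lee_fin.
Qed.

Definition norm1 n (x : 'rV[R]_n) : R := \sum_i `|x ord0 i|.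

Lemma measurable_norm1 n : measurable_fun [set: 'rV[R]_n] (@norm1 n).
Proof.
apply: measurable_sum => i.
by apply: (measurable_fun_coord (h := @Num.norm _ R)); exact: normr_measurable.
Qed.

Lemma norm1_consrV n (a : R) (x : 'rV[R]_n) : norm1 (consrV (a, x)) = `|a| + norm1 x.
Proof.
rewrite /norm1 big_ord_recl consrV_ord0; congr (_ + _).
by apply: eq_bigr => i _; rewrite consrV_lift.
Qed.

Lemma measurable_abel n (dl th : R) (z : 'rV[R]_n) :
  measurable_fun [set: 'rV[R]_n] (fun y => (1 + cos (th + dotp z y)) * expR (- dl * norm1 y)).
Proof.
apply: measurable_funM.
  apply: measurable_funD => //.
  apply: (@measurableT_comp _ _ _ _ _ _ cos).
    by apply: continuous_measurable_fun; exact: continuous_cos.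
  by apply: measurable_funD => //; exact: measurable_dotp.
apply: (@measurableT_comp _ _ _ _ _ _ expR) => //.
by apply: measurable_funM => //; exact: measurable_norm1.
Qed.

Lemma abel_rV n (dl th : R) (z : 'rV[R]_n) : 0 < dl ->
  (\int[leb n]_y ((1 + cos (th + dotp z y)) * expR (- dl * norm1 y))%:E)%E =
  ((2 / dl) ^+ n + cos th * \prod_i (2 * dl / (dl ^+ 2 + z ord0 i ^+ 2)))%:E.
Proof.
move=> dl0; elim: n th z => [|n IH] th z.
  rewrite integral_rV0; last by apply/measurable_EFinP; exact: measurable_abel.
  by rewrite /dotp /norm1 !big_ord0 addr0 mulr0 expR0 expr0 !mulr1.
have w0 k t (y x : 'rV[R]_k) : 0 <= (1 + cos (t + dotp x y)) * expR (- dl * norm1 y).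
  by rewrite mulr_ge0 ?expR_ge0// -lerBlDl sub0r cos_geN1.
rewrite ge0_integral_rVS; last 2 first.
- by apply/measurable_EFinP; exact: measurable_abel.
- by move=> x; rewrite lee_fin.
have [a [x ->]] := rV_consrV z.
set Q := \prod_i (2 * dl / (dl ^+ 2 + x ord0 i ^+ 2)).
have q0 (t : R) : 0 <= 2 * dl / (dl ^+ 2 + t ^+ 2).
  by rewrite divr_ge0 ?mulr_ge0 ?ltW// ltr_pwDl ?exprn_gt0// sqr_ge0.
have Q0 : 0 <= Q by apply: prodr_ge0 => i _.
have QM : Q <= (2 / dl) ^+ n.
  rewrite -[n in leRHS]card_ord -prodr_const; apply: ler_prod => i _; rewrite q0/=.
  rewrite ler_pdivrMr ?ltr_pwDl ?exprn_gt0 ?sqr_ge0// mulrDr.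
  rewrite (_ : 2 / dl * dl ^+ 2 = 2 * dl); last by field; rewrite gt_eqF.
  by rewrite lerDl mulr_ge0 ?sqr_ge0// divr_ge0// ltW.
pose g (s : R) := ((1 + cos (th + a * s)) * expR (- dl * `|s|)).
(* The plain weight, written with phase [pi / 2] and frequency 0 so that [abel_line] integrates it
   too. *)
pose g1 (s : R) := ((1 + cos (pi / 2 + 0 * s)) * expR (- dl * `|s|)).
have mg th' a' : measurable_fun [set: R] (fun s => ((1 + cos (th' + a' * s)) * expR (- dl * `|s|))).
  apply: measurable_funM.
    apply: measurable_funD => //; apply: (@measurableT_comp _ _ _ _ _ _ cos).
      by apply: continuous_measurable_fun; exact: continuous_cos.
    by apply: measurable_funD => //; apply: measurable_funM.
  by apply: (@measurableT_comp _ _ _ _ _ _ expR) => //; apply: measurable_funM.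
(* By induction the inner integral is [(2 / dl) ^+ n + Q * cos (th + a * s)]. Moving [Q] next to the
   cosine leaves the remainder [(2 / dl) ^+ n - Q], which is nonnegative by [QM], so both terms can
   be integrated as nonnegative functions. *)
transitivity (\int[mu]_s (Q%:E * (g s)%:E + ((2 / dl) ^+ n - Q)%:E * (g1 s)%:E))%E.
  apply: eq_integral => s _.
  transitivity ((expR (- dl * `|s|))%:E * \int[leb n]_y
      ((1 + cos (th + a * s + dotp x y)) * expR (- dl * norm1 y))%:E)%E.
    have mA : measurable_fun [set: 'rV[R]_n] (fun y =>
        ((1 + cos (th + a * s + dotp x y)) * expR (- dl * norm1 y))%:E).
      by apply/measurable_EFinP; exact: measurable_abel.
    rewrite -(ge0_integralZl _ measurableT mA); [|by move=> y _; rewrite lee_fin|by rewrite lee_fin expR_ge0].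
    apply: eq_integral => y _; rewrite -EFinM; congr EFin.
    by rewrite dotp_consrV norm1_consrV mulrDr expRD addrA; ring.
  rewrite IH -!EFinM -EFinD; congr EFin; rewrite -/Q /g /g1 mul0r addr0 cos_pihalf; ring.
have mEg : measurable_fun [set: R] (fun s => (g s)%:E) by apply/measurable_EFinP; exact: mg.
have mEg1 : measurable_fun [set: R] (fun s => (g1 s)%:E) by apply/measurable_EFinP; exact: mg.
have g0 s : [set: R] s -> (0 <= (g s)%:E)%E.
  by rewrite lee_fin mulr_ge0 ?expR_ge0// -lerBlDl sub0r cos_geN1.
have g10 s : [set: R] s -> (0 <= (g1 s)%:E)%E.
  by rewrite lee_fin mulr_ge0 ?expR_ge0// -lerBlDl sub0r cos_geN1.
have QE : (0 <= Q%:E)%E by rewrite lee_fin.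
have QE1 : (0 <= ((2 / dl) ^+ n - Q)%:E)%E by rewrite lee_fin subr_ge0.
rewrite ge0_integralD//; [|by move=> s _; apply: mule_ge0 => //; exact: g0|exact: measurable_funeM
  |by move=> s _; apply: mule_ge0 => //; exact: g10|exact: measurable_funeM].
transitivity (Q%:E * (\int[mu]_s (g s)%:E) + ((2 / dl) ^+ n - Q)%:E * \int[mu]_s (g1 s)%:E)%E.
  by congr (_ + _)%E; [exact: (ge0_integralZl mu measurableT mEg g0 QE)|
                       exact: (ge0_integralZl mu measurableT mEg1 g10 QE1)].
rewrite !abel_line// cos_pihalf -!EFinM -EFinD; congr EFin.
rewrite big_ord_recl consrV_ord0.
under [X in _ = _ + _ * (_ * X)]eq_bigr do rewrite consrV_lift.
by rewrite -/Q [_ ^+ n.+1]exprS; ring.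
Qed.

Lemma ge0_integralN_line (phi : R -> \bar R) : measurable_fun [set: R] phi ->
  (forall t, 0 <= phi t)%E -> (\int[mu]_t phi (- t)%R = \int[mu]_t phi t)%E.
Proof.
move=> mphi phi0.
rewrite -[LHS]/(\int[mu]_(t in (-%R : R -> measurableTypeR R) @^-1` [set: R]) (phi \o -%R) t)%E.
rewrite -ge0_integral_pushforward//=.
by apply: eq_measure_integral => //= A mA _; exact: lebesgue_measureN.
Qed.

Lemma measurable_oppV n : measurable_fun [set: 'rV[R]_n] (fun x : 'rV[R]_n => - x).
Proof.
apply: (@measurable_fun_rVP _ _ _ (measurableTypeR R)) => i.
rewrite (_ : (fun x => _) = (fun x : 'rV[R]_n => - (x ord0 i))).
  by apply: (measurable_fun_coord (h := -%R)).
by apply/funext => x; rewrite mxE.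
Qed.

Lemma ge0_integralN_rV n (phi : 'rV[R]_n -> \bar R) : measurable_fun [set: 'rV[R]_n] phi ->
  (forall t, 0 <= phi t)%E -> (\int[leb n]_t phi (- t)%R = \int[leb n]_t phi t)%E.
Proof.
elim: n phi => [|n IH] phi mphi phi0.
  rewrite !integral_rV0 ?oppr0//.
  by apply: measurableT_comp => //; exact: measurable_oppV.
have mcons a : measurable_fun [set: 'rV[R]_n] (fun x => consrV (a, x)).
  by apply: (measurableT_comp (@measurable_consrV R n)); exact: pair1_measurable.
have mN : measurable_fun [set: 'rV[R]_n.+1] (fun t => phi (- t)).
  by apply: measurableT_comp => //; exact: measurable_oppV.
rewrite (ge0_integral_rVS mphi phi0) (ge0_integral_rVS mN (fun t => phi0 (- t))).
pose psi (a : R) := (\int[leb n]_x phi (consrV (a, x)))%E.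
have mpsi : measurable_fun [set: measurableTypeR R] psi.
  apply: (@measurable_fun_fubini_tonelli_F _ _ _ _ R (leb n) (phi \o consrV)) => //.
    by apply: measurableT_comp => //; exact: measurable_consrV.
  by move=> x; exact: phi0.
rewrite -[RHS]/(\int[mu]_a psi a)%E -(ge0_integralN_line mpsi); last first.
  by move=> a; apply: integral_ge0.
apply: eq_integral => a _; rewrite /psi -(IH (fun x => phi (consrV (- a, x))))//.
  by apply: eq_integral => x _; rewrite consrVN.
by apply: measurableT_comp => //; exact: mcons.
Qed.

End rV_integral.

Section param_integral.
Context d1 d2 (T1 : measurableType d1) (T2 : measurableType d2) (R : realType).
Variable m2 : {sigma_finite_measure set T2 -> \bar R}.

(** Tonelli makes the integrals of the positive and of the negative part measurable in [x], and so
    is their difference, whatever its value where both are infinite. *)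
Lemma measurable_integral_param (f : T1 * T2 -> R) : measurable_fun [set: T1 * T2] f ->
  measurable_fun [set: T1] (fun x => \int[m2]_y (f (x, y))%:E)%E.
Proof.
move=> mf; have mEf : measurable_fun [set: T1 * T2] (fun z => (f z)%:E) by exact/measurable_EFinP.
rewrite (_ : (fun x => _) = (fun x => \int[m2]_y ((fun z => (f z)%:E)^\+%E (x, y))
    - \int[m2]_y ((fun z => (f z)%:E)^\-%E (x, y)))%E); last first.
  by apply/funext => x; rewrite (integralE m2 setT (fun y => (f (x, y))%:E)); congr (_ - _)%E; apply: eq_integral => y _; rewrite ?funeposE ?funenegE.
apply: emeasurable_funB.
- apply: (measurable_fun_fubini_tonelli_F (m2 := m2) ((fun z => (f z)%:E)^\+)%E) => //.
  exact: measurable_funepos.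
- apply: (measurable_fun_fubini_tonelli_F (m2 := m2) ((fun z => (f z)%:E)^\-)%E) => //.
  exact: measurable_funeneg.
Qed.

Lemma measurable_Rintegral_param (f : T1 * T2 -> R) : measurable_fun [set: T1 * T2] f ->
  measurable_fun [set: T1] (fun x => \int[m2]_y (f (x, y))).
Proof.
by move=> mf; apply: (measurableT_comp (f := fine)) => //; exact: measurable_integral_param.
Qed.

End param_integral.

(** * Half-open boxes as a generating family closed under intersection *)

Section boxes.
Context {R : realType} {n : nat}.
Local Notation E := 'rV[R]_n.
Local Notation mu := (@lebesgue_measure R).
Local Notation leb := (lebesgue_rV R n).

Definition rV_box (a b : E) : set E :=
  [set x | forall i, x ord0 i \in `]a ord0 i, b ord0 i]].

Definition boxes : set (set E) := [set A | exists a b, A = rV_box a b].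

Lemma boxesI : setI_closed boxes.
Proof.
move=> _ _ [a [b ->]] [a' [b' ->]].
exists (\row_i Num.max (a ord0 i) (a' ord0 i)), (\row_i Num.min (b ord0 i) (b' ord0 i)).
apply/seteqP; split => [x [xa xb] i|x xab].
  rewrite !mxE in_itv/= gt_max le_min.
  by have := xa i; have := xb i; rewrite !in_itv/= => /andP[-> ->] /andP[-> ->].
split => i; have := xab i; rewrite !mxE !in_itv/= gt_max le_min => /andP[/andP[? ?] /andP[? ?]];
  by apply/andP.
Qed.

Lemma measurable_rV_box a b : measurable (rV_box a b).
Proof.
rewrite (_ : rV_box a b = \bigcap_(i in [set: 'I_n])
    ((fun x : E => x ord0 i) @^-1` `]a ord0 i, b ord0 i]%classic)); last first.
  by apply/seteqP; split => [x xab i _|x xab i]; exact: xab.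
apply: fin_bigcap_measurable => // i _.
rewrite -[X in measurable X]setTI; by apply: measurable_coord.
Qed.

Lemma boxes_generate : @measurable _ E = <<s boxes >>.
Proof.
apply/seteqP; split; last first.
  apply: smallest_sub; first exact: sigma_algebra_measurable.
  by move=> _ [a [b ->]]; exact: measurable_rV_box.
have mid : measurable_fun [set: g_sigma_algebraType boxes] (id : g_sigma_algebraType boxes -> E).
  apply: (@measurable_fun_rVP _ _ _ (measurableTypeR R)) => i.
  apply: (@measurability _ _ _ _ _ _ R.-ocitv.-measurable); first by [].
  move=> _ [_ [[p q] _ <-] <-]; rewrite setTI.
  (* A slab in the coordinate [i] is the union of the boxes that are bounded by [k] in all other
     coordinates. *)
  rewrite (_ : _ @^-1` _ = \bigcup_k rV_box (\row_j if j == i then p else - k%:R)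
                                            (\row_j if j == i then q else k%:R)).
    apply: bigcup_measurable => k _; apply: sub_sigma_algebra.
    by eexists; eexists.
  apply/seteqP; split => [x xpq|x [k _ /(_ i)]]; last by rewrite !mxE eqxx.
  have [k kP] : exists k : nat, forall j, `|x ord0 j| < k%:R.
    exists (\sum_j Num.bound `|x ord0 j|)%N => j.
    apply: (lt_le_trans (archi_boundP (normr_ge0 _))).
    by rewrite ler_nat (bigD1 j)//= leq_addr.
  exists k => // j; rewrite !mxE in_itv/=; have [->//|_] := eqVneq j i.
  by have := kP j; rewrite ltr_norml => /andP[-> /ltW].
move=> A mA; have := mid measurableT A mA; rewrite setTI preimage_id.
by [].
Qed.

Definition cube (k : nat) : set E := rV_box (\row__ - k%:R) (\row__ k%:R).

Lemma cube_nd : nondecreasing_seq cube.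
Proof.
move=> i j ij; apply/subsetPset => x xi k; have := xi k; rewrite !mxE !in_itv/= => /andP[u v].
have ij' : i%:R <= j%:R :> R by rewrite ler_nat.
by rewrite (le_lt_trans _ u) ?lerN2// (le_trans v).
Qed.

Lemma bigcup_cube : \bigcup_k cube k = setT.
Proof.
apply/seteqP; split => // x _.
exists (\sum_j Num.bound `|x ord0 j|)%N => // j; rewrite !mxE in_itv/=.
have : `|x ord0 j| < (\sum_j Num.bound `|x ord0 j|)%:R :> R.
  apply: (lt_le_trans (archi_boundP (normr_ge0 _))).
  by rewrite ler_nat (bigD1 j)//= leq_addr.
by rewrite ltr_norml => /andP[-> /ltW].
Qed.

Lemma indic_rV_box a b (x : E) :
  \1_(rV_box a b) x = \prod_i \1_(`]a ord0 i, b ord0 i]%classic : set R) (x ord0 i) :> R.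
Proof.
rewrite indicE; have [|nx] := boolP (x \in rV_box a b).
  rewrite inE => xab; rewrite big1// => i _.
  by rewrite indicE mem_set//; exact: xab.
rewrite notin_setE in nx; have /existsNP[i ni] := nx.
rewrite (bigD1 i)//= indicE memNset ?mul0r//.
Qed.

Lemma measurable_indic_itv (i : interval R) :
  measurable_fun [set: R] (\1_([set` i]) : R -> R).
Proof. by apply: measurable_indic; exact: measurable_itv. Qed.

Lemma lebesgue_rV_box a b : leb (rV_box a b) =
  (\prod_i (if a ord0 i < b ord0 i then b ord0 i - a ord0 i else 0))%:E.
Proof.
have <- : (\int[leb]_x (\1_(rV_box a b) x)%:E)%E = leb (rV_box a b).
  by rewrite integral_indic ?setIT//; exact: measurable_rV_box.
under eq_integral do rewrite indic_rV_box.
apply: (integral_prod_rV (h := fun i => \1_(`]a ord0 i, b ord0 i]%classic))).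
- by move=> i; exact: measurable_indic_itv.
- by move=> i t; rewrite indicE.
- move=> i; rewrite integral_indic ?setIT//.
  by rewrite [LHS]lebesgue_measure_itv/= lte_fin; case: ifPn.
Qed.

End boxes.

(** * The Poisson kernel in several variables *)

Section poisson.
Context {R : realType} {n : nat}.
Local Notation E := 'rV[R]_n.
Local Notation mu := (@lebesgue_measure R).
Local Notation leb := (lebesgue_rV R n).

Definition poisson (dl : R) (y x : E) : R := \prod_i poisson1 dl (y ord0 i - x ord0 i).

Lemma poisson_ge0 dl y x : 0 < dl -> 0 <= poisson dl y x.
Proof. by move=> dl0; apply: prodr_ge0 => i _; rewrite ltW// poisson1_gt0. Qed.

Lemma poissonC dl y x : poisson dl y x = poisson dl x y.
Proof. by apply: eq_bigr => i _; rewrite /poisson1 -(opprB (x ord0 i)) sqrrN. Qed.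

Lemma poisson_le dl y x : 0 < dl -> poisson dl y x <= (pi * dl) ^- n.
Proof.
move=> dl0; rewrite -exprVn -[n in leRHS]card_ord -prodr_const; apply: ler_prod => i _.
by rewrite ltW ?poisson1_gt0//= poisson1_le.
Qed.

Lemma measurable_poisson1 dl : 0 < dl -> measurable_fun [set: R] (poisson1 dl).
Proof.
move=> dl0; rewrite (_ : poisson1 dl = fun y => poisson1 dl (0 - y)); last first.
  by apply/funext => t; rewrite /poisson1 sub0r sqrrN.
by apply: continuous_measurable_fun; apply: continuous_poisson1.
Qed.

Lemma measurable_poisson dl : 0 < dl ->
  measurable_fun [set: E * E] (fun z : E * E => poisson dl z.1 z.2).
Proof.
move=> dl0; apply: measurable_prod => i _.
apply: (measurableT_comp (measurable_poisson1 dl0)).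
apply: measurable_funB.
  exact: (measurableT_comp (measurable_coord i) measurable_fst).
exact: (measurableT_comp (measurable_coord i) measurable_snd).
Qed.

Lemma measurable_poissonr dl y : 0 < dl -> measurable_fun [set: E] (poisson dl y).
Proof.
move=> dl0; apply: (measurable_prod_coord (h := fun i t => poisson1 dl (y ord0 i - t))) => i.
by apply: (measurableT_comp (measurable_poisson1 dl0)); exact: measurable_funB.
Qed.

Lemma integral_poisson_le1 dl y : 0 < dl -> (\int[leb]_x (poisson dl y x)%:E <= 1)%E.
Proof.
move=> dl0; pose h (i : 'I_n) (t : R) := poisson1 dl (y ord0 i - t).
have h1 i : (\int[mu]_t (h i t)%:E <= 1)%E by exact: integral_poisson1_le1.
have h0 i : (0 <= \int[mu]_t (h i t)%:E)%E.
  by apply: integral_ge0 => t _; rewrite lee_fin ltW// poisson1_gt0.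
have hfin i : (\int[mu]_t (h i t)%:E)%E \is a fin_num.
  by rewrite ge0_fin_numE// (le_lt_trans (h1 i))// ltry.
rewrite (integral_prod_rV (h := h) (c := fun i => fine (\int[mu]_t (h i t)%:E))).
- rewrite lee_fin; apply: (@prodr_ile1 R) => i _.
  by rewrite fine_ge0//= -lee_fin fineK.
- move=> i; apply: (measurableT_comp (measurable_poisson1 dl0)).
  by apply: measurable_funB.
- by move=> i t; rewrite ltW// poisson1_gt0.
- by move=> i; rewrite fineK.
Qed.

Lemma L2_sqrt_poisson dl y : 0 < dl -> L2 leb (fun x => Num.sqrt (poisson dl y x)).
Proof.
move=> dl0; split.
  have ms : measurable_fun [set: R] (@Num.sqrt R).
    by apply: continuous_measurable_fun; exact: sqrt_continuous.
  exact: (measurableT_comp ms (measurable_poissonr y dl0)).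
rewrite /sqint; under eq_integral do rewrite sqr_sqrtr ?poisson_ge0//.
by apply: le_lt_trans (integral_poisson_le1 _ dl0) _; rewrite ltry.
Qed.

Definition poisson_conv dl (u : E -> R) (y : E) : R := \int[leb]_x (u x * poisson dl y x).

Lemma L2_mul_sqrt_poisson dl u y : 0 < dl -> L2 leb u ->
  L2 leb (fun x => u x * Num.sqrt (poisson dl y x)).
Proof.
move=> dl0 Lu; pose B := Num.sqrt ((pi * dl) ^- n).
apply: (L2_le (w := fun x => B * u x)).
- by apply: measurable_funM; [exact: Lu.1|exact: (L2_sqrt_poisson y dl0).1].
- exact: L2Z.
- move=> x; rewrite !normrM [leLHS]mulrC ler_wpM2r// !ger0_norm ?sqrtr_ge0//.
  by rewrite ler_wsqrtr// poisson_le.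
Qed.

Lemma poisson_conv_ip dl u y : 0 < dl ->
  poisson_conv dl u y = ip leb (fun x => u x * Num.sqrt (poisson dl y x))
                               (fun x => Num.sqrt (poisson dl y x)).
Proof.
move=> dl0; apply: eq_Rintegral => x _.
by rewrite -mulrA -expr2 sqr_sqrtr// poisson_ge0.
Qed.

Lemma poisson_conv_integrable dl u y : 0 < dl -> L2 leb u ->
  leb.-integrable [set: E] (fun x => (u x * poisson dl y x)%:E).
Proof.
move=> dl0 Lu; apply: eq_integrable (L2_mul (L2_mul_sqrt_poisson y dl0 Lu) (L2_sqrt_poisson y dl0)) => //.
by move=> x _; rewrite -mulrA -expr2 sqr_sqrtr// poisson_ge0.
Qed.

Lemma poisson_convD dl a u v y : 0 < dl -> L2 leb u -> L2 leb v ->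
  poisson_conv dl (fun x => u x + a * v x) y = poisson_conv dl u y + a * poisson_conv dl v y.
Proof.
move=> dl0 Lu Lv; rewrite /poisson_conv -RintegralZl//; last exact: poisson_conv_integrable.
rewrite -RintegralD//; last 2 first.
- exact: poisson_conv_integrable.
- have := poisson_conv_integrable y dl0 (L2Z a Lv); apply: eq_integrable => // x _ /=.
  by rewrite mulrA.
by apply: eq_Rintegral => x _; rewrite mulrDl mulrA.
Qed.

(** With the kernel [P] split as [sqrt P * sqrt P], Cauchy-Schwarz bounds the square of the
    convolution of [u] by the convolution of [u ^+ 2], because [P] has mass at most 1. Since [P] is
    symmetric, it also has mass at most 1 in the other variable, and Tonelli concludes. *)
Lemma poisson_conv_contract dl u : 0 < dl -> L2 leb u ->
  L2 leb (poisson_conv dl u) /\ (sqint leb (poisson_conv dl u) <= sqint leb u)%E.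
Proof.
move=> dl0 Lu.
have mu2 : measurable_fun [set: E * E] (fun z : E * E => u z.2 * poisson dl z.1 z.2).
  apply: measurable_funM; last exact: measurable_poisson.
  by exact: (measurableT_comp Lu.1 measurable_snd).
have mK : measurable_fun [set: E] (poisson_conv dl u).
  exact: (measurable_Rintegral_param leb mu2).
have mT : measurable_fun [set: E * E] (fun z : E * E => (u z.2 ^+ 2 * poisson dl z.1 z.2)%:E).
  apply/measurable_EFinP; apply: measurable_funM; last exact: measurable_poisson.
  by apply: measurable_funX; exact: (measurableT_comp Lu.1 measurable_snd).
have T0 (z : E * E) : (0 <= (u z.2 ^+ 2 * poisson dl z.1 z.2)%:E)%E.
  by rewrite lee_fin mulr_ge0 ?sqr_ge0 ?poisson_ge0.
suff H : (sqint leb (poisson_conv dl u) <= sqint leb u)%E.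
  by split => //; split => //; exact: le_lt_trans Lu.2.
apply: (@le_trans _ _ (\int[leb]_y \int[leb]_x (u x ^+ 2 * poisson dl y x)%:E)%E).
  apply: ge0_le_integral => //.
  - by move=> y _; rewrite lee_fin sqr_ge0.
  - exact: measurable_sq.
  - exact: (measurable_fun_fubini_tonelli_F (m2 := leb) _ mT T0).
  - move=> y _; rewrite poisson_conv_ip//.
    have L1 := L2_mul_sqrt_poisson y dl0 Lu; have L2' := L2_sqrt_poisson y dl0.
    apply: (@le_trans _ _ (ip leb (fun x => u x * Num.sqrt (poisson dl y x)) (fun x => u x * Num.sqrt (poisson dl y x)))%:E).
      have := cauchy_schwarz L1 L2'; rewrite lee_fin -sqr_normr => cs.
      rewrite -nrm_sq; apply: le_trans (_ : (nrm leb (fun x => u x * Num.sqrt (poisson dl y x)) * 1) ^+ 2 <= _).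
        rewrite lerXn2r ?nnegrE ?mulr_ge0 ?nrm_ge0//; apply: le_trans cs _.
        rewrite ler_wpM2l ?nrm_ge0// nrm_le// expr1n.
        rewrite /sqint; under eq_integral do rewrite sqr_sqrtr ?poisson_ge0//.
        exact: integral_poisson_le1.
      by rewrite mulr1.
    rewrite ipE// le_eqVlt; apply/orP; left; apply/eqP; apply: eq_integral => x _.
    by rewrite -expr2 exprMn sqr_sqrtr// poisson_ge0.
rewrite (fubini_tonelli (m1 := leb) (m2 := leb) _ mT T0); apply: ge0_le_integral => //.
- by move=> x _; apply: integral_ge0 => y _; exact: (T0 (y, x)).
- exact: (measurable_fun_fubini_tonelli_G (m1 := leb) _ mT T0).
- exact: measurable_sq Lu.1.
- move=> x _ /=; under eq_integral do rewrite EFinM poissonC.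
  rewrite ge0_integralZl//.
  + by rewrite -[leRHS]mule1 lee_wpmul2l ?lee_fin ?sqr_ge0//; exact: integral_poisson_le1.
  + by apply/measurable_EFinP; exact: measurable_poissonr.
  + by move=> y _; rewrite lee_fin poisson_ge0.
  + by rewrite lee_fin sqr_ge0.
Qed.

End poisson.

Section nrm_cvg.
Context d (T : measurableType d) (R : realType).
Variable m : {measure set T -> \bar R}.

Lemma nrm_cvg0 (I : Type) (F : set_system I) (FF : ProperFilter F) (f_ : I -> T -> R) :
  (forall k, L2 m (f_ k)) ->
  sqint m (f_ k) @[k --> F] --> 0%E <-> nrm m (f_ k) @[k --> F] --> 0.
Proof.
move=> Lf; split.
- move=> /(cvge0P FF (fun k => sqint_ge0 m (f_ k))) H; apply/cvgrPdist_le => e e0.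
  have := H _ (exprn_gt0 2 e0); apply: filterS => k fk.
  by rewrite sub0r normrN ger0_norm ?nrm_ge0// nrm_le// ltW.
- move=> /cvgrPdist_le H; apply/(cvge0P FF (fun k => sqint_ge0 m (f_ k))) => e e0.
  have s0 : 0 < Num.sqrt e by rewrite sqrtr_gt0.
  apply: filterS (H _ s0) => k; rewrite sub0r normrN ger0_norm ?nrm_ge0// => fk.
  by rewrite sqint_nrm// lee_fin -(sqr_sqrtr (ltW e0)) lerXn2r ?nnegrE ?nrm_ge0 ?sqrtr_ge0.
Qed.

End nrm_cvg.

Lemma cvg_prodr (R : realType) (I : Type) (s : seq I) (f : nat -> I -> R) (l : I -> R) :
  (forall i, f k i @[k --> \oo] --> l i) ->
  \prod_(i <- s) f k i @[k --> \oo] --> \prod_(i <- s) l i.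
Proof.
move=> fl; elim: s => [|i s IH].
  by under eq_fun do rewrite big_nil; rewrite big_nil; exact: cvg_cst.
by under eq_fun do rewrite big_cons; rewrite big_cons; apply: cvgM.
Qed.

(** * The Poisson kernel as an approximate identity in L2 *)

Section approximate_identity.
Context {R : realType} {n : nat}.
Local Notation E := 'rV[R]_n.
Local Notation mu := (@lebesgue_measure R).
Local Notation leb := (lebesgue_rV R n).

Definition dlt (k : nat) : R := k.+1%:R^-1.

Lemma dlt_gt0 k : 0 < dlt k. Proof. by rewrite invr_gt0. Qed.

(** The one-dimensional convolution of the Poisson kernel with the indicator of []a, b]]. The test
    returns 0 for an empty interval, where the difference of arctangents would be nonpositive. *)
Definition poisson_itv dl (a b t : R) : R :=
  if a < b then atan ((b - t) / dl) / pi - atan ((a - t) / dl) / pi else 0.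

Lemma integral_poisson_itv dl a b t : 0 < dl ->
  (\int[mu]_s (poisson1 dl (t - s) * \1_(`]a, b]%classic : set R) s)%:E)%E = (poisson_itv dl a b t)%:E.
Proof.
move=> dl0.
transitivity (\int[mu]_(s in `]a, b]) (poisson1 dl (t - s))%:E)%E.
  rewrite [RHS]integral_mkcond epatch_indic; apply: eq_integral => s _.
  by rewrite EFinM.
rewrite /poisson_itv; case: ifPn => [ab|]; last first.
  by rewrite -leNgt => ba; rewrite set_itv_ge ?integral_set0// bnd_simp -leNgt.
rewrite integral_itv_obnd_cbnd; first exact: integral_poisson1 (ltW ab).
apply: measurable_funTS; apply/measurable_EFinP.
by apply: (measurableT_comp (measurable_poisson1 dl0)); exact: measurable_funB.
Qed.

Lemma poisson_itv_ge0 dl a b t : 0 < dl -> 0 <= poisson_itv dl a b t.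
Proof.
move=> dl0; rewrite -lee_fin -integral_poisson_itv//; apply: integral_ge0 => s _.
by rewrite lee_fin mulr_ge0 ?indicE// ltW// poisson1_gt0.
Qed.

Lemma poisson_itv_le1 dl a b t : 0 < dl -> poisson_itv dl a b t <= 1.
Proof.
move=> dl0; rewrite /poisson_itv; case: ifPn => // _.
rewrite -mulrBl ler_pdivrMr ?pi_gt0// mul1r.
have := atan_ltpi2 ((b - t) / dl); have := atan_gtNpi2 ((a - t) / dl); lra.
Qed.

Lemma measurable_poisson_itv dl a b : 0 < dl -> measurable_fun [set: R] (poisson_itv dl a b).
Proof.
move=> dl0; rewrite /poisson_itv; case: (a < b); last exact: measurable_cst.
have H c : measurable_fun [set: R] (fun t : R => atan ((c - t) / dl) / pi).
  apply: measurable_funM => //; apply: (@measurableT_comp _ _ _ _ _ _ (@atan R)).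
    by apply: continuous_measurable_fun; exact: continuous_atan.
  by apply: measurable_funM => //; exact: measurable_funB.
by apply: measurable_funB.
Qed.

Lemma cvg_atan_scale (c : R) : 0 < c -> atan (c / dlt k) @[k --> \oo] --> (pi / 2 : R).
Proof.
move=> c0; apply: (@cvg_comp _ _ _ (fun k => c / dlt k) (@atan R) \oo +oo); last exact: cvgy_atan.
apply/cvgryPge => A; near=> k; rewrite /dlt invrK.
have : A / c <= k%:R by near: k; exact: nbhs_infty_ger.
by rewrite ler_pdivrMr// => /le_trans; apply; rewrite mulrC ler_wpM2l ?ler_nat ?ltW.
Unshelve. all: by end_near. Qed.

Lemma cvg_poisson_itv (a b t : R) : a < t < b ->
  poisson_itv (dlt k) a b t @[k --> \oo] --> (1 : R).
Proof.
move=> /andP[at_ tb]; rewrite /poisson_itv (lt_trans at_ tb).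
have p0 : pi != 0 :> R by rewrite gt_eqF// pi_gt0.
have -> : (1 : R) = (pi / 2) / pi - (- (pi / 2)) / pi.
  by move: pi p0 => p p0; field.
apply: cvgB; apply: cvgM; try exact: cvg_cst.
  by apply: cvg_atan_scale; rewrite subr_gt0.
rewrite (_ : (fun k => _) = (fun k => - atan ((t - a) / dlt k))); last first.
  by apply/funext => k; rewrite -atanN -mulNr opprB.
by apply: cvgN; apply: cvg_atan_scale; rewrite subr_gt0.
Qed.

Lemma cvg_integral_poisson_itv (a b : R) :
  (\int[mu]_t (poisson_itv (dlt k) a b t * \1_(`]a, b]%classic : set R) t)) @[k --> \oo] -->
  (if a < b then b - a else 0).
Proof.
case: ifPn => [ab|nab]; last first.
  rewrite (_ : (fun k => _) = fun=> 0); first exact: cvg_cst.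
  apply/funext => k; rewrite /poisson_itv (negbTE nab).
  by rewrite /Rintegral integral0_eq// => t _; rewrite mul0r.
have mI : measurable_fun [set: R] (\1_(`]a, b]%classic : set R) : R -> R).
  by apply: measurable_indic; exact: measurable_itv.
have iI : mu.-integrable [set: R] (EFin \o (\1_(`]a, b]%classic : set R) : R -> R)).
  exact: integrable_indic_itv.
have mf k : measurable_fun [set: R] (fun t => (poisson_itv (dlt k) a b t * \1_(`]a, b]%classic : set R) t)%:E).
  apply/measurable_EFinP; apply: measurable_funM => //.
  by apply: measurable_poisson_itv; exact: dlt_gt0.
have mg : measurable_fun [set: R] (EFin \o (\1_(`]a, b]%classic : set R) : R -> R)).
  exact/measurable_EFinP.
have cv : {ae mu, forall t, [set: R] t ->
    (poisson_itv (dlt k) a b t * \1_(`]a, b]%classic : set R) t)%:E @[k --> \oo] -->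
    (EFin \o (\1_(`]a, b]%classic : set R) : R -> R)) t}.
  exists [set b]; split; [exact: measurable_set1|exact: lebesgue_measure_set1|].
  move=> t /= /not_implyP[_ H]; apply: contrapT => tb; apply: H.
  apply: cvg_EFin; first exact: nearW.
  have [tab|ntab] := boolP (t \in `]a, b]).
    rewrite indicE mem_set//; rewrite -[X in _ --> X]mul1r; apply: cvgM; last exact: cvg_cst.
    apply: cvg_poisson_itv; move: tab; rewrite in_itv/= => /andP[-> ].
    by rewrite le_eqVlt => /predU1P[].
  rewrite indicE memNset ?mulr0//; last by move=> /= tt; rewrite tt in ntab.
  under eq_fun do rewrite mulr0; exact: cvg_cst.
have dom : {ae mu, forall t k, [set: R] t ->
    (`|(poisson_itv (dlt k) a b t * \1_(`]a, b]%classic : set R) t)%:E| <=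
     (EFin \o (\1_(`]a, b]%classic : set R) : R -> R)) t)%E}.
  apply: aeW => t k _; rewrite lee_fin ger0_norm ?mulr_ge0 ?poisson_itv_ge0 ?dlt_gt0 ?indicE//.
  by rewrite ler_piMl// poisson_itv_le1 ?dlt_gt0.
have [_ _ H] := @dominated_convergence _ (measurableTypeR R) R mu _ measurableT _ _ _ mf mg cv iI dom.
have E0 : (\int[mu]_t (EFin \o (\1_(`]a, b]%classic : set R) : R -> R)) t)%E = (b - a)%:E.
  by rewrite integral_indic// setIT [LHS]lebesgue_measure_itv/= lte_fin ab.
by move: H; rewrite E0 => /fine_cvgP[_].
Qed.

Lemma rV_box_lty (a b : E) : (leb (rV_box a b) < +oo)%E.
Proof. by rewrite lebesgue_rV_box ltry. Qed.

Lemma poisson_conv_box dl (a b y : E) : 0 < dl ->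
  poisson_conv dl \1_(rV_box a b) y = \prod_i poisson_itv dl (a ord0 i) (b ord0 i) (y ord0 i).
Proof.
move=> dl0; apply: EFin_inj; rewrite /poisson_conv /Rintegral.
rewrite -(integral_prod_rV (h := fun i s => poisson1 dl (y ord0 i - s) *
    \1_(`]a ord0 i, b ord0 i]%classic : set R) s)).
- rewrite fineK.
    apply: eq_integral => x _; congr EFin; rewrite indic_rV_box mulrC /poisson -big_split/=.
    by [].
  apply: integrable_fin_num => //; apply: poisson_conv_integrable => //.
  by apply: L2_indic; [exact: measurable_rV_box|exact: rV_box_lty].
- move=> i; apply: measurable_funM; last exact: measurable_indic_itv.
  by apply: (measurableT_comp (measurable_poisson1 dl0)); exact: measurable_funB.
- by move=> i t; rewrite mulr_ge0 ?indicE// ltW// poisson1_gt0.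
- by move=> i; rewrite integral_poisson_itv.
Qed.

Lemma L2_box (a b : E) : L2 leb (\1_(rV_box a b) : E -> R).
Proof.
by apply: L2_indic; [exact: measurable_rV_box|exact: rV_box_lty].
Qed.

(** Kernel and indicator both factor over the coordinates, so this is a finite product of
    one-dimensional limits. *)
Lemma ip_poisson_conv_box (a b : E) :
  ip leb (poisson_conv (dlt k) \1_(rV_box a b)) \1_(rV_box a b) @[k --> \oo] -->
  ip leb \1_(rV_box a b) \1_(rV_box a b).
Proof.
have -> : ip leb \1_(rV_box a b) \1_(rV_box a b) =
    \prod_i (if a ord0 i < b ord0 i then b ord0 i - a ord0 i else 0).
  apply: EFin_inj; rewrite ipE; [|exact: L2_box|exact: L2_box].
  transitivity (\int[leb]_x (\1_(rV_box a b) x)%:E)%E.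
    by apply: eq_integral => x _; rewrite indicE -natrM mulnb andbb.
  rewrite integral_indic//; last exact: measurable_rV_box.
  by rewrite setIT; exact: lebesgue_rV_box.
rewrite (_ : (fun k => _) = fun k => \prod_i (\int[mu]_t
   (poisson_itv (dlt k) (a ord0 i) (b ord0 i) t * \1_(`]a ord0 i, b ord0 i]%classic : set R) t))).
  by apply: cvg_prodr => i; exact: cvg_integral_poisson_itv.
apply/funext => k; have dl0 := dlt_gt0 k.
apply: EFin_inj; rewrite ipE; [|exact: (poisson_conv_contract dl0 (L2_box a b)).1|exact: L2_box].
rewrite -(integral_prod_rV (h := fun i t => poisson_itv (dlt k) (a ord0 i) (b ord0 i) t *
   \1_(`]a ord0 i, b ord0 i]%classic : set R) t)).
- apply: eq_integral => x _; congr EFin.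
  by rewrite poisson_conv_box// indic_rV_box -big_split.
- move=> i; apply: measurable_funM; last exact: measurable_indic_itv.
  exact: measurable_poisson_itv.
- by move=> i t; rewrite mulr_ge0 ?indicE// poisson_itv_ge0.
- move=> i; rewrite fineK//; apply: integrable_fin_num => //.
  have iI : mu.-integrable [set: R] (EFin \o (\1_(`]a ord0 i, b ord0 i]%classic : set R) : R -> R)).
    exact: integrable_indic_itv.
  apply: (le_integrable _ _ _ iI) => //.
    apply/measurable_EFinP; apply: measurable_funM; last exact: measurable_indic_itv.
    exact: measurable_poisson_itv.
  move=> t _; rewrite lee_fin !ger0_norm ?mulr_ge0 ?poisson_itv_ge0 ?indicE//.
  by rewrite ler_piMl// poisson_itv_le1.
Qed.

(** The contraction property transports convergence from boxes to all of L2. For a box indicator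
    [u], with convolution [P u], it also gives [|P u - u|^2 <= 2 * (|u|^2 - ip (P u) u)], so the
    convergence of the inner products implies convergence in norm. *)
Lemma poisson_conv_cvg (u : E -> R) : L2 leb u ->
  sqint leb (poisson_conv (dlt k) u \- u) @[k --> \oo] --> 0%E.
Proof.
have K k v := @poisson_conv_contract R n (dlt k) v (dlt_gt0 k).
have LK k v : L2 leb v -> L2 leb (poisson_conv (dlt k) v \- v).
  by move=> Lv; apply: L2B => //; exact: (K k v Lv).1.
move: u; apply: (@L2_density _ _ _ leb (@boxes R n) (@cube R n)).
- exact: boxes_generate.
- exact: boxesI.
- by move=> k; eexists; eexists.
- exact: cube_nd.
- exact: bigcup_cube.
- by move=> k; exact: rV_box_lty.
- move=> a f g Lf Lg /(nrm_cvg0 _ (fun k => LK k f Lf)) cf /(nrm_cvg0 _ (fun k => LK k g Lg)) cg.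
  have Lfg : L2 leb (fun x => f x + a * g x) by exact: (L2D Lf (L2Z a Lg)).
  apply/(nrm_cvg0 _ (fun k => LK k _ Lfg)).
  apply: (@squeeze_cvgr _ _ _ _ (fun=> 0) (fun k => nrm leb (poisson_conv (dlt k) f \- f) +
     `|a| * nrm leb (poisson_conv (dlt k) g \- g))).
  + apply: nearW => k; rewrite nrm_ge0/=.
    rewrite (_ : _ \- _ = (poisson_conv (dlt k) f \- f) \+
       (fun x => a * (poisson_conv (dlt k) g \- g) x)); last first.
      by apply/funext => x /=; rewrite poisson_convD ?dlt_gt0//; ring.
    apply: le_trans (nrmD (LK k f Lf) (L2Z a (LK k g Lg))) _; rewrite lerD2l.
    rewrite nrm_le ?mulr_ge0 ?nrm_ge0//; first exact: L2Z (LK k g Lg).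
    rewrite sqintZ; last exact: (LK k g Lg).1.
    by rewrite sqint_nrm ?exprMn ?sqr_normr ?EFinM//; exact: LK.
  + exact: cvg_cst.
  + rewrite -[X in _ --> X](addr0 0) -[X in _ --> _ + X](mulr0 `|a|).
    by apply: cvgD => //; apply: cvgM => //; exact: cvg_cst.
- move=> f_ f Lf_ Lf cf_.
  have LB j : L2 leb (f_ j \- f) by exact: L2B.
  move=> /(nrm_cvg0 _ LB) /cvgrPdist_le cf.
  apply/(nrm_cvg0 _ (fun k => LK k _ Lf)); apply/cvgrPdist_le => e e0.
  have e3 : 0 < e / 3 by rewrite divr_gt0.
  near \oo => j.
  have fj : nrm leb (f_ j \- f) <= e / 3.
    have : `|0 - nrm leb (f_ j \- f)| <= e / 3 by near: j; exact: cf.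
    by rewrite sub0r normrN ger0_norm ?nrm_ge0.
  have /(nrm_cvg0 _ (fun k => LK k _ (Lf_ j))) /cvgrPdist_le/(_ _ e3) := cf_ j.
  apply: filterS => k; rewrite !sub0r !normrN !ger0_norm ?nrm_ge0// => Kj.
  have L1 : L2 leb (poisson_conv (dlt k) (f_ j \- f)) by exact: (K k _ (LB j)).1.
  rewrite (_ : _ \- _ = ((poisson_conv (dlt k) (f_ j) \- f_ j) \+ (f_ j \- f)) \-
      poisson_conv (dlt k) (f_ j \- f)); last first.
    apply/funext => x /=; have -> : (f_ j \- f) = (fun x => f_ j x + (- 1) * f x).
      by apply/funext => z /=; rewrite mulN1r.
    by rewrite poisson_convD ?dlt_gt0//; ring.
  apply: le_trans (nrmB (L2D (LK k _ (Lf_ j)) (LB j)) L1) _.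
  have := nrmD (LK k _ (Lf_ j)) (LB j).
  have : nrm leb (poisson_conv (dlt k) (f_ j \- f)) <= e / 3.
    apply: le_trans fj; apply: nrm_le => //; first exact: nrm_ge0.
    by rewrite -sqint_nrm//; exact: (K k _ (LB j)).2.
  lra.
- move=> _ [a [b ->]] _; set u : E -> R := \1_(rV_box a b).
  have Lu : L2 leb u by exact: L2_box.
  apply/(cvge0P _ (fun k => sqint_ge0 leb (poisson_conv (dlt k) u \- u))) => e e0.
  have e2 : 0 < e / 2 by rewrite divr_gt0.
  have /cvgrPdist_le/(_ _ e2) := @ip_poisson_conv_box a b.
  apply: filterS => k; rewrite -/u ler_norml => /andP[_ H].
  have LKu := (K k u Lu).1; have := (K k u Lu).2.
  rewrite (sqintE LKu) (sqintE Lu) lee_fin => H1.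
  rewrite (sqintE (LK k u Lu)) lee_fin.
  have -> : poisson_conv (dlt k) u \- u = poisson_conv (dlt k) u \+ (fun x => (- 1) * u x).
    by apply/funext => x /=; rewrite mulN1r.
  rewrite ip_sqD//; lra.
Unshelve. all: by end_near. Qed.

End approximate_identity.

Section Fubini_mul.
Context d1 d2 (T1 : measurableType d1) (T2 : measurableType d2) (R : realType).
Variable m1 : {sigma_finite_measure set T1 -> \bar R}.
Variable m2 : {sigma_finite_measure set T2 -> \bar R}.

(** A bounded kernel between two integrable functions: the shape of every exchange of integrals for
    the transforms below, and of the integration by parts in [prim_mul]. *)
Lemma Fubini_mul (g : T1 -> R) (h : T2 -> R) (k : T1 * T2 -> R) (B : R) :
  m1.-integrable [set: T1] (EFin \o g) -> m2.-integrable [set: T2] (EFin \o h) ->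
  measurable_fun [set: T1 * T2] k -> (forall z, `|k z| <= B) ->
  (\int[m1]_x (g x * (\int[m2]_y (h y * k (x, y))))) =
  (\int[m2]_y (h y * (\int[m1]_x (g x * k (x, y))))).
Proof.
move=> ig ih mk kB; have B0 : 0 <= B by apply: le_trans (kB (point, point)).
have mg : measurable_fun [set: T1] g by move/measurable_int: ig => /measurable_EFinP.
have mh : measurable_fun [set: T2] h by move/measurable_int: ih => /measurable_EFinP.
have mk1 x : measurable_fun [set: T2] (fun y => k (x, y)).
  exact: (measurableT_comp mk (@pair1_measurable _ _ T1 T2 x)).
have mk2 y : measurable_fun [set: T1] (fun x => k (x, y)).
  exact: (measurableT_comp mk (@pair2_measurable _ _ T1 T2 y)).
have ihk x : m2.-integrable [set: T2] (fun y => (h y * k (x, y))%:E).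
  apply: le_integrable (integrableZl measurableT B ih) => //.
    by apply/measurable_EFinP; exact: measurable_funM.
  move=> y _; rewrite /= -?EFinM lee_fin !normrM mulrC ler_wpM2r//.
  by rewrite (le_trans (kB _))// ler_norm.
have igk y : m1.-integrable [set: T1] (fun x => (g x * k (x, y))%:E).
  apply: le_integrable (integrableZl measurableT B ig) => //.
    by apply/measurable_EFinP; exact: measurable_funM.
  move=> x _; rewrite /= -?EFinM lee_fin !normrM mulrC ler_wpM2r//.
  by rewrite (le_trans (kB _))// ler_norm.
pose f (z : T1 * T2) := (g z.1 * h z.2 * k z)%:E.
have mf : measurable_fun [set: T1 * T2] f.
  apply/measurable_EFinP; apply: measurable_funM => //; apply: measurable_funM.
    exact: (measurableT_comp mg measurable_fst).
  exact: (measurableT_comp mh measurable_snd).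
have F1 x : (\int[m2]_y f (x, y) = (g x * \int[m2]_y (h y * k (x, y)))%:E)%E.
  rewrite EFinM /Rintegral fineK ?integrable_fin_num// -integralZl//.
  by apply: eq_integral => y _; rewrite /f /= -mulrA EFinM.
have F2 y : (\int[m1]_x f (x, y) = (h y * \int[m1]_x (g x * k (x, y)))%:E)%E.
  rewrite EFinM /Rintegral fineK ?integrable_fin_num// -integralZl//.
  by apply: eq_integral => x _; rewrite /f /= -EFinM; congr EFin; ring.
have imf : (m1 \x m2)%E.-integrable [set: T1 * T2] f.
  apply/integrable12ltyP => //.
  have mah : measurable_fun [set: T2] (fun y => (B * `|h y|)%:E).
    by apply/measurable_EFinP; apply: measurable_funM => //; exact: measurableT_comp.
  have ah0 y : [set: T2] y -> (0 <= (B * `|h y|)%:E)%E by rewrite lee_fin mulr_ge0.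
  have hfin : (\int[m2]_y (B * `|h y|)%:E)%E \is a fin_num.
    have := integrable_norm ih => /(integrableZl measurableT B)/(integrable_fin_num measurableT).
    by congr (_ \is a fin_num); apply: eq_integral => y _; rewrite EFinM.
  pose c := fine (\int[m2]_y (B * `|h y|)%:E)%E.
  apply: (@le_lt_trans _ _ (\int[m1]_x (`|g x| * c)%:E)%E).
    apply: ge0_le_integral => //.
    - by move=> x _; apply: integral_ge0.
    - apply: (measurable_fun_fubini_tonelli_F (m2 := m2) (abse \o f)).
        exact: measurableT_comp.
      by move=> z; exact: abse_ge0.
    - by apply/measurable_EFinP; apply: measurable_funM => //; exact: measurableT_comp.
    - move=> x _; rewrite EFinM /c fineK// -(ge0_integralZl m2 measurableT mah ah0)//.
      apply: ge0_le_integral => //.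
      + by apply: measurableT_comp => //; exact: (measurableT_comp mf (@pair1_measurable _ _ T1 T2 x)).
      + exact: measurable_funeM.
      + move=> y _; rewrite /f /= -!EFinM lee_fin !normrM -mulrA ler_wpM2l// mulrC ler_wpM2r//.
  have ig' : m1.-integrable [set: T1] (fun x => (`|g x| * c)%:E).
    have := integrableZr measurableT c (integrable_norm ig).
    by apply: eq_integrable => // x _; rewrite EFinM.
  have := integrable_fin_num measurableT ig'; rewrite ge0_fin_numE//.
  by apply: integral_ge0 => x _; rewrite lee_fin mulr_ge0// fine_ge0// integral_ge0.
have := Fubini imf; rewrite (eq_integral _ _ (fun x _ => F1 x)) (eq_integral _ _ (fun x _ => F2 x)).
by rewrite /Rintegral => ->.
Qed.

End Fubini_mul.

(** * The Hartley transform *)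

Section hartley_integral.
Context {R : realType} {N : nat}.
Local Notation E := 'rV[R]_N.
Local Notation leb := (lebesgue_rV R N).
Implicit Types v u w : E -> R.

(** The Hartley kernel: real, bounded and, composed with [dotp], symmetric in position and
    frequency. *)
Definition cas (t : R) : R := cos t + sin t.

Lemma dotpC (x y : E) : dotp x y = dotp y x.
Proof. by apply: eq_bigr => i _; rewrite mulrC. Qed.

Lemma dotpNr (x y : E) : dotp x (- y) = - dotp x y.
Proof. by rewrite /dotp -sumrN; apply: eq_bigr => i _; rewrite mxE mulrN. Qed.

Lemma dotpDl (x y z : E) : dotp (x + y) z = dotp x z + dotp y z.
Proof. by rewrite /dotp -big_split; apply: eq_bigr => i _; rewrite mxE mulrDl. Qed.

Lemma dotpBl (x y z : E) : dotp (x - y) z = dotp x z - dotp y z.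
Proof. by rewrite dotpDl [dotp (- y) z]dotpC dotpNr [dotp z y]dotpC. Qed.

Lemma dotp0 (y : E) : dotp 0 y = 0.
Proof. by apply: big1 => i _; rewrite mxE mul0r. Qed.

Lemma measurable_dotp2 : measurable_fun [set: E * E] (fun z : E * E => dotp z.1 z.2).
Proof.
apply: measurable_sum => i; apply: measurable_funM.
  exact: (measurableT_comp (measurable_coord i) measurable_fst).
exact: (measurableT_comp (measurable_coord i) measurable_snd).
Qed.

Lemma measurable_cos : measurable_fun [set: R] (@cos R).
Proof. by apply: continuous_measurable_fun; exact: continuous_cos. Qed.

Lemma measurable_sin : measurable_fun [set: R] (@sin R).
Proof. by apply: continuous_measurable_fun; exact: continuous_sin. Qed.

Lemma measurable_cas : measurable_fun [set: R] cas.
Proof. by apply: measurable_funD; [exact: measurable_cos|exact: measurable_sin]. Qed.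

Lemma normr_cas t : `|cas t| <= 2.
Proof.
rewrite ler_norml /cas; have := cos_geN1 t; have := cos_le1 t.
by have := sin_geN1 t; have := sin_le1 t; lra.
Qed.

Lemma measurable_cas2 : measurable_fun [set: E * E] (fun z : E * E => cas (dotp z.1 z.2)).
Proof. exact: (measurableT_comp measurable_cas measurable_dotp2). Qed.

Definition fcst : R := Num.sqrt (2 * pi) ^- N.

Lemma fcst_gt0 : 0 < fcst.
Proof. by rewrite invr_gt0 exprn_gt0// sqrtr_gt0 mulr_gt0// pi_gt0. Qed.

Definition hartI v (xi : E) : R := fcst * \int[leb]_x (v x * cas (dotp x xi)).

Definition L1 v := leb.-integrable [set: E] (EFin \o v).

Lemma L1_mul_bounded v (k : E -> R) (B : R) : L1 v -> measurable_fun [set: E] k ->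
  (forall x, `|k x| <= B) -> L1 (fun x => v x * k x).
Proof.
move=> iv mk kB; have B0 : 0 <= B by apply: le_trans (kB 0).
apply: le_integrable (integrableZl measurableT B iv) => //.
  apply/measurable_EFinP; apply: measurable_funM => //.
  by move/measurable_int: iv => /measurable_EFinP.
move=> y _; rewrite /= -?EFinM lee_fin !normrM mulrC ler_wpM2r//.
by rewrite (le_trans (kB _))// ler_norm.
Qed.

Lemma measurable_cas_dotp (xi : E) : measurable_fun [set: E] (fun x => cas (dotp x xi)).
Proof.
rewrite (_ : (fun x => _) = cas \o (dotp xi)); last by apply/funext => x /=; rewrite dotpC.
exact: (measurableT_comp measurable_cas (measurable_dotp xi)).
Qed.

Lemma L1_mul_cas v (xi : E) : L1 v -> L1 (fun x => v x * cas (dotp x xi)).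
Proof.
by move=> iv; apply: (L1_mul_bounded iv (measurable_cas_dotp xi)) => x; exact: normr_cas.
Qed.

Lemma measurable_hartI v : L1 v -> measurable_fun [set: E] (hartI v).
Proof.
move=> iv; apply: measurable_funM => //.
apply: (measurable_Rintegral_param leb (f := fun z : E * E => v z.2 * cas (dotp z.2 z.1))).
apply: measurable_funM.
  move/measurable_int: iv => /measurable_EFinP mv.
  exact: (measurableT_comp mv measurable_snd).
rewrite (_ : (fun z : E * E => _) = (fun z : E * E => cas (dotp z.1 z.2))).
  exact: measurable_cas2.
by apply/funext => z; rewrite dotpC.
Qed.

Lemma hartI_bounded v : L1 v -> exists B, forall xi, `|hartI v xi| <= B.
Proof.
move=> iv; exists (fcst * \int[leb]_x (`|v x| * 2)) => xi.
rewrite normrM gtr0_norm ?fcst_gt0// ler_pM2l ?fcst_gt0//.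
apply: le_trans (le_normr_Rintegral measurableT (L1_mul_cas xi iv)) _.
apply: le_Rintegral => //.
- exact: integrable_norm (L1_mul_cas xi iv).
- apply: (@L1_mul_bounded (fun x => `|v x|) (fun=> 2) 2) => //.
  + exact: integrable_norm iv.
  + by move=> x; rewrite ger0_norm.
- by move=> x _; rewrite normrM ler_wpM2l// normr_cas.
Qed.

Lemma cas_integral v (xi : E) : \int[leb]_x (v x * cas (dotp x xi)) = fcst^-1 * hartI v xi.
Proof. by rewrite /hartI mulKf// gt_eqF// fcst_gt0. Qed.

Lemma cas_integralC v (xi : E) : \int[leb]_x (v x * cas (dotp xi x)) = fcst^-1 * hartI v xi.
Proof. by rewrite -cas_integral; apply: eq_Rintegral => x _; rewrite dotpC. Qed.

Lemma L1_mul_hartI u v : L1 u -> L1 v -> L1 (fun x => u x * hartI v x).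
Proof.
move=> iu iv; have [B HB] := hartI_bounded iv; have mH := measurable_hartI iv.
exact: (L1_mul_bounded iu mH HB).
Qed.

Lemma hartI_sym u v : L1 u -> L1 v ->
  \int[leb]_xi (hartI u xi * v xi) = \int[leb]_x (u x * hartI v x).
Proof.
move=> iu iv; have c0 : fcst^-1 != 0 by rewrite invr_neq0// gt_eqF// fcst_gt0.
have H := Fubini_mul iv iu measurable_cas2 (fun z => normr_cas _).
have HL : \int[leb]_x (v x * \int[leb]_y (u y * cas (dotp x y))) =
    fcst^-1 * \int[leb]_x (v x * hartI u x).
  rewrite -(RintegralZl _ measurableT (L1_mul_hartI iv iu)); apply: eq_Rintegral => x _.
  by rewrite cas_integralC mulrCA.
have HR : \int[leb]_y (u y * \int[leb]_x (v x * cas (dotp x y))) =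
    fcst^-1 * \int[leb]_x (u x * hartI v x).
  rewrite -(RintegralZl _ measurableT (L1_mul_hartI iu iv)); apply: eq_Rintegral => x _.
  by rewrite cas_integral mulrCA.
move: H; rewrite /= HL HR => /(mulfI c0) <-; apply: eq_Rintegral => x _.
by rewrite mulrC.
Qed.

Lemma integrable_abel dl (th : R) (z : E) : 0 < dl ->
  L1 (fun y => (1 + cos (th + dotp z y)) * expR (- dl * norm1 y)).
Proof.
move=> dl0; apply/integrableP; split; first by apply/measurable_EFinP; exact: measurable_abel.
rewrite (eq_integral (fun y => ((1 + cos (th + dotp z y)) * expR (- dl * norm1 y))%:E)).
  by rewrite abel_rV// ltry.
move=> y _ /=; rewrite ger0_norm// mulr_ge0 ?expR_ge0//.
Qed.

Lemma Rintegral_abel dl (th : R) (z : E) : 0 < dl ->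
  \int[leb]_y ((1 + cos (th + dotp z y)) * expR (- dl * norm1 y)) =
  (2 / dl) ^+ N + cos th * \prod_i (2 * dl / (dl ^+ 2 + z ord0 i ^+ 2)).
Proof. by move=> dl0; rewrite /Rintegral abel_rV. Qed.

Lemma L1_abel_weight dl : 0 < dl -> L1 (fun y => expR (- dl * norm1 y)).
Proof.
move=> dl0; have := integrable_abel (pi / 2) 0 dl0; apply: eq_integrable => // y _ /=.
by rewrite dotp0 addr0 cos_pihalf addr0 mul1r.
Qed.

(** From [cas a * cas b = cos (a - b) + sin (a + b)]. The sine is a cosine of phase [- pi / 2], and
    in [abel_rV] this phase multiplies its kernel by [cos (- pi / 2) = 0]; only the cosine of the
    difference survives. Each cosine enters with an added 1, and [iC] removes both. *)
Lemma abel_kernel dl (x y : E) : 0 < dl ->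
  \int[leb]_xi (expR (- dl * norm1 xi) * cas (dotp x xi) * cas (dotp y xi)) =
  fcst ^- 2 * poisson dl x y.
Proof.
move=> dl0.
have iA := integrable_abel 0 (x - y) dl0.
have iB := integrable_abel (- (pi / 2)) (x + y) dl0.
have iC := integrable_abel (pi / 2) 0 dl0.
transitivity (\int[leb]_xi ((((1 + cos (0 + dotp (x - y) xi)) * expR (- dl * norm1 xi)) +
     ((1 + cos (- (pi / 2) + dotp (x + y) xi)) * expR (- dl * norm1 xi))) -
   2 * ((1 + cos (pi / 2 + dotp 0 xi)) * expR (- dl * norm1 xi)))).
  apply: eq_Rintegral => xi _.
  rewrite dotp0 addr0 cos_pihalf add0r dotpBl dotpDl [- (pi / 2) + _]addrC cosBpihalf.
  by rewrite cosB sinD /cas; ring.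
have iAB := integrableD measurableT iA iB; have iC2 := integrableZl measurableT 2 iC.
rewrite RintegralB//.
rewrite RintegralD// RintegralZl// !Rintegral_abel// cos0 cosN cos_pihalf !mul0r !addr0 mul1r.
rewrite (_ : fcst ^- 2 = \prod_(i < N) (2 * pi)); last first.
  rewrite prodr_const card_ord /fcst -exprVn invrK -exprM mulnC exprM sqr_sqrtr//.
  by rewrite mulr_ge0// pi_ge0.
rewrite /poisson -big_split /=.
rewrite (eq_bigr (fun i => 2 * pi * poisson1 dl (x ord0 i - y ord0 i))); last first.
  move=> i _; rewrite !mxE /poisson1.
  have p0 : pi != 0 :> R by rewrite gt_eqF// pi_gt0.
  have D0 : dl ^+ 2 + (x ord0 i - y ord0 i) ^+ 2 != 0.
    by rewrite gt_eqF// ltr_pwDl ?exprn_gt0// sqr_ge0.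
  by move: pi p0 => p p0; field; rewrite ?D0 ?p0.
ring.
Qed.

(** Unfolding both transforms gives a triple integral of [v x * v y] against the damped product of
    two kernels. Integrating in the frequency first produces the Poisson kernel, by
    [abel_kernel]. *)
Lemma hartI_weighted dl v : 0 < dl -> L1 v -> L2 leb v ->
  \int[leb]_xi (hartI v xi ^+ 2 * expR (- dl * norm1 xi)) = ip leb (poisson_conv dl v) v.
Proof.
move=> dl0 iv Lv.
have iw := L1_abel_weight dl0.
have [B HB] := hartI_bounded iv.
have mH := measurable_hartI iv.
have iG : L1 (fun xi => expR (- dl * norm1 xi) * hartI v xi) by exact: L1_mul_bounded HB.
have c0 := fcst_gt0.
have cV : fcst^-1 != 0 by rewrite invr_neq0// gt_eqF.
pose G xi := expR (- dl * norm1 xi) * hartI v xi.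
have inner x : \int[leb]_xi (G xi * cas (dotp xi x)) = fcst^-1 * poisson_conv dl v x.
  have iwx : L1 (fun xi => expR (- dl * norm1 xi) * cas (dotp xi x)) by exact: L1_mul_cas.
  have H := Fubini_mul iwx iv measurable_cas2 (fun z => normr_cas _).
  have HL : \int[leb]_xi (expR (- dl * norm1 xi) * cas (dotp xi x) *
      \int[leb]_y (v y * cas (dotp xi y))) = fcst^-1 * \int[leb]_xi (G xi * cas (dotp xi x)).
    rewrite -(RintegralZl _ measurableT (L1_mul_cas x iG)); apply: eq_Rintegral => xi _.
    by rewrite cas_integralC /G; ring.
  have HR : \int[leb]_y (v y * \int[leb]_xi (expR (- dl * norm1 xi) * cas (dotp xi x) * cas (dotp xi y))) =
      fcst ^- 2 * poisson_conv dl v x.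
    rewrite -(RintegralZl _ measurableT (poisson_conv_integrable x dl0 Lv)); apply: eq_Rintegral => y _.
    rewrite mulrCA -abel_kernel//; congr (_ * _).
    by apply: eq_Rintegral => xi _; rewrite [dotp xi x]dotpC [dotp xi y]dotpC.
  move: H; rewrite /= HL HR => /(congr1 (fun t => fcst * t)).
  rewrite mulVKf ?gt_eqF// => ->.
  by field; rewrite gt_eqF.
have H := Fubini_mul iG iv measurable_cas2 (fun z => normr_cas _).
have HL : \int[leb]_xi (G xi * \int[leb]_y (v y * cas (dotp xi y))) =
    fcst^-1 * \int[leb]_xi (hartI v xi ^+ 2 * expR (- dl * norm1 xi)).
  have i2 : L1 (fun xi => hartI v xi ^+ 2 * expR (- dl * norm1 xi)).
    have := L1_mul_bounded iG mH HB; apply: eq_integrable => // xi _ /=.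
    by congr EFin; ring.
  rewrite -(RintegralZl _ measurableT i2); apply: eq_Rintegral => xi _.
  by rewrite cas_integralC /G; ring.
have HR : \int[leb]_y (v y * \int[leb]_xi (G xi * cas (dotp xi y))) =
    fcst^-1 * ip leb (poisson_conv dl v) v.
  have i2 := L2_mul (poisson_conv_contract dl0 Lv).1 Lv.
  rewrite -(RintegralZl _ measurableT i2); apply: eq_Rintegral => x _.
  by rewrite inner; ring.
by move: H; rewrite /= HL HR => /(mulfI cV).
Qed.

Lemma hartI_isometry v : L1 v -> L2 leb v -> L2 leb (hartI v) /\ sqint leb (hartI v) = sqint leb v.
Proof.
move=> iv Lv; have mH := measurable_hartI iv.
suff H : sqint leb (hartI v) = sqint leb v by split => //; split => //; rewrite H; exact: Lv.2.
(* The damping increases to 1 with [k]: monotone convergence identifies the undamped integral before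
   it is known to be finite. *)
pose g k xi : \bar R := (hartI v xi ^+ 2 * expR (- dlt k * norm1 xi))%:E.
have n0 (xi : E) : 0 <= norm1 xi by apply: sumr_ge0.
have mg k : measurable_fun [set: E] (g k).
  apply/measurable_EFinP; apply: measurable_funM; first exact: measurable_funX.
  apply: (@measurableT_comp _ _ _ _ _ _ expR) => //.
  by apply: measurable_funM => //; exact: measurable_norm1.
have g0 k xi : [set: E] xi -> (0 <= g k xi)%E by rewrite lee_fin mulr_ge0 ?sqr_ge0 ?expR_ge0.
have ndg xi : [set: E] xi -> {homo g^~ xi : n m / (n <= m)%N >-> (n <= m)%E}.
  move=> _ p q pq; rewrite lee_fin ler_wpM2l ?sqr_ge0// ler_expR ler_wpM2r// lerN2.
  by rewrite /dlt lef_pV2 ?posrE// ler_nat.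
have := @cvg_monotone_convergence _ E R leb setT measurableT g mg g0 ndg.
have -> : (\int[leb]_xi limn (g^~ xi))%E = sqint leb (hartI v).
  apply: eq_integral => xi _; apply/cvg_lim => //; apply: cvg_EFin; first exact: nearW.
  rewrite -[X in _ --> X]mulr1; apply: cvgM; first exact: cvg_cst.
  rewrite -expR0; apply: continuous_cvg; first exact: continuous_expR.
  rewrite -(mul0r (norm1 xi)) -oppr0; apply: cvgM; last exact: cvg_cst.
  by apply: cvgN; exact: cvg_harmonic.
move=> c1.
have c2 : (\int[leb]_xi g k xi)%E @[k --> \oo] --> sqint leb v.
  rewrite sqintE// (_ : (fun k => _) = fun k => (ip leb (poisson_conv (dlt k) v) v)%:E).
    apply: cvg_EFin; first exact: nearW.
    have LK k := (poisson_conv_contract (dlt_gt0 k) Lv).1.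
    have LD k : L2 leb (poisson_conv (dlt k) v \- v) by apply: L2B.
    have := poisson_conv_cvg Lv => /(nrm_cvg0 _ LD) cn.
    apply/cvgrPdist_le => e e0.
    have e1 : 0 < e / (nrm leb v + 1) by rewrite divr_gt0// ltr_wpDl// nrm_ge0.
    move/cvgrPdist_le : cn => /(_ _ e1); apply: filterS => k.
    rewrite sub0r normrN ger0_norm ?nrm_ge0// => kn.
    rewrite distrC -ipBl//; apply: le_trans (cauchy_schwarz (LD k) Lv) _.
    apply: le_trans (_ : e / (nrm leb v + 1) * nrm leb v <= _); first by rewrite ler_wpM2r// nrm_ge0.
    have q : (nrm leb v + 1)^-1 * nrm leb v <= 1.
      by rewrite mulrC ler_pdivrMr ?mul1r ?lerDl// ltr_wpDl ?nrm_ge0.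
    by rewrite -mulrA ler_piMr// ltW.
  apply/funext => k; rewrite -hartI_weighted ?dlt_gt0// /Rintegral fineK//.
  have [B HB] := hartI_bounded iv.
  have iG := L1_mul_bounded (L1_mul_bounded (L1_abel_weight (dlt_gt0 k)) mH HB) mH HB.
  apply: integrable_fin_num => //; move: iG; apply: eq_integrable => // xi _ /=.
  by congr EFin; ring.
by rewrite -(cvg_lim _ c1)// -(cvg_lim _ c2).
Qed.

End hartley_integral.

(** * The extended L2 norm in terms of the integral of the square *)

Section L2norm.
Context {R : realType} {N : nat}.
Local Notation E := 'rV[R]_N.
Local Notation leb := (lebesgue_rV R N).
Implicit Types v u : E -> R.

Lemma L2normE v : L2norm v = sqrte (sqint leb v).
Proof.
rewrite /L2norm unlock -poweR12_sqrt ?sqint_ge0//; congr (_ `^ _)%E.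
by apply: eq_integral => x _; rewrite /= ?poweR_EFin powR_mulrn// sqr_normr.
Qed.

Lemma L2norm_sq v : (L2norm v ^+ 2 = sqint leb v)%E.
Proof. by rewrite L2normE sqr_sqrte// sqint_ge0. Qed.

Lemma L2norm_ge0 v : (0 <= L2norm v)%E.
Proof. by rewrite L2normE sqrte_ge0. Qed.

Lemma L2norm_le v (e : R) : 0 <= e -> (L2norm v <= e%:E)%E = (sqint leb v <= (e ^+ 2)%:E)%E.
Proof.
move=> e0; rewrite L2normE -[in RHS]lee_sqrt ?lee_fin ?sqr_ge0//.
by rewrite EFin_expe sqrte_sqr gee0_abs.
Qed.

Lemma L2norm_lty v : (L2norm v < +oo)%E = (sqint leb v < +oo)%E.
Proof.
have h0 := sqint_ge0 leb v; have h1 := L2norm_ge0 v.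
by rewrite -(ge0_fin_numE h0) -(ge0_fin_numE h1) L2normE sqrte_fin_num.
Qed.

Lemma L2norm_cvg0 (I : Type) (F : set_system I) (FF : ProperFilter F) (f_ : I -> E -> R) :
  L2norm (f_ k) @[k --> F] --> 0%E <-> sqint leb (f_ k) @[k --> F] --> 0%E.
Proof.
split.
- move=> /(cvge0P FF (fun k => L2norm_ge0 (f_ k))) H.
  apply/(cvge0P FF (fun k => sqint_ge0 leb (f_ k))) => e e0.
  have s0 : 0 < Num.sqrt e by rewrite sqrtr_gt0.
  apply: filterS (H _ s0) => k; rewrite L2norm_le; last exact: ltW.
  by rewrite sqr_sqrtr// ltW.
- move=> /(cvge0P FF (fun k => sqint_ge0 leb (f_ k))) H.
  apply/(cvge0P FF (fun k => L2norm_ge0 (f_ k))) => e e0.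
  apply: filterS (H _ (exprn_gt0 2 e0)) => k.
  by rewrite L2norm_le// ltW.
Qed.

Lemma inL2E v : inL2 v <-> L2 leb v.
Proof.
rewrite /inL2 inE; split=> [/andP[mv fv]|[mv voo]].
  move: mv fv; rewrite inE/= => mv; rewrite inE /= => fv; split => //.
  by rewrite -L2norm_lty.
by apply/andP; rewrite !inE/=; split => //; rewrite /finite_norm -/(L2norm v) L2norm_lty.
Qed.

End L2norm.

Section ae_reflection.
Context {R : realType} {N : nat}.
Local Notation E := 'rV[R]_N.
Local Notation leb := (lebesgue_rV R N).

Lemma ae_oppV (P : E -> Prop) : {ae leb, forall x, P x} -> {ae leb, forall x, P (- x)}.
Proof.
move=> [A [mA A0 PA]]; exists (-%R @^-1` A); split.
- by rewrite -[X in measurable X]setTI; exact: measurable_oppV.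
- have m1 : measurable_fun [set: E] (fun x => (\1_A x : R)%:E).
    by apply/measurable_EFinP; exact: measurable_indic.
  have p0 x : (0 <= (\1_A x : R)%:E)%E by rewrite lee_fin indicE.
  have H := ge0_integralN_rV m1 p0.
  have mNA : measurable (-%R @^-1` A : set E).
    by rewrite -[X in measurable X]setTI; exact: measurable_oppV.
  have E1 := @integral_indic _ _ R leb setT measurableT _ mNA; rewrite setIT in E1.
  have E2 := @integral_indic _ _ R leb setT measurableT _ mA; rewrite setIT in E2.
  rewrite -[LHS]E1 -[RHS]A0 -[RHS]E2 -[RHS]H.
  by [].
- by move=> x /= nP; exact: PA.
Qed.

Lemma sqint_oppV (v : E -> R) : measurable_fun [set: E] v ->
  sqint leb (fun x => v (- x)) = sqint leb v.
Proof.
move=> mv; apply: (ge0_integralN_rV (phi := fun x => (v x ^+ 2)%:E)).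
  exact: measurable_sq.
by move=> x; rewrite lee_fin sqr_ge0.
Qed.

Lemma measurable_comp_oppV (v : E -> R) : measurable_fun [set: E] v ->
  measurable_fun [set: E] (fun x => v (- x)).
Proof. by move=> mv; exact: (measurableT_comp mv (@measurable_oppV R N)). Qed.

Lemma L2_oppV (v : E -> R) : L2 leb v -> L2 leb (fun x => v (- x)).
Proof.
by move=> [mv voo]; split; [exact: measurable_comp_oppV|rewrite sqint_oppV].
Qed.

End ae_reflection.

(** * Extension of the Hartley integral to L2 and its relation to the Fourier transform *)

Section hartley_L2.
Context {R : realType} {N : nat}.
Local Notation E := 'rV[R]_N.
Local Notation leb := (lebesgue_rV R N).
Local Notation cabs := (@Normc.normc R).
Implicit Types v u w h : E -> R.

Definition trunc (n : nat) v (x : E) : R := v x * \1_(cube n) x.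

Lemma L2_cube n : L2 leb (\1_(cube n) : E -> R). Proof. exact: L2_box. Qed.

Lemma trunc_L1 n v : L2 leb v -> L1 (trunc n v).
Proof. by move=> Lv; exact: L2_mul Lv (L2_cube n). Qed.

Lemma trunc_L2 n v : L2 leb v -> L2 leb (trunc n v).
Proof.
move=> Lv; apply: (L2_le _ Lv).
  by apply: measurable_funM; [exact: Lv.1|exact: (L2_cube n).1].
by move=> x; rewrite /trunc normrM ler_piMr// indicE; case: (_ \in _); rewrite ?normr1 ?normr0.
Qed.

Lemma trunc_cvg v : L2 leb v -> sqint leb (trunc n v \- v) @[n --> \oo] --> 0%E.
Proof.
move=> Lv; apply: (L2_dominated (g := fun x => `|v x|)).
- by move=> n; exact: (trunc_L2 n Lv).1.
- exact: Lv.1.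
- exact: L2_abs.
- apply: aeW => x; apply: cvg_near_cst.
  have : [set: E] x by []. rewrite -bigcup_cube => -[K _ xK].
  exists K => // n /= Kn; rewrite /trunc indicE mem_set ?mulr1//.
  by have /subsetPset := @cube_nd R N _ _ Kn; apply.
- move=> n; apply: aeW => x; rewrite /trunc indicE.
  by case: (_ \in _); rewrite ?mulr1 ?subrr ?normr0// mulr0 sub0r normrN.
Qed.

Lemma hartIB u v xi : L1 u -> L1 v -> hartI (u \- v) xi = hartI u xi - hartI v xi.
Proof.
move=> iu iv; rewrite /hartI -mulrBr -RintegralB//; [|exact: L1_mul_cas|exact: L1_mul_cas].
by congr (_ * _); apply: eq_Rintegral => x _; rewrite mulrBl.
Qed.

(** All approximating sequences are required to give the limit [h], in particular the unknown one
    hidden in [is_fourier]; uniqueness of the Fourier transform rests on this. *)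
Definition hart_limit v h := L2 leb h /\
  forall vn : nat -> E -> R, (forall n, L1 (vn n) /\ L2 leb (vn n)) ->
    sqint leb (vn n \- v) @[n --> \oo] --> 0%E ->
    sqint leb (hartI (vn n) \- h) @[n --> \oo] --> 0%E.

Lemma hart_limit_exists v : L2 leb v -> exists h, hart_limit v h.
Proof.
move=> Lv; pose v0 n := trunc n v.
have L1v n : L1 (v0 n) by exact: trunc_L1.
have L2v n : L2 leb (v0 n) by exact: trunc_L2.
have LH n := (hartI_isometry (L1v n) (L2v n)).1.
have LB n : L2 leb (v0 n \- v) by exact: L2B.
have diff (u w : E -> R) : L1 u -> L2 leb u -> L1 w -> L2 leb w ->
    sqint leb (hartI u \- hartI w) = sqint leb (u \- w).
  move=> iu Lu iw Lw; have iuw : L1 (u \- w).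
    by have := integrableB measurableT iu iw; apply: eq_integrable.
  rewrite -(hartI_isometry iuw (L2B Lu Lw)).2; congr sqint.
  by apply/funext => xi; rewrite hartIB.
have cau (e : R) : 0 < e -> exists M, forall p q, (M <= p)%N -> (M <= q)%N ->
    (sqint leb (hartI (v0 p) \- hartI (v0 q)) <= e%:E)%E.
  move=> e0; have e4 : 0 < e / 4 by rewrite divr_gt0.
  have := trunc_cvg Lv => /(cvge0P _ (fun k => sqint_ge0 leb _))/(_ _ e4)[M _ HM].
  exists M => p q Mp Mq; rewrite diff//.
  rewrite (_ : v0 p \- v0 q = (v0 p \- v) \+ (v \- v0 q)); last first.
    by apply/funext => x /=; rewrite addrA subrK.
  apply: le_trans (sqintD_le leb (LB p).1 (L2B Lv (L2v q)).1) _.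
  rewrite (sqintBC leb v) (_ : e%:E = 2%:E * (e / 4)%:E + 2%:E * (e / 4)%:E)%E; last first.
    by rewrite -!EFinM -EFinD; congr EFin; field.
  by rewrite leeD// lee_wpmul2l//; exact: HM.
have [h [Lh ch]] := L2_complete LH cau.
exists h; split; first exact: Lh.
move=> vn Lvn cvn.
have LDn n : L2 leb (vn n \- v) by apply: L2B => //; exact: (Lvn n).2.
have LDh n : L2 leb (hartI (v0 n) \- h) by exact: L2B.
have LHn n : L2 leb (hartI (vn n)) by exact: (hartI_isometry (Lvn n).1 (Lvn n).2).1.
have LE n : L2 leb (hartI (vn n) \- h) by exact: L2B.
apply/(nrm_cvg0 _ LE).
move/(nrm_cvg0 _ LDn) : cvn => cvn; move/(nrm_cvg0 _ LDh) : ch => ch.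
have c0 := trunc_cvg Lv; move/(nrm_cvg0 _ LB) : c0 => c0.
apply: (@squeeze_cvgr _ _ _ _ (fun=> 0) (fun n => nrm leb (vn n \- v) + nrm leb (v0 n \- v) +
    nrm leb (hartI (v0 n) \- h))).
- apply: nearW => n; rewrite nrm_ge0/=.
  rewrite (_ : hartI (vn n) \- h = (hartI (vn n) \- hartI (v0 n)) \+ (hartI (v0 n) \- h)); last first.
    by apply/funext => x /=; rewrite addrA subrK.
  apply: le_trans (nrmD (L2B (LHn n) (LH n)) (LDh n)) _; rewrite lerD2r.
  apply: le_trans (nrmB (LDn n) (LB n)); rewrite /nrm.
  rewrite (_ : ip leb (hartI (vn n) \- hartI (v0 n)) _ = ip leb (vn n \- v0 n) (vn n \- v0 n)).
    rewrite (_ : vn n \- v0 n = (vn n \- v) \- (v0 n \- v))//.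
    by apply/funext => x /=; rewrite opprB addrA subrK.
  apply: EFin_inj; rewrite -(sqintE (L2B (LHn n) (LH n))) -(sqintE (L2B (Lvn n).2 (L2v n))).
  by apply: diff => //; [exact: (Lvn n).1|exact: (Lvn n).2].
- exact: cvg_cst.
- rewrite -[X in _ --> X](addr0 0) -[X in _ --> X + _](addr0 0).
  by apply: cvgD => //; apply: cvgD.
Qed.

(** The Fourier transform of a real function recovered from its Hartley transform: the even part of
    [h] is the real part, and minus the odd part is the imaginary part. *)
Definition hft h (xi : E) : R[i] :=
  (((h xi + h (- xi)) / 2) +i* (- ((h xi - h (- xi)) / 2)))%C.

Lemma fourier_integralE v xi : L1 v -> fourier_integral v xi = hft (hartI v) xi.
Proof.
move=> iv.
have ic : L1 (fun x => v x * cos (dotp x xi)).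
  apply: (L1_mul_bounded (B := 1) iv).
    rewrite (_ : (fun x => _) = cos \o (dotp xi)); last by apply/funext => x /=; rewrite dotpC.
    exact: (measurableT_comp measurable_cos (measurable_dotp xi)).
  by move=> x; rewrite ler_norml cos_geN1 cos_le1.
have is_ : L1 (fun x => v x * sin (dotp x xi)).
  apply: (L1_mul_bounded (B := 1) iv).
    rewrite (_ : (fun x => _) = sin \o (dotp xi)); last by apply/funext => x /=; rewrite dotpC.
    exact: (measurableT_comp measurable_sin (measurable_dotp xi)).
  by move=> x; rewrite ler_norml sin_geN1 sin_le1.
have hp : hartI v xi = @fcst R N * (\int[leb]_x (v x * cos (dotp x xi)) + \int[leb]_x (v x * sin (dotp x xi))).
  rewrite -RintegralD//; congr (_ * _); apply: eq_Rintegral => x _.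
  by rewrite /cas mulrDr.
have hm : hartI v (- xi) = @fcst R N * (\int[leb]_x (v x * cos (dotp x xi)) - \int[leb]_x (v x * sin (dotp x xi))).
  rewrite -RintegralB//; congr (_ * _); apply: eq_Rintegral => x _.
  by rewrite /cas dotpNr cosN sinN mulrBr.
rewrite /fourier_integral /hft hp hm -/(@fcst R N); simpc.
by congr (_ +i* _)%C; field.
Qed.

Lemma cabs_sq (z : R[i]) : cabs z ^+ 2 = complex.Re z ^+ 2 + complex.Im z ^+ 2.
Proof. by case: z => a b /=; rewrite sqr_sqrtr// addr_ge0 ?sqr_ge0. Qed.

Lemma cabs_hft_sq h xi : cabs (hft h xi) ^+ 2 = (h xi ^+ 2 + h (- xi) ^+ 2) / 2.
Proof. by rewrite cabs_sq /=; field. Qed.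

Lemma hftB h h' xi : hft h xi - hft h' xi = hft (h \- h') xi.
Proof. by rewrite /hft /=; simpc; congr (_ +i* _)%C; field. Qed.

(** [|hft h|^2] at [xi] is the mean of [h ^+ 2] at [xi] and [- xi]; against an even weight both
    halves contribute equally. This is how the evenness of the symbol is used in passing from
    Fourier to Hartley. *)
Lemma ge0_integral_hft (phi : E -> R) h : measurable_fun [set: E] phi ->
  measurable_fun [set: E] h -> (forall x, 0 <= phi x) ->
  {ae leb, forall x, phi (- x) = phi x} ->
  (\int[leb]_xi (phi xi * cabs (hft h xi) ^+ 2)%:E = \int[leb]_xi (phi xi * h xi ^+ 2)%:E)%E.
Proof.
move=> mphi mh phi0 ephi.
have mhN := measurable_comp_oppV mh.
have m1 : measurable_fun [set: E] (fun xi => (phi xi * h xi ^+ 2)%:E).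
  by apply/measurable_EFinP; apply: measurable_funM => //; exact: measurable_funX.
have m2 : measurable_fun [set: E] (fun xi => (phi xi * h (- xi) ^+ 2)%:E).
  by apply/measurable_EFinP; apply: measurable_funM => //; exact: measurable_funX.
have p1 xi : [set: E] xi -> (0 <= (phi xi * h xi ^+ 2)%:E)%E by rewrite lee_fin mulr_ge0 ?sqr_ge0.
have p2 xi : [set: E] xi -> (0 <= (phi xi * h (- xi) ^+ 2)%:E)%E by rewrite lee_fin mulr_ge0 ?sqr_ge0.
have half0 : (0 <= (2^-1 : R)%:E)%E by rewrite lee_fin.
transitivity (\int[leb]_xi ((2^-1)%:E * (phi xi * h xi ^+ 2)%:E + (2^-1)%:E * (phi xi * h (- xi) ^+ 2)%:E))%E.
  apply: eq_integral => xi _; rewrite cabs_hft_sq -!EFinM -EFinD; congr EFin; by field.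
rewrite ge0_integralD//; [|by move=> x _; apply: mule_ge0 => //; exact: p1|exact: measurable_funeM
  |by move=> x _; apply: mule_ge0 => //; exact: p2|exact: measurable_funeM].
rewrite (_ : \int[leb]_x ((2^-1)%:E * (phi x * h x ^+ 2)%:E) = (2^-1)%:E * \int[leb]_x (phi x * h x ^+ 2)%:E)%E;
  last exact: (ge0_integralZl leb measurableT m1 p1 half0).
rewrite (_ : \int[leb]_x ((2^-1)%:E * (phi x * h (- x) ^+ 2)%:E) = (2^-1)%:E * \int[leb]_x (phi x * h (- x) ^+ 2)%:E)%E;
  last exact: (ge0_integralZl leb measurableT m2 p2 half0).
have -> : (\int[leb]_x (phi x * h (- x) ^+ 2)%:E = \int[leb]_x (phi x * h x ^+ 2)%:E)%E.
  rewrite -(ge0_integralN_rV (phi := fun x => (phi x * h x ^+ 2)%:E) m1 (fun x => p1 x I)).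
  apply: ge0_ae_eq_integral => //.
  - apply/measurable_EFinP; apply: measurable_funM; last exact: measurable_funX.
    exact: measurable_comp_oppV.
  - by move=> x _; exact: p1.
  - by apply: filterS ephi => x /= -> _.
set I := (\int[leb]_x _)%E; have I0 : (0 <= I)%E by apply: integral_ge0.
by rewrite -ge0_muleDl// -EFinD (_ : 2^-1 + 2^-1 = 1 :> R) ?mul1e//; field.
Qed.

Lemma sqint_cabs_hft h : measurable_fun [set: E] h -> sqint leb (fun xi => cabs (hft h xi)) = sqint leb h.
Proof.
move=> mh.
have H := @ge0_integral_hft (fun=> 1) h (measurable_cst _) mh (fun=> ler01) (aeW _ (fun=> erefl)).
transitivity (\int[leb]_xi (1 * cabs (hft h xi) ^+ 2)%:E)%E.
  by apply: eq_integral => xi _; rewrite mul1r.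
by rewrite H; apply: eq_integral => xi _; rewrite mul1r.
Qed.

Lemma inL2C_hft h : L2 leb h -> inL2C (hft h).
Proof.
move=> Lh; split; apply/inL2E => /=.
  rewrite (_ : (fun xi => _) = (fun xi => 2^-1 * (h \+ (fun x => h (- x))) xi)).
    by apply: L2Z; apply: L2D => //; exact: L2_oppV.
  by apply/funext => xi /=; rewrite mulrC.
rewrite (_ : (fun xi => _) = (fun xi => (- 2^-1) * (h \- (fun x => h (- x))) xi)).
  by apply: L2Z; apply: L2B => //; exact: L2_oppV.
by apply/funext => xi /=; rewrite mulNr mulrC.
Qed.

Lemma is_fourier_hft v h : L2 leb v -> hart_limit v h -> is_fourier v (hft h).
Proof.
move=> Lv [Lh ch]; split; [exact/inL2E|exact: inL2C_hft|].
exists (fun n => trunc n v); split.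
- move=> n; split; last by apply/inL2E; exact: trunc_L2.
  by apply/Lfun1_integrable; exact: trunc_L1.
- by apply/L2norm_cvg0; exact: trunc_cvg.
- apply/L2norm_cvg0.
  have Lt n : L1 (trunc n v) /\ L2 leb (trunc n v) by split; [exact: trunc_L1|exact: trunc_L2].
  have := ch _ Lt (trunc_cvg Lv).
  rewrite [X in X @ _ --> _ -> _](_ : _ = (fun n => sqint leb (fun xi => cabs (fourier_integral (trunc n v) xi - hft h xi)))) //.
  apply/funext => n; rewrite -sqint_cabs_hft; last first.
    by apply: (L2B _ Lh).1; exact: (hartI_isometry (Lt n).1 (Lt n).2).1.
  by congr sqint; apply/funext => xi; rewrite fourier_integralE ?hftB//; exact: (Lt n).1.
Qed.

(** The sequence provided by [is_fourier] approximates [v], so its Hartley integrals tend to [h];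
    its Fourier integrals then tend to [hft h] as well as to [w]. *)
Lemma is_fourier_unique v h (w : E -> R[i]) : L2 leb v -> hart_limit v h -> is_fourier v w ->
  {ae leb, forall xi, w xi = hft h xi}.
Proof.
move=> Lv [Lh ch] [_ [/inL2E Lre /inL2E Lim] [vn [Lvn cvn cw]]].
have Lt n : L1 (vn n) /\ L2 leb (vn n).
  by have [/Lfun1_integrable ? /inL2E ?] := Lvn n.
have ch' : sqint leb (hartI (vn n) \- h) @[n --> \oo] --> 0%E.
  by apply: ch => //; apply/L2norm_cvg0.
move/L2norm_cvg0 : cw => cw.
have LH n : L2 leb (hartI (vn n)) by exact: (hartI_isometry (Lt n).1 (Lt n).2).1.
have [mre mim] := inL2C_hft Lh; move/inL2E : mre => Lhre; move/inL2E : mim => Lhim.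
have LD n : L2 leb (hartI (vn n) \- h) by exact: L2B.
have mcabs (z : E -> R[i]) : measurable_fun [set: E] (fun xi => complex.Re (z xi)) ->
    measurable_fun [set: E] (fun xi => complex.Im (z xi)) ->
    measurable_fun [set: E] (fun xi => cabs (z xi)).
  move=> m1 m2; have ms : measurable_fun [set: R] (@Num.sqrt R).
    by apply: continuous_measurable_fun; exact: sqrt_continuous.
  rewrite (_ : (fun xi => cabs (z xi)) = (fun xi => Num.sqrt (complex.Re (z xi) ^+ 2 + complex.Im (z xi) ^+ 2))).
    by apply: (measurableT_comp ms); apply: measurable_funD; exact: measurable_funX.
  by apply/funext => xi; case: (z xi).
have Re_sub (z z' : R[i]) : complex.Re (z - z') = complex.Re z - complex.Re z' by case: z z' => [? ?] [? ?].
have Im_sub (z z' : R[i]) : complex.Im (z - z') = complex.Im z - complex.Im z' by case: z z' => [? ?] [? ?].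
have mwh : measurable_fun [set: E] (fun xi => cabs (w xi - hft h xi)).
  apply: mcabs.
    by under eq_fun do rewrite Re_sub; exact: (L2B Lre Lhre).1.
  by under eq_fun do rewrite Im_sub; exact: (L2B Lim Lhim).1.
have mfw n : measurable_fun [set: E] (fun xi => cabs (fourier_integral (vn n) xi - w xi)).
  under eq_fun do rewrite (fourier_integralE _ (Lt n).1).
  have [/inL2E L1' /inL2E L2'] := inL2C_hft (LH n).
  apply: mcabs.
    by under eq_fun do rewrite Re_sub; exact: (L2B L1' Lre).1.
  by under eq_fun do rewrite Im_sub; exact: (L2B L2' Lim).1.
have mfh n : measurable_fun [set: E] (fun xi => cabs (hft (hartI (vn n) \- h) xi)).
  have [/inL2E L1' /inL2E L2'] := inL2C_hft (LD n).
  by apply: mcabs; [exact: L1'.1|exact: L2'.1].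
have key n : (sqint leb (fun xi => cabs (w xi - hft h xi)%R) <=
    2%:E * sqint leb (fun xi => cabs (fourier_integral (vn n) xi - w xi)%R) +
    2%:E * sqint leb (hartI (vn n) \- h))%E.
  rewrite -(sqint_cabs_hft (LD n).1); apply: le_trans (sqintD_le leb (mfw n) (mfh n)).
  apply: sqint_le => //; first exact: measurable_funD.
  move=> xi; have c0 (z : R[i]) : 0 <= cabs z by case: z => a b; exact: sqrtr_ge0.
  rewrite -[(_ \+ _) xi]/(cabs (fourier_integral (vn n) xi - w xi) + cabs (hft (hartI (vn n) \- h) xi)).
  rewrite !ger0_norm ?addr_ge0// -hftB -fourier_integralE; last exact: (Lt n).1.
  rewrite (_ : w xi - hft h xi = - (fourier_integral (vn n) xi - w xi) + (fourier_integral (vn n) xi - hft h xi)).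
    apply: le_trans (complex.le_normcD _ _) _; rewrite lerD2r.
    by case: (_ - _) => a b; simpc; rewrite /= !sqrrN.
  by rewrite opprB addrA subrK.
have z0 : sqint leb (fun xi => cabs (w xi - hft h xi)) = 0%E.
  apply/eqP; rewrite eq_le sqint_ge0 andbT; apply/lee_addgt0Pr => e e0; rewrite add0e.
  have e4 : 0 < e / 4 by rewrite divr_gt0.
  have A1 : \forall n \near \oo, (sqint leb (fun xi => cabs (fourier_integral (vn n) xi - w xi)%R) <= (e / 4)%:E)%E.
    by move/(cvge0P _ (fun k => sqint_ge0 leb _)) : cw; apply.
  have A2 : \forall n \near \oo, (sqint leb (hartI (vn n) \- h) <= (e / 4)%:E)%E.
    by move/(cvge0P _ (fun k => sqint_ge0 leb _)) : ch'; apply.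
  near \oo => n.
  apply: le_trans (key n) _.
  rewrite (_ : e%:E = 2%:E * (e / 4)%:E + 2%:E * (e / 4)%:E)%E; last first.
    by rewrite -!EFinM -EFinD; congr EFin; field.
  by rewrite leeD// lee_wpmul2l//; near: n.
have := sqint_eq0 mwh z0; apply: filterS => xi /eqP.
rewrite -[X in X == _]/(cabs (w xi - hft h xi)) => /eqP/Normc.eq0_normc/eqP.
by rewrite subr_eq0 => /eqP.
Unshelve. all: by end_near. Qed.

End hartley_L2.

Section nrm_continuity.
Context d (T : measurableType d) (R : realType).
Variable m : {measure set T -> \bar R}.
Implicit Types f g : T -> R.

Lemma nrm_dist f g : L2 m f -> L2 m g -> `|nrm m f - nrm m g| <= nrm m (f \- g).
Proof.
move=> Lf Lg; have Lfg := L2B Lf Lg; rewrite ler_norml; apply/andP; split.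
  have := nrmD Lfg (L2N Lf); rewrite (_ : (f \- g) \+ (\- f) = \- g) ?nrmN; first lra.
  by apply/funext => x /=; ring.
rewrite lerBlDr; have := nrmD Lfg Lg.
by rewrite (_ : (f \- g) \+ g = f)//; apply/funext => x /=; rewrite subrK.
Qed.

Lemma nrm_cvg (f_ : nat -> T -> R) f : (forall n, L2 m (f_ n)) -> L2 m f ->
  sqint m (f_ n \- f) @[n --> \oo] --> 0%E -> nrm m (f_ n) @[n --> \oo] --> nrm m f.
Proof.
move=> Lf_ Lf /(nrm_cvg0 _ (fun n => L2B (Lf_ n) Lf)) /cvgrPdist_le H.
apply/cvgrPdist_le => e /H; apply: filterS => n.
rewrite sub0r normrN ger0_norm ?nrm_ge0// => h; rewrite distrC.
exact: le_trans (nrm_dist (Lf_ n) Lf) h.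
Qed.

Lemma ip_cvg (f_ : nat -> T -> R) f g : (forall n, L2 m (f_ n)) -> L2 m f -> L2 m g ->
  sqint m (f_ n \- f) @[n --> \oo] --> 0%E -> ip m (f_ n) g @[n --> \oo] --> ip m f g.
Proof.
move=> Lf_ Lf Lg /(nrm_cvg0 _ (fun n => L2B (Lf_ n) Lf)) c.
have c2 : nrm m (f_ n \- f) * nrm m g @[n --> \oo] --> 0.
  by rewrite -(mul0r (nrm m g)); apply: cvgM => //; exact: cvg_cst.
move/cvgrPdist_le : c2 => c2; apply/cvgrPdist_le => e /c2; apply: filterS => n.
rewrite sub0r normrN ger0_norm ?mulr_ge0 ?nrm_ge0// => h.
rewrite distrC -ipBl//; exact: le_trans (cauchy_schwarz (L2B (Lf_ n) Lf) Lg) h.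
Qed.

Lemma L2_cvg_unique (f_ : nat -> T -> R) f g : (forall n, L2 m (f_ n)) -> L2 m f -> L2 m g ->
  sqint m (f_ n \- f) @[n --> \oo] --> 0%E -> sqint m (f_ n \- g) @[n --> \oo] --> 0%E ->
  {ae m, forall x, f x = g x}.
Proof.
move=> Lf_ Lf Lg cf cg; apply: ip_eq => // h Lh.
by rewrite -(cvg_lim _ (ip_cvg Lf_ Lf Lh cf))// (cvg_lim _ (ip_cvg Lf_ Lg Lh cg)).
Qed.

Lemma ae_sqint_cvg (f_ : nat -> T -> R) f g : (forall n, measurable_fun [set: T] (f_ n)) ->
  measurable_fun [set: T] f -> measurable_fun [set: T] g -> {ae m, forall x, f x = g x} ->
  sqint m (f_ n \- f) @[n --> \oo] --> 0%E -> sqint m (f_ n \- g) @[n --> \oo] --> 0%E.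
Proof.
move=> mf_ mf mg fg; rewrite (_ : (fun n => sqint m (f_ n \- f)) = (fun n => sqint m (f_ n \- g)))//.
apply/funext => n; apply: eq_sqint; [exact: measurable_funB|exact: measurable_funB|].
by apply: filterS fg => x /= ->.
Qed.

End nrm_continuity.

(** * The Hartley transform as an isometric involution of L2 *)

Section hartley.
Context {R : realType} {N : nat}.
Local Notation E := 'rV[R]_N.
Local Notation leb := (lebesgue_rV R N).
Local Notation cabs := (@Normc.normc R).
Implicit Types v u w h : E -> R.

(** Built from the representative [fourier v] that the statement fixes, so that facts on [hart]
    transfer to the statement directly. *)
Definition hart v (xi : E) : R := complex.Re (fourier v xi) - complex.Im (fourier v xi).

Lemma fourierP v : L2 leb v -> is_fourier v (fourier v).
Proof.
move=> Lv; have [h hh] := hart_limit_exists Lv.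
by apply: (@xgetPex _ (fun=> 0) [set w | is_fourier v w]); exists (hft h); exact: is_fourier_hft.
Qed.

Lemma L2_hart v : L2 leb v -> L2 leb (hart v).
Proof. by move=> /fourierP[_ [/inL2E L1' /inL2E L2'] _]; exact: (L2B L1' L2'). Qed.

Lemma hart_ae v h : L2 leb v -> hart_limit v h -> {ae leb, forall xi, hart v xi = h xi}.
Proof.
move=> Lv hh; apply: filterS (is_fourier_unique Lv hh (fourierP Lv)) => xi E1.
by rewrite /hart E1 /hft /=; field.
Qed.

Lemma hartP v : L2 leb v -> hart_limit v (hart v).
Proof.
move=> Lv; have [h hh] := hart_limit_exists Lv; split; first exact: L2_hart.
move=> vn Lvn cvn; apply: (ae_sqint_cvg (f := h)).
- by move=> n; apply: (hartI_isometry (Lvn n).1 (Lvn n).2).1.1.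
- exact: hh.1.1.
- exact: (L2_hart Lv).1.
- by apply: filterS (hart_ae Lv hh) => x ->.
- exact: hh.2.
Qed.

Lemma fourier_hft v : L2 leb v -> {ae leb, forall xi, fourier v xi = hft (hart v) xi}.
Proof. by move=> Lv; apply: is_fourier_unique (hartP Lv) (fourierP Lv). Qed.

Lemma trunc_hart v : L2 leb v -> [/\ forall n, L2 leb (hartI (trunc n v)),
  forall n, nrm leb (hartI (trunc n v)) = nrm leb (trunc n v) &
  sqint leb (hartI (trunc n v) \- hart v) @[n --> \oo] --> 0%E].
Proof.
move=> Lv; have Lt n : L1 (trunc n v) /\ L2 leb (trunc n v).
  by split; [exact: trunc_L1|exact: trunc_L2].
split.
- by move=> n; exact: (hartI_isometry (Lt n).1 (Lt n).2).1.
- move=> n; have [L' E'] := hartI_isometry (Lt n).1 (Lt n).2.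
  by move: E'; rewrite (sqintE L') (sqintE (Lt n).2) /nrm => -[->].
- exact: (hartP Lv).2 _ Lt (trunc_cvg Lv).
Qed.

Lemma nrm_hart v : L2 leb v -> nrm leb (hart v) = nrm leb v.
Proof.
move=> Lv; have [LH nH cH] := trunc_hart Lv.
have c1 := nrm_cvg LH (L2_hart Lv) cH.
have c2 := nrm_cvg (fun n => trunc_L2 n Lv) Lv (trunc_cvg Lv).
by rewrite -(cvg_lim _ c1)// -(cvg_lim _ c2)//; congr (limn _); apply/funext.
Qed.

Lemma sqint_hart v : L2 leb v -> sqint leb (hart v) = sqint leb v.
Proof. by move=> Lv; rewrite !sqint_nrm ?nrm_hart//; exact: L2_hart. Qed.

Lemma hartD a u v : L2 leb u -> L2 leb v ->
  {ae leb, forall xi, hart (fun x => u x + a * v x) xi = hart u xi + a * hart v xi}.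
Proof.
move=> Lu Lv; have Luv : L2 leb (fun x => u x + a * v x) by exact: (L2D Lu (L2Z a Lv)).
have [LHu _ cu] := trunc_hart Lu; have [LHv _ cv] := trunc_hart Lv.
have [LHw _ cw] := trunc_hart Luv.
have Lhu := L2_hart Lu; have Lhv := L2_hart Lv.
apply: (L2_cvg_unique LHw (L2_hart Luv) (L2D Lhu (L2Z a Lhv)) cw).
have LBu n : L2 leb (hartI (trunc n u) \- hart u) by exact: L2B.
have LBv n : L2 leb (hartI (trunc n v) \- hart v) by exact: L2B.
have eqw n : hartI (trunc n (fun x => u x + a * v x)) \- (hart u \+ (fun x => a * hart v x)) =
    (hartI (trunc n u) \- hart u) \+ (fun x => a * (hartI (trunc n v) \- hart v) x).
  apply/funext => xi /=.
  have i1 := L1_mul_cas xi (trunc_L1 n Lu); have i2 := L1_mul_cas xi (trunc_L1 n Lv).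
  have -> : hartI (trunc n (fun x => u x + a * v x)) xi = hartI (trunc n u) xi + a * hartI (trunc n v) xi.
    rewrite /hartI [a * _]mulrCA -mulrDr -(RintegralZl _ measurableT i2).
    rewrite -RintegralD//; last first.
      by have := integrableZl measurableT a i2; apply: eq_integrable.
    by congr (_ * _); apply: eq_Rintegral => x _; rewrite /trunc; ring.
  by ring.
have LBw n : L2 leb (hartI (trunc n (fun x => u x + a * v x)) \- (hart u \+ (fun x => a * hart v x))).
  by rewrite eqw; apply: L2D => //; exact: L2Z.
apply/(nrm_cvg0 _ LBw).
move/(nrm_cvg0 _ LBu) : cu => cu; move/(nrm_cvg0 _ LBv) : cv => cv.
apply: (@squeeze_cvgr _ _ _ _ (fun=> 0) (fun n => nrm leb (hartI (trunc n u) \- hart u) +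
   `|a| * nrm leb (hartI (trunc n v) \- hart v))).
- apply: nearW => n; rewrite nrm_ge0/= eqw.
  apply: le_trans (nrmD (LBu n) (L2Z a (LBv n))) _; rewrite lerD2l.
  apply: nrm_le; [by rewrite mulr_ge0 ?nrm_ge0|exact: L2Z|].
  by rewrite (sqintZ _ a (LBv n).1) (sqint_nrm (LBv n)) exprMn sqr_normr EFinM.
- exact: cvg_cst.
- rewrite -[X in _ --> X](addr0 0) -[X in _ --> _ + X](mulr0 `|a|).
  by apply: cvgD; [exact: cu|apply: cvgM; [exact: cvg_cst|exact: cv]].
Qed.

Lemma hartB u v : L2 leb u -> L2 leb v ->
  {ae leb, forall xi, hart (u \- v) xi = hart u xi - hart v xi}.
Proof.
move=> Lu Lv; apply: filterS (hartD (- 1) Lu Lv) => xi; rewrite mulN1r => <-.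
by congr (hart _ xi); apply/funext => x /=; rewrite mulN1r.
Qed.

Lemma ip_hartC u v : L2 leb u -> L2 leb v -> ip leb (hart u) v = ip leb u (hart v).
Proof.
move=> Lu Lv; have [LHu _ cu] := trunc_hart Lu; have [LHv _ cv] := trunc_hart Lv.
have Lhu := L2_hart Lu; have Lhv := L2_hart Lv.
have E1 n : ip leb (hartI (trunc n u)) v = ip leb (trunc n u) (hart v).
  have c1 : ip leb (trunc k v) (hartI (trunc n u)) @[k --> \oo] --> ip leb v (hartI (trunc n u)).
    exact: ip_cvg (fun k => trunc_L2 k Lv) Lv (LHu n) (trunc_cvg Lv).
  have c2 : ip leb (hartI (trunc k v)) (trunc n u) @[k --> \oo] --> ip leb (hart v) (trunc n u).
    exact: ip_cvg LHv Lhv (trunc_L2 n Lu) cv.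
  rewrite ipC [RHS]ipC -(cvg_lim _ c1)// -(cvg_lim _ c2)//; congr (limn _); apply/funext => k.
  rewrite ipC [RHS]ipC; apply: hartI_sym; [exact: trunc_L1|exact: trunc_L1].
have c1 := ip_cvg LHu Lhu Lv cu.
have c2 := ip_cvg (fun k => trunc_L2 k Lu) Lu Lhv (trunc_cvg Lu).
by rewrite -(cvg_lim _ c1)// -(cvg_lim _ c2)//; congr (limn _); apply/funext.
Qed.

(** Polarization of the isometry [nrm_hart]. *)
Lemma ip_hart u v : L2 leb u -> L2 leb v -> ip leb (hart u) (hart v) = ip leb u v.
Proof.
move=> Lu Lv; have Lhu := L2_hart Lu; have Lhv := L2_hart Lv.
have Luv : L2 leb (u \+ (fun x => 1 * v x)) by exact: (L2D Lu (L2Z 1 Lv)).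
have E1 : ip leb (hart u \+ (fun x => 1 * hart v x)) (hart u \+ (fun x => 1 * hart v x)) =
    ip leb (u \+ (fun x => 1 * v x)) (u \+ (fun x => 1 * v x)).
  rewrite -!nrm_sq; rewrite -(nrm_hart Luv) !nrm_sq.
  have Ls : L2 leb (hart u \+ (fun x => 1 * hart v x)) by exact: (L2D Lhu (L2Z 1 Lhv)).
  apply: (eq_ip Ls (L2_hart Luv) Ls (L2_hart Luv)).
    by apply: filterS (hartD 1 Lu Lv) => x /= ->.
  by apply: filterS (hartD 1 Lu Lv) => x /= ->.
move: E1; rewrite !ip_sqD// -!nrm_sq !nrm_hart//; lra.
Qed.

(** A symmetric isometry is an involution: the inner product of [hart (hart v)] with [w] equals that
    of [hart v] with [hart w], hence that of [v] with [w]. *)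
Lemma hartK v : L2 leb v -> {ae leb, forall x, hart (hart v) x = v x}.
Proof.
move=> Lv; have Lhv := L2_hart Lv; apply: (ip_eq (L2_hart Lhv) Lv) => w Lw.
by rewrite (ip_hartC Lhv Lw) (ip_hart Lv Lw).
Qed.

(** Equality everywhere, although the hypothesis is almost everywhere: the chosen representative
    depends on the set of candidates only, and that set is the same for [u] and [v]. *)
Lemma eq_fourier u v : L2 leb u -> L2 leb v -> {ae leb, forall x, u x = v x} ->
  fourier u = fourier v.
Proof.
move=> Lu Lv uv.
suff H u' v' : L2 leb u' -> L2 leb v' -> {ae leb, forall x, u' x = v' x} ->
    [set w | is_fourier u' w] `<=` [set w | is_fourier v' w].
  rewrite /fourier; congr (xget _ _); apply/seteqP; split; apply: H => //.
  by apply: filterS uv => x ->.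
move=> {uv Lu Lv} Lu Lv uv w [_ Lw [vn [Lvn cvn cw]]]; split => //; first exact/inL2E.
exists vn; split => //; apply/L2norm_cvg0; move/L2norm_cvg0 : cvn.
apply: ae_sqint_cvg => //; [|exact: Lu.1|exact: Lv.1].
by move=> n; have [_ /inL2E[]] := Lvn n.
Qed.

Lemma eq_hart u v : L2 leb u -> L2 leb v -> {ae leb, forall x, u x = v x} -> hart u = hart v.
Proof. by move=> Lu Lv uv; rewrite /hart (eq_fourier Lu Lv uv). Qed.

Lemma hart_inj u v : L2 leb u -> L2 leb v -> {ae leb, forall x, hart u x = hart v x} ->
  {ae leb, forall x, u x = v x}.
Proof.
move=> Lu Lv uv; apply: (ip_eq Lu Lv) => w Lw.
rewrite -(ip_hart Lu Lw) -(ip_hart Lv Lw).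
by apply: (eq_ip (L2_hart Lu) (L2_hart Lv) (L2_hart Lw) (L2_hart Lw)) => //; exact: aeW.
Qed.

Lemma ge0_integral_fourier (phi : E -> R) v : measurable_fun [set: E] phi ->
  (forall x, 0 <= phi x) -> {ae leb, forall x, phi (- x) = phi x} -> L2 leb v ->
  (\int[leb]_xi (phi xi * cabs (fourier v xi) ^+ 2)%:E = \int[leb]_xi (phi xi * hart v xi ^+ 2)%:E)%E.
Proof.
move=> mphi phi0 ephi Lv; have Lh := L2_hart Lv.
rewrite -(ge0_integral_hft mphi Lh.1 phi0 ephi).
have [_ [/inL2E Lr /inL2E Li] _] := fourierP Lv.
have [/inL2E Lhr /inL2E Lhi] := inL2C_hft Lh.
apply: ge0_ae_eq_integral => //.
- apply/measurable_EFinP; apply: measurable_funM => //.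
  by under eq_fun do rewrite cabs_sq; apply: measurable_funD; apply: measurable_funX; [exact: Lr.1|exact: Li.1].
- apply/measurable_EFinP; apply: measurable_funM => //.
  by under eq_fun do rewrite cabs_sq; apply: measurable_funD; apply: measurable_funX; [exact: Lhr.1|exact: Lhi.1].
- by move=> xi _; rewrite lee_fin mulr_ge0 ?sqr_ge0.
- by move=> xi _; rewrite lee_fin mulr_ge0 ?sqr_ge0.
- by apply: filterS (fourier_hft Lv) => xi ->.
Qed.

End hartley.

(** * Primitives and linear equations on the half-line *)

Section prim.
Context {R : realType}.
Local Notation mu := (@lebesgue_measure R).
Implicit Types (y z p q : R -> R).

Lemma mitv (i : interval R) : measurable ([set` i] : set (measurableTypeR R)).
Proof. exact: measurable_itv. Qed.

(** The equation [y' = z] on the half-line in integrated form: [y] is locally absolutely continuous,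
    and [z] matters up to null sets only. Values at negative times are free. *)
Definition prim y z := (forall T, mu.-integrable `[0, T] (EFin \o z)) /\
  (forall t, 0 <= t -> y t = y 0 + \int[mu]_(s in `[0, t]) z s).

Lemma prim_measurable_deriv y z (T : R) : prim y z -> measurable_fun `[0, T] z.
Proof. by move=> [iz _]; move/measurable_int : (iz T) => /measurable_EFinP. Qed.

Lemma prim_int c z : (forall T, mu.-integrable `[0, T] (EFin \o z)) ->
  prim (fun t => c + \int[mu]_(s in `[0, t]) z s) z.
Proof.
by move=> iz; split => // t t0; rewrite set_itv1 Rintegral_set1 addr0.
Qed.

Lemma eq_prim y y' z z' : prim y z -> (forall t, 0 <= t -> y t = y' t) ->
  (forall t, 0 <= t -> z t = z' t) -> prim y' z'.
Proof.
move=> [iz yz] yy zz; split=> [T|t t0].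
  by apply: eq_integrable (iz T) => // t; rewrite inE/= in_itv/= => /andP[t0 _]; rewrite /= zz.
rewrite -!yy// yz//; congr (_ + _); apply: eq_Rintegral => s.
by rewrite inE/= in_itv/= => /andP[s0 _]; rewrite zz.
Qed.

Lemma prim_cst c : prim (fun=> c) (fun=> 0).
Proof.
split=> [T|t t0]; last by rewrite /Rintegral integral0_eq ?addr0.
exact: integrable0.
Qed.

Lemma primD y z y' z' : prim y z -> prim y' z' -> prim (y \+ y') (z \+ z').
Proof.
move=> [iz yz] [iz' yz']; split=> [T|t t0].
  by have := integrableD (mitv _) (iz T) (iz' T); apply: eq_integrable.
by rewrite /= yz// yz'// (RintegralD (mitv _) (iz t) (iz' t)); ring.
Qed.

Lemma primZ c y z : prim y z -> prim (fun t => c * y t) (fun t => c * z t).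
Proof.
move=> [iz yz]; split=> [T|t t0].
  by have := integrableZl (mitv _) c (iz T); apply: eq_integrable.
by rewrite yz// (RintegralZl _ (mitv _) (iz t)) mulrDr.
Qed.

Lemma primB y z y' z' : prim y z -> prim y' z' -> prim (y \- y') (z \- z').
Proof.
move=> p1 p2; have := primD p1 (primZ (- 1) p2).
by move/eq_prim; apply => t _ /=; rewrite mulN1r.
Qed.

Lemma continuous_integrable_itv z (T : R) : continuous z -> mu.-integrable `[0, T] (EFin \o z).
Proof.
move=> cz; apply: continuous_compact_integrable; first exact: segment_compact.
exact: continuous_subspaceT.
Qed.

Lemma prim_derive y z : continuous z -> (forall t : R, is_derive t 1 y (z t)) -> prim y z.
Proof.
move=> cz dy; split=> [T|t t0]; first exact: continuous_integrable_itv.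
by rewrite /Rintegral (FTC2 t0 cz dy) /= addrC subrK.
Qed.

Lemma prim_exp c : prim (fun t => expR (c * t)) (fun t => c * expR (c * t)).
Proof.
apply: prim_derive => [t|t]; last exact: is_derive_expRZ.
by apply: cvgM; [exact: cvg_cst|exact: continuous_expRZ].
Qed.

Lemma prim_continuous y z (T : R) : 0 <= T -> prim y z -> {within `[0, T], continuous y}.
Proof.
move=> T0 [iz yz].
have c1 := parameterized_integral_continuous T0 (iz T).
have c2 : {within `[0, T], continuous (fun t => y 0 + \int[mu]_(s in `[0, t]) z s)}.
  by move=> t; apply: cvgD; [exact: cvg_cst|exact: c1].
apply: subspace_eq_continuous c2 => t; rewrite inE/= in_itv/= => /andP[t0 _].
exact: (esym (yz t t0)).
Qed.

Lemma prim_measurable y z (T : R) : prim y z -> measurable_fun `[0, T] y.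
Proof.
move=> yz; have [T0|T0] := leP 0 T.
  by apply: subspace_continuous_measurable_fun => //; exact: prim_continuous yz.
by rewrite set_itv_ge ?bnd_simp -?ltNge//; exact: measurable_fun_set0.
Qed.

Lemma prim_bounded y z (T : R) : prim y z -> exists2 B, 0 <= B & forall t, 0 <= t <= T -> `|y t| <= B.
Proof.
move=> [iz yz]; exists (`|y 0| + \int[mu]_(s in `[0, T]) `|z s|).
  by rewrite addr_ge0// Rintegral_ge0.
move=> t /andP[t0 tT]; rewrite yz//; apply: le_trans (ler_normD _ _) _; rewrite lerD2l.
apply: le_trans (le_normr_Rintegral (mitv _) (iz t)) _.
have iT := integrable_norm (iz T).
have it : mu.-integrable `[0, t] (EFin \o (fun s => `|z s|)) by exact: integrable_norm (iz t).
rewrite -lee_fin /Rintegral !fineK; last 2 first.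
- exact: integrable_fin_num iT.
- exact: integrable_fin_num it.
apply: ge0_subset_integral => //.
- by apply: measurable_int iT.
- by apply: subset_itvl; rewrite bnd_simp.
Qed.

Lemma integrable_mul_prim y z p (T : R) : prim y z -> mu.-integrable `[0, T] (EFin \o p) ->
  mu.-integrable `[0, T] (EFin \o (fun t => p t * y t)).
Proof.
move=> yz ip; have [B B0 yB] := prim_bounded T yz.
have mT := mitv `[0, T].
apply: (le_integrable mT _ _ (integrableZl mT B ip)).
  apply/measurable_EFinP; apply: measurable_funM; last exact: prim_measurable yz.
  by move/measurable_int : ip => /measurable_EFinP.
move=> t /=; rewrite in_itv/= => tT; rewrite -?EFinM lee_fin !normrM mulrC.
by rewrite ler_wpM2r// (le_trans (yB _ tT))// ler_norm.
Qed.

Lemma prim_sub_int y z (s t : R) : prim y z -> 0 <= s <= t -> \int[mu]_(r in `]s, t]) z r = y t - y s.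
Proof.
move=> [iz yz] /andP[s0 st]; rewrite (yz t) ?(le_trans s0)// (yz s)//.
have := @Rintegral_itvB R z (BLeft 0) (BRight t) s.
rewrite !bnd_simp => H; rewrite -(H _ s0 st); first by ring.
exact: iz.
Qed.

(** The product rule for absolutely continuous functions, obtained from Fubini for [z t * z' s] over
    the triangle [s <= t] of the square of side [T]. *)
Lemma prim_mul y z y' z' : prim y z -> prim y' z' ->
  prim (fun t => y t * y' t) (fun t => z t * y' t + z' t * y t).
Proof.
move=> pz pz'; have [iz yz] := pz; have [iz' yz'] := pz'.
have i1 T := integrable_mul_prim pz' (iz T).
have i2 T := integrable_mul_prim pz (iz' T).
split=> [T|T T0].
  by have := integrableD (mitv _) (i1 T) (i2 T); apply: eq_integrable.
rewrite (RintegralD (mitv _) (i1 T) (i2 T)).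
pose I : set (measurableTypeR R) := `[0, T]%classic.
have mI : measurable I by exact: mitv.
pose k (u : measurableTypeR R * measurableTypeR R) : R := ((u.2 : R) <= (u.1 : R))%R%:R.
have mk : measurable_fun [set: measurableTypeR R * measurableTypeR R] k.
  apply: (@measurableT_comp _ _ _ _ _ _ (fun b : bool => b%:R : R)) => //.
  by apply: measurable_fun_ler; [exact: measurable_snd|exact: measurable_fst].
have k1 u : `|k u| <= 1 by rewrite /k ger0_norm// lern1 leq_b1.
have ig : mu.-integrable [set: measurableTypeR R] (EFin \o (z \_ I)).
  by rewrite -restrict_EFin; apply: (integrable_mkcond _ mI).1; exact: iz.
have ih : mu.-integrable [set: measurableTypeR R] (EFin \o (z' \_ I)).
  by rewrite -restrict_EFin; apply: (integrable_mkcond _ mI).1; exact: iz'.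
have H := Fubini_mul ig ih mk k1.
have inner t : I t -> \int[mu]_s ((z' \_ I) s * k (t, s)) = y' t - y' 0.
  rewrite /I /= in_itv/= => /andP[t0 tT].
  rewrite yz'// addrC addKr Rintegral_mkcond; apply: eq_Rintegral => s _.
  rewrite !patchE /k /=; case: ifPn => sI; case: ifPn => st.
  + by move: st; rewrite inE/= in_itv/= => /andP[_ ->]; rewrite mulr1.
  + move: sI st; rewrite !inE notin_setE /I /= !in_itv/= => /andP[s0 _] /negP.
    by rewrite s0 /= => /negbTE ->; rewrite mulr0.
  + move: sI st; rewrite !inE notin_setE /I /= !in_itv/= => /negP sI /andP[s0 st].
    by rewrite s0 (le_trans st tT) in sI.
  + by rewrite mul0r.
have inner2 s : I s -> \int[mu]_t ((z \_ I) t * k (t, s)) = y T - y s.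
  rewrite /I /= in_itv/= => /andP[s0 sT].
  rewrite -(prim_sub_int pz) ?s0//.
  rewrite Rintegral_itv_obnd_cbnd; last first.
    apply: (integrableS (mitv _) (mitv _) _ (iz T)) => r /=.
    by rewrite !in_itv/= => /andP[sr ->]; rewrite (ltW (le_lt_trans s0 sr)).
  rewrite Rintegral_mkcond; apply: eq_Rintegral => t _.
  rewrite !patchE /k /=; case: ifPn => tI; case: ifPn => st.
  + by move: st; rewrite inE/= in_itv/= => /andP[-> _]; rewrite mulr1.
  + move: tI st; rewrite !inE notin_setE /I /= !in_itv/= => /andP[_ tT] /negP.
    by rewrite tT andbT => /negbTE ->; rewrite mulr0.
  + move: tI st; rewrite !inE notin_setE /I /= !in_itv/= => /negP tI /andP[st tT].
    by rewrite (le_trans s0 st) tT in tI.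
  + by rewrite mul0r.
have HL : \int[mu]_t ((z \_ I) t * \int[mu]_s ((z' \_ I) s * k (t, s))) =
    \int[mu]_(t in `[0, T]) (z t * y' t) - y' 0 * \int[mu]_(t in `[0, T]) z t.
  rewrite -(RintegralZl _ mI (iz T)) -(RintegralB mI (i1 T)); last first.
    by have := integrableZl mI (y' 0) (iz T); apply: eq_integrable.
  rewrite [RHS]Rintegral_mkcond; apply: eq_Rintegral => t _.
  rewrite !patchE; case: ifPn => [|_]; last by rewrite mul0r.
  by rewrite inE => tI; rewrite inner//; ring.
have HR : \int[mu]_s ((z' \_ I) s * \int[mu]_t ((z \_ I) t * k (t, s))) =
    y T * \int[mu]_(t in `[0, T]) z' t - \int[mu]_(t in `[0, T]) (z' t * y t).
  rewrite -(RintegralZl _ mI (iz' T)) -(RintegralB mI _ (i2 T)); last first.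
    by have := integrableZl mI (y T) (iz' T); apply: eq_integrable.
  rewrite [RHS]Rintegral_mkcond; apply: eq_Rintegral => s _.
  rewrite !patchE; case: ifPn => [|_]; last by rewrite mul0r.
  by rewrite inE => sI; rewrite inner2//; ring.
move: H; rewrite HL HR.
have : \int[mu]_(t in `[0, T]) z t = y T - y 0 by rewrite (yz T)// addrC addKr.
have : \int[mu]_(t in `[0, T]) z' t = y' T - y' 0 by rewrite (yz' T)// addrC addKr.
move=> -> ->; set A := \int[mu]_(t in _) _; set B := \int[mu]_(t in _) _ => H.
have -> : A = y T * (y' T - y' 0) - B + y' 0 * (y T - y 0) by rewrite -H; ring.
by ring.
Qed.

End prim.

(** * Integrals on the half-line, Gronwall's inequality and differentiation of integrals *)

Section halfline.
Context {R : realType}.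
Local Notation mu := (@lebesgue_measure R).
Implicit Types (y z p q f g : R -> R).

Lemma le_Rint d (T : measurableType d) (m : {measure set T -> \bar R}) (D : set T) (f g : T -> R) :
  measurable D -> m.-integrable D (EFin \o f) -> m.-integrable D (EFin \o g) ->
  (forall x, D x -> f x <= g x) -> \int[m]_(x in D) f x <= \int[m]_(x in D) g x.
Proof.
move=> mD jf jg fg; rewrite /Rintegral; apply: fine_le.
- exact: integrable_fin_num jf.
- exact: integrable_fin_num jg.
- by apply: (le_integral mD jf jg) => x Dx; rewrite lee_fin fg// -in_setE.
Qed.

Lemma bigcup_itv0 : \bigcup_n `[0%R, (n%:R : R)]%classic = `[(0 : R)%R, +oo[%classic.
Proof.
apply/seteqP; split => [x [n _]|x] /=; first by rewrite !in_itv/= => /andP[->].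
rewrite in_itv/= andbT => x0; exists (Num.truncn x).+1 => //=.
by rewrite in_itv/= x0 ltW// truncnS_gt.
Qed.

Lemma measurable_halfline p : (forall T : R, measurable_fun `[0, T] p) -> measurable_fun `[(0 : R), +oo[ p.
Proof.
move=> mp; rewrite -bigcup_itv0; apply/measurable_fun_bigcup => [n|n]; first exact: mitv.
exact: mp.
Qed.

Lemma homo_itv0 : {homo (fun n => `[0%R, (n%:R : R)]%classic) : n m / (n <= m)%N >-> (n <= m)%O}.
Proof. by move=> n m nm; apply/subsetPset/subset_itvl; rewrite bnd_simp ler_nat. Qed.

Lemma subset_halfline (T : R) : `[0, T] `<=` `[(0 : R)%R, +oo[.
Proof. by move=> x /=; rewrite !in_itv/= andbT => /andP[]. Qed.

Lemma ge0_cvg_halfline p : measurable_fun `[(0 : R), +oo[ p -> (forall t, 0 <= t -> 0 <= p t) ->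
  (\int[mu]_(t in `[0%R, n%:R]) (p t)%:E)%E @[n --> \oo] --> (\int[mu]_(t in `[(0 : R)%R, +oo[) (p t)%:E)%E.
Proof.
move=> mp p0; rewrite -bigcup_itv0.
apply: (@ge0_nondecreasing_set_cvg_integral _ (measurableTypeR R) R) => [|n|n|n t /=].
- exact: homo_itv0.
- exact: mitv.
- apply/measurable_EFinP; apply: measurable_funS mp; [exact: mitv|exact: subset_halfline].
- by rewrite in_itv/= => /andP[t0 _]; rewrite lee_fin p0.
Qed.

Lemma halfline_le p (C : R) : measurable_fun `[(0 : R), +oo[ p -> (forall t, 0 <= t -> 0 <= p t) ->
  (forall T, 0 <= T -> mu.-integrable `[0, T] (EFin \o p)) ->
  (forall T, 0 <= T -> \int[mu]_(t in `[0, T]) p t <= C) ->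
  mu.-integrable `[(0 : R), +oo[ (EFin \o p) /\ \int[mu]_(t in `[(0 : R), +oo[) p t <= C.
Proof.
move=> mp p0 ip pC.
have H : (\int[mu]_(t in `[(0 : R)%R, +oo[) (p t)%:E <= C%:E)%E.
  rewrite -(cvg_lim _ (ge0_cvg_halfline mp p0))//; apply: lime_le.
    by apply/cvg_ex; eexists; exact: ge0_cvg_halfline.
  apply: nearW => n; have n0 : (0 <= n%:R :> R) by [].
  rewrite -[X in (X <= _)%E]fineK; first by rewrite lee_fin; exact: pC.
  exact: integrable_fin_num (ip _ n0).
have P0 t : `[(0 : R)%R, +oo[%classic t -> (0 <= (p t)%:E)%E.
  by rewrite /= in_itv/= andbT => t0; rewrite lee_fin p0.
have I : mu.-integrable `[(0 : R), +oo[ (EFin \o p).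
  apply/integrableP; split; first exact/measurable_EFinP.
  apply: le_lt_trans (ltry C); apply: le_trans H; rewrite le_eqVlt; apply/orP; left; apply/eqP.
  by apply: eq_integral => t; rewrite inE => /P0; rewrite lee_fin => h; rewrite /= ger0_norm.
split => //; rewrite -lee_fin /Rintegral fineK//; exact: integrable_fin_num I.
Qed.

Lemma integrable_halfline_sub f (T : R) : mu.-integrable `[(0 : R), +oo[ (EFin \o f) ->
  mu.-integrable `[0, T] (EFin \o f).
Proof. by apply: integrableS; [exact: mitv|exact: mitv|exact: subset_halfline]. Qed.

Lemma integrable_obnd f (a : R) : mu.-integrable `[a, +oo[ (EFin \o f) ->
  mu.-integrable `]a, +oo[ (EFin \o f).
Proof. by apply: integrableS; [exact: mitv|exact: mitv|apply: subset_itvr; rewrite bnd_simp]. Qed.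

Lemma Rint_split f (T : R) : 0 <= T -> mu.-integrable `[(0 : R), +oo[ (EFin \o f) ->
  \int[mu]_(t in `[(0 : R), +oo[) f t = \int[mu]_(t in `[0, T]) f t + \int[mu]_(t in `]T, +oo[) f t.
Proof.
move=> T0 jf; have := @Rintegral_itvB R f (BLeft 0) +oo%O T jf; rewrite !bnd_simp => /(_ T0 isT) <-.
by ring.
Qed.

Lemma cvg_halfline f : mu.-integrable `[(0 : R), +oo[ (EFin \o f) ->
  forall e : R, 0 < e -> exists2 T, 0 <= T & \int[mu]_(t in `]T, +oo[) `|f t| <= e.
Proof.
move=> jf e e0; have jn := integrable_norm jf.
have mf : measurable_fun `[(0 : R)%R, +oo[ (fun t => `|f t|).
  by move/measurable_int : jn => /measurable_EFinP.
have := ge0_cvg_halfline mf (fun t _ => normr_ge0 _).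
rewrite -[X in _ --> X]fineK; last exact: integrable_fin_num jn.
move/fine_cvg => /cvgrPdist_le /(_ e e0) [n _ /(_ n (leqnn n)) /= H].
have n0 : (0 <= n%:R :> R) by [].
exists n%:R => //; move: H; rewrite -/(Rintegral _ _ _) -/(Rintegral _ _ _).
rewrite (Rint_split n0 jn) addrC addKr => H; apply: le_trans H; exact: ler_norm.
Qed.

(** Integrability of [z] makes [y] converge to [y 0] plus the integral of [z]. A nonzero limit [c]
    would keep [|y|] above [|c| / 2] from some time on, against the integrability of [y]. *)
Lemma prim_vanish y z : prim y z -> mu.-integrable `[(0 : R), +oo[ (EFin \o y) ->
  mu.-integrable `[(0 : R), +oo[ (EFin \o z) -> \int[mu]_(t in `[(0 : R), +oo[) z t = - y 0.
Proof.
move=> [iz yz] jy jz; set I := \int[mu]_(t in `[(0 : R), +oo[) z t.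
apply/eqP; rewrite -subr_eq0 opprK; apply/negPn/negP => c0.
set c := I + y 0 in c0; have c2 : 0 < `|c| / 2 by rewrite divr_gt0// normr_gt0.
have [T T0 HT] := cvg_halfline jz c2.
have yc t : T <= t -> `|c| / 2 <= `|y t|.
  move=> Tt; have t0 := le_trans T0 Tt.
  have E : c - y t = \int[mu]_(s in `]t, +oo[) z s.
    by rewrite /c /I (Rint_split t0 jz) (yz t t0); ring.
  have S : `]t, +oo[ `<=` `]T, +oo[ by apply: subset_itvr; rewrite bnd_simp.
  have jT : mu.-integrable `]T, +oo[ (EFin \o z).
    apply: (integrableS (mitv _) (mitv _) _ jz) => s /=; rewrite !in_itv/= !andbT.
    by move=> Ts; rewrite (ltW (le_lt_trans T0 Ts)).
  have jt := integrableS (mitv _) (mitv _) S jT.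
  have : `|c - y t| <= `|c| / 2.
    rewrite E; apply: (le_trans (le_normr_Rintegral (mitv _) jt)); apply: (le_trans _ HT).
    rewrite /Rintegral; apply: fine_le.
    - exact: integrable_fin_num (integrable_norm jt).
    - exact: integrable_fin_num (integrable_norm jT).
    apply: ge0_subset_integral => //.
    by have := integrable_norm jT; move/measurable_int.
  have := ler_normB c (c - y t); rewrite (_ : c - (c - y t) = y t); last by ring.
  by have := lerB_dist c (c - y t); rewrite (_ : c - (c - y t) = y t); [lra|ring].
have /integrableP[_] := jy; rewrite ltNge => /negP; apply.
have -> : (+oo = \int[mu]_(t in `[T, +oo[) (`|c| / 2)%:E)%E.
  rewrite integral_cst; last exact: mitv.
  have mT : lebesgue_measure `[T, +oo[ = +oo%E :> \bar R by rewrite lebesgue_measure_itv /= ltry.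
  by rewrite [X in (_ * X)%E](_ : _ = +oo%E) ?gt0_muley ?lte_fin//; exact: mT.
apply: (@le_trans _ _ (\int[mu]_(t in `[T, +oo[) (`|y t|)%:E)%E).
  have jyT : mu.-integrable `[T, +oo[ (EFin \o y).
    apply: (integrableS (mitv _) (mitv _) _ jy); apply: subset_itvr; by rewrite bnd_simp.
  apply: ge0_le_integral.
  - exact: mitv.
  - by move=> t _; rewrite lee_fin ltW.
  - exact: measurable_cst.
  - by have := integrable_norm jyT; move/measurable_int.
  - by move=> t /=; rewrite in_itv/= andbT lee_fin; exact: yc.
apply: ge0_subset_integral.
- exact: mitv.
- exact: mitv.
- by have := integrable_norm jy; move/measurable_int.
- by move=> t _; rewrite lee_fin normr_ge0.
- by apply: subset_itvr; rewrite bnd_simp.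
Qed.

Lemma prim_expM c y z : prim y z ->
  prim (fun t => expR (c * t) * y t) (fun t => expR (c * t) * (c * y t + z t)).
Proof.
move=> yz; have := prim_mul (prim_exp c) yz.
by move/eq_prim; apply => t _ //=; ring.
Qed.

Lemma prim_sq y z : prim y z -> prim (fun t => y t ^+ 2) (fun t => 2 * (z t * y t)).
Proof. by move=> yz; have := prim_mul yz yz; move/eq_prim; apply => t _; [rewrite expr2|ring]. Qed.

Lemma gronwall y z p c (T : R) : prim y z -> (forall T, mu.-integrable `[0, T] (EFin \o p)) ->
  0 <= c -> 0 <= T -> (forall t, 0 <= t <= T -> 0 <= p t) ->
  (forall t, 0 <= t <= T -> z t <= c * y t + p t) ->
  y T <= expR (c * T) * (y 0 + \int[mu]_(t in `[0, T]) p t).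
Proof.
move=> yz ip c0 T0 p0 zp; have [ie ye] := prim_expM (- c) yz.
have := ye T T0; rewrite mulr0 expR0 mul1r => E.
rewrite -ler_pdivrMl ?expR_gt0// -expRN -mulNr E lerD2l; apply: le_Rint.
- exact: mitv.
- exact: ie.
- exact: ip.
move=> t /=; rewrite in_itv/= => tT; have [t0 _] := andP tT.
have zt := zp _ tT; have pt := p0 _ tT.
apply: (@le_trans _ _ (expR (- c * t) * p t)); first by rewrite ler_wpM2l ?expR_ge0//; lra.
by rewrite ler_piMl// -expR0 ler_expR mulNr oppr_le0 mulr_ge0.
Qed.

Lemma ae_muS (P Q : R -> Prop) : (forall t, P t -> Q t) -> {ae mu, forall t, P t} ->
  {ae mu, forall t, Q t}.
Proof. exact: (@filterS _ _ (ae_filter_ringOfSetsType mu)). Qed.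

(** By Lebesgue's differentiation theorem, [z] is almost everywhere the derivative of its indefinite
    integral. *)
Lemma integral0_ae z : (forall T, mu.-integrable `[0, T] (EFin \o z)) ->
  (forall t, 0 <= t -> \int[mu]_(s in `[0, t]) z s = 0) -> {ae mu, forall t, 0 < t -> z t = 0}.
Proof.
move=> iz z0; suff H n : {ae mu, forall t, 0 < t < n%:R -> z t = 0}.
  have /ae_foralln := H; apply: ae_muS => t Ht t0; apply: (Ht (Num.truncn t).+1).
  by rewrite t0 truncnS_gt.
pose I : set (measurableTypeR R) := `[0, n%:R]%classic.
have mI : measurable I by exact: mitv.
have jz : mu.-integrable [set: R] (EFin \o (z \_ I)).
  by rewrite -restrict_EFin; apply: (integrable_mkcond _ mI).1; exact: iz.
have /lebesgue_differentiation := integrable_locally mI (iz n%:R).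
apply: ae_muS => t lt /andP[t0 tn].
have jz1 : mu.-integrable `]-oo, n%:R] (EFin \o (z \_ I)).
  by apply: (integrableS measurableT (mitv _) _ jz).
have [_] := FTC1_lebesgue_pt tn jz1 (ltNyr _) lt.
rewrite patchE mem_set; last by rewrite /I /= in_itv/= !ltW.
move=> <-; rewrite derive1E -[RHS](derive_cst (W := R) (0 : R) t (1 : R)).
apply: near_eq_derive; near=> s.
have s0 : 0 < s by near: s; exact: lt_nbhsr.
have sn : s < n%:R by near: s; exact: lt_nbhsl.
apply: (etrans _ (z0 s (ltW s0))).
rewrite [LHS]Rintegral_mkcond [RHS]Rintegral_mkcond.
apply: eq_Rintegral => r _; rewrite !patchE.
have [rs|rs] := boolP (r \in `]-oo, s]%classic); last first.
  by case: ifPn => // ; move: rs; rewrite !inE notin_setE /= !in_itv/= => /negP/negbTE-> ; rewrite andbF.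
have [r0|r0] := boolP (r \in `[0, s]%classic).
  rewrite mem_set//; move: r0; rewrite inE /I /= !in_itv/= => /andP[-> rs'].
  by rewrite (le_trans rs' (ltW sn)).
case: ifPn => // rI; move: r0 rI rs; rewrite notin_setE !inE /I /= !in_itv/= => /negP r0 /andP[r1 _] rs.
by rewrite r1 rs in r0.
Unshelve. all: by end_near. Qed.

End halfline.

(** * Data of exponential growth and the solution that stays bounded by them *)

Section weighted_data.
Context {R : realType}.
Local Notation mu := (@lebesgue_measure R).
Implicit Types (y z g F : R -> R).

Lemma prim_mono y z (s t : R) : prim y z -> (forall t, 0 <= t -> z t <= 0) -> 0 <= s <= t -> y t <= y s.
Proof.
move=> yz z0 /andP[s0 st]; rewrite -subr_le0 -(prim_sub_int yz) ?s0//.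
have iz : mu.-integrable `]s, t] (EFin \o z).
  apply: (integrableS (mitv _) (mitv _) _ (yz.1 t)) => r /=.
  by rewrite !in_itv/= => /andP[sr ->]; rewrite (ltW (le_lt_trans s0 sr)).
rewrite -oppr_ge0 -mulN1r -(RintegralZl _ (mitv _) iz); apply: Rintegral_ge0 => r /=.
by rewrite in_itv/= => /andP[sr _]; have := z0 r (ltW (le_lt_trans s0 sr)); lra.
Qed.

Lemma expR_tail (c : R) (t : R) : 0 < c -> mu.-integrable `[t, +oo[ (EFin \o (fun s => expR (- c * s))) /\
  \int[mu]_(s in `[t, +oo[) expR (- c * s) = expR (- c * t) / c.
Proof.
move=> c0.
have H : (\int[mu]_(s in `[t, +oo[) (expR (- c * s))%:E)%E = (expR (- c * t) / c)%:E.
  have d s : is_derive s (1 : R) (fun s : R => - c^-1 * expR (- c * s)) (expR (- c * s)).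
    have := is_deriveZ (- c^-1) (is_derive_expRZ (- c) s).
    by rewrite /GRing.scale /= mulrA mulrNN mulVf ?gt_eqF// mul1r.
  have l : - c^-1 * expR (- c * s) @[s --> +oo] --> (0 : R).
    by rewrite -(mulr0 (- c^-1)); apply: cvgM; [exact: cvg_cst|exact: cvg_expR_decay].
  rewrite (FTC2y t (fun s => expR_ge0 _) (@continuous_expRZ R (- c)) d l).
  by congr EFin; field; rewrite gt_eqF.
split; last by rewrite /Rintegral H.
apply/integrableP; split.
  apply/measurable_EFinP; apply: measurable_funTS; apply: continuous_measurable_fun.
  exact: continuous_expRZ.
apply: le_lt_trans (ltry (expR (- c * t) / c)); rewrite -H le_eqVlt; apply/orP; left; apply/eqP.
by apply: eq_integral => s _ /=; rewrite ger0_norm ?expR_ge0.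
Qed.

Let aux (x y z w v : R) : x - y <= z -> z <= w -> w <= v -> y <= v -> x <= 2 * v.
Proof. lra. Qed.

Variables (sg : R) (F : R -> R).
Hypothesis sg0 : 0 <= sg.
Hypothesis mF : measurable_fun [set: R] F.
Hypothesis iF : mu.-integrable `[(0 : R), +oo[ (EFin \o (fun s => expR (- sg * s) * F s ^+ 2)).

Definition wint : R := \int[mu]_(s in `[(0 : R), +oo[) (expR (- sg * s) * F s ^+ 2).

Let w0 s : 0 <= expR (- sg * s) * F s ^+ 2.
Proof. by rewrite mulr_ge0 ?expR_ge0 ?sqr_ge0. Qed.

Lemma wint_ge0 : 0 <= wint.
Proof. by apply: Rintegral_ge0 => t _; exact: w0. Qed.

Lemma wF_sq (T : R) : mu.-integrable `[0, T] (EFin \o (fun s => F s ^+ 2)).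
Proof.
have iT := integrable_halfline_sub T iF.
have mT := mitv `[0, T].
have mF2 : measurable_fun `[0, T] (EFin \o (fun s => F s ^+ 2)).
  by apply/measurable_EFinP; apply: measurable_funTS; exact: measurable_funX.
apply: (le_integrable mT mF2 _ (integrableZl mT (expR (sg * T)) iT)) => s /=.
rewrite in_itv/= => /andP[s0 sT]; rewrite -?EFinM lee_fin (ger0_norm (sqr_ge0 (F s))) [leRHS]ger0_norm.
  2: by rewrite mulr_ge0 ?expR_ge0// mulr_ge0 ?expR_ge0// sqr_ge0.
rewrite mulrA -expRD -[leLHS]mul1r ler_wpM2r ?sqr_ge0// -expR0 ler_expR.
by have := ler_wpM2l sg0 sT; lra.
Qed.

Lemma wF_sq_le (T : R) : 0 <= T -> \int[mu]_(s in `[0, T]) (F s ^+ 2) <= expR (sg * T) * wint.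
Proof.
move=> T0; have iT := integrable_halfline_sub T iF; have mT := mitv `[0, T].
apply: (@le_trans _ _ (\int[mu]_(s in `[0, T]) (expR (sg * T) * (expR (- sg * s) * F s ^+ 2)))).
  apply: (le_Rint mT (wF_sq T)).
    by have := integrableZl mT (expR (sg * T)) iT; apply: eq_integrable.
  move=> s /=; rewrite in_itv/= => /andP[s0 sT].
  rewrite mulrA -expRD -[leLHS]mul1r ler_wpM2r ?sqr_ge0// -expR0 ler_expR.
  by have := ler_wpM2l sg0 sT; lra.
rewrite (RintegralZl _ mT iT) ler_wpM2l ?expR_ge0// /wint (Rint_split T0 iF) lerDl.
by apply: Rintegral_ge0 => s _; exact: w0.
Qed.

Lemma wF_integrable (T : R) : mu.-integrable `[0, T] (EFin \o F).
Proof.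
have mT := mitv `[0, T].
have i1 : mu.-integrable `[0, T] (EFin \o (fun=> (1 : R))).
  by apply: continuous_integrable_itv => t; exact: cvg_cst.
have mF' : measurable_fun `[0, T] (EFin \o F).
  by apply/measurable_EFinP; apply: measurable_funTS.
apply: (le_integrable mT mF' _ (integrableD mT i1 (wF_sq T))) => s _ /=.
rewrite -?EFinD lee_fin [leRHS]ger0_norm; last by rewrite addr_ge0 ?sqr_ge0.
rewrite -[F s ^+ 2]sqr_normr; have := sqr_ge0 (`|F s| - 1); rewrite sqrrB1.
have := sqr_ge0 (`|F s|); rewrite -mulr_natr; lra.
Qed.

Variable a : R.
Hypothesis a_sg : sg <= a.
Hypothesis a0 : 0 < a.

Local Notation c := (2 * a - sg).
Let c0 : 0 < c. Proof. by move: a_sg a0; lra. Qed.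

(** Half of the weight, [expR (- (sg / 2) * s)], goes with [F]. The square of the other factor is
    [expR (- c * s)] with [c = 2 * a - sg], positive because [sg <= a] and [0 < a]. The parameter
    [l] is kept in order to be optimized in [wF_tail]. *)
Lemma wF_amgm (l s : R) : 0 < l ->
  2 * `|expR (- a * s) * F s| <= l * expR (- c * s) + l^-1 * (expR (- sg * s) * F s ^+ 2).
Proof.
move=> l0; rewrite normrM ger0_norm ?expR_ge0//.
have -> : expR (- c * s) = expR (- (a - sg / 2) * s) ^+ 2.
  by rewrite -expRM_natl; congr expR; field.
have -> : expR (- a * s) = expR (- (a - sg / 2) * s) * expR (- (sg / 2) * s).
  by rewrite -expRD; congr expR; field.
have -> : expR (- sg * s) = expR (- (sg / 2) * s) ^+ 2.
  by rewrite -expRM_natl; congr expR; field.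
set x := expR _; set y := expR _; rewrite -(sqr_normr (F s)); set z := `|F s|.
have := sqr_ge0 (l * x - y * z); have li : l * l^-1 = 1 by rewrite mulfV ?gt_eqF.
have -> : (l * x - y * z) ^+ 2 = l * (l * x ^+ 2 + l^-1 * (y ^+ 2 * z ^+ 2) - 2 * (x * y * z)).
  rewrite !mulrDr (mulrA l l^-1) li; ring.
by rewrite pmulr_rge0// subr_ge0.
Qed.

Lemma wF_exp : mu.-integrable `[(0 : R), +oo[ (EFin \o (fun s => expR (- a * s) * F s)).
Proof.
have m0 := mitv `[(0 : R), +oo[.
have [i1 _] := expR_tail 0 c0.
have mE : measurable_fun `[(0 : R), +oo[ (EFin \o (fun s => expR (- a * s) * F s)).
  apply/measurable_EFinP; apply: measurable_funTS; apply: measurable_funM => //.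
  by apply: continuous_measurable_fun; exact: continuous_expRZ.
apply: (le_integrable m0 mE _ (integrableD m0 i1 iF)) => s _ /=.
rewrite -?EFinD lee_fin [leRHS]ger0_norm; last by rewrite addr_ge0 ?expR_ge0 ?w0.
have := wF_amgm s (@ltr01 R); rewrite invr1 !mul1r; have := normr_ge0 (expR (- a * s) * F s); lra.
Qed.

Lemma wF_tail (t : R) : 0 <= t ->
  (\int[mu]_(s in `]t, +oo[) (expR (- a * s) * F s)) ^+ 2 <= expR (- c * t) / c * wint.
Proof.
move=> t0; have mt := mitv `]t, +oo[.
have sub : `]t, +oo[%classic `<=` `[(0 : R), +oo[%classic.
  by move=> s /=; rewrite !in_itv/= !andbT => ts; exact: ltW (le_lt_trans t0 ts).
have i1 := integrableS (mitv _) mt sub wF_exp.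
have i2 := integrableS (mitv _) mt sub iF.
have [i3' E3] := expR_tail t c0; have i3 := integrable_obnd i3'.
set P := \int[mu]_(s in _) _; set X := expR (- c * t) / c.
have X0 : 0 < X by rewrite divr_gt0 ?expR_gt0.
have H l : 0 < l -> 2 * `|P| <= l * X + l^-1 * wint.
  move=> l0; apply: (@le_trans _ _ (2 * \int[mu]_(s in `]t, +oo[) `|expR (- a * s) * F s|)).
    by rewrite ler_pM2l//; exact: le_normr_Rintegral.
  have i1n := integrable_norm i1.
  rewrite -(RintegralZl _ mt i1n).
  apply: (@le_trans _ _ (\int[mu]_(s in `]t, +oo[) (l * expR (- c * s) + l^-1 * (expR (- sg * s) * F s ^+ 2)))).
    apply: (le_Rint mt).
    - by have := integrableZl mt 2 i1n; apply: eq_integrable.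
    - by have := integrableD mt (integrableZl mt l i3) (integrableZl mt l^-1 i2); apply: eq_integrable.
    - by move=> s _; exact: wF_amgm.
  rewrite (RintegralD mt); last 2 first.
  - by have := integrableZl mt l i3; apply: eq_integrable.
  - by have := integrableZl mt l^-1 i2; apply: eq_integrable.
  rewrite (RintegralZl _ mt i3) (RintegralZl _ mt i2) (Rintegral_itv_obnd_cbnd i3) E3 -/X lerD2l.
  apply: ler_wpM2l; first by rewrite invr_ge0 ltW.
  rewrite /wint (Rint_split t0 iF) lerDr.
  by apply: Rintegral_ge0 => s _; exact: w0.
clearbody X P; rewrite -sqr_normr; have [->|P0] := eqVneq P 0.
  by rewrite normr0 expr0n mulr_ge0 ?wint_ge0// ltW.
have P0' : 0 < `|P| by rewrite normr_gt0.
(* The optimal [l]: it makes the first term equal to [|P|], which the left side absorbs. *)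
have := H (`|P| / X) (divr_gt0 P0' X0); rewrite invf_div.
have -> : `|P| / X * X = `|P| by apply: divfK; rewrite gt_eqF.
have -> : X / `|P| * wint = X * wint / `|P| by ring.
move=> h; have : `|P| <= X * wint / `|P| by lra.
by rewrite ler_pdivlMr.
Qed.

Variable e : R.
Hypothesis e0 : 0 < e.

(** This is [e^-1] times the integral over [s >= t] of [expR (a * (t - s)) * F s], the solution of
    [g' = a g - F / e] without the mode [expR (a * t)]. The tail is written as a difference of two
    integrals, which makes it a primitive at once. *)
Definition tailg (t : R) : R := e^-1 * (expR (a * t) *
  (\int[mu]_(s in `[(0 : R), +oo[) (expR (- a * s) * F s) - \int[mu]_(s in `[0, t]) (expR (- a * s) * F s))).

Lemma prim_tailg : prim tailg (fun t => a * tailg t - e^-1 * F t).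
Proof.
have p1 := primB (prim_cst (\int[mu]_(s in `[(0 : R), +oo[) (expR (- a * s) * F s)))
  (prim_int 0 (fun T => integrable_halfline_sub T wF_exp)).
have p2 := primZ e^-1 (prim_expM a p1).
apply: (eq_prim p2) => t t0 /=; first by rewrite /tailg add0r.
have E : expR (a * t) * expR (- a * t) = 1 by rewrite -expRD mulNr addrN expR0.
rewrite /tailg add0r sub0r -[in RHS](mul1r (F t)) -E; ring.
Qed.

Lemma tailg_sq t : 0 <= t -> tailg t ^+ 2 <= expR (sg * t) * wint / (e ^+ 2 * c).
Proof.
move=> t0; rewrite /tailg (Rint_split t0 wF_exp) addrC addKr.
have := wF_tail t0; set P := \int[mu]_(s in _) _ => HP.
rewrite !exprMn; have E : expR (sg * t) = expR (a * t) ^+ 2 * expR (- c * t).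
  by rewrite -expRM_natl -expRD; congr expR; ring.
have -> : expR (sg * t) * wint / (e ^+ 2 * c) = e^-1 ^+ 2 * (expR (a * t) ^+ 2 * (expR (- c * t) / c * wint)).
  by rewrite E; field; rewrite (gt_eqF e0) (gt_eqF c0).
by rewrite ler_wpM2l ?sqr_ge0// ler_wpM2l ?sqr_ge0.
Qed.

Lemma prim_sq_integrable y z (T : R) : prim y z -> mu.-integrable `[0, T] (EFin \o (fun t => y t ^+ 2)).
Proof.
have [T0|T0] := leP 0 T; last first.
  by move=> _; rewrite set_itv_ge ?bnd_simp -?ltNge//; exact: integrable_set0.
move=> /prim_sq yz; apply: continuous_compact_integrable; first exact: segment_compact.
exact: prim_continuous yz.
Qed.

(** Energy estimate with [g = tailg]: by Young's inequality [(g ^+ 2)' >= a g ^+ 2 - k F ^+ 2] with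
    [k = (a * e ^+ 2)^-1]. Since the equation is unstable forwards, it is the final value [g T] that
    must be controlled, and [tailg_sq] does so at the same order, whence the factor 2. *)
Lemma tailg_energy T : 0 <= T ->
  \int[mu]_(t in `[0, T]) (tailg t ^+ 2) <= 2 * (expR (sg * T) * wint) / (e * a) ^+ 2.
Proof.
move=> T0; have mT := mitv `[0, T].
have [ig Eg] := prim_sq prim_tailg.
have iT := prim_sq_integrable T prim_tailg.
have iF2 := wF_sq T.
have ca : a <= c by move: a_sg; lra.
pose k := (a * e ^+ 2)^-1.
have k0 : 0 < k by rewrite invr_gt0 mulr_gt0 ?exprn_gt0.
have i1 : mu.-integrable `[0, T] (EFin \o (fun t => a * tailg t ^+ 2)).
  by have := integrableZl mT a iT; apply: eq_integrable.
have i2 : mu.-integrable `[0, T] (EFin \o (fun t => k * F t ^+ 2)).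
  by have := integrableZl mT k iF2; apply: eq_integrable.
have i3 : mu.-integrable `[0, T] (EFin \o (fun t => a * tailg t ^+ 2 - k * F t ^+ 2)).
  by have := integrableB mT i1 i2; apply: eq_integrable.
have H : a * \int[mu]_(t in `[0, T]) (tailg t ^+ 2) - k * \int[mu]_(t in `[0, T]) (F t ^+ 2) <= tailg T ^+ 2.
  rewrite (Eg T T0) -(RintegralZl _ mT iT) -(RintegralZl _ mT iF2) -(RintegralB mT i1 i2).
  apply: ler_wpDl; first exact: sqr_ge0.
  apply: (le_Rint mT i3 (ig T)) => t _.
  have := sqr_ge0 (a * e * tailg t - F t); rewrite -(pmulr_rge0 _ k0).
  have -> : k * (a * e * tailg t - F t) ^+ 2 = 2 * ((a * tailg t - e^-1 * F t) * tailg t)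
     - (a * tailg t ^+ 2 - k * F t ^+ 2) by rewrite /k; field; rewrite !gt_eqF.
  by rewrite subr_ge0.
have H1 := tailg_sq T0; have H2 := wF_sq_le T0.
set W := expR (sg * T) * wint in H1 H2 *.
have W0 : 0 <= W by rewrite mulr_ge0 ?expR_ge0 ?wint_ge0.
have H3 : W / (e ^+ 2 * c) <= k * W.
  rewrite mulrC; apply: ler_wpM2r => //; rewrite /k lef_pV2 ?posrE.
  - by rewrite [a * _]mulrC; apply: ler_wpM2l => //; exact: sqr_ge0.
  - by rewrite mulr_gt0 ?exprn_gt0.
  - by rewrite mulr_gt0 ?exprn_gt0.
have H4 : k * \int[mu]_(t in `[0, T]) (F t ^+ 2) <= k * W by rewrite ler_pM2l.
rewrite -(ler_pM2l a0); apply: (@le_trans _ _ (2 * (k * W))); first exact: aux H H1 H3 H4.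
by rewrite /k le_eqVlt; apply/orP; left; apply/eqP; field; rewrite !gt_eqF.
Qed.

End weighted_data.

(** * Scalar linear equations: Duhamel's formula, growth and comparison *)

Section ode.
Context {R : realType}.
Local Notation mu := (@lebesgue_measure R).
Implicit Types (v y z g p q : R -> R).

Definition odesol (b h0 : R) g (t : R) : R :=
  expR (- b * t) * (h0 + \int[mu]_(s in `[0, t]) (expR (b * s) * g s)).

Lemma odesol0 b h0 g : odesol b h0 g 0 = h0.
Proof. by rewrite /odesol set_itv1 Rintegral_set1 addr0 mulr0 expR0 mul1r. Qed.

Lemma integrable_expM b g : (forall T, mu.-integrable `[0, T] (EFin \o g)) ->
  forall T, mu.-integrable `[0, T] (EFin \o (fun s => expR (b * s) * g s)).
Proof.
move=> ig T; have := integrable_mul_prim (prim_exp b) (ig T).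
by apply: eq_integrable => // s _ /=; rewrite mulrC.
Qed.

Lemma prim_odesol b h0 g : (forall T, mu.-integrable `[0, T] (EFin \o g)) ->
  prim (odesol b h0 g) (fun t => g t - b * odesol b h0 g t).
Proof.
move=> ig; have p := prim_expM (- b) (prim_int h0 (integrable_expM b ig)).
have E t : expR (b * t) * expR (- b * t) = 1 by rewrite -expRD mulNr addrN expR0.
by apply: (eq_prim p) => t t0 //=; rewrite /odesol -[in RHS](mul1r (g t)) -(E t); ring.
Qed.

Lemma integrable_sub_obnd g (T : R) : mu.-integrable `[0, T] (EFin \o g) ->
  mu.-integrable `]0, T] (EFin \o g).
Proof. by apply: integrableS; [exact: mitv|exact: mitv|apply: subset_itvr; rewrite bnd_simp]. Qed.

Lemma odesol_unique b g v w : (forall T, mu.-integrable `[0, T] (EFin \o g)) ->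
  prim v w -> {ae mu, forall t, 0 < t -> w t + b * v t = g t} ->
  forall t, 0 <= t -> v t = odesol b (v 0) g t.
Proof.
move=> ig vw wg t t0; have [iz E] := prim_expM b vw.
have := E t t0; rewrite mulr0 expR0 mul1r => Et.
rewrite /odesol; suff -> : \int[mu]_(s in `[0, t]) (expR (b * s) * g s) =
    \int[mu]_(s in `[0, t]) (expR (b * s) * (b * v s + w s)).
  by rewrite -Et mulrA -expRD mulNr addNr expR0 mul1r.
have ie := integrable_expM b ig t.
rewrite -(Rintegral_itv_obnd_cbnd (integrable_sub_obnd ie)) -(Rintegral_itv_obnd_cbnd (integrable_sub_obnd (iz t))).
rewrite /Rintegral; congr fine; apply: ae_eq_integral.
- exact: mitv.
- by have /measurable_int := integrable_sub_obnd ie.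
- by have /measurable_int := integrable_sub_obnd (iz t).
- apply: ae_muS wg => s Hs /=; rewrite in_itv/= => /andP[s0 _].
  by rewrite -(Hs s0) addrC.
Qed.

Lemma odesol_growth b h0 g (k c T : R) : 0 <= k -> - k <= b -> 1 + 2 * k <= c ->
  (forall T, mu.-integrable `[0, T] (EFin \o g)) ->
  (forall T, mu.-integrable `[0, T] (EFin \o (fun t => g t ^+ 2))) -> 0 <= T ->
  odesol b h0 g T ^+ 2 <= expR (c * T) * (h0 ^+ 2 + \int[mu]_(t in `[0, T]) (g t ^+ 2)).
Proof.
move=> k0 kb kc ig ig2 T0.
have p := prim_sq (prim_odesol b h0 ig).
have c0 : 0 <= c by lra.
have := gronwall p ig2 c0 T0; rewrite odesol0; apply => [t _|t _]; first exact: sqr_ge0.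
set y := odesol b h0 g t; set x := g t.
have h1 : 2 * ((x - b * y) * y) = 2 * x * y - 2 * b * y ^+ 2 by ring.
have h2 := sqr_ge0 (x - y); have h3 := sqr_ge0 y.
have h4 : 0 <= (c - 1 + 2 * b) * y ^+ 2 by apply: mulr_ge0 => //; lra.
have h5 : (x - y) ^+ 2 = x ^+ 2 - 2 * x * y + y ^+ 2 by ring.
rewrite h1; rewrite h5 in h2; have h6 : (c - 1 + 2 * b) * y ^+ 2 = c * y ^+ 2 - y ^+ 2 + 2 * b * y ^+ 2 by ring.
rewrite h6 in h4; lra.
Qed.

(** The damping absorbs the product term: [2 * (g - b * y) * y <= g ^+ 2 / (2 * b)]. The factor
    [b^-1] is what pays for a multiplication by [L] in [odesol_bound]. *)
Lemma odesol_damped b h0 g (T : R) : 0 < b ->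
  (forall T, mu.-integrable `[0, T] (EFin \o g)) ->
  (forall T, mu.-integrable `[0, T] (EFin \o (fun t => g t ^+ 2))) -> 0 <= T ->
  odesol b h0 g T ^+ 2 <= h0 ^+ 2 + (2 * b)^-1 * \int[mu]_(t in `[0, T]) (g t ^+ 2).
Proof.
move=> b0 ig ig2 T0.
have p := prim_sq (prim_odesol b h0 ig).
have ig2' T' : mu.-integrable `[0, T'] (EFin \o (fun t => (2 * b)^-1 * g t ^+ 2)).
  by have := integrableZl (mitv _) (2 * b)^-1 (ig2 T'); apply: eq_integrable.
have := gronwall p ig2' (lexx 0) T0; rewrite odesol0 mul0r expR0 mul1r.
rewrite (RintegralZl _ (mitv _) (ig2 T)); apply => [t _|t _].
  by rewrite mulr_ge0 ?sqr_ge0// invr_ge0 mulr_ge0// ltW.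
set y := odesol b h0 g t; set x := g t; rewrite mul0r add0r.
have h := sqr_ge0 (x - 2 * b * y).
have -> : (2 * b)^-1 * x ^+ 2 = 2 * ((x - b * y) * y) + (2 * b)^-1 * (x - 2 * b * y) ^+ 2.
  by field; rewrite gt_eqF.
by rewrite lerDl mulr_ge0// invr_ge0 mulr_ge0// ltW.
Qed.

(** [B * expR (k * t)] is a barrier for [v' + b v = b p] on both sides: with the integrating factor
    [expR (b * t)], the difference of [v] or [- v] with the barrier is nonincreasing. The condition
    [|b| <= b + k] is the derivative test, and it admits moderately negative [b]. *)
Lemma cmp_ode b v p (B k : R) : prim v (fun t => b * p t - b * v t) ->
  (forall t, 0 <= t -> `|p t| <= B * expR (k * t)) -> `|v 0| <= B -> `|b| <= b + k ->
  forall t, 0 <= t -> `|v t| <= B * expR (k * t).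
Proof.
move=> vp pB vB bk.
have H s : s = 1 \/ s = -1 -> forall t, 0 <= t -> s * v t <= B * expR (k * t).
  move=> s1 t t0; have pz := primB (primZ s (prim_expM b vp)) (primZ B (prim_exp (b + k))).
  have ss x : s * x <= `|x|.
    by case: s1 => ->; rewrite ?mul1r ?mulN1r ?ler_norm// -normrN ler_norm.
  have := prim_mono pz _ (_ : 0 <= 0 <= t); rewrite lexx t0 /= !mulr0 expR0 mul1r mulr1.
  have e0 : expR (b * t) > 0 by exact: expR_gt0.
  have -> : expR ((b + k) * t) = expR (b * t) * expR (k * t) by rewrite -expRD mulrDl.
  have s0 := ss (v 0).
  move=> K; have {}K : s * (expR (b * t) * v t) - B * (expR (b * t) * expR (k * t)) <= s * v 0 - B.
    apply: K => // r r0 /=; have -> : expR ((b + k) * r) = expR (b * r) * expR (k * r) by rewrite -expRD mulrDl.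
    have er : 0 < expR (b * r) by exact: expR_gt0.
    set er' := expR (b * r) in er *; set kr := expR (k * r).
    have -> : s * (er' * (b * v r + (b * p r - b * v r))) - B * ((b + k) * (er' * kr))
       = er' * (s * (b * p r) - (b + k) * (B * kr)) by ring.
    rewrite pmulr_rle0// subr_le0; apply: le_trans (ss _) _; rewrite normrM.
    apply: ler_pM => //; exact: pB.
  have : s * (expR (b * t) * v t) - B * (expR (b * t) * expR (k * t)) <= 0 by lra.
  have -> : s * (expR (b * t) * v t) - B * (expR (b * t) * expR (k * t)) =
    expR (b * t) * (s * v t - B * expR (k * t)) by ring.
  by rewrite pmulr_rle0// subr_le0.
move=> t t0; rewrite ler_norml lerNl; have := H 1 (or_introl erefl) t t0.
by have := H (-1) (or_intror erefl) t t0; rewrite mul1r mulN1r => -> ->.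
Qed.

(** The equation is unstable forwards, so it is integrated back from infinity. With the factor
    [expR (- a * t)], the signed value of [v] plus the barrier is nonincreasing and, because [v]
    grows more slowly than [expR (a * t)], its lower bounds at late times tend to 0; hence it is
    nonnegative. *)
Lemma backward_ode a v p (P B k : R) : prim v (fun t => a * v t - p t) -> 0 <= B ->
  (forall t, 0 <= t -> `|p t| <= P * expR (k * t)) -> k < a ->
  (forall t, 0 <= t -> `|v t| <= B * expR (k * t)) ->
  forall t, 0 <= t -> `|v t| <= P * expR (k * t) / (a - k).
Proof.
move=> vp B0 pP ka vB; set c := a - k; have c0 : 0 < c by rewrite /c; lra.
have H s : s = 1 \/ s = -1 -> forall t, 0 <= t -> - (s * v t) <= P * expR (k * t) / c.
  move=> s1 t t0; have pz := primD (primZ s (prim_expM (- a) vp)) (primZ (P / c) (prim_exp (- c))).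
  have ss x : - (s * x) <= `|x|.
    by case: s1 => ->; rewrite ?mul1r ?mulN1r ?opprK ?ler_norm// -normrN ler_norm.
  have E r : expR (- c * r) = expR (- a * r) * expR (k * r).
    by rewrite -expRD /c; congr expR; ring.
  have et : 0 < expR (- a * t) by exact: expR_gt0.
  rewrite -subr_ge0 -(pmulr_rge0 _ et).
  have -> : expR (- a * t) * (P * expR (k * t) / c - - (s * v t)) =
     s * (expR (- a * t) * v t) + P / c * expR (- c * t) by rewrite E; ring.
  apply/ler_addgt0Pl => d d0; rewrite -lerBlDl sub0r.
  have [T tT HT] : exists2 T, t <= T & B * expR (- c * T) <= d.
    have : B * expR (- c * T) @[T --> +oo] --> B * (0 : R) by apply: cvgM; [exact: cvg_cst|exact: cvg_expR_decay].
    move=> /cvgrPdist_le /(_ d d0) [M [Mr HM]]; exists (Num.max t (M + 1)).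
      by rewrite le_max lexx.
    have := HM (Num.max t (M + 1)); rewrite mulr0 sub0r normrN => HM'.
    by apply: le_trans (ler_norm _) (HM' _); rewrite lt_max ltrDl ltr01 orbT.
  have T0 := le_trans t0 tT.
  have M : s * (expR (- a * T) * v T) + P / c * expR (- c * T) <= s * (expR (- a * t) * v t) + P / c * expR (- c * t).
    apply: (prim_mono pz) => [r r0|]; last by rewrite t0.
    rewrite /= E; have er : 0 < expR (- a * r) by exact: expR_gt0.
    have -> : s * (expR (- a * r) * (- a * v r + (a * v r - p r))) + P / c * (- c * (expR (- a * r) * expR (k * r)))
      = expR (- a * r) * (- (s * p r) - P * expR (k * r)) by field; rewrite gt_eqF.
    by rewrite pmulr_rle0// subr_le0; apply: le_trans (ss _) (pP _ r0).
  apply: le_trans M; rewrite -(lerD2r (- (P / c * expR (- c * T)))) addrK.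
  apply: (@le_trans _ _ (- (B * expR (- c * T)))).
    have P0 : 0 <= P.
      by have := pP 0 (lexx 0); rewrite mulr0 expR0 mulr1; apply: le_trans.
    have h1 : 0 <= P / c * expR (- c * T) by rewrite mulr_ge0 ?expR_ge0// divr_ge0// ltW.
    move: HT h1; lra.
  rewrite lerNl; have := ss (expR (- a * T) * v T); move/le_trans; apply.
  rewrite normrM ger0_norm ?expR_ge0// E mulrCA ler_wpM2l ?expR_ge0//.
  exact: vB.
move=> t t0; rewrite ler_norml lerNl; have := H 1 (or_introl erefl) t t0.
by have := H (-1) (or_intror erefl) t t0; rewrite mul1r mulN1r opprK => -> ->.
Qed.

End ode.

(** * The problem at a fixed frequency *)

Section frequency.
Context {R : realType}.
Local Notation mu := (@lebesgue_measure R).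
Implicit Types (g F : R -> R).

(** [root_a] and [- root_b] are the exponents of the Euler-Lagrange equation
    [- e v'' + v' + L v = F]. As [e] tends to 0, [root_b] tends to [L] while
    [root_a = root_b + 1 / e] blows up. *)
Definition root_a (e L : R) : R := (1 + Num.sqrt (1 + 4 * e * L)) / (2 * e).
Definition root_b (e L : R) : R := (Num.sqrt (1 + 4 * e * L) - 1) / (2 * e).

Definition wdata (sg : R) F := measurable_fun [set: R] F /\
  mu.-integrable `[(0 : R), +oo[ (EFin \o (fun s => expR (- sg * s) * F s ^+ 2)).

Lemma sqr_le_expR (x X c t : R) : 0 <= X -> x ^+ 2 <= X * expR (c * t) ->
  `|x| <= Num.sqrt X * expR (c / 2 * t).
Proof.
move=> X0 H; rewrite -(@ler_pXn2r _ 2) ?nnegrE ?mulr_ge0 ?sqrtr_ge0 ?expR_ge0//.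
rewrite sqr_normr exprMn sqr_sqrtr// -expRM_natl.
by rewrite (_ : 2%:R * (c / 2 * t) = c * t) //; field.
Qed.

Lemma prim_integrable (y z : R -> R) (T : R) : prim y z -> mu.-integrable `[0, T] (EFin \o y).
Proof.
have [T0|T0] := leP 0 T; last first.
  by move=> _; rewrite set_itv_ge ?bnd_simp -?ltNge//; exact: integrable_set0.
move=> yz; apply: continuous_compact_integrable; first exact: segment_compact.
exact: prim_continuous yz.
Qed.

Variables (K sg : R).
Hypothesis K0 : K <= 0.
Hypothesis sg0 : 0 <= sg.

(** Growth exponent of squares, uniform in [e] and in the frequency. The term [sg] is the growth of
    the data; [- 8 * K] ensures [- 4 * K <= rate / 2], as [cmp_ode] requires with [b >= 2 * K], and
    [- 1 / 16 <= e * K] when [2 * e * rate <= 1]. *)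
Definition rate : R := 1 - 8 * K + sg.
(** The contribution of one frequency to the squared norms of the data: the datum in V and the
    forcing in weighted L2. Every estimate is linear in it, and it is integrable over the
    frequencies. *)
Definition size2 (L h0 : R) F : R := (1 + `|L|) * h0 ^+ 2 + wint sg F.
Definition cstU : R := 10 * (1 - K).
Definition cstZ : R := 4 + 6 * cstU.

Lemma cstU_ge0 : 0 <= cstU. Proof. by rewrite /cstU; move: K0; lra. Qed.

Lemma cstZ_ge0 : 0 <= cstZ. Proof. by rewrite /cstZ; have := cstU_ge0; lra. Qed.

Lemma size2_ge0 L h0 F : 0 <= size2 L h0 F.
Proof. by rewrite addr_ge0 ?wint_ge0// mulr_ge0 ?sqr_ge0// addr_ge0. Qed.

Lemma rate_ge1 : 1 <= rate. Proof. by rewrite /rate; move: K0 sg0; lra. Qed.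

Lemma root_props e L : 0 < e -> 2 * e * rate <= 1 -> K <= L ->
  [/\ e * root_a e L = 1 + e * root_b e L, e * root_b e L ^+ 2 + root_b e L = L,
      1 / 2 <= e * root_a e L, 2 * K <= root_b e L & `|root_b e L| <= 2 * `|L|] /\
      (0 < L -> 0 < root_b e L).
Proof.
move=> e0 er KL; rewrite /root_a /root_b; set D := Num.sqrt _.
(* Hence [1 + 4 * e * L >= 3 / 4], so that the roots are real and the square root [D] is at least
   [1 / 2]. *)
have eK : - (1 / 16) <= e * K.
  have := mulr_ge0 (ltW e0) sg0; move: er; rewrite /rate => er h.
  have h' : 2 * e * (1 - 8 * K + sg) = 2 * e - 16 * (e * K) + 2 * (e * sg) by ring.
  rewrite h' in er; lra.
have eKL : e * K <= e * L by rewrite ler_pM2l.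
have D2 : D ^+ 2 = 1 + 4 * e * L by rewrite sqr_sqrtr// -mulrA; lra.
have D0 : 0 <= D by exact: sqrtr_ge0.
have D12 : 1 / 2 <= D.
  rewrite -(@ler_pXn2r _ 2) ?nnegrE//.
  by rewrite D2 -mulrA expr_div_n; lra.
have e20 : 0 < 2 * e by rewrite mulr_gt0.
set b := (D - 1) / (2 * e).
have Eb : b * (1 + D) = 2 * L.
  have -> : b * (1 + D) = (D ^+ 2 - 1) / (2 * e) by rewrite /b; ring.
  by rewrite D2; field; rewrite gt_eqF.
have bL : `|b| <= 2 * `|L|.
  have D10 : 0 <= 1 + D by lra.
  have := congr1 (fun x => `|x|) Eb; rewrite /= !normrM (ger0_norm D10) (ger0_norm (ler0n R 2)) => <-.
  by rewrite ler_peMr//; lra.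
have pL : 0 < L -> 0 < b.
  move=> L0; have : 0 < b * (1 + D) by rewrite Eb mulr_gt0.
  by rewrite pmulr_lgt0//; lra.
split; last exact: pL.
split; last exact: bL.
- by rewrite /b; field; rewrite gt_eqF.
- have -> : e * b ^+ 2 + b = (D ^+ 2 - 1) / (4 * e) by rewrite /b; field; rewrite gt_eqF.
  by rewrite D2; field; rewrite gt_eqF.
- have -> : e * ((1 + D) / (2 * e)) = (1 + D) / 2 by field; rewrite gt_eqF.
  lra.
- have [L0|L0] := ltP 0 L; first by have := pL L0; move: K0; lra.
  move: bL; rewrite (ler0_norm L0) ler_norml => /andP[+ _]; lra.
Qed.

(** One bound for [Uf], where [g] is the tail solution, and for the limit [U0f], where [b = L] and
    [g = F]. The factor [|L|] has two sources of control: for [L > 0] the damping, in the form of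
    the bound on [L] times the integral of [g ^+ 2] by [b]; for [L <= 0] the lower bound, since then
    [|L| <= - K]. *)
Lemma odesol_bound b L h0 F g : K <= L -> 2 * K <= b -> wdata sg F ->
  (forall T, mu.-integrable `[0, T] (EFin \o g)) ->
  (forall T, mu.-integrable `[0, T] (EFin \o (fun t => g t ^+ 2))) ->
  (forall T, 0 <= T -> \int[mu]_(t in `[0, T]) (g t ^+ 2) <= 8 * (expR (sg * T) * wint sg F)) ->
  (0 < L -> 0 < b /\ forall T, 0 <= T ->
     L * \int[mu]_(t in `[0, T]) (g t ^+ 2) <= 4 * b * (expR (sg * T) * wint sg F)) ->
  forall t, 0 <= t -> (1 + `|L|) * odesol b h0 g t ^+ 2 <= cstU * size2 L h0 F * expR (rate * t).
Proof.
move=> KL Kb wF ig ig2 G1 G2 t t0.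
have H1 := @odesol_growth R b h0 g (- 2 * K) (1 - 4 * K) t _ _ _ ig ig2 t0.
have {}H1 : odesol b h0 g t ^+ 2 <= expR ((1 - 4 * K) * t) * (h0 ^+ 2 + \int[mu]_(t in `[0, t]) (g t ^+ 2)).
  by apply: H1; move: K0 Kb; lra.
have A0 := wint_ge0 sg F; have G1t := G1 t t0.
rewrite /size2; set A := wint sg F in A0 G1t G1 G2 *; set Y := odesol _ _ _ _ in H1 *.
set e1 := expR ((1 - 4 * K) * t) in H1; set es := expR (sg * t) in G1t G2.
set I := \int[mu]_(t in `[0, t]) (g t ^+ 2) in H1 G1t.
set ec := expR (rate * t).
have e1s : e1 * es <= ec by rewrite -expRD ler_expR -mulrDl ler_wpM2r// /rate; move: K0 sg0; lra.
have e1c : e1 <= ec by rewrite ler_expR ler_wpM2r// /rate; move: K0 sg0; lra.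
have esc : es <= ec by rewrite ler_expR ler_wpM2r// /rate; move: K0 sg0; lra.
have ec1 : 1 <= ec by rewrite -expR0 ler_expR mulr_ge0// (le_trans ler01 rate_ge1).
have e10 : 0 <= e1 by exact: expR_ge0.
have h20 := sqr_ge0 h0.
have Y1 : Y ^+ 2 <= 8 * (h0 ^+ 2 + A) * ec.
  apply: (le_trans H1); apply: (@le_trans _ _ (e1 * h0 ^+ 2 + 8 * (e1 * es) * A)).
    have -> : e1 * h0 ^+ 2 + 8 * (e1 * es) * A = e1 * (h0 ^+ 2 + 8 * (es * A)) by ring.
    by rewrite ler_wpM2l// lerD2l.
  have := ler_wpM2r h20 e1c; have := ler_wpM2r A0 e1s.
  have : 0 <= ec * h0 ^+ 2 by rewrite mulr_ge0// (le_trans ler01 ec1).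
  have -> : 8 * (h0 ^+ 2 + A) * ec = 8 * (ec * h0 ^+ 2) + 8 * (ec * A) by ring.
  have -> : 8 * (e1 * es) * A = 8 * (e1 * es * A) by ring.
  move: (ec * h0 ^+ 2) (ec * A) (e1 * es * A) (e1 * h0 ^+ 2) => a1 a2 a3 a4; lra.
have ec0 := le_trans ler01 ec1.
have L0 := normr_ge0 L.
have Lh : 0 <= `|L| * h0 ^+ 2 by rewrite mulr_ge0.
have Q0 : 0 <= (h0 ^+ 2 + A) * ec by rewrite mulr_ge0// addr_ge0.
have LY : `|L| * Y ^+ 2 <= (10 * - K * (h0 ^+ 2 + A) + 2 * A + `|L| * h0 ^+ 2) * ec.
  have [Lp|Ln] := ltP 0 L.
    have [b0 /(_ t t0) G3] := G2 Lp.
    have := odesol_damped h0 b0 ig ig2 t0; rewrite -/Y -/I => H2.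
    rewrite (gtr0_norm Lp) in Lh *; apply: (le_trans (ler_wpM2l (ltW Lp) H2)).
    have h : (2 * b)^-1 * (L * I) <= 2 * (es * A).
      rewrite ler_pdivrMl ?mulr_gt0//.
      by have -> : 2 * b * (2 * (es * A)) = 4 * b * (es * A) by ring.
    have h2 : es * A <= ec * A by rewrite ler_wpM2r.
    have h3 : L * h0 ^+ 2 <= ec * (L * h0 ^+ 2) by rewrite ler_peMl.
    have h4 : 0 <= - K * ((h0 ^+ 2 + A) * ec) by rewrite mulr_ge0// oppr_ge0.
    have -> : L * (h0 ^+ 2 + (2 * b)^-1 * I) = L * h0 ^+ 2 + (2 * b)^-1 * (L * I) by ring.
    have -> : (10 * - K * (h0 ^+ 2 + A) + 2 * A + L * h0 ^+ 2) * ec =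
      10 * (- K * ((h0 ^+ 2 + A) * ec)) + 2 * (ec * A) + ec * (L * h0 ^+ 2) by ring.
    move: h h2 h3 h4; clear; lra.
  have LK : `|L| <= - K by rewrite ler0_norm// lerN2.
  have h1 : `|L| * Y ^+ 2 <= - K * (8 * (h0 ^+ 2 + A) * ec) by apply: ler_pM => //; exact: sqr_ge0.
  apply: (le_trans h1).
  have h2 : 0 <= - K * ((h0 ^+ 2 + A) * ec) by rewrite mulr_ge0// oppr_ge0.
  have h3 : 0 <= ec * A by rewrite mulr_ge0.
  have h4 : 0 <= ec * (`|L| * h0 ^+ 2) by rewrite mulr_ge0.
  have -> : - K * (8 * (h0 ^+ 2 + A) * ec) = 8 * (- K * ((h0 ^+ 2 + A) * ec)) by ring.
  have -> : (10 * - K * (h0 ^+ 2 + A) + 2 * A + `|L| * h0 ^+ 2) * ec =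
      10 * (- K * ((h0 ^+ 2 + A) * ec)) + 2 * (ec * A) + ec * (`|L| * h0 ^+ 2) by ring.
  move: h2 h3 h4; clear; lra.
rewrite mulrDl mul1r; apply: (le_trans (lerD Y1 LY)); rewrite -subr_ge0 /cstU.
have -> : 10 * (1 - K) * ((1 + `|L|) * h0 ^+ 2 + A) * ec -
   (8 * (h0 ^+ 2 + A) * ec + (10 * - K * (h0 ^+ 2 + A) + 2 * A + `|L| * h0 ^+ 2) * ec) =
   ec * (2 * h0 ^+ 2 + (9 - 10 * K) * (`|L| * h0 ^+ 2)) by ring.
by rewrite mulr_ge0// addr_ge0// mulr_ge0//; move: K0; lra.
Qed.

Section one_eps.
Variables (e L h0 : R) (F : R -> R).
Hypothesis e0 : 0 < e.
Hypothesis er : 2 * e * rate <= 1.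
Hypothesis KL : K <= L.
Hypothesis wF : wdata sg F.

Definition gf := tailg F (root_a e L) e.
Definition Uf := odesol (root_b e L) h0 gf.
(** The derivative of [Uf] read off from its equation. In this form it is a combination of
    primitives and can be differentiated once more in the comparison arguments. *)
Definition Zf t := gf t - root_b e L * Uf t.

Lemma root_a_ge : (2 * e)^-1 <= root_a e L.
Proof.
have [[_ _ h _ _] _] := root_props e0 er KL.
rewrite -(ler_pM2l e0); have -> : e * (2 * e)^-1 = 1 / 2 by field; rewrite gt_eqF.
exact: h.
Qed.

Lemma root_a_gt0 : 0 < root_a e L.
Proof. by apply: lt_le_trans root_a_ge; rewrite invr_gt0 mulr_gt0. Qed.

Lemma rate_le_a : rate <= root_a e L.
Proof.
apply: le_trans root_a_ge; rewrite -[leRHS]mul1r ler_pdivlMr ?mulr_gt0//.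
by rewrite mulrC.
Qed.

Lemma sg_le_a : sg <= root_a e L.
Proof. by apply: le_trans rate_le_a; rewrite /rate; move: K0; lra. Qed.

Lemma prim_gf : prim gf (fun t => root_a e L * gf t - e^-1 * F t).
Proof. by case: wF => mF iF; apply: (prim_tailg mF iF sg_le_a root_a_gt0). Qed.

Lemma gf_sq_int T : mu.-integrable `[0, T] (EFin \o (fun t => gf t ^+ 2)).
Proof. exact: prim_sq_integrable prim_gf. Qed.

Lemma gf_int T : mu.-integrable `[0, T] (EFin \o gf).
Proof.
exact: prim_integrable prim_gf.
Qed.

Lemma prim_Uf : prim Uf Zf. Proof. exact: prim_odesol gf_int. Qed.

Lemma Uf0 : Uf 0 = h0. Proof. exact: odesol0. Qed.

Lemma gf_bound t : 0 <= t -> gf t ^+ 2 <= 2 / e * size2 L h0 F * expR (rate * t).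
Proof.
move=> t0; have [[_ _ ha _ _] _] := root_props e0 er KL; case: (wF) => mF iF.
apply: (le_trans (tailg_sq mF iF sg_le_a root_a_gt0 e0 t0)).
have W0 := wint_ge0 sg F.
have c1 : e / 2 <= e ^+ 2 * (2 * root_a e L - sg).
  have h : 1 / 2 <= e * (2 * root_a e L - sg).
    have := ler_wpM2l (ltW e0) sg_le_a; move: ha; have -> : e * (2 * root_a e L - sg) = 2 * (e * root_a e L) - e * sg by ring.
    lra.
  rewrite expr2 -mulrA ler_pM2l//; move: h; lra.
have c0 : 0 < e / 2 by rewrite divr_gt0.
have h1 : (e ^+ 2 * (2 * root_a e L - sg))^-1 <= 2 / e.
  by rewrite -invf_div lef_pV2 ?posrE// (lt_le_trans c0 c1).
have h2 : expR (sg * t) <= expR (rate * t).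
  by rewrite ler_expR ler_wpM2r// /rate; move: K0; lra.
have h3 : wint sg F <= size2 L h0 F.
  by rewrite lerDr mulr_ge0 ?sqr_ge0// addr_ge0.
rewrite mulrC -mulrA [_ * expR _]mulrC.
apply: ler_pM => //.
- by rewrite invr_ge0 (le_trans (ltW c0) c1).
- by rewrite mulr_ge0// expR_ge0.
- by apply: ler_pM => //; exact: expR_ge0.
Qed.

Lemma Uf_bound t : 0 <= t -> (1 + `|L|) * Uf t ^+ 2 <= cstU * size2 L h0 F * expR (rate * t).
Proof.
have [[ea eb ha hb hL] hp] := root_props e0 er KL.
have a0 := root_a_gt0; case: (wF) => mF iF; have W0 := wint_ge0 sg F.
have G T : 0 <= T -> (e * root_a e L) ^+ 2 * \int[mu]_(t in `[0, T]) (gf t ^+ 2) <= 2 * (expR (sg * T) * wint sg F).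
  move=> T0; have := tailg_energy sg0 mF iF sg_le_a root_a_gt0 e0 T0.
  have P : 0 < (e * root_a e L) ^+ 2 by apply: exprn_gt0; exact: (mulr_gt0 e0 a0).
  by rewrite (ler_pdivlMr _ _ P) => h; rewrite mulrC.
have I0 T : 0 <= \int[mu]_(t in `[0, T]) (gf t ^+ 2) by apply: Rintegral_ge0 => s _; exact: sqr_ge0.
apply: odesol_bound => //.
- exact: gf_int.
- exact: gf_sq_int.
- move=> T T0; have := G T T0; set I := \int[mu]_(t in _) _; set W := _ * wint _ _ => GT.
  have h : 1 / 4 <= (e * root_a e L) ^+ 2.
    by have := ler_pM _ _ ha ha; rewrite -expr2 => /(_ ltac:(lra) ltac:(lra)); lra.
  have := ler_wpM2r (I0 T) h; rewrite -/I; move: GT; set z := _ ^+ 2 * I; lra.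
- move=> L0; split; first exact: hp.
  move=> T T0; have := G T T0; set I := \int[mu]_(t in _) _; set W := _ * wint _ _ => GT.
  have b0 := hp L0.
  have EL : L = root_b e L * (e * root_a e L) by rewrite ea -[LHS]eb; ring.
  have h : 1 / 2 * (e * root_a e L * I) <= 2 * W.
    apply: le_trans GT; rewrite expr2 -[leRHS]mulrA; apply: ler_wpM2r => //.
    by apply: mulr_ge0; [exact: ltW (mulr_gt0 e0 a0)|exact: I0].
  rewrite [X in X * I]EL; set b := root_b e L; set a := root_a e L.
  have -> : b * (e * a) * I = b * (e * a * I) by ring.
  have -> : 4 * b * W = b * (4 * W) by ring.
  by rewrite ler_pM2l//; move: h; rewrite -/a; lra.
Qed.

(** The estimate of the derivative carries the factor [e]: [gf ^+ 2] is of order [1 / e], and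
    [e * b ^+ 2 = L - b] is at most [3 * |L|], which the weighted bound on [Uf] absorbs. This is the
    origin of the powers of [sqrt e]. *)
Lemma Zf_bound t : 0 <= t -> e * Zf t ^+ 2 <= cstZ * size2 L h0 F * expR (rate * t).
Proof.
move=> t0; have [[ea eb ha hb hL] hp] := root_props e0 er KL.
have U := Uf_bound t0; have G := gf_bound t0.
have h1 : e * gf t ^+ 2 <= 2 * (size2 L h0 F * expR (rate * t)).
  have := ler_wpM2l (ltW e0) G.
  by rewrite (_ : e * (2 / e * size2 L h0 F * expR (rate * t)) = 2 * (size2 L h0 F * expR (rate * t))) //; field; rewrite gt_eqF.
have h2 : e * root_b e L ^+ 2 <= 3 * `|L|.
  have : e * root_b e L ^+ 2 = L - root_b e L by rewrite -[in X in _ = X - _]eb addrK.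
  move: hL (ler_norm L) (ler_norm (- root_b e L)); rewrite normrN; lra.
have U2 : 0 <= Uf t ^+ 2 by exact: sqr_ge0.
have h3 : e * (root_b e L * Uf t) ^+ 2 <= 3 * (cstU * size2 L h0 F * expR (rate * t)).
  have -> : e * (root_b e L * Uf t) ^+ 2 = e * root_b e L ^+ 2 * Uf t ^+ 2 by ring.
  apply: (le_trans (ler_wpM2r U2 h2)).
  have -> : 3 * `|L| * Uf t ^+ 2 = 3 * (`|L| * Uf t ^+ 2) by ring.
  rewrite ler_pM2l//.
  by apply: le_trans U; rewrite mulrDl lerDr mul1r.
have h4 : Zf t ^+ 2 <= 2 * gf t ^+ 2 + 2 * (root_b e L * Uf t) ^+ 2.
  rewrite /Zf; have := sqr_ge0 (gf t + root_b e L * Uf t); rewrite sqrrD sqrrB.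
  set x := gf t; set y := _ * Uf t; lra.
have := ler_wpM2l (ltW e0) h4; rewrite /cstZ.
have -> : (4 + 6 * cstU) * size2 L h0 F * expR (rate * t) =
  4 * (size2 L h0 F * expR (rate * t)) + 6 * (cstU * size2 L h0 F * expR (rate * t)) by ring.
rewrite mulrDr; move: h1 h3.
set x := size2 L h0 F * _; set y := cstU * _ * _; set u := gf t ^+ 2; set v := (_ * Uf t) ^+ 2.
move=> h1 h3; have -> : e * (2 * u) = 2 * (e * u) by ring.
have -> : e * (2 * v) = 2 * (e * v) by ring.
lra.
Qed.

End one_eps.

Definition U0f (L h0 : R) F := odesol L h0 F.

Lemma U0f_bound L h0 F t : K <= L -> wdata sg F -> 0 <= t ->
  (1 + `|L|) * U0f L h0 F t ^+ 2 <= cstU * size2 L h0 F * expR (rate * t).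
Proof.
move=> KL [mF iF]; have W0 := wint_ge0 sg F.
have E0 T : 0 <= expR (sg * T) * wint sg F by rewrite mulr_ge0 ?expR_ge0.
apply: odesol_bound => //.
- by move: K0; lra.
- by move=> T; exact: (wF_integrable sg0 mF iF).
- by move=> T; exact: (wF_sq sg0 mF iF).
- by move=> T T0; have := wF_sq_le sg0 mF iF T0; have := E0 T; lra.
- move=> L0; split=> // T T0; rewrite [4 * L]mulrC -mulrA ler_pM2l//.
  by have := wF_sq_le sg0 mF iF T0; have := E0 T; lra.
Qed.

Definition amp (L h0 : R) F : R := Num.sqrt (cstZ * size2 L h0 F).

Lemma Zf_abs e L h0 F t : 0 < e -> 2 * e * rate <= 1 -> K <= L -> wdata sg F -> 0 <= t ->
  `|Zf e L h0 F t| <= amp L h0 F / Num.sqrt e * expR (rate / 2 * t).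
Proof.
move=> e0 er KL wF t0; have s0 : 0 < Num.sqrt e by rewrite sqrtr_gt0.
rewrite mulrAC ler_pdivlMr//.
have -> : `|Zf e L h0 F t| * Num.sqrt e = `|Num.sqrt e * Zf e L h0 F t|.
  by rewrite normrM (gtr0_norm s0) mulrC.
apply: sqr_le_expR; first by rewrite mulr_ge0 ?size2_ge0 ?cstZ_ge0.
by rewrite exprMn sqr_sqrtr ?(ltW e0)//; exact: Zf_bound.
Qed.

End frequency.

(** * Distance to the limit, and Lipschitz dependence on the square root of the parameter *)

Section frequency_limits.
Context {R : realType}.
Local Notation mu := (@lebesgue_measure R).
Implicit Types (F : R -> R).
Variables (K sg : R).
Hypothesis K0 : K <= 0.
Hypothesis sg0 : 0 <= sg.
Local Notation rate := (rate K sg).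
Local Notation amp := (amp K sg).

Lemma amp_ge0 L h0 F : 0 <= amp L h0 F. Proof. exact: sqrtr_ge0. Qed.

(* [v := U0f - Uf + e Zf] solves [v' + L v = L (e Zf)]. *)
Lemma Uf_cvg_rate e L h0 F t : 0 < e -> 2 * e * rate <= 1 -> K <= L -> wdata sg F -> 0 <= t ->
  `|U0f L h0 F t - Uf e L h0 F t| <= 2 * (amp L h0 F * Num.sqrt e * expR (rate / 2 * t)).
Proof.
move=> e0 er KL wF t0; have [[ea eb ha hb hL] _] := root_props K0 sg0 e0 er KL.
have s0 : 0 < Num.sqrt e by rewrite sqrtr_gt0.
have se : e / Num.sqrt e = Num.sqrt e.
  by rewrite -[X in X / _](sqr_sqrtr (ltW e0)) expr2 mulfK// gt_eqF.
case: (wF) => mF iF.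
have p0 : prim (U0f L h0 F) (fun t => F t - L * U0f L h0 F t) by exact: prim_odesol (wF_integrable sg0 mF iF).
have p1 := prim_Uf K0 sg0 h0 e0 er KL wF; have pg := prim_gf K0 sg0 e0 er KL wF.
have pz := primB pg (primZ (root_b e L) p1).
set Z := Zf e L h0 F in p1 pz *.
have pv := primD (primB p0 p1) (primZ e pz).
have {}pv : prim (fun s => U0f L h0 F s - Uf e L h0 F s + e * Z s)
    (fun s => L * (e * Z s) - L * (U0f L h0 F s - Uf e L h0 F s + e * Z s)).
  apply: (eq_prim pv) => s s0' //=.
  have -> : e * (root_a e L * gf e L F s - e^-1 * F s - root_b e L * Z s) =
     e * root_a e L * gf e L F s - F s - e * root_b e L * Z s by field; rewrite gt_eqF.
  rewrite ea /Z /Zf -[X in X * U0f _ _ _ _]eb -[X in _ = X * _ - _]eb -[X in _ = _ - X * _]eb; ring.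
have ZB s : 0 <= s -> `|e * Z s| <= amp L h0 F * Num.sqrt e * expR (rate / 2 * s).
  move=> s0'; rewrite normrM (gtr0_norm e0); have := ler_wpM2l (ltW e0) (Zf_abs K0 sg0 h0 e0 er KL wF s0').
  by rewrite -/Z -[X in _ -> _ <= _ * X * _]se; have -> : e * (amp L h0 F / Num.sqrt e * expR (rate / 2 * s)) =
     amp L h0 F * (e / Num.sqrt e) * expR (rate / 2 * s) by ring.
have V := cmp_ode pv ZB _ _ t0.
have {}V : `|U0f L h0 F t - Uf e L h0 F t + e * Z t| <= amp L h0 F * Num.sqrt e * expR (rate / 2 * t).
  apply: V.
    rewrite /U0f odesol0 Uf0 subrr add0r; have := ZB 0 (lexx 0).
    by rewrite mulr0 expR0 mulr1.
  (* For [L < 0] the condition [|L| <= L + rate / 2] of [cmp_ode] reads [- 2 * L <= rate / 2], and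
     [L >= K]. *)
  have rK : - 2 * K <= rate / 2 by rewrite /rate; move: K0 sg0; lra.
  have [L0|L0] := leP 0 L; first by rewrite ger0_norm// lerDl; move: K0 rK; lra.
  by rewrite ltr0_norm//; move: KL rK; lra.
have := ZB t t0; rewrite -[`|e * Z t|]normrN => Zt.
have -> : U0f L h0 F t - Uf e L h0 F t = (U0f L h0 F t - Uf e L h0 F t + e * Z t) + - (e * Z t) by ring.
by apply: (le_trans (ler_normD _ _)); move: V Zt; lra.
Qed.

(* [R := (1 + k) Zf_e + b_d Uf_e - g_d], [k = (e - d) / d], solves
   [R' = a_d R - k a_d Zf_e] with slow growth, hence is small, and
   [w := Uf_d - Uf_e] satisfies [w' + b_d w = k Zf_e - R]. *)
Lemma Uf_lip d e L h0 F t : 0 < d -> d <= e -> 2 * e * rate <= 1 -> K <= L -> wdata sg F -> 0 <= t ->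
  `|Uf d L h0 F t - Uf e L h0 F t| <=
    16 * ((Num.sqrt e - Num.sqrt d) * (amp L h0 F * expR (rate / 2 * t))).
Proof.
move=> d0 de er KL wF t0; have e0 := lt_le_trans d0 de.
have r1 := rate_ge1 K0 sg0.
have dr : 2 * d * rate <= 1.
  by apply: le_trans er; rewrite ler_wpM2r ?ler_wpM2l//; apply: le_trans r1.
have [[ea eb _ _ _] _] := root_props K0 sg0 e0 er KL.
have [[da db ha hb hL] hp] := root_props K0 sg0 d0 dr KL.
have a0 := root_a_gt0 K0 sg0 d0 dr KL.
set a := root_a d L in da ha a0 *; set b := root_b d L in da db hb hL hp *.
have p1 := prim_Uf K0 sg0 h0 e0 er KL wF; have pe := prim_gf K0 sg0 e0 er KL wF.
have pd := prim_Uf K0 sg0 h0 d0 dr KL wF; have pg := prim_gf K0 sg0 d0 dr KL wF.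
rewrite -/a in pg.
set U := Uf e L h0 F in p1 *; set V := Uf d L h0 F in pd *.
have pz := primB pe (primZ (root_b e L) p1).
set Z := Zf e L h0 F in p1 pz *.
pose k := (e - d) / d; pose S s := (1 + k) * Z s + b * U s - gf d L F s.
have k0 : 0 <= k by rewrite divr_ge0 ?subr_ge0// ltW.
have k1 : 1 + k = e / d by rewrite /k; field; rewrite gt_eqF.
have ab : a = b + d^-1.
  apply: (mulfI (lt0r_neq0 d0)); rewrite da mulrDr mulfV ?gt_eqF//; ring.
have pS : prim S (fun s => a * S s - k * a * Z s).
  apply: (eq_prim (primB (primD (primZ (1 + k) pz) (primZ b p1)) pg)) => s s0 //=.
  have EZ : e * (root_a e L * gf e L F s - e^-1 * F s - root_b e L * Z s) = Z s + L * U s - F s.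
    have -> : e * (root_a e L * gf e L F s - e^-1 * F s - root_b e L * Z s) =
      e * root_a e L * gf e L F s - F s - e * root_b e L * Z s by field; rewrite gt_eqF.
    by rewrite ea /Z /Zf -/U -[X in _ = _ + X * _ - _]eb; ring.
  have -> : (1 + k) * (root_a e L * gf e L F s - e^-1 * F s - root_b e L * Z s) = d^-1 * (Z s + L * U s - F s).
    by rewrite -EZ k1; ring.
  have abL : a * b = d^-1 * L by rewrite ab -db; field; rewrite gt_eqF.
  rewrite /S; have -> : a * ((1 + k) * Z s + b * U s - gf d L F s) - k * a * Z s =
     a * Z s + a * b * U s - a * gf d L F s by ring.
  have -> : a * Z s = b * Z s + d^-1 * Z s by rewrite [X in X * _ = _]ab mulrDl.
  by rewrite abL; ring.
set A := amp L h0 F; pose kp := rate / 2.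
have A0 : 0 <= A by exact: amp_ge0.
have ZB s : 0 <= s -> `|Z s| <= A / Num.sqrt e * expR (kp * s) by exact: Zf_abs.
(* Any bound of this growth will do, even one that degenerates with [d]: its purpose is to exclude
   the mode [expR (a * s)] in [backward_ode]. *)
have [B B0 SB] : exists2 B, 0 <= B & forall s, 0 <= s -> `|S s| <= B * expR (kp * s).
  have M0 := size2_ge0 sg L h0 F.
  pose B1 := Num.sqrt (cstU K * size2 sg L h0 F); pose B2 := Num.sqrt (2 / d * size2 sg L h0 F).
  have UB s : 0 <= s -> `|U s| <= B1 * expR (kp * s).
    move=> s0; apply: sqr_le_expR; first by rewrite mulr_ge0 ?cstU_ge0.
    apply: le_trans (Uf_bound K0 sg0 h0 e0 er KL wF s0); rewrite -/U.
    by rewrite mulrDl mul1r lerDl mulr_ge0 ?sqr_ge0.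
  have GB s : 0 <= s -> `|gf d L F s| <= B2 * expR (kp * s).
    move=> s0; apply: sqr_le_expR; first by rewrite mulr_ge0// divr_ge0// ltW.
    exact: gf_bound.
  exists ((1 + k) * (A / Num.sqrt e) + `|b| * B1 + B2).
    rewrite addr_ge0 ?sqrtr_ge0// addr_ge0// mulr_ge0 ?sqrtr_ge0//.
      by rewrite addr_ge0.
    by rewrite divr_ge0 ?sqrtr_ge0.
  move=> s s0; rewrite /S (mulrDl _ B2) (mulrDl _ (`|b| * B1)); apply: (le_trans (ler_normB _ _)); apply: lerD; last exact: GB.
  have kk : 0 <= 1 + k by rewrite addr_ge0.
  apply: (le_trans (ler_normD _ _)); apply: lerD.
    by rewrite normrM (ger0_norm kk) -mulrA; apply: (ler_wpM2l kk); exact: ZB.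
  by rewrite normrM -mulrA; apply: (ler_wpM2l (normr_ge0 _)); exact: UB.
have se0 : 0 < Num.sqrt e by rewrite sqrtr_gt0.
have ra : rate <= a by exact: rate_le_a.
have kpa : kp <= a / 2 by rewrite /kp ler_pM2r ?invr_gt0.
have ka : kp < a by move: kpa a0; lra.
have kaZ s : 0 <= s -> `|k * a * Z s| <= k * a * (A / Num.sqrt e) * expR (kp * s).
  have ka0 : 0 <= k * a by apply: mulr_ge0 => //; exact: ltW.
  by move=> s0; rewrite normrM (ger0_norm ka0) -[leRHS]mulrA; apply: (ler_wpM2l ka0); exact: ZB.
pose C := 4 * (e - d) * (A / Num.sqrt e).
have C0 : 0 <= C by rewrite /C !mulr_ge0 ?subr_ge0 ?invr_ge0// ltW.
have HS s : 0 <= s -> `|S s / a| <= C * expR (kp * s).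
  move=> s0; have := backward_ode pS B0 kaZ ka SB s0.
  set E := expR (kp * s); have E0 : 0 <= E by exact: expR_ge0.
  rewrite normrM normfV (gtr0_norm a0) ler_pdivrMr// => /le_trans; apply.
  rewrite ler_pdivrMr ?subr_gt0//.
  (* As [kp <= a / 2], the gap [a - kp] is comparable to [a], which is at least [1 / (2 * d)]. *)
  have h : 1 / 2 <= 4 * d * (a - kp).
    have : d * a / 2 <= d * (a - kp) by rewrite -mulrA ler_wpM2l ?(ltW d0)//; move: kpa; lra.
    by move: ha; rewrite -(mulrA 4); lra.
  have -> : k * a * (A / Num.sqrt e) * E = (k * d) * (d^-1 * a * (A / Num.sqrt e) * E).
    by rewrite /k; field; rewrite !gt_eqF.
  have -> : C * E * a * (a - kp) = (k * d) * (a * (A / Num.sqrt e) * E * (4 * (a - kp))).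
    by rewrite /C /k; field; rewrite !gt_eqF.
  apply: ler_wpM2l; first by rewrite mulr_ge0// ltW.
  have -> : d^-1 * a * (A / Num.sqrt e) * E = a * (A / Num.sqrt e) * E * d^-1 by ring.
  have As0 : 0 <= A / Num.sqrt e by rewrite divr_ge0// ltW.
  apply: ler_wpM2l; first by apply: mulr_ge0 => //; apply: mulr_ge0 => //; exact: ltW.
  rewrite -[leLHS]mul1r ler_pdivrMr//; move: h ha.
  have -> : 4 * (a - kp) * d = 4 * d * (a - kp) by ring.
  have : d * a / 2 <= d * (a - kp) by rewrite -mulrA ler_wpM2l ?(ltW d0)//; move: kpa; lra.
  by rewrite -(mulrA 4); lra.
have pw := primD (primB pd p1) (primZ a^-1 pS).
have {}pw : prim (fun s => V s - U s + S s / a) (fun s => b * (S s / a) - b * (V s - U s + S s / a)).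
  apply: (eq_prim pw) => s s0 /=; first by rewrite mulrC.
  have -> : Zf d L h0 F s = gf d L F s - b * V s by [].
  have -> : a^-1 * (a * S s - k * a * Z s) = S s - k * Z s by field; rewrite gt_eqF.
  by rewrite /S; ring.
have Wt : `|V t - U t + S t / a| <= C * expR (kp * t).
  apply: (cmp_ode pw HS) => //.
    by rewrite /V /U !Uf0 subrr add0r; have := HS 0 (lexx 0); rewrite mulr0 expR0 mulr1.
  have rK : - 4 * K <= kp by rewrite /kp /rate; move: K0 sg0; lra.
  have [b0|b0] := leP 0 b; first by rewrite ger0_norm// lerDl; move: K0 rK; lra.
  by rewrite ltr0_norm//; move: hb rK; lra.
have := HS t t0; rewrite -[`|S t / a|]normrN => St.
have -> : V t - U t = (V t - U t + S t / a) + - (S t / a) by ring.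
apply: (le_trans (ler_normD _ _)); apply: (@le_trans _ _ (2 * C * expR (kp * t))).
  by move: Wt St; lra.
rewrite -/kp; set E := expR (kp * t); have E0 : 0 <= E by exact: expR_ge0.
have -> : 2 * C * E = 8 * ((e - d) / Num.sqrt e * (A * E)) by rewrite /C; ring.
have AE : 0 <= A * E by rewrite mulr_ge0.
(* Factor [e - d] as a difference of squares; [sqrt e + sqrt d] is at most [2 * sqrt e]. The
   division by [sqrt e] thus turns a difference of parameters into a difference of square roots,
   which telescopes. *)
have h : (e - d) / Num.sqrt e <= 2 * (Num.sqrt e - Num.sqrt d).
  rewrite ler_pdivrMr// -[X in X - _](sqr_sqrtr (ltW e0)) -[X in _ - X](sqr_sqrtr (ltW d0)).
  have sde : Num.sqrt d <= Num.sqrt e by rewrite ler_wsqrtr.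
  rewrite subr_sqr -mulrA [leRHS]mulrCA ler_wpM2l ?subr_ge0//; move: sde; lra.
by have := ler_wpM2r AE h; lra.
Qed.

End frequency_limits.

(** * Test functions and weak derivatives in time *)

Section smooth.
Context {R : realType}.
Local Notation mu := (@lebesgue_measure R).
Implicit Types (f : R -> R) (p : {poly R}).

(** A whole tower of derivatives as witness: sums, dilations and primitives act on the tower, and no
    induction on [derive1n] is needed for them. *)
Definition smooth f := exists D : nat -> R -> R, D 0 = f /\
  forall n (x : R), is_derive x (1 : R) (D n) (D n.+1 x).

Lemma smooth_derivable f : smooth f -> forall n t, derivable (derive1n n f) t 1.
Proof.
move=> [D [D0 dD]] n t; suff -> : derive1n n f = D n by exact: (@ex_derive _ _ _ _ _ _ _ (dD n t)).
elim: n => [|n IH]; first by rewrite derive1n0 D0.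
rewrite derive1nS IH; apply/funext => x; rewrite derive1E; exact: (@derive_val _ _ _ _ _ _ _ (dD n x)).
Qed.

Lemma smoothB f g : smooth f -> smooth g -> smooth (fun x => f x - g x).
Proof.
move=> [D [D0 dD]] [G [G0 dG]]; exists (fun n x => D n x - G n x); split; first by rewrite D0 G0.
move=> n x; exact: is_deriveB (dD n x) (dG n x).
Qed.

Lemma smooth_affine f a b : smooth f -> smooth (fun x => f (a + b * x)).
Proof.
move=> [D [D0 dD]]; exists (fun n x => b ^+ n * D n (a + b * x)); split.
  by apply/funext => x; rewrite expr0 mul1r D0.
move=> n x; have := is_deriveZ (b ^+ n) (is_derive_affine_comp (dD n (a + b * x))).
by rewrite /GRing.scale /= exprSr -mulrA.
Qed.

Lemma smoothZ f c : smooth f -> smooth (fun x => c * f x).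
Proof.
move=> [D [D0 dD]]; exists (fun n x => c * D n x); split; first by rewrite D0.
move=> n x; exact: is_deriveZ (dD n x).
Qed.

Lemma smooth_prim f g : smooth g -> (forall x : R, is_derive x (1 : R) f (g x)) -> smooth f.
Proof.
move=> [D [D0 dD]] fg; exists (fun n => if n is m.+1 then D m else f); split=> //.
by case=> [|n] x; [rewrite D0; exact: fg|exact: dD].
Qed.

(** Settles the two end points of the bump, where no formula is valid on a whole neighbourhood. *)
Lemma is_derive_flat f (x C : R) : 0 <= C -> f x = 0 -> (forall h, `|f (h + x)| <= C * h ^+ 2) ->
  is_derive x (1 : R) f 0.
Proof.
move=> C0 fx fC.
have cv : h^-1 *: (f (h *: (1 : R) + x) - f x) @[h --> 0^'] --> (0 : R).
  apply/cvgr0Pnorm_le => e e0.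
  have d0 : 0 < e / (C + 1) by rewrite divr_gt0// ltr_wpDl.
  near=> h.
  have h0 : h != 0 by near: h; exact: nbhs_dnbhs_neq.
  have hd : `|h| <= e / (C + 1) by near: h; apply: dnbhs0_le.
  rewrite fx subr0 /GRing.scale /= mulr1 normrM normfV.
  rewrite ler_pdivrMl ?normr_gt0//; apply: (le_trans (fC h)).
  rewrite -(sqr_normr h) expr2 mulrA mulrC; apply: ler_wpM2l => //.
  apply: (@le_trans _ _ (C * (e / (C + 1)))); first by rewrite ler_wpM2l.
  rewrite mulrA ler_pdivrMr ?ltr_wpDl// mulrC ler_pM2l//; lra.
apply: DeriveDef; first by apply/cvg_ex; exists 0.
exact: cvg_lim cv.
Unshelve. all: by end_near. Qed.

Lemma pow_expN_le (m : nat) (y : R) : (0 < m)%N -> 0 < y -> y ^+ m * expR (- y) <= m%:R ^+ m.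
Proof.
move=> m0 y0; rewrite expRN ler_pdivrMr ?expR_gt0//.
have mr : 0 < m%:R :> R by rewrite ltr0n.
have -> : expR y = expR (y / m%:R) ^+ m.
  by rewrite -expRM_natl mulrCA mulfV ?gt_eqF// mulr1.
have h : y / m%:R <= expR (y / m%:R) by apply: le_trans (expR_ge1Dx _); lra.
have := lerXn2r m _ _ h; rewrite !nnegrE => /(_ (divr_ge0 (ltW y0) (ltW mr)) (expR_ge0 _)) h2.
apply: le_trans (ler_wpM2l _ h2); last by rewrite exprn_ge0.
by rewrite -exprMn mulrCA mulfV ?gt_eqF// mulr1.
Qed.

Let qq : {poly R} := 'X * (1 - 'X).

Let qqE x : qq.[x] = x * (1 - x).
Proof. by rewrite /qq !hornerE. Qed.

(** With [q = x * (1 - x)], the functions [p * q ^- k * exp (- 1 / q)]. The polynomial [p] and the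
    exponent [k] are there to make the family closed under differentiation; the usual bump is
    [bump 0 1]. *)
Definition bump (k : nat) p (x : R) : R :=
  if 0 < x < 1 then p.[x] * (qq.[x]^-1 ^+ k * expR (- qq.[x]^-1)) else 0.

Lemma poly_bounded p : exists2 B, 0 <= B & forall x, 0 <= x <= 1 -> `|p.[x]| <= B.
Proof.
exists (\sum_(i < size p) `|p`_i|); first exact: sumr_ge0.
move=> x /andP[x0 x1]; rewrite horner_coef; apply: (le_trans (ler_norm_sum _ _ _)).
apply: ler_sum => i _; rewrite normrM ler_piMr// normrX ger0_norm//.
exact: exprn_ile1.
Qed.

(** The exponential beats the power [k.+2] of [1 / q], which leaves a factor [q ^+ 2] that is
    quadratic at both ends. *)
Lemma bump_bound k p : exists2 C, 0 <= C & forall x, `|bump k p x| <= C * x ^+ 2 /\ `|bump k p x| <= C * (1 - x) ^+ 2.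
Proof.
have [B B0 HB] := poly_bounded p.
have M0 : 0 <= (k.+2%:R : R) ^+ k.+2 by exact: exprn_ge0.
exists (B * k.+2%:R ^+ k.+2); first exact: mulr_ge0.
move=> x; rewrite /bump; case: ifPn => [/andP[x0 x1]|_]; last first.
  by rewrite normr0; split; apply: mulr_ge0; rewrite ?sqr_ge0//; exact: mulr_ge0.
have q0 : 0 < qq.[x] by rewrite qqE mulr_gt0// subr_gt0.
have H : `|p.[x] * (qq.[x]^-1 ^+ k * expR (- qq.[x]^-1))| <= B * k.+2%:R ^+ k.+2 * qq.[x] ^+ 2.
  rewrite normrM -mulrA; apply: ler_pM => //; first by apply: HB; rewrite !ltW.
  have y0 : 0 < qq.[x]^-1 by rewrite invr_gt0.
  rewrite ger0_norm ?mulr_ge0 ?expR_ge0 ?exprn_ge0 ?(ltW y0)//.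
  rewrite -ler_pdivrMr ?exprn_gt0//; apply: le_trans (pow_expN_le (m := k.+2) isT y0).
  by rewrite mulrAC -exprVn -exprD addn2.
have Q2 (y z : R) : 0 < y -> 0 < z -> z < 1 -> (y * z) ^+ 2 <= y ^+ 2.
  move=> y0 z0 z1; have z2 : z ^+ 2 <= 1 by apply: exprn_ile1; exact: ltW.
  by rewrite exprMn -[leRHS]mulr1; exact: (ler_wpM2l (sqr_ge0 y) z2).
have xp : 0 < 1 - x by rewrite subr_gt0.
split; apply: (le_trans H); apply: (ler_wpM2l (mulr_ge0 B0 M0)); rewrite qqE.
  by apply: Q2 => //; lra.
by rewrite mulrC; apply: Q2 => //; lra.
Qed.

(** The numerator of the derivative over [q ^+ k.+2]: differentiating [1 / q] costs two powers of
    [q]. *)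
Let dbump k p := p^`() * qq ^+ 2 - k%:R *: (p * qq^`() * qq) + p * qq^`().

Let dbumpE k p x : (dbump k p).[x] =
  p^`().[x] * qq.[x] ^+ 2 - k%:R * (p.[x] * qq^`().[x] * qq.[x]) + p.[x] * qq^`().[x].
Proof. by rewrite /dbump !(hornerD, hornerN, hornerZ, hornerM, horner_exp). Qed.

Lemma is_derive_bump k p (x : R) : is_derive x (1 : R) (bump k p) (bump k.+2 (dbump k p) x).
Proof.
have [C C0 HC] := bump_bound k p.
have [xI|xI] := boolP (0 < x < 1); last first.
  have -> : bump k.+2 (dbump k p) x = 0 by rewrite /bump (negbTE xI).
  have bx : bump k p x = 0 by rewrite /bump (negbTE xI).
  have [x0|x0] := ltP x 0.
    apply: near_eq_is_derive (is_derive_cst (0 : R) x (1 : R)).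
    near=> y; rewrite /bump; case: ifPn => // /andP[y0 _].
    suff : y < 0 by lra.
    by near: y; exact: lt_nbhsl.
  have [x1|x1] := ltP 1 x.
    apply: near_eq_is_derive (is_derive_cst (0 : R) x (1 : R)).
    near=> y; rewrite /bump; case: ifPn => // /andP[_ y0].
    suff : 1 < y by lra.
    by near: y; exact: lt_nbhsr.
  have [x00|x00] := eqVneq x 0.
    apply: is_derive_flat C0 bx _ => h; have [+ _] := HC (h + x).
    by rewrite x00 addr0.
  have [x11|x11] := eqVneq x 1.
    apply: is_derive_flat C0 bx _ => h; have [_] := HC (h + x).
    by rewrite x11 opprD addrCA subrr addr0 sqrrN.
  by move: xI; rewrite !lt_neqAle x0 x1 x11 eq_sym x00.
have q0 : qq.[x] != 0 by rewrite qqE mulf_neq0//; move: xI => /andP[]; lra.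
apply: (@near_eq_is_derive _ _ _ (fun y => p.[y] * (qq.[y]^-1 ^+ k * expR (- qq.[y]^-1)))).
  have xI' : x \in `]0, 1[ by rewrite in_itv.
  near=> y; rewrite /bump ifT//.
  suff : y \in `]0, 1[ by rewrite in_itv.
  by near: y; exact: near_in_itvoo.
have d1 := is_derive_poly p x.
have d2 := is_deriveV q0 (is_derive_poly qq x).
have d3 := is_deriveX k d2; rewrite exprfctE in d3.
have d4 : is_derive x (1 : R) (fun y => expR (- qq.[y]^-1)) (expR (- qq.[x]^-1) * (qq.[x] ^- 2 * qq^`().[x])).
  have d2N : is_derive x (1 : R) (fun y => - qq.[y]^-1) (qq.[x] ^- 2 * qq^`().[x]).
    by have := is_deriveN d2; rewrite /GRing.scale /= mulNr opprK.
  have := @is_derive1_comp R expR (fun y => - qq.[y]^-1) x _ _ (is_derive_expR (- qq.[x]^-1)) d2N.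
  by rewrite /GRing.scale /= mulrC.
apply: (is_derive_eq (is_deriveM d1 (is_deriveM d3 d4))); rewrite /bump xI dbumpE !fctE.
move: {d1 d2 d3 d4 C C0 HC} q0; set Q := qq.[x]; set Q' := qq^`().[x]; set P := p.[x]; set P' := p^`().[x].
set X := expR _; clearbody X Q Q' P P' => q0.
suff : P * (Q^-1 ^+ k * (X * (Q ^- 2 * Q')) + X * (k%:R * Q^-1 ^+ k.-1 * (- Q ^- 2 * Q'))) + Q^-1 ^+ k * X * P' =
  (P' * Q ^+ 2 - k%:R * (P * Q' * Q) + P * Q') * (Q^-1 ^+ k.+2 * X) by [].
case: k => [|k]; first by rewrite !expr0 ?mulr0n; field.
by rewrite [k.+1.-1]/= !exprS; set Y := Q^-1 ^+ k; field.
Unshelve. all: by end_near. Qed.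

Lemma smooth_bump k p : smooth (bump k p).
Proof.
pose nxt (a : nat * {poly R}) := (a.1.+2, dbump a.1 a.2).
exists (fun n => let a := iter n nxt (k, p) in bump a.1 a.2); split=> // n x.
exact: is_derive_bump.
Qed.

Lemma bump_ge0 x : 0 <= bump 0 1 x.
Proof. by rewrite /bump; case: ifPn => // _; rewrite hornerC mul1r expr0 mul1r expR_ge0. Qed.

Lemma bump_out x : ~~ (0 < x < 1) -> bump 0 1 x = 0.
Proof. by rewrite /bump => /negbTE ->. Qed.

Lemma continuous_bump : continuous (bump 0 1).
Proof. by move=> x; exact: (is_derive_continuous (is_derive_bump 0 1 x)). Qed.

Let step0 (x : R) : R := \int[mu]_(t in `]-oo, x]) bump 0 1 t.

Let ibump : mu.-integrable [set: R] (EFin \o bump 0 1).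
Proof.
have E : bump 0 1 = (bump 0 1) \_ `[0, 1]%classic.
  apply/funext => x; rewrite patchE; case: ifPn => //; rewrite notin_setE /= in_itv/= => /negP h.
  by rewrite bump_out//; apply: contra h => /andP[h1 h2]; rewrite !ltW.
rewrite E -restrict_EFin; apply: (integrable_mkcond _ (mitv _)).1.
exact: continuous_integrable_itv continuous_bump.
Qed.

Let is_derive_step0 (x : R) : is_derive x (1 : R) step0 (bump 0 1 x).
Proof.
have i1 : mu.-integrable `]-oo, x + 1] (EFin \o bump 0 1).
  by apply: (integrableS measurableT (mitv _) _ ibump).
have := continuous_FTC1 (_ : x < x + 1) i1 (ltNyr _) (@continuous_bump x).
rewrite ltrDl ltr01 => /(_ isT)[d1 d2]; apply: DeriveDef; first exact: d1.
by rewrite -derive1E.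
Qed.

Let step00 x : x <= 0 -> step0 x = 0.
Proof.
move=> x0; rewrite /step0 /Rintegral integral0_eq// => t /=; rewrite in_itv/= => tx.
by rewrite bump_out// negb_and -leNgt (le_trans tx x0).
Qed.

Let c0 : R := \int[mu]_t bump 0 1 t.

Let step0_le (x : R) : 0 <= step0 x <= c0.
Proof.
apply/andP; split; first by apply: Rintegral_ge0 => t _; exact: bump_ge0.
rewrite /step0 /c0 /Rintegral; apply: fine_le.
- have i1 : mu.-integrable `]-oo, x] (EFin \o bump 0 1).
    by apply: (integrableS measurableT (mitv _) _ ibump).
  exact: integrable_fin_num i1.
- exact: integrable_fin_num ibump.
apply: ge0_subset_integral.
- exact: mitv.
- exact: measurableT.
- by have /measurable_int := ibump.
- by move=> t _; rewrite lee_fin bump_ge0.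
- by [].
Qed.

Let step01 (x : R) : 1 <= x -> step0 x = c0.
Proof.
move=> x1; rewrite /step0 /c0 Rintegral_mkcond; apply: eq_Rintegral => t _.
rewrite patchE; case: ifPn => //; rewrite notin_setE /= in_itv/= => /negP; rewrite -ltNge => xt.
by rewrite bump_out// negb_and -!leNgt (le_trans x1 (ltW xt)) orbT.
Qed.

Let c0_gt0 : 0 < c0.
Proof.
have c00 : 0 <= c0 by apply: Rintegral_ge0 => t _; exact: bump_ge0.
rewrite lt_neqAle c00 andbT eq_sym; apply/eqP => cE.
(* If the mass were 0, the primitive would be constant, but its derivative at [1 / 2] is
   positive. *)
have E : step0 = fun=> (0 : R).
  apply/funext => x; apply/eqP; rewrite eq_le; have := step0_le x; rewrite cE => /andP[-> ->//].
have h : 0 < (2^-1 : R) < 1 by apply/andP; split; lra.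
have := @derive_val _ _ _ _ _ _ _ (is_derive_step0 2^-1).
rewrite E derive_cst /bump h hornerC mul1r expr0 mul1r => /esym/eqP.
by rewrite gt_eqF// expR_gt0.
Qed.

Definition mollifier (x : R) : R := c0^-1 * bump 0 1 x.
Definition smooth_step (x : R) : R := c0^-1 * step0 x.

Lemma is_derive_smooth_step (x : R) : is_derive x (1 : R) smooth_step (mollifier x).
Proof. exact: is_deriveZ (is_derive_step0 x). Qed.

Lemma smooth_smooth_step : smooth smooth_step.
Proof. exact: smooth_prim (smoothZ c0^-1 (smooth_bump 0 1)) is_derive_smooth_step. Qed.

Lemma smooth_step0 x : x <= 0 -> smooth_step x = 0.
Proof. by move=> x0; rewrite /smooth_step step00// mulr0. Qed.

Lemma smooth_step1 x : 1 <= x -> smooth_step x = 1.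
Proof. by move=> x0; rewrite /smooth_step step01// mulVf// gt_eqF. Qed.

Lemma smooth_step_ge0 x : 0 <= smooth_step x <= 1.
Proof.
have /andP[h1 h2] := step0_le x; rewrite /smooth_step mulr_ge0 ?invr_ge0 ?(ltW c0_gt0)//=.
by rewrite ler_pdivrMl// mulr1.
Qed.

Lemma mollifier_ge0 x : 0 <= mollifier x.
Proof. by rewrite mulr_ge0 ?bump_ge0// invr_ge0 ltW. Qed.

Lemma mollifier_out x : ~~ (0 < x < 1) -> mollifier x = 0.
Proof. by move=> h; rewrite /mollifier bump_out// mulr0. Qed.

Lemma continuous_mollifier : continuous mollifier.
Proof. by move=> x; apply: cvgM; [exact: cvg_cst|exact: continuous_bump]. Qed.

(** One-sided: the mass sits in []s, s + 1 / j.+1[], hence at positive times for [s > 0]. *)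
Definition approx_delta (j : nat) (s x : R) : R := j.+1%:R * mollifier (j.+1%:R * (x - s)).

Lemma approx_delta_ge0 j s x : 0 <= approx_delta j s x.
Proof. by rewrite mulr_ge0// mollifier_ge0. Qed.

Lemma approx_delta_out j s x : ~~ (s < x < s + j.+1%:R^-1) -> approx_delta j s x = 0.
Proof.
move=> h; rewrite /approx_delta mollifier_out ?mulr0//; apply: contra h => /andP[h1 h2].
have j0 : 0 < j.+1%:R :> R by [].
move: h1; rewrite pmulr_rgt0// subr_gt0 => -> /=.
by rewrite -ltrBlDl -(ltr_pM2l j0) mulfV ?gt_eqF.
Qed.

(** A smooth version of the indicator of []s, t]] whose derivative is a difference of two
    approximate Dirac masses. Its support lies in [[s, t + 1]] for every [j], which provides a
    common dominating function. *)
Definition window (j : nat) (s t x : R) : R :=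
  smooth_step (j.+1%:R * (x - s)) - smooth_step (j.+1%:R * (x - t)).

Lemma is_derive_step_at j (s x : R) : is_derive x (1 : R) (fun x => smooth_step (j.+1%:R * (x - s))) (approx_delta j s x).
Proof.
have E y : j.+1%:R * (y - s) = - (j.+1%:R * s) + j.+1%:R * y by ring.
rewrite (_ : (fun _ => _) = (fun y : R => smooth_step (- (j.+1%:R * s) + j.+1%:R * y))); last first.
  by apply/funext => y; rewrite E.
by rewrite /approx_delta E; exact: is_derive_affine_comp (is_derive_smooth_step _).
Qed.

Lemma smooth_window j s t : smooth (window j s t).
Proof.
apply: smoothB.
  have := smooth_affine (- (j.+1%:R * s)) j.+1%:R smooth_smooth_step.
  by congr smooth; apply/funext => y; congr smooth_step; ring.
have := smooth_affine (- (j.+1%:R * t)) j.+1%:R smooth_smooth_step.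
by congr smooth; apply/funext => y; congr smooth_step; ring.
Qed.

Lemma window_out j s t x : s <= t -> ~~ (s <= x <= t + 1) -> window j s t x = 0.
Proof.
move=> st; rewrite negb_and -!ltNge /window => /orP[xs|tx].
  rewrite !smooth_step0 ?subrr//.
    by rewrite pmulr_rle0// subr_le0 ltW// (lt_le_trans xs st).
  by rewrite pmulr_rle0// subr_le0 ltW.
have j1 : 1 <= j.+1%:R :> R by rewrite ler1n.
have h y : y + 1 <= x -> 1 <= j.+1%:R * (x - y).
  by move=> yx; rewrite -[leLHS]mulr1; apply: ler_pM => //; lra.
by rewrite !smooth_step1 ?subrr//; apply: h; lra.
Qed.

Lemma window_test j s t : 0 < s <= t -> test_fun (window j s t).
Proof.
move=> /andP[s0 st]; split; first exact: smooth_derivable (smooth_window j s t).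
exists s, (t + 1); split=> // x; apply: contraNT => h; apply/eqP; exact: window_out.
Qed.

Lemma derive1_window j s t x : derive1 (window j s t) x = approx_delta j s x - approx_delta j t x.
Proof.
rewrite derive1E; exact: (@derive_val _ _ _ _ _ _ _ (is_deriveB (is_derive_step_at j s x) (is_derive_step_at j t x))).
Qed.

Lemma continuous_approx_delta j s : continuous (approx_delta j s).
Proof.
move=> x; apply: cvgM; first exact: cvg_cst.
apply: (@continuous_comp _ _ _ (fun x : R => j.+1%:R * (x - s)) mollifier); last exact: continuous_mollifier.
by apply: cvgM; [exact: cvg_cst|apply: cvgB; [exact: cvg_id|exact: cvg_cst]].
Qed.

Lemma integral_approx_delta j s : 0 < s -> mu.-integrable `](0 : R), +oo[ (EFin \o approx_delta j s) /\
  \int[mu]_(x in `](0 : R), +oo[) approx_delta j s x = 1.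
Proof.
move=> s0.
have l : smooth_step (j.+1%:R * (x - s)) @[x --> +oo] --> (1 : R).
  apply: cvg_near_cst; exists (s + 1); split; first exact: num_real.
  move=> x sx; rewrite /= smooth_step1//.
  have j1 : 1 <= j.+1%:R :> R by rewrite ler1n.
  by rewrite -[leLHS]mulr1; apply: ler_pM => //; lra.
have := FTC2y 0 (approx_delta_ge0 j s) (@continuous_approx_delta j s) (is_derive_step_at j s) l.
rewrite [X in 1 - X]smooth_step0; last by rewrite sub0r mulrN oppr_le0 mulr_ge0// ltW.
rewrite subr0 => H.
have I : mu.-integrable `[(0 : R), +oo[ (EFin \o approx_delta j s).
  apply/integrableP; split.
    apply/measurable_EFinP; apply: measurable_funTS; apply: continuous_measurable_fun.
    exact: continuous_approx_delta.
  apply: le_lt_trans (ltry (1 : R)); rewrite -H le_eqVlt; apply/orP; left; apply/eqP.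
  by apply: eq_integral => x _ /=; rewrite ger0_norm ?approx_delta_ge0.
split; first exact: integrable_obnd.
by rewrite (Rintegral_itv_obnd_cbnd (integrable_obnd I)) /Rintegral H.
Qed.

Lemma approx_delta_cvg (m : R -> R) (s : R) : 0 < s -> measurable_fun `](0 : R), +oo[ m -> {for s, continuous m} ->
  (\forall j \near \oo, mu.-integrable `](0 : R), +oo[ (EFin \o (fun x => approx_delta j s x * m x))) /\
  \int[mu]_(x in `](0 : R), +oo[) (approx_delta j s x * m x) @[j --> \oo] --> m s.
Proof.
move=> s0 mm cm.
have H (e : R) : 0 < e -> \forall j \near \oo, forall x, `|approx_delta j s x * (m x - m s)| <= e * approx_delta j s x.
  move=> e0; have /cvgrPdist_le /(_ e e0) /nbhs_ballP[d /= d0 Hd] := cm.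
  near=> j; move=> x.
  have [xs|xs] := boolP (s < x < s + j.+1%:R^-1); last first.
    by rewrite approx_delta_out// mul0r normr0 mulr0.
  rewrite normrM (ger0_norm (approx_delta_ge0 _ _ _)) mulrC ler_wpM2r ?approx_delta_ge0//.
  have jd : j.+1%:R^-1 < d by near: j; exact: near_infty_natSinv_lt (PosNum d0).
  rewrite distrC; apply: Hd; suff : `|s - x| < d by [].
  move: xs => /andP[xs1 xs2]; rewrite ltr0_norm ?subr_lt0// opprB ltrBlDl.
  by apply: (lt_le_trans xs2); rewrite lerD2l; exact: ltW.
have mD := mitv `](0 : R), +oo[.
have IB (e : R) : 0 < e -> \forall j \near \oo,
    mu.-integrable `](0 : R), +oo[ (EFin \o (fun x => approx_delta j s x * (m x - m s))) /\
    `|\int[mu]_(x in `](0 : R), +oo[) (approx_delta j s x * (m x - m s))| <= e.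
  move=> e0; near=> j.
  have Hj : forall x, `|approx_delta j s x * (m x - m s)| <= e * approx_delta j s x by near: j; exact: H.
  have [i1 E1] := integral_approx_delta j s0.
  have iz := integrableZl mD e i1.
  have ii : mu.-integrable `](0 : R), +oo[ (EFin \o (fun x => approx_delta j s x * (m x - m s))).
    apply: (le_integrable mD _ _ iz).
      apply/measurable_EFinP; apply: measurable_funM.
        by move/measurable_int : i1 => /measurable_EFinP.
      by apply: measurable_funB => //; exact: measurable_cst.
    move=> x _ /=; rewrite lee_fin; apply: (le_trans (Hj x)).
    exact: ler_norm.
  split=> //; apply: (le_trans (le_normr_Rintegral mD ii)).
  rewrite -[leRHS]mulr1 -E1 -(RintegralZl _ mD i1); apply: (le_Rint mD) => //.
  exact: integrable_norm.
have IM : \forall j \near \oo, mu.-integrable `](0 : R), +oo[ (EFin \o (fun x => approx_delta j s x * m x)).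
  near=> j.
  have [i1 _] := integral_approx_delta j s0.
  have [i2 _] : mu.-integrable `](0 : R), +oo[ (EFin \o (fun x => approx_delta j s x * (m x - m s))) /\
    `|\int[mu]_(x in `](0 : R), +oo[) (approx_delta j s x * (m x - m s))| <= 1.
    by near: j; exact: IB.
  have := integrableD mD i2 (integrableZl mD (m s) i1); apply: eq_integrable => // x _ /=.
  by rewrite -EFinM -EFinD; congr EFin; ring.
split=> //; apply/cvgrPdist_le => e e0; near=> j.
have [i1 E1] := integral_approx_delta j s0.
have [i2 H2] : mu.-integrable `](0 : R), +oo[ (EFin \o (fun x => approx_delta j s x * (m x - m s))) /\
    `|\int[mu]_(x in `](0 : R), +oo[) (approx_delta j s x * (m x - m s))| <= e.
  by near: j; exact: IB.
have iM : mu.-integrable `](0 : R), +oo[ (EFin \o (fun x => approx_delta j s x * m x)) by near: j; exact: IM.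
rewrite distrC; move: H2; congr (`|_| <= _).
rewrite -[in RHS](mulr1 (m s)) -E1 -(RintegralZl _ mD i1) -(RintegralB mD iM).
  by apply: eq_Rintegral => x _; ring.
by have := integrableZl mD (m s) i1; apply: eq_integrable.
Unshelve. all: by end_near. Qed.

Lemma window_cvg s t x : s <= t -> window j s t x @[j --> \oo] --> (\1_(`]s, t]%classic : set R) x : R).
Proof.
move=> st; have stp y : y < x -> \forall j \near \oo, smooth_step (j.+1%:R * (x - y)) = 1.
  move=> yx; have d0 : 0 < x - y by rewrite subr_gt0.
  near=> j; rewrite smooth_step1//.
  have : j.+1%:R^-1 < x - y by near: j; exact: near_infty_natSinv_lt (PosNum d0).
  by rewrite invf_plt ?posrE// => h; rewrite -ler_pdivrMr// div1r ltW.
have stn y j : x <= y -> smooth_step (j.+1%:R * (x - y)) = 0.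
  by move=> xy; rewrite smooth_step0// pmulr_rle0// subr_le0.
apply: cvg_near_cst; rewrite indicE; have [xs|sx] := leP x s.
  near=> j; rewrite /window !stn ?(le_trans xs st)// subrr memNset//= in_itv/= => /andP[].
  by rewrite ltNge xs.
have [xt|tx] := leP x t.
  near=> j; rewrite /window (stn t)// subr0 mem_set/= ?in_itv/= ?sx//.
  by near: j; exact: stp.
near=> j; rewrite memNset; last by rewrite /= in_itv/= leNgt tx andbF.
rewrite /window; have -> : smooth_step (j.+1%:R * (x - s)) = 1 by near: j; exact: stp.
have -> : smooth_step (j.+1%:R * (x - t)) = 1 by near: j; exact: stp.
by rewrite subrr.
Unshelve. all: by end_near. Qed.

(** The weak equation is tested with [window j s t]. As [j] grows the left side tends to [m s - m t]
    by continuity of [m], and the right side to minus the integral of [n] by domination. *)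
Lemma weak_derivative_increment (m n : R -> R) (s t : R) : measurable_fun `](0 : R), +oo[ m ->
  (forall r : R, 0 < r -> {for r, continuous m}) ->
  measurable_fun `](0 : R), +oo[ n -> (forall a b : R, 0 < a -> mu.-integrable `[a, b] (EFin \o n)) ->
  (forall phi, test_fun phi -> \int[mu]_(r in `](0 : R), +oo[) (derive1 phi r * m r) =
     - \int[mu]_(r in `](0 : R), +oo[) (phi r * n r)) ->
  0 < s <= t -> \int[mu]_(r in `]s, t]) n r = m t - m s.
Proof.
move=> mm cm mn jn H st0; have /andP[s0 st] := st0; have t0 := lt_le_trans s0 st.
have mD := mitv `](0 : R), +oo[.
have [js Ls] := approx_delta_cvg s0 mm (cm s s0).
have [jt Lt] := approx_delta_cvg t0 mm (cm t t0).
have L1 : \int[mu]_(r in `](0 : R), +oo[) (derive1 (window j s t) r * m r) @[j --> \oo] --> m s - m t.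
  apply: cvg_trans (cvgB Ls Lt); apply: near_eq_cvg; near=> j.
  have i1 : mu.-integrable `](0 : R), +oo[ (EFin \o (fun x => approx_delta j s x * m x)) by near: j.
  have i2 : mu.-integrable `](0 : R), +oo[ (EFin \o (fun x => approx_delta j t x * m x)) by near: j.
  rewrite !fctE -(RintegralB mD i1 i2); apply: eq_Rintegral => r _.
  by rewrite derive1_window mulrBl.
pose I : set (measurableTypeR R) := `[s, t + 1]%classic.
have mI : measurable I by exact: mitv.
pose g : R -> \bar R := (EFin \o (fun r => `|n r|)) \_ I.
have ig : mu.-integrable `](0 : R), +oo[ g.
  apply: (integrableS measurableT mD); first by [].
  by apply: (integrable_mkcond _ mI).1; exact: integrable_norm (jn _ _ s0).
have mw j : measurable_fun `](0 : R), +oo[ (EFin \o (fun r => window j s t r * n r)).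
  apply/measurable_EFinP; apply: measurable_funM => //; apply: measurable_funTS.
  apply: continuous_measurable_fun => x.
  by apply: is_derive_continuous (is_deriveB (is_derive_step_at j s x) (is_derive_step_at j t x)).
pose chi (r : R) : R := \1_(`]s, t]%classic : set R) r.
have mc : measurable_fun `](0 : R), +oo[ (EFin \o (fun r => chi r * n r)).
  apply/measurable_EFinP; apply: measurable_funM => //; apply: measurable_funTS.
  exact: measurable_indic_itv.
have cw : {ae mu, forall r, `](0 : R), +oo[%classic r -> (EFin \o (fun r => window j s t r * n r)) r @[j --> \oo] --> (EFin \o (fun r => chi r * n r)) r}.
  apply: aeW => r _; apply: cvg_EFin; first by near=> j.
  by apply: cvgM; [exact: window_cvg|exact: cvg_cst].
have dw : {ae mu, forall r : R, forall j : nat, `](0 : R), +oo[%classic r -> (`|(EFin \o (fun r => window j s t r * n r)%R) r| <= g r)%E}.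
  apply: aeW => r j _; rewrite /g patchE; case: ifPn => [_|rI] /=.
    rewrite lee_fin normrM ler_piMl// ler_norml.
    have := smooth_step_ge0 (j.+1%:R * (r - s)); have := smooth_step_ge0 (j.+1%:R * (r - t)).
    by rewrite /window; lra.
  move: rI; rewrite notin_setE /I /= in_itv/= => /negP rI.
  by rewrite window_out ?mul0r ?normr0.
have [jcc _ L2'] := @dominated_convergence _ (measurableTypeR R) R mu _ mD _ _ _ mw mc cw ig dw.
have jc : \int[mu]_(r in `](0 : R), +oo[) (chi r * n r) = \int[mu]_(r in `]s, t]) n r.
  rewrite [LHS]Rintegral_mkcond [RHS]Rintegral_mkcond; apply: eq_Rintegral => r _.
  rewrite !patchE /chi indicE; case: (boolP (r \in `]s, t]%classic)) => rI; last first.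
    by case: ifP => _ //; rewrite mul0r.
  rewrite mul1r ifT//; move: rI; rewrite !inE/= !in_itv/= andbT => /andP[sr _].
  exact: lt_trans sr.
have L2 : (fun j => - \int[mu]_(r in `](0 : R), +oo[) (window j s t r * n r)) @ \oo --> - \int[mu]_(r in `]s, t]) n r.
  apply: cvgN; rewrite -jc.
  have fc : (\int[mu]_(r in `](0 : R)%R, +oo[) (chi r * n r)%R%:E)%E \is a fin_num.
    exact: integrable_fin_num jcc.
  by apply: fine_cvg; rewrite fineK.
have : m s - m t = - \int[mu]_(r in `]s, t]) n r.
  apply: (@cvg_unique _ (@Rhausdorff R) (fmap (fun j => \int[mu]_(r in `](0 : R), +oo[) (derive1 (window j s t) r * m r)) \oo)) => //.
  rewrite (_ : (fun j => _) = (fun j => - \int[mu]_(r in `](0 : R), +oo[) (window j s t r * n r))) //.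
  by apply/funext => j; exact: H (window_test j st0).
by move=> E; rewrite -[LHS]opprK -E opprB.
Unshelve. all: by end_near. Qed.

End smooth.

(** * Completing the square *)

Section key_identity.
Context {R : realType}.
Local Notation mu := (@lebesgue_measure R).
Implicit Types (v w g F X Y : R -> R).
Local Notation H0 := (`[(0 : R), +oo[%classic).

Lemma weighted_mul (c : R) X Y : measurable_fun H0 X -> measurable_fun H0 Y ->
  mu.-integrable H0 (EFin \o (fun t => expR (- c * t) * X t ^+ 2)) ->
  mu.-integrable H0 (EFin \o (fun t => expR (- c * t) * Y t ^+ 2)) ->
  mu.-integrable H0 (EFin \o (fun t => expR (- c * t) * (X t * Y t))).
Proof.
move=> mX mY iX iY; have m0 := mitv `[(0 : R), +oo[.
have mE : measurable_fun H0 (EFin \o (fun t => expR (- c * t) * (X t * Y t))).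
  apply/measurable_EFinP; apply: measurable_funM; last exact: measurable_funM.
  by apply: measurable_funTS; apply: continuous_measurable_fun; exact: continuous_expRZ.
apply: (le_integrable m0 mE _ (integrableD m0 iX iY)) => t _ /=.
rewrite -?EFinD lee_fin [leRHS]ger0_norm; last by rewrite addr_ge0// mulr_ge0 ?expR_ge0 ?sqr_ge0.
rewrite normrM ger0_norm ?expR_ge0// -mulrDr; apply: (ler_wpM2l (expR_ge0 _)).
rewrite normrM -(sqr_normr (X t)) -(sqr_normr (Y t)).
have := sqr_ge0 (`|X t| - `|Y t|); rewrite sqrrB.
have := mulr_ge0 (normr_ge0 (X t)) (normr_ge0 (Y t)); lra.
Qed.

(** A Hardy inequality with exponential weight: [(expR (- b * t) * v ^+ 2)'] is at most
    [expR (- b * t)] times [2 / b * w ^+ 2 - b / 2 * v ^+ 2]. It controls a function by its initial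
    value and its derivative, and with [weighted_mul] it makes every product in [key_identity]
    integrable. *)
Lemma hardy (b : R) v w : 0 < b -> prim v w ->
  mu.-integrable H0 (EFin \o (fun t => expR (- b * t) * w t ^+ 2)) ->
  mu.-integrable H0 (EFin \o (fun t => expR (- b * t) * v t ^+ 2)) /\
  \int[mu]_(t in H0) (expR (- b * t) * v t ^+ 2) <=
    2 / b * v 0 ^+ 2 + 4 / b ^+ 2 * \int[mu]_(t in H0) (expR (- b * t) * w t ^+ 2).
Proof.
move=> b0 vw iw; have pv := prim_expM (- b) (prim_sq vw); have [iz E] := pv.
have mv : measurable_fun H0 (fun t => expR (- b * t) * v t ^+ 2).
  by apply: measurable_halfline => T; exact: prim_measurable pv.
have ip T : mu.-integrable `[0, T] (EFin \o (fun t => expR (- b * t) * v t ^+ 2)).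
  exact: prim_integrable pv.
apply: halfline_le => // [t _|T T0]; first by rewrite mulr_ge0 ?expR_ge0 ?sqr_ge0.
have mT := mitv `[0, T]; have iwT := integrable_halfline_sub T iw.
have i1 : mu.-integrable `[0, T] (EFin \o (fun t => 2 / b * (expR (- b * t) * w t ^+ 2))).
  by have := integrableZl mT (2 / b) iwT; apply: eq_integrable.
have i2 : mu.-integrable `[0, T] (EFin \o (fun t => b / 2 * (expR (- b * t) * v t ^+ 2))).
  by have := integrableZl mT (b / 2) (ip T); apply: eq_integrable.
have i3 : mu.-integrable `[0, T] (EFin \o (fun t => 2 / b * (expR (- b * t) * w t ^+ 2) - b / 2 * (expR (- b * t) * v t ^+ 2))).
  by have := integrableB mT i1 i2; apply: eq_integrable.
have K : \int[mu]_(t in `[0, T]) (expR (- b * t) * (- b * v t ^+ 2 + 2 * (w t * v t))) <=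
   2 / b * \int[mu]_(t in `[0, T]) (expR (- b * t) * w t ^+ 2) - b / 2 * \int[mu]_(t in `[0, T]) (expR (- b * t) * v t ^+ 2).
  rewrite -(RintegralZl _ mT iwT) -(RintegralZl _ mT (ip T)) -(RintegralB mT i1 i2).
  apply: (le_Rint mT (iz T) i3) => t _.
  have -> : 2 / b * (expR (- b * t) * w t ^+ 2) - b / 2 * (expR (- b * t) * v t ^+ 2) =
    expR (- b * t) * (- b * v t ^+ 2 + 2 * (w t * v t)) + expR (- b * t) * ((2 * b)^-1 * (b * v t - 2 * w t) ^+ 2).
    by field; rewrite gt_eqF.
  rewrite lerDl mulr_ge0 ?expR_ge0// mulr_ge0 ?sqr_ge0// invr_ge0 mulr_ge0// ltW//.
have W : \int[mu]_(t in `[0, T]) (expR (- b * t) * w t ^+ 2) <= \int[mu]_(t in H0) (expR (- b * t) * w t ^+ 2).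
  rewrite (Rint_split T0 iw) lerDl; apply: Rintegral_ge0 => t _.
  by rewrite mulr_ge0 ?expR_ge0 ?sqr_ge0.
have := E T T0; rewrite mulr0 expR0 mul1r => ET.
have vT : 0 <= expR (- b * T) * v T ^+ 2 by rewrite mulr_ge0 ?expR_ge0 ?sqr_ge0.
have b2 : 0 < b / 2 by rewrite divr_gt0.
rewrite -(ler_pM2l b2).
have -> : b / 2 * (2 / b * v 0 ^+ 2 + 4 / b ^+ 2 * \int[mu]_(t in H0) (expR (- b * t) * w t ^+ 2)) =
  v 0 ^+ 2 + 2 / b * \int[mu]_(t in H0) (expR (- b * t) * w t ^+ 2) by field; rewrite gt_eqF.
have := ler_wpM2l (ltW (divr_gt0 (ltr0n R 2 : 0 < 2) b0)) W.
move: K ET vT; set I1 := \int[mu]_(t in `[0, T]) (_ * (_ + _)); set V0 := v 0 ^+ 2; lra.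
Qed.

Definition Jdens (e L : R) F v w (t : R) : R :=
  expR (- e^-1 * t) * (e / 2 * w t ^+ 2 + 2^-1 * (L * v t ^+ 2) - F t * v t).

Definition Sdens (e b : R) g v w (t : R) : R :=
  expR (- e^-1 * t) * (e / 2 * (w t + b * v t - g t) ^+ 2).

Variables (e L a b : R) (F g : R -> R).
Hypothesis e0 : 0 < e.
Hypothesis ea : e * a = 1 + e * b.
Hypothesis eb : e * b ^+ 2 + b = L.
Hypothesis pg : prim g (fun t => a * g t - e^-1 * F t).
Hypothesis mF : measurable_fun [set: R] F.
Hypothesis iF : mu.-integrable H0 (EFin \o (fun t => expR (- e^-1 * t) * F t ^+ 2)).
Hypothesis ig : mu.-integrable H0 (EFin \o (fun t => expR (- e^-1 * t) * g t ^+ 2)).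

Definition Cdens (h0 : R) : R :=
  e * b / 2 * h0 ^+ 2 - e * g 0 * h0 - \int[mu]_(t in H0) (expR (- e^-1 * t) * (e / 2 * g t ^+ 2)).

Lemma key_identity v w : prim v w -> mu.-integrable H0 (EFin \o (fun t => expR (- e^-1 * t) * w t ^+ 2)) ->
  mu.-integrable H0 (EFin \o Jdens e L F v w) /\ mu.-integrable H0 (EFin \o Sdens e b g v w) /\
  \int[mu]_(t in H0) Jdens e L F v w t = \int[mu]_(t in H0) Sdens e b g v w t + Cdens (v 0).
Proof.
move=> vw iw; have m0 := mitv `[(0 : R), +oo[.
have ei : 0 < e^-1 by rewrite invr_gt0.
have [iv _] := hardy ei vw iw.
have mv : measurable_fun H0 v by apply: measurable_halfline => T; exact: prim_measurable vw.
have mw : measurable_fun H0 w by apply: measurable_halfline => T; exact: prim_measurable_deriv vw.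
have mg : measurable_fun H0 g by apply: measurable_halfline => T; exact: prim_measurable pg.
have mF0 : measurable_fun H0 F by exact: measurable_funTS.
have ivw := weighted_mul mv mw iv iw; have ivg := weighted_mul mv mg iv ig.
have iwg := weighted_mul mw mg iw ig; have iFv := weighted_mul mF0 mv iF iv.
pose E t := expR (- e^-1 * t).
(* Every density below is a combination of these seven products, so integrability is checked once
   and for all. *)
have lin (c1 c2 c3 c4 c5 c6 c7 : R) : mu.-integrable H0 (EFin \o (fun t => c1 * (E t * w t ^+ 2) + c2 * (E t * v t ^+ 2)
   + c3 * (E t * (v t * w t)) + c4 * (E t * (v t * g t)) + c5 * (E t * (w t * g t)) + c6 * (E t * (F t * v t)) + c7 * (E t * g t ^+ 2))).
  have zz c X : mu.-integrable H0 (EFin \o X) -> mu.-integrable H0 (EFin \o (fun t => c * X t)).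
    by move=> iX; have := integrableZl m0 c iX; apply: eq_integrable.
  have dd X Y : mu.-integrable H0 (EFin \o X) -> mu.-integrable H0 (EFin \o Y) -> mu.-integrable H0 (EFin \o (fun t => X t + Y t)).
    by move=> iX iY; have := integrableD m0 iX iY; apply: eq_integrable.
  apply: (dd); last exact: zz. apply: (dd); last exact: zz. apply: (dd); last exact: zz.
  apply: (dd); last exact: zz. apply: (dd); last exact: zz. by apply: (dd); exact: zz.
have jJ : mu.-integrable H0 (EFin \o Jdens e L F v w).
  have := lin (e / 2) (2^-1 * L) 0 0 0 (- 1) 0; apply: eq_integrable => // t _ /=.
  by rewrite /Jdens -/(E t); congr EFin; ring.
have jS : mu.-integrable H0 (EFin \o Sdens e b g v w).
  have := lin (e / 2) (e / 2 * b ^+ 2) (e * b) (- e * b) (- e) 0 (e / 2); apply: eq_integrable => // t _ /=.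
  by rewrite /Sdens -/(E t); congr EFin; field.
(* The exact derivative that separates the two densities is that of
   [e * E * (g * v - b / 2 * v ^+ 2)]. By [prim_vanish] it contributes minus the initial value of
   this function, which is the first part of [Cdens]. *)
pose phi t := e * E t * (- e^-1 * (- (b / 2) * v t ^+ 2 + g t * v t) + (- b * (w t * v t) + ((a * g t - e^-1 * F t) * v t + w t * g t))).
have pP : prim (fun t => e * (E t * (- (b / 2) * v t ^+ 2 + g t * v t))) phi.
  apply: (eq_prim (primZ e (prim_expM (- e^-1) (primD (primZ (- (b / 2)) (prim_sq vw)) (prim_mul pg vw))))) => t t0 //=.
  by rewrite /phi /E; field; rewrite gt_eqF.
have jphi : mu.-integrable H0 (EFin \o phi).
  have := lin 0 (b / 2) (- e * b) (e * a - 1) e (- 1) 0; apply: eq_integrable => // t _ /=.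
  by rewrite /phi; congr EFin; field; rewrite gt_eqF.
have jP : mu.-integrable H0 (EFin \o (fun t => e * (E t * (- (b / 2) * v t ^+ 2 + g t * v t)))).
  have := lin 0 (- (e * b / 2)) 0 e 0 0 0; apply: eq_integrable => // t _ /=.
  by congr EFin; field.
have V := prim_vanish pP jP jphi.
have jG : mu.-integrable H0 (EFin \o (fun t => E t * (e / 2 * g t ^+ 2))).
  have := lin 0 0 0 0 0 0 (e / 2); apply: eq_integrable => // t _ /=; congr EFin; ring.
split=> //; split=> //.
have -> : \int[mu]_(t in H0) Jdens e L F v w t = \int[mu]_(t in H0) (Sdens e b g v w t - E t * (e / 2 * g t ^+ 2) + phi t).
  apply: eq_Rintegral => t _; rewrite /Jdens /Sdens /phi -/(E t) -eb.
  have -> : e * E t * (- e^-1 * (- (b / 2) * v t ^+ 2 + g t * v t) + (- b * (w t * v t) + ((a * g t - e^-1 * F t) * v t + w t * g t))) =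
    E t * (b / 2 * v t ^+ 2 - g t * v t - e * b * (w t * v t) + e * a * (g t * v t) - F t * v t + e * (w t * g t)) by field; rewrite gt_eqF.
  by rewrite ea; field.
have jSG : mu.-integrable H0 (EFin \o (fun t => Sdens e b g v w t - E t * (e / 2 * g t ^+ 2))).
  by have := integrableB m0 jS jG; apply: eq_integrable.
rewrite (RintegralD m0 jSG jphi) (RintegralB m0 jS jG) V /Cdens /E mulr0 expR0 mul1r; ring.
Qed.

End key_identity.

(** * Functions of time with values in L2 *)

Section real_fubini.
Context d1 d2 (T1 : measurableType d1) (T2 : measurableType d2) (R : realType).
Variable m1 : {sigma_finite_measure set T1 -> \bar R}.
Variable m2 : {sigma_finite_measure set T2 -> \bar R}.
Variable f : T1 * T2 -> R.
Hypothesis jf : (m1 \x m2)%E.-integrable [set: T1 * T2] (EFin \o f).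

Lemma ae_EFin_inner1 : {ae m1, forall x, (\int[m2]_y (f (x, y))%:E)%E = (\int[m2]_y f (x, y))%:E}.
Proof.
have := ae_integrable1 jf; apply: filterS => x ix.
by rewrite /Rintegral fineK//; exact: integrable_fin_num ix.
Qed.

Lemma ae_EFin_inner2 : {ae m2, forall y, (\int[m1]_x (f (x, y))%:E)%E = (\int[m1]_x f (x, y))%:E}.
Proof.
have := ae_integrable2 jf; apply: filterS => x ix.
by rewrite /Rintegral fineK//; exact: integrable_fin_num ix.
Qed.

Let mf : measurable_fun [set: T1 * T2] f.
Proof. by move/measurable_int : jf => /measurable_EFinP. Qed.

Lemma measurable_Rinner1 : measurable_fun [set: T1] (fun x => \int[m2]_y f (x, y)).
Proof. exact: measurable_Rintegral_param. Qed.

Lemma measurable_Rinner2 : measurable_fun [set: T2] (fun y => \int[m1]_x f (x, y)).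
Proof.
apply: (measurable_Rintegral_param m1 (f := fun z : T2 * T1 => f (z.2, z.1))).
apply: (measurableT_comp mf); exact: (measurable_fun_pair measurable_snd measurable_fst).
Qed.

Lemma integrable_Rinner1 : m1.-integrable [set: T1] (EFin \o (fun x => \int[m2]_y f (x, y))).
Proof.
have /integrableP[mF iF] := integrable_fubini_F jf; apply/integrableP; split.
  by apply/measurable_EFinP; exact: measurable_Rinner1.
apply: le_lt_trans iF; rewrite le_eqVlt; apply/orP; left; apply/eqP.
apply: ae_eq_integral => //.
- by apply: measurableT_comp => //; apply/measurable_EFinP; exact: measurable_Rinner1.
- exact: measurableT_comp.
- by have := ae_EFin_inner1; apply: filterS => x /= + _; rewrite /fubini_F /= => ->.
Qed.

Lemma integrable_Rinner2 : m2.-integrable [set: T2] (EFin \o (fun y => \int[m1]_x f (x, y))).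
Proof.
have mfE : measurable_fun [set: T1 * T2] (EFin \o f) by exact/measurable_EFinP.
have /(integrable21ltyP m1 m2 mfE) iF := jf; apply/integrableP; split.
  by apply/measurable_EFinP; exact: measurable_Rinner2.
apply: le_lt_trans iF.
apply: (@le_trans _ _ (\int[m2]_y `|\int[m1]_x (f (x, y))%:E|)%E).
  rewrite le_eqVlt; apply/orP; left; apply/eqP; apply: ae_eq_integral => //.
  - by apply: measurableT_comp => //; apply/measurable_EFinP; exact: measurable_Rinner2.
  - by apply: measurableT_comp => //; exact: measurable_fubini_G jf.
  - by have := ae_EFin_inner2; apply: filterS => x /= + _ => ->.
have my y : measurable_fun [set: T1] (fun x => (f (x, y))%:E).
  by apply/measurable_EFinP; exact: (measurableT_comp mf (@pair2_measurable _ _ T1 T2 y)).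
apply: ge0_le_integral => //.
- by apply: measurableT_comp => //; exact: measurable_fubini_G jf.
- apply: (measurable_fun_fubini_tonelli_G (m1 := m1) (abse \o (EFin \o f))).
    exact: measurableT_comp.
  by move=> z; exact: abse_ge0.
- by move=> y _; exact: le_abse_integral.
Qed.

Lemma EFubini1 : (\int[m1]_x (\int[m2]_y f (x, y))%R%:E = \int[m1]_x \int[m2]_y (f (x, y))%:E)%E.
Proof.
apply: ae_eq_integral => //.
- by apply/measurable_EFinP; exact: measurable_Rinner1.
- exact: measurable_fubini_F jf.
- by have := ae_EFin_inner1; apply: filterS => x /= + _ => ->.
Qed.

Lemma EFubini2 : (\int[m2]_y (\int[m1]_x f (x, y))%R%:E = \int[m2]_y \int[m1]_x (f (x, y))%:E)%E.
Proof.
apply: ae_eq_integral => //.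
- by apply/measurable_EFinP; exact: measurable_Rinner2.
- exact: measurable_fubini_G jf.
- by have := ae_EFin_inner2; apply: filterS => x /= + _ => ->.
Qed.

Lemma RFubini : \int[m1]_x (\int[m2]_y f (x, y)) = \int[m2]_y (\int[m1]_x f (x, y)).
Proof. by rewrite {1 3}/Rintegral EFubini1 EFubini2 (Fubini jf). Qed.

End real_fubini.

(** * L2 of the product of time and space, and a jointly measurable Hartley transform *)

Section product_L2.
Context {R : realType} {N : nat}.
Local Notation E := 'rV[R]_N.
Local Notation mu := (@lebesgue_measure R).
Local Notation leb := (lebesgue_rV R N).
Local Notation T := (measurableTypeR R).
Local Notation M := (lebesgue_measure \x leb)%E.
Implicit Types (G W : R -> E -> R) (h v : E -> R).

Lemma ae_muI (P Q : R -> Prop) : {ae mu, forall t, P t} -> {ae mu, forall t, Q t} ->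
  {ae mu, forall t, P t /\ Q t}.
Proof. exact: (@filterI _ _ (ae_filter_ringOfSetsType mu)). Qed.

Definition unc G (z : T * E) : R := G z.1 z.2.
Definition jmeas G := measurable_fun [set: T * E] (unc G).

Lemma jmeas_t G (t : R) : jmeas G -> measurable_fun [set: E] (G t).
Proof. by move=> mG; exact: (measurableT_comp mG (@pair1_measurable _ _ T E t)). Qed.

Lemma jmeas_x G (x : E) : jmeas G -> measurable_fun [set: R] (G^~ x).
Proof. by move=> mG; exact: (measurableT_comp mG (@pair2_measurable _ _ T E x)). Qed.

Lemma jmeas_M G W : jmeas G -> jmeas W -> jmeas (fun t x => G t x * W t x).
Proof. by move=> mG mW; exact: measurable_funM. Qed.

Lemma jmeas_B G W : jmeas G -> jmeas W -> jmeas (fun t x => G t x - W t x).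
Proof. by move=> mG mW; exact: measurable_funB. Qed.

Lemma jmeas_fst (p : R -> R) : measurable_fun [set: R] p -> jmeas (fun t _ => p t).
Proof. by move=> mp; exact: (measurableT_comp mp measurable_fst). Qed.

Lemma jmeas_snd h : measurable_fun [set: E] h -> jmeas (fun _ x => h x).
Proof. by move=> mp; exact: (measurableT_comp mp measurable_snd). Qed.

Lemma measurable_sqint G : jmeas G -> measurable_fun [set: T] (fun t => sqint leb (G t)).
Proof.
move=> mG; apply: (measurable_integral_param leb (f := fun z : T * E => unc G z ^+ 2)).
exact: measurable_funX.
Qed.

Lemma sqint_unc G : jmeas G -> sqint M (unc G) = (\int[mu]_t sqint leb (G t))%E.
Proof.
move=> mG; rewrite /sqint (fubini_tonelli1 (m1 := mu) (m2 := leb)) //.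
- exact: measurable_sq.
- by move=> z; rewrite lee_fin sqr_ge0.
Qed.

Lemma sqint_unc2 G : jmeas G -> sqint M (unc G) = (\int[leb]_x sqint mu (G^~ x))%E.
Proof.
move=> mG; rewrite /sqint (fubini_tonelli2 (m1 := mu) (m2 := leb)) //.
- exact: measurable_sq.
- by move=> z; rewrite lee_fin sqr_ge0.
Qed.

Lemma ae_lty_integral d (X : measurableType d) (m : {measure set X -> \bar R}) (p : X -> \bar R) :
  measurable_fun [set: X] p -> (forall x, 0 <= p x)%E -> (\int[m]_x p x < +oo)%E ->
  {ae m, forall x, (p x < +oo)%E}.
Proof.
move=> mp p0 pf; have ip : m.-integrable [set: X] p.
  apply/integrableP; split=> //; apply: le_lt_trans pf; rewrite le_eqVlt; apply/orP; left; apply/eqP.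
  by apply: eq_integral => x _; rewrite gee0_abs.
have := integrable_ae measurableT ip; apply: filterS => x /(_ I).
by rewrite ge0_fin_numE.
Qed.

Lemma ae_L2_t G : L2 M (unc G) -> {ae mu, forall t, L2 leb (G t)}.
Proof.
move=> [mG fG]; rewrite sqint_unc// in fG.
have := @ae_lty_integral _ T mu _ (measurable_sqint mG) (fun t => sqint_ge0 leb (G t)) fG.
by apply: filterS => t Gt; split=> //; exact: jmeas_t.
Qed.

Lemma ae_L2_x G : L2 M (unc G) -> {ae leb, forall x, L2 mu (G^~ x)}.
Proof.
move=> [mG fG]; rewrite sqint_unc2// in fG.
have mG' : measurable_fun [set: E] (fun x => sqint mu (G^~ x)).
  apply: (measurable_integral_param mu (f := fun z : E * T => unc G (z.2, z.1) ^+ 2)).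
  apply: measurable_funX; apply: (measurableT_comp mG).
  exact: (measurable_fun_pair measurable_snd measurable_fst).
have := ae_lty_integral mG' (fun x => sqint_ge0 mu (G^~ x)) fG.
by apply: filterS => t Gt; split=> //; exact: jmeas_x.
Qed.

(** The Hartley integrals of the truncations of [G] are jointly measurable, and by the isometry at
    almost every time they form a Cauchy sequence in L2 of the product. Their limit is the version
    sought; at almost every time it must be identified with [hart (G t)]. *)
Lemma hart_version G : L2 M (unc G) -> exists W, [/\ jmeas W, L2 M (unc W) &
  {ae mu, forall t, {ae leb, forall xi, W t xi = hart (G t) xi}}].
Proof.
move=> LG; have [mG fG] := LG.
pose Gn n t x := trunc n (G t) x.
have mGn n : jmeas (Gn n).
  by apply: measurable_funM => //; exact: jmeas_snd (L2_cube n).1.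
have LGn n : L2 M (unc (Gn n)).
  apply: L2_le (mGn n) LG _ => z; rewrite /unc /Gn /trunc normrM ler_piMr//.
  by rewrite indicE ger0_norm// lern1 leq_b1.
have cGn : sqint M (unc (Gn n) \- unc G) @[n --> \oo] --> 0%E.
  apply: (L2_dominated mGn mG (L2_abs LG)); last first.
    move=> n; apply: aeW => z; rewrite /unc /Gn /trunc indicE; case: (_ \in _) => /=.
      by rewrite mulr1 subrr normr0.
    by rewrite mulr0 sub0r normrN.
  apply: aeW => z; apply: cvg_near_cst.
  have : (\bigcup_k cube k) z.2 by rewrite bigcup_cube.
  move=> [k _ zk]; exists k => // n /= kn; rewrite /unc /Gn /trunc indicE mem_set ?mulr1//.
  by have /subsetPset := @cube_nd R N _ _ kn; apply.
pose Hn n t xi := hartI (Gn n t) xi.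
have mHn n : jmeas (Hn n).
  apply: measurable_funM => //.
  apply: (measurable_Rintegral_param leb (f := fun z : (T * E) * E => Gn n z.1.1 z.2 * cas (dotp z.2 z.1.2))).
  apply: measurable_funM.
    have := measurableT_comp (mGn n) (measurable_fun_pair (measurableT_comp (@measurable_fst _ _ T E) (@measurable_fst _ _ (T * E)%type E)) (@measurable_snd _ _ (T * E)%type E)).
    exact.
  rewrite (_ : (fun z : (T * E) * E => _) = (fun z : (T * E) * E => cas (dotp z.1.2 z.2))).
    have := measurableT_comp (@measurable_cas2 R N) (measurable_fun_pair (measurableT_comp (@measurable_snd _ _ T E) (@measurable_fst _ _ (T * E)%type E)) (@measurable_snd _ _ (T * E)%type E)).
    exact.
  by apply/funext => z; rewrite dotpC.
have aeL := ae_L2_t LG.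
have dist n p : sqint M (unc (Hn n) \- unc (Hn p)) = sqint M (unc (Gn n) \- unc (Gn p)).
  have -> : unc (Hn n) \- unc (Hn p) = unc (fun t x => Hn n t x - Hn p t x) by [].
  have -> : unc (Gn n) \- unc (Gn p) = unc (fun t x => Gn n t x - Gn p t x) by [].
  rewrite !sqint_unc; [|exact: jmeas_B|exact: jmeas_B].
  apply: ae_eq_integral => //; [exact: measurable_sqint (jmeas_B _ _)|exact: measurable_sqint (jmeas_B _ _)|].
  apply: ae_muS aeL => t Lt _.
  have [L1n L2n] : L1 (Gn n t) /\ L2 leb (Gn n t) by split; [exact: trunc_L1|exact: trunc_L2].
  have [L1p L2p] : L1 (Gn p t) /\ L2 leb (Gn p t) by split; [exact: trunc_L1|exact: trunc_L2].
  have i1 : L1 (Gn n t \- Gn p t) by have := integrableB measurableT L1n L1p; apply: eq_integrable.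
  rewrite -[RHS](hartI_isometry i1 (L2B L2n L2p)).2; congr sqint; apply/funext => xi.
  by rewrite hartIB.
have LHn n : L2 M (unc (Hn n)).
  split; first exact: mHn.
  rewrite (sqint_unc (mHn n)).
  have -> : (\int[mu]_t sqint leb (Hn n t) = \int[mu]_t sqint leb (Gn n t))%E.
    apply: ae_eq_integral => //; [exact: measurable_sqint|exact: measurable_sqint|].
    apply: ae_muS aeL => t Lt _.
    exact: (hartI_isometry (trunc_L1 n Lt) (trunc_L2 n Lt)).2.
  by rewrite -(sqint_unc (mGn n)); exact: (LGn n).2.
have [W0 [LW0 cW0]] : exists h : T * E -> R, L2 M h /\ sqint M (unc (Hn n) \- h) @[n --> \oo] --> 0%E.
  apply: L2_complete => // e e0.
  have e4 : 0 < e / 4 by rewrite divr_gt0.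
  have := cGn; move/(cvge0P _ (fun k => sqint_ge0 M _)) => /(_ _ e4) [n _ Hc].
  exists n => p q np nq; rewrite dist.
  have -> : unc (Gn p) \- unc (Gn q) = (unc (Gn p) \- unc G) \+ (unc G \- unc (Gn q)).
    by apply/funext => z /=; ring.
  apply: (le_trans (sqintD_le M (measurable_funB (mGn p) mG) (measurable_funB mG (mGn q)))).
  have h1 := Hc p np; have h2 := Hc q nq; rewrite sqintBC in h2.
  apply: (@le_trans _ _ (2%:E * (e / 4)%:E + 2%:E * (e / 4)%:E)%E).
    by apply: leeD; apply: lee_wpmul2l.
  by rewrite -!EFinM -EFinD lee_fin; lra.
pose W t x := W0 (t, x).
have WE : unc W = W0 by apply/funext => -[t x].
have mW : jmeas W by rewrite /jmeas WE; exact: LW0.1.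
exists W; split=> //; first by rewrite WE.
have mD n : jmeas (fun t x => Hn n t x - W t x) by exact: jmeas_B.
(* Convergence in L2 of the product says nothing at a fixed time along the full sequence. Fatou's
   lemma in time shows that the lower limit of the distances at time [t] is 0 for almost every [t],
   and this suffices. *)
have F := @fatou _ T R mu _ measurableT (fun n t => sqint leb (Hn n t \- W t)) (fun n => measurable_sqint (mD n)) (fun n t _ => sqint_ge0 leb _).
have mL : measurable_fun [set: T] (fun t => limn_einf (fun n => sqint leb (Hn n t \- W t))).
  rewrite (_ : (fun x => _) = (fun x => - limn_esup (fun n => - sqint leb (Hn n x \- W x)))%E).
    apply: measurableT_comp => //; apply: measurable_fun_limn_esup => n.
    by apply: measurableT_comp => //; exact: (measurable_sqint (mD n)).
  by apply/funext => x; rewrite (limn_esupN (fun n => sqint leb (Hn n x \- W x))) oppeK.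
have L0 t : (0 <= limn_einf (fun n => sqint leb (Hn n t \- W t)))%E.
  rewrite limn_einf_lim; apply: lime_ge; first exact: is_cvg_einfs.
  by apply: nearW => n; apply: le_ereal_inf_tmp => _ [k _ <-]; exact: sqint_ge0.
have I0 : (\int[mu]_t limn_einf (fun n => sqint leb (Hn n t \- W t)) = 0)%E.
  apply/eqP; rewrite eq_le; apply/andP; split; last exact: integral_ge0.
  apply: (le_trans F); rewrite (_ : (fun n => _) = (fun n => sqint M (unc (Hn n) \- W0))).
    by have [-> _] := cvg_limn_einf_sup cW0.
  apply/funext => n; rewrite -WE; have -> : unc (Hn n) \- unc W = unc (fun t x => Hn n t x - W t x) by [].
  by rewrite sqint_unc.
have aeI : {ae mu, forall t, limn_einf (fun n => sqint leb (Hn n t \- W t)) = 0%E}.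
  have E : (\int[mu]_t `|limn_einf (fun n => sqint leb (Hn n t \- W t))| = 0)%E.
    by rewrite -[RHS]I0; apply: eq_integral => t _; rewrite gee0_abs.
  have := (@ae_eq_integral_abs _ T R mu _ measurableT _ mL).1 E.
  by apply: ae_muS => t /(_ I).
have := ae_muI aeI (ae_muI aeL (ae_L2_t (G := W) (eq_ind_r (L2 M) LW0 WE))).
apply: ae_muS => t [t0 [Lt LWt]].
have [LHt _ cH] := trunc_hart Lt.
apply: sqint_sub_eq0; [exact: LWt.1|exact: (L2_hart Lt).1|].
apply/eqP; rewrite eq_le sqint_ge0 andbT; apply/lee_addgt0Pr => e e0; rewrite add0e.
have e4 : 0 < e / 4 by rewrite divr_gt0.
have [n0 _ Hc] := (cvge0P _ (fun k => sqint_ge0 leb _)).2 cH _ e4.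
(* A lower limit equal to 0 provides, beyond any index, one [n] close to [W t]; the approximations
   at [t] are all close to [hart (G t)] beyond [n0]. *)
have [n nn0 Hn4] : exists2 n, (n0 <= n)%N & (sqint leb (Hn n t \- W t) <= (e / 4)%:E)%E.
  apply/not_exists2P => Hno.
  have : ((e / 4)%:E <= limn_einf (fun n => sqint leb (Hn n t \- W t)))%E.
    rewrite limn_einf_lim; apply: lime_ge; first exact: is_cvg_einfs.
    exists n0 => // n /= n0n; apply: le_ereal_inf_tmp => _ [k /= nk <-].
    have [/(_ (leq_trans n0n nk))//|/negP] := Hno k.
    by rewrite -ltNge => /ltW.
  by rewrite t0 lee_fin; lra.
have -> : W t \- hart (G t) = (W t \- Hn n t) \+ (Hn n t \- hart (G t)) by apply/funext => x /=; ring.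
have mHt : measurable_fun [set: E] (Hn n t) by exact: jmeas_t.
apply: (le_trans (sqintD_le leb (measurable_funB LWt.1 mHt) (measurable_funB mHt (L2_hart Lt).1))).
rewrite sqintBC in Hn4; have h2 := Hc n nn0.
apply: (@le_trans _ _ (2%:E * (e / 4)%:E + 2%:E * (e / 4)%:E)%E).
  by apply: leeD; apply: lee_wpmul2l.
by rewrite -!EFinM -EFinD lee_fin; lra.
Qed.

End product_L2.

(** * Weighted L2 spaces on the half-line and integration in time *)

Section weighted_functions.
Context {R : realType} {N : nat}.
Local Notation E := 'rV[R]_N.
Local Notation mu := (@lebesgue_measure R).
Local Notation leb := (lebesgue_rV R N).
Local Notation T := (measurableTypeR R).
Local Notation M := (lebesgue_measure \x leb)%E.
Implicit Types (G W : R -> E -> R) (h v : E -> R).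

Definition wL2 (c : R) G := jmeas G /\
  (\int[mu]_(t in `[(0 : R)%R, +oo[) ((expR (- c * t))%:E * sqint leb (G t)) < +oo)%E.

(** The square root of the exponential weight, cut at time 0: multiplication by it identifies
    [wL2 c] with a subset of the plain L2 of the product. *)
Definition wt (c t : R) : R := expR (- (c / 2) * t) * \1_(`[(0 : R), +oo[%classic : set R) t.
Definition wtG c G (t : R) (x : E) : R := wt c t * G t x.

Lemma measurable_wt c : measurable_fun [set: T] (wt c).
Proof.
apply: measurable_funM; last exact: measurable_indic_itv.
by apply: continuous_measurable_fun; exact: continuous_expRZ.
Qed.

Lemma jmeas_wtG c G : jmeas G -> jmeas (wtG c G).
Proof. by move=> mG; apply: (@jmeas_M _ _ (fun t _ => wt c t) G) => //; exact: jmeas_fst (measurable_wt c). Qed.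

Lemma wt_sq c t : wt c t ^+ 2 = expR (- c * t) * \1_(`[(0 : R), +oo[%classic : set R) t.
Proof.
rewrite /wt exprMn -expRM_natl; congr (expR _ * _); first by field.
by rewrite indicE; case: (_ \in _); rewrite ?expr1n ?expr0n.
Qed.

Lemma wL2P c G : jmeas G -> wL2 c G <-> L2 M (unc (wtG c G)).
Proof.
move=> mG; have mw := jmeas_wtG c mG; rewrite /wL2 /L2 (sqint_unc mw).
suff -> : (\int[mu]_t sqint leb (wtG c G t) = \int[mu]_(t in `[(0 : R)%R, +oo[) ((expR (- c * t))%:E * sqint leb (G t)))%E by tauto.
rewrite [RHS]integral_mkcond; apply: eq_integral => t _.
rewrite (sqintZ leb (wt c t) (jmeas_t t mG)) wt_sq patchE indicE.
by case: ifPn => tI; rewrite ?mulr1 ?mulr0 ?mul0e.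
Qed.

Lemma wt_ge0 c t : 0 <= t -> wt c t = expR (- (c / 2) * t).
Proof. by move=> t0; rewrite /wt indicE mem_set ?mulr1//= in_itv/= andbT. Qed.

Lemma wL2_ae_t c G : wL2 c G -> {ae mu, forall t, 0 <= t -> L2 leb (G t)}.
Proof.
move=> wG; have mG := wG.1; have /(wL2P c mG)/ae_L2_t := wG.
apply: ae_muS => t Lt t0; have := L2Z (expR (c / 2 * t)) Lt.
congr L2; apply/funext => x; rewrite /wtG wt_ge0// mulrA -expRD mulNr addrN expR0 mul1r//.
Qed.

Lemma wL2_wdata c G : wL2 c G -> {ae leb, forall x, wdata c (G^~ x)}.
Proof.
move=> wG; have mG := wG.1; have /(wL2P c mG)/ae_L2_x := wG.
apply: filterS => x Lx; split; first exact: jmeas_x.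
have := integrableS measurableT (mitv `[(0 : R), +oo[) (@subsetT _ _) (L2_integrable Lx).
apply: eq_integrable => // t; rewrite inE/= in_itv/= andbT => t0.
by rewrite /wtG exprMn wt_sq indicE mem_set ?mulr1//= in_itv/= andbT.
Qed.

Definition tint G (t : R) (x : E) : R := \int[mu]_(s in `[0, t]) G s x.

Lemma tintE G t x : tint G t x = \int[mu]_s (((0 <= s) && (s <= t))%:R * G s x).
Proof.
rewrite /tint Rintegral_mkcond; apply: eq_Rintegral => s _; rewrite patchE.
case: ifPn => [|]; first by rewrite inE/= in_itv/= => ->; rewrite mul1r.
by rewrite notin_setE/= in_itv/= => /negP/negbTE ->; rewrite mul0r.
Qed.

Lemma jmeas_tint G : jmeas G -> jmeas (tint G).
Proof.
move=> mG; rewrite /jmeas (_ : unc (tint G) = (fun z : T * E => \int[mu]_s (((0 <= s) && (s <= z.1))%:R * G s z.2))); last first.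
  by apply/funext => z; rewrite /unc tintE.
apply: (measurable_Rintegral_param mu (f := fun u : (T * E) * T => ((0 <= u.2) && (u.2 <= u.1.1))%:R * G u.2 u.1.2)).
have m1 : measurable_fun [set: (T * E) * T] (fun u : (T * E) * T => u.1.1).
  exact: (measurableT_comp (@measurable_fst _ _ T E) (@measurable_fst _ _ (T * E)%type T)).
have m2 : measurable_fun [set: (T * E) * T] (fun u : (T * E) * T => u.2) by exact: measurable_snd.
apply: measurable_funM.
  apply: (@measurableT_comp _ _ _ _ _ _ (fun b : bool => b%:R : R)) => //.
  by apply: measurable_and; apply: measurable_fun_ler => //; exact: measurable_cst.
have m3 : measurable_fun [set: (T * E) * T] (fun u : (T * E) * T => u.1.2).
  exact: (measurableT_comp (@measurable_snd _ _ T E) (@measurable_fst _ _ (T * E)%type T)).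
exact: (measurableT_comp mG (measurable_fun_pair m2 m3)).
Qed.

(** The inverse weight on [[0, b]]: with it, [tint G b x] becomes an inner product in L2 of time
    with the weighted function, and Cauchy-Schwarz applies. *)
Definition wker (c b s : R) : R := expR (c / 2 * s) * \1_(`[0, b]%classic : set R) s.

Lemma measurable_wker c b : measurable_fun [set: T] (wker c b).
Proof.
apply: measurable_funM; last exact: measurable_indic_itv.
by apply: continuous_measurable_fun; exact: continuous_expRZ.
Qed.

Lemma L2_wker c b : 0 <= c -> L2 mu (wker c b).
Proof.
move=> c0; have mI : (mu `[(0 : R)%R, b]%classic < +oo)%E.
  have := lebesgue_measure_itv `[0, b]; rewrite /= => E; apply: (@le_lt_trans _ _ (if (0%:E < b%:E)%E then (b%:E - 0%:E) else 0)%E).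
    by rewrite -E.
  by case: ifP => _; rewrite ?ltry// -EFinB ltry.
apply: L2_le (measurable_wker c b) (L2Z (expR (c / 2 * b)) (L2_indic (mitv `[0, b]) mI)) _ => s.
rewrite /wker !indicE; case: (boolP (s \in _)) => sI; rewrite ?mulr0 ?normr0// !mulr1 !ger0_norm ?expR_ge0//.
rewrite ler_expR ler_wpM2l ?divr_ge0//; by move: sI; rewrite inE/= in_itv/= => /andP[].
Qed.

Lemma wker_wt c b s x G : wtG c G s x * wker c b s = ((0 <= s) && (s <= b))%:R * G s x.
Proof.
rewrite /wtG /wker /wt !indicE; case: (boolP ((0 <= s) && (s <= b))) => [sI|sI].
  have /andP[s0 _] := sI; rewrite !mem_set ?in_itv/= ?s0 ?sI//= ?in_itv/= ?s0 ?sI//= !mulr1.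
  by rewrite mulrAC -expRD mulNr addNr expR0.
have -> : (s \in `[0, b]%classic) = false.
  by apply/negbTE; rewrite notin_setE /= in_itv/=; exact/negP.
by rewrite !mulr0 mul0r.
Qed.

Lemma tint_L2 c G b : wL2 c G -> 0 <= c -> L2 leb (tint G b).
Proof.
move=> wG c0; have mG := wG.1; have Lw := (wL2P c mG).1 wG; have Lk := L2_wker b c0.
split; first exact: jmeas_t (jmeas_tint mG).
have mw := jmeas_wtG c mG.
have mx : measurable_fun [set: E] (fun x => sqint mu ((wtG c G)^~ x)).
  apply: (measurable_integral_param mu (f := fun z : E * T => unc (wtG c G) (z.2, z.1) ^+ 2)).
  apply: measurable_funX; apply: (measurableT_comp mw).
  exact: (measurable_fun_pair measurable_snd measurable_fst).
apply: (@le_lt_trans _ _ (\int[leb]_x ((nrm mu (wker c b) ^+ 2)%:E * sqint mu ((wtG c G)^~ x)))%E); last first.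
  rewrite (ge0_integralZl leb measurableT mx (fun x _ => sqint_ge0 mu _)) ?lee_fin ?sqr_ge0//.
  rewrite -(sqint_unc2 mw) muleC lte_mul_pinfty ?sqint_ge0// ?ltry//.
  by rewrite ge0_fin_numE ?sqint_ge0//; exact: Lw.2.
apply: ae_ge0_le_integral => //.
- by move=> x _; rewrite lee_fin sqr_ge0.
- exact: measurable_sq (jmeas_t b (jmeas_tint mG)).
- by move=> x _; rewrite mule_ge0 ?sqint_ge0// lee_fin sqr_ge0.
- exact: measurable_funeM.
have := ae_L2_x Lw; apply: filterS => x Lx _.
have -> : tint G b x = ip mu ((wtG c G)^~ x) (wker c b).
  by rewrite tintE; apply: eq_Rintegral => s _; rewrite wker_wt.
rewrite (sqint_nrm Lx) -EFinM lee_fin -sqr_normr -exprMn mulrC lerXn2r ?nnegrE ?mulr_ge0 ?nrm_ge0//.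
exact: cauchy_schwarz.
Qed.

Lemma tint_ip c G b h : wL2 c G -> 0 <= c -> L2 leb h ->
  ip leb (tint G b) h = \int[mu]_s (((0 <= s) && (s <= b))%:R * ip leb (G s) h).
Proof.
move=> wG c0 Lh; have mG := wG.1; have Lw := (wL2P c mG).1 wG; have Lk := L2_wker b c0.
have mk : jmeas (fun s x => wker c b s * h x).
  by apply: (@jmeas_M _ _ (fun s _ => wker c b s) (fun _ x => h x)); [exact: jmeas_fst (measurable_wker c b)|exact: jmeas_snd Lh.1].
have Lkh : L2 M (unc (fun s x => wker c b s * h x)).
  split=> //; rewrite (sqint_unc mk).
  have -> : (\int[mu]_t sqint leb (fun x => wker c b t * h x)%R = \int[mu]_t ((wker c b t ^+ 2)%:E * sqint leb h))%E.
    by apply: eq_integral => s _; rewrite (sqintZ leb _ Lh.1).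
  rewrite ge0_integralZr//.
  - rewrite -/(sqint mu _) lte_mul_pinfty ?sqint_ge0//; last exact: Lh.2.
    by rewrite ge0_fin_numE ?sqint_ge0//; exact: Lk.2.
  - exact: measurable_sq (measurable_wker c b).
  - by move=> s _; rewrite lee_fin sqr_ge0.
  - exact: sqint_ge0.
have jf := L2_mul Lw Lkh.
have := RFubini jf.
have -> : \int[leb]_y (\int[mu]_x (unc (wtG c G) (x, y) * unc (fun s x => wker c b s * h x) (x, y))) = ip leb (tint G b) h.
  apply: (congr1 fine); apply: ae_eq_integral => //.
  - by apply/measurable_EFinP; exact: (measurable_Rinner2 jf).
  - by apply/measurable_EFinP; apply: measurable_funM; [exact: jmeas_t (jmeas_tint mG)|exact: Lh.1].
  - have := ae_L2_x Lw; apply: filterS => x Lx _; congr EFin.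
    have -> : tint G b x = ip mu ((wtG c G)^~ x) (wker c b).
      by rewrite tintE; apply: eq_Rintegral => s _; rewrite wker_wt.
    rewrite mulrC /ip -(RintegralZl _ measurableT (L2_mul Lx Lk)); apply: eq_Rintegral => s _.
    by rewrite /unc /=; ring.
move=> <-; apply: (congr1 fine); apply: ae_eq_integral => //.
- by apply/measurable_EFinP; exact: (measurable_Rinner1 jf).
- apply/measurable_EFinP; apply: measurable_funM.
    apply: (@measurableT_comp _ _ _ _ _ _ (fun b : bool => b%:R : R)) => //.
    by apply: measurable_and; apply: measurable_fun_ler => //; exact: measurable_cst.
  apply: (measurable_Rintegral_param leb (f := fun z : T * E => unc G z * h z.2)).
  by apply: measurable_funM => //; exact: (measurableT_comp Lh.1 measurable_snd).
- have := wL2_ae_t wG; apply: ae_muS => s Ls _; congr EFin.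
  have [sI|sI] := boolP ((0 <= s) && (s <= b)); last first.
    rewrite mul0r; rewrite (_ : (fun y => _) = (fun=> 0)) ?Rintegral_cst//; last first.
      by apply/funext => y; rewrite /unc /= mulrA wker_wt (negbTE sI) !mul0r.
    by rewrite mul0r.
  have /andP[s0 _] := sI; rewrite mul1r; apply: eq_Rintegral => y _.
  by rewrite /unc /= mulrA wker_wt sI mul1r.
Qed.

(** Tested against [h]: the transform moves to [h] by symmetry, Fubini takes the inner product
    inside the time integral, and symmetry is used again at almost every time. *)
Lemma hart_tint c G W b : wL2 c G -> wL2 c W -> 0 <= c ->
  {ae mu, forall t, 0 <= t -> {ae leb, forall xi, W t xi = hart (G t) xi}} ->
  {ae leb, forall xi, hart (tint G b) xi = tint W b xi}.
Proof.
move=> wG wW c0 GW; have LG := tint_L2 b wG c0; have LW := tint_L2 b wW c0.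
apply: ip_eq => //; first exact: L2_hart.
move=> h Lh; rewrite (ip_hartC LG Lh) (tint_ip b wG c0 (L2_hart Lh)) (tint_ip b wW c0 Lh).
have meas (X : R -> E -> R) (k : E -> R) : jmeas X -> measurable_fun [set: E] k ->
    measurable_fun [set: T] (fun s : T => (((0 <= s) && (s <= b))%:R * ip leb (X s) k)%:E).
  move=> mX mk; apply/measurable_EFinP; apply: measurable_funM.
    apply: (@measurableT_comp _ _ _ _ _ _ (fun b : bool => b%:R : R)) => //.
    by apply: measurable_and; apply: measurable_fun_ler => //; exact: measurable_cst.
  apply: (measurable_Rintegral_param leb (f := fun z : T * E => unc X z * k z.2)).
  by apply: measurable_funM => //; exact: (measurableT_comp mk measurable_snd).
apply: (congr1 fine); apply: ae_eq_integral => //; [exact: meas wG.1 (L2_hart Lh).1|exact: meas wW.1 Lh.1|].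
have := ae_muI GW (ae_muI (wL2_ae_t wG) (wL2_ae_t wW)).
apply: ae_muS => s [Gs [LGs LWs]] _; congr EFin.
have [/andP[s0 _]|_] := boolP ((0 <= s) && (s <= b)); last by rewrite !mul0r.
rewrite !mul1r -(ip_hartC (LGs s0) Lh); apply: eq_ip => //.
- exact: L2_hart (LGs s0).
- exact: LWs.
- by have := Gs s0; apply: filterS => xi ->.
- exact: aeW.
Qed.

Lemma hartZ (a : R) v : L2 leb v -> {ae leb, forall xi, hart (fun x => a * v x) xi = a * hart v xi}.
Proof.
move=> Lv; have H := hartD a (L2_0 leb) Lv.
have H0 : {ae leb, forall xi, hart (fun=> 0 : R) xi = 0}.
  apply: sqint_eq0; first exact: (L2_hart (L2_0 leb)).1.
  by rewrite (sqint_hart (L2_0 leb)) /sqint integral0_eq// => x _; rewrite expr0n.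
have -> : (fun x => a * v x) = (fun x => 0 + a * v x) by apply/funext => x; rewrite add0r.
by apply: filterS2 H H0 => xi -> ->; rewrite add0r.
Qed.

Lemma wL2_hart c G : wL2 c G -> exists2 W, wL2 c W &
  {ae mu, forall t, 0 <= t -> {ae leb, forall xi, W t xi = hart (G t) xi}}.
Proof.
move=> wG; have mG := wG.1; have Lw := (wL2P c mG).1 wG.
have [W0 [mW0 LW0 HW0]] := hart_version Lw.
pose W t x := expR (c / 2 * t) * W0 t x.
have mW : jmeas W.
  apply: (@jmeas_M _ _ (fun t _ => expR (c / 2 * t)) W0) => //; apply: jmeas_fst.
  by apply: continuous_measurable_fun; exact: continuous_expRZ.
exists W.
  apply/(wL2P c mW); apply: L2_le (jmeas_wtG c mW) LW0 _ => -[t x]; rewrite /unc /wtG /W /=.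
  rewrite mulrA normrM ler_piMl// /wt mulrAC -expRD mulNr addNr expR0 mul1r indicE.
  by rewrite ger0_norm ?lern1 ?leq_b1.
have := ae_muI HW0 (wL2_ae_t wG).
apply: ae_muS => t [H Lt] t0; have Lt0 := Lt t0.
have := hartZ (wt c t) Lt0; apply: filterS2 H => xi; rewrite /W => -> /= E2.
rewrite (_ : wtG c G t = (fun x => wt c t * G t x))// E2 wt_ge0// mulrA -expRD mulNr addrN expR0.
by rewrite mul1r.
Qed.

End weighted_functions.

(** * Increments and uniqueness for the weak time derivative *)

Section weak_derivative.
Context {R : realType} {N : nat}.
Local Notation E := 'rV[R]_N.
Local Notation mu := (@lebesgue_measure R).
Local Notation leb := (lebesgue_rV R N).
Local Notation T := (measurableTypeR R).
Local Notation M := (lebesgue_measure \x leb)%E.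
Implicit Types (u g G W : R -> E -> R) (h v : E -> R) (A : set E).

(** An integral is continuous in its end point, so rational end points suffice. They are countable,
    and the exceptional null sets attached to them can be united. *)
Lemma integral0_dense (z : R -> R) : (forall b, mu.-integrable `[0, b] (EFin \o z)) ->
  (forall j k : nat, \int[mu]_(s in `[0, j%:R / k.+1%:R]) z s = 0) -> {ae mu, forall t, 0 < t -> z t = 0}.
Proof.
move=> iz z0; apply: integral0_ae => // t t0.
have [->|tn0] := eqVneq t 0; first by rewrite set_itv1 Rintegral_set1.
have tp : 0 < t by rewrite lt_neqAle eq_sym tn0.
have py := prim_int 0 iz; have T0 : 0 <= t + 1 by rewrite addr_ge0.
have := prim_continuous T0 py => /(continuous_within_itvP _ (ltr_wpDl t0 ltr01))[ct _ _].
have tI : t \in `]0, t + 1[ by rewrite in_itv/= tp ltrDl ltr01.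
have {}ct := ct t tI.
pose tk (k : nat) : R := (Num.truncn (t * k.+1%:R))%:R / k.+1%:R.
have ctk : tk k @[k --> \oo] --> t.
  apply/cvgrPdist_le => e e0; near=> k.
  have k0 : 0 < k.+1%:R :> R by [].
  have h0 : 0 <= t * k.+1%:R by rewrite mulr_ge0.
  have h1 := truncn_le (t * k.+1%:R); rewrite h0 in h1.
  have h2 := truncnS_gt (t * k.+1%:R).
  have ke : k.+1%:R^-1 < e by near: k; exact: near_infty_natSinv_lt (PosNum e0).
  have -> : t - tk k = (t * k.+1%:R - (Num.truncn (t * k.+1%:R))%:R) / k.+1%:R.
    by rewrite /tk mulrBl mulfK ?gt_eqF.
  rewrite ger0_norm; last by rewrite divr_ge0// subr_ge0.
  apply: (le_trans _ (ltW ke)); rewrite -[leRHS]mul1r ler_wpM2r ?invr_ge0//.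
  by move: h2; rewrite -natr1; lra.
have C := cvg_comp _ _ ctk ct.
have C0 : (fun k => 0 + \int[mu]_(s in `[0, tk k]) z s) @ \oo --> (0 : R).
  by rewrite (_ : (fun k => _) = fun=> 0) ?addr0; [exact: cvg_cst|apply/funext => k; rewrite z0 addr0].
by have := cvg_unique _ C C0; rewrite add0r; apply.
Unshelve. all: by end_near. Qed.

Lemma ae_swap G : jmeas G -> {ae leb, forall x, {ae mu, forall t, G t x = 0}} ->
  {ae mu, forall t, {ae leb, forall x, G t x = 0}}.
Proof.
move=> mG H; have E0 : sqint M (unc G) = 0%E.
  rewrite (sqint_unc2 mG); rewrite -[RHS](integral0 leb setT); apply: ae_eq_integral => //.
    apply: (measurable_integral_param mu (f := fun z : E * T => unc G (z.2, z.1) ^+ 2)).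
    apply: measurable_funX; apply: (measurableT_comp mG).
    exact: (measurable_fun_pair measurable_snd measurable_fst).
  apply: filterS H => x Hx _; rewrite (@eq_sqint _ T R mu _ (fun=> 0)) //.
  - by rewrite /sqint integral0_eq// => t _; rewrite expr0n.
  - exact: jmeas_x.
rewrite (sqint_unc mG) in E0.
have E1 : (\int[mu]_t `|sqint leb (G t)| = 0)%E.
  by rewrite -[RHS]E0; apply: eq_integral => t _; rewrite gee0_abs ?sqint_ge0.
have := (@ae_eq_integral_abs _ T R mu _ measurableT _ (measurable_sqint mG)).1 E1.
apply: ae_muS => t /(_ I) /= Ht; exact: sqint_eq0 (jmeas_t t mG) Ht.
Qed.

Lemma Rint_indic d (X : measurableType d) (m : {measure set X -> \bar R}) (A : set X) (f : X -> R) :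
  \int[m]_(x in A) f x = \int[m]_x (\1_A x * f x).
Proof.
rewrite Rintegral_mkcond; apply: eq_Rintegral => x _; rewrite patchE indicE.
by case: (_ \in _); rewrite ?mul1r ?mul0r.
Qed.

(** The statement gives measurability at positive times only; extension by 0 makes the function
    measurable on the whole product. *)
Definition pos_ext u (t : R) (x : E) : R := if 0 < t then u t x else 0.

Lemma jmeas_pos_ext u : measurable_fun [set z : R * E | 0 < z.1] (fun z : R * E => u z.1 z.2) ->
  jmeas (pos_ext u).
Proof.
move=> mu_; rewrite /jmeas (_ : unc (pos_ext u) = (fun z : T * E => u z.1 z.2) \_ [set z | 0 < z.1]).
  apply/(measurable_restrictT _ _).1 => //.
  rewrite -[X in measurable X]setTI.
  have := @measurable_fst _ _ T E measurableT _ (mitv `](0 : R), +oo[); rewrite setTI => h.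
  apply: (eq_ind _ measurable h); apply/seteqP; split => z /=; rewrite in_itv/= andbT; [by case|by split].
apply/funext => -[t x]; rewrite /unc /pos_ext patchE /=; case: ifPn => t0.
  by rewrite mem_set.
by rewrite memNset//=; exact/negP.
Qed.

Lemma L2norm_CS G A (t : R) : jmeas G -> L2 leb (\1_A : E -> R) ->
  (\int[leb]_x (`|G t x| * \1_A x)%:E <= (nrm leb (\1_A : E -> R) + 1)%:E * L2norm (G t))%E.
Proof.
move=> mG LA; have c0 : 0 < nrm leb (\1_A : E -> R) + 1 by rewrite ltr_wpDl ?nrm_ge0.
have mGt := jmeas_t t mG.
have [Gf|] := ltP (L2norm (G t)) +oo%E; last first.
  by rewrite leye_eq => /eqP ->; rewrite gt0_muley ?leey// lte_fin.
have LG : L2 leb (G t) by split=> //; rewrite -L2norm_lty.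
have La := L2_abs LG; rewrite -(ipE La LA).
rewrite L2normE (sqint_nrm LG) /sqrte -EFinM lee_fin sqrtr_sqr (ger0_norm (nrm_ge0 _ _)).
have -> : nrm leb (G t) = nrm leb (fun x => `|G t x|).
  by rewrite /nrm; congr Num.sqrt; apply: eq_Rintegral => x _; rewrite -!expr2 sqr_normr.
apply: (le_trans (ler_norm _)); apply: (le_trans (cauchy_schwarz La LA)).
by rewrite mulrC ler_wpM2r ?nrm_ge0// lerDl.
Qed.

Lemma L1loc_test g A (phi : R -> R) (a b B : R) : L1locL2 g -> L2 leb (\1_A : E -> R) ->
  measurable_fun [set: R] phi -> 0 < a -> (forall t, `|phi t| <= B) -> (forall t, ~~ (a <= t <= b) -> phi t = 0) ->
  M.-integrable [set: T * E] (EFin \o (fun z : T * E => phi z.1 * (pos_ext g z.1 z.2 * \1_A z.2))).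
Proof.
move=> [mg ig] LA mphi a0 phiB phi0; have mG := jmeas_pos_ext mg.
have B0 : 0 <= B by apply: le_trans (phiB 0).
have mf : measurable_fun [set: T * E] (EFin \o (fun z : T * E => phi z.1 * (pos_ext g z.1 z.2 * \1_A z.2))).
  apply/measurable_EFinP; apply: measurable_funM; first exact: (measurableT_comp mphi measurable_fst).
  by apply: measurable_funM => //; exact: (measurableT_comp LA.1 measurable_snd).
apply/integrable12ltyP => //.
set c := nrm leb (\1_A : E -> R) + 1.
have c0 : 0 < c by rewrite ltr_wpDl ?nrm_ge0.
have mn : measurable_fun [set: T] (fun t => L2norm (pos_ext g t)).
  rewrite (_ : (fun t => _) = (fun t => sqint leb (pos_ext g t) `^ 2^-1)%E); last first.
    by apply/funext => t; rewrite L2normE poweR12_sqrt// sqint_ge0.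
  by apply: (measurableT_comp (measurable_poweR _)); exact: measurable_sqint.
apply: (@le_lt_trans _ _ (\int[mu]_(t in `[a, b]) ((B * c)%:E * L2norm (g t)))%E); last first.
  have mn' : measurable_fun `[a, b] (fun t => L2norm (g t)).
    apply: (eq_measurable_fun (fun t => L2norm (pos_ext g t))); last exact: measurable_funTS.
    move=> t; rewrite inE/= in_itv/= => /andP[at_ _]; congr L2norm; apply/funext => x.
    by rewrite /pos_ext (lt_le_trans a0 at_).
  rewrite (ge0_integralZl mu (mitv `[a, b]) mn' (fun t _ => L2norm_ge0 _)); last by rewrite lee_fin mulr_ge0 ?(ltW c0).
  rewrite muleC lte_mul_pinfty ?lee_fin ?ltry ?mulr_ge0 ?(ltW c0)//.
  - by apply: integral_ge0 => t _; exact: L2norm_ge0.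
  - by rewrite ge0_fin_numE; [exact: ig|apply: integral_ge0 => t _; exact: L2norm_ge0].
pose RH := (fun t => ((B * c)%:E * L2norm (g t))%E) \_ `[a, b]%classic.
have mRH : measurable_fun [set: T] RH.
  apply/(measurable_restrictT _ (mitv `[a, b])); apply: measurable_funeM.
  apply: (eq_measurable_fun (fun t => L2norm (pos_ext g t))); last exact: measurable_funTS.
  move=> t; rewrite inE/= in_itv/= => /andP[at_ _]; congr L2norm; apply/funext => x.
  by rewrite /pos_ext (lt_le_trans a0 at_).
rewrite [leRHS]integral_mkcond; apply: ge0_le_integral => //.
- by move=> t _; apply: integral_ge0.
- apply: (measurable_fun_fubini_tonelli_F (m2 := leb) (abse \o (EFin \o (fun z : T * E => phi z.1 * (pos_ext g z.1 z.2 * \1_A z.2))))).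
    exact: measurableT_comp.
  by move=> z; exact: abse_ge0.
- move=> t _; have mabs : measurable_fun [set: E] (fun x => (`|pos_ext g t x| * \1_A x)%:E).
    apply/measurable_EFinP; apply: measurable_funM; last exact: LA.1.
    by apply: measurableT_comp => //; exact: jmeas_t.
  have abs0 x : [set: E] x -> (0 <= (`|pos_ext g t x| * \1_A x)%:E)%E.
    by rewrite lee_fin mulr_ge0.
  have -> : (\int[leb]_y `|(EFin \o (fun z : T * E => (phi z.1 * (pos_ext g z.1 z.2 * \1_A z.2))%R)) (t, y)|)%E =
      (`|phi t|%:E * \int[leb]_x (`|pos_ext g t x| * \1_A x)%:E)%E.
    rewrite -(ge0_integralZl leb measurableT mabs abs0) ?lee_fin//; apply: eq_integral => x _ /=.
    by rewrite -EFinM !normrM (ger0_norm (_ : 0 <= \1_A x)) // indicE.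
  rewrite patchE; case: ifPn => [|]; last first.
    by rewrite notin_setE/= in_itv/= => /negP h; rewrite (phi0 _ h) normr0 mul0e.
  rewrite inE/= in_itv/= => /andP[at_ tb].
  have -> : g t = pos_ext g t by apply/funext => x; rewrite /pos_ext (lt_le_trans a0 at_).
  rewrite EFinM -muleA; apply: lee_pmul.
  - by rewrite lee_fin.
  - by apply: integral_ge0 => x _; exact: abs0.
  - by rewrite lee_fin; exact: phiB.
  - exact: L2norm_CS.
Qed.

Section pairing.
Variables (g : R -> E -> R) (A : set E) (phi : R -> R) (a b B : R).
Hypothesis Lg : L1locL2 g.
Hypothesis LA : L2 leb (\1_A : E -> R).
Hypothesis mphi : measurable_fun [set: R] phi.
Hypothesis a0 : 0 < a.
Hypothesis phiB : forall t, `|phi t| <= B.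
Hypothesis phi0 : forall t, ~~ (a <= t <= b) -> phi t = 0.

Let jf := L1loc_test Lg LA mphi a0 phiB phi0.

Let inner2 x : \int[mu]_r (phi r * (pos_ext g r x * \1_A x)) = \1_A x * \int[mu]_r (phi r * pos_ext g r x).
Proof.
rewrite indicE; case: (_ \in _) => /=.
  by rewrite mul1r; apply: eq_Rintegral => r _; rewrite mulr1.
by rewrite mul0r /Rintegral integral0_eq// => r _; rewrite !mulr0.
Qed.

Let inner1 : {ae mu, forall r, \int[leb]_x (phi r * (pos_ext g r x * \1_A x)) =
  phi r * \int[leb]_x (pos_ext g r x * \1_A x)}.
Proof.
have := ae_integrable1 jf; apply: ae_muS => r ir.
have [->|pr] := eqVneq (phi r) 0.
  by rewrite mul0r /Rintegral integral0_eq// => x _; rewrite mul0r.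
have ir' : leb.-integrable [set: E] (EFin \o (fun x => pos_ext g r x * \1_A x)).
  have := integrableZl measurableT (phi r)^-1 ir; apply: eq_integrable => // x _ /=.
  by rewrite -?EFinM mulKf.
by rewrite (RintegralZl _ measurableT ir').
Qed.

Let mn : measurable_fun [set: T] (fun r => \int[leb]_x (pos_ext g r x * \1_A x)).
Proof.
apply: (measurable_Rintegral_param leb (f := fun z : T * E => unc (pos_ext g) z * \1_A z.2)).
by apply: measurable_funM; [exact: jmeas_pos_ext Lg.1|exact: (measurableT_comp LA.1 measurable_snd)].
Qed.

Lemma pairing_integrable : mu.-integrable [set: R] (EFin \o (fun r => phi r * \int[leb]_x (pos_ext g r x * \1_A x))).
Proof.
have /integrableP[_ i1] := integrable_Rinner1 jf; apply/integrableP; split.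
  by apply/measurable_EFinP; exact: measurable_funM.
apply: le_lt_trans i1; rewrite le_eqVlt; apply/orP; left; apply/eqP; apply: ae_eq_integral => //.
- by apply: measurableT_comp => //; apply/measurable_EFinP; exact: measurable_funM.
- by apply: measurableT_comp => //; apply/measurable_EFinP; exact: (measurable_Rinner1 jf).
- by have := inner1; apply: ae_muS => r /= E1 _; rewrite E1.
Qed.

Lemma pairing_integrable2 : leb.-integrable [set: E] (EFin \o (fun x => \1_A x * \int[mu]_r (phi r * pos_ext g r x))).
Proof.
have := integrable_Rinner2 jf; apply: eq_integrable => // x _ /=; congr EFin; exact: inner2.
Qed.

Lemma pairing_fubini : \int[mu]_r (phi r * \int[leb]_x (pos_ext g r x * \1_A x)) =
  \int[leb]_x (\1_A x * \int[mu]_r (phi r * pos_ext g r x)).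
Proof.
have -> : \int[mu]_r (phi r * \int[leb]_x (pos_ext g r x * \1_A x)) =
    \int[mu]_r (\int[leb]_x (phi r * (pos_ext g r x * \1_A x))).
  apply: (congr1 fine); apply: ae_eq_integral => //.
  - by apply/measurable_EFinP; exact: measurable_funM.
  - by apply/measurable_EFinP; exact: (measurable_Rinner1 jf).
  - by have := inner1; apply: ae_muS => r /= E1 _; rewrite E1.
rewrite (RFubini jf); apply: eq_Rintegral => x _; exact: inner2.
Qed.

Lemma pairing_ae : {ae leb, forall x, A x -> mu.-integrable [set: R] (EFin \o (fun r => phi r * pos_ext g r x))}.
Proof.
have := ae_integrable2 jf; apply: filterS => x ix Ax.
by apply: eq_integrable ix => // r _ /=; rewrite indicE mem_set// mulr1.
Qed.

End pairing.

Lemma test_fun_bounded (phi : R -> R) : test_fun phi -> exists a b B : R, [/\ 0 < a,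
  measurable_fun [set: R] phi, measurable_fun [set: R] (derive1 phi),
  (forall t, `|phi t| <= B) /\ (forall t, `|derive1 phi t| <= B) &
  (forall t, ~~ (a <= t <= b) -> phi t = 0) /\ (forall t, ~~ (a <= t <= b) -> derive1 phi t = 0)].
Proof.
move=> [dphi [a [b [a0 sphi]]]].
have z0 t : ~~ (a <= t <= b) -> phi t = 0 by apply: contraNeq; exact: sphi.
have c0 : continuous phi.
  by move=> t; apply: differentiable_continuous; apply/derivable1_diffP; exact: (dphi 0 t).
have c1 : continuous (derive1 phi).
  by move=> t; apply: differentiable_continuous; apply/derivable1_diffP; exact: (dphi 1 t).
have z1 t : ~~ (a <= t <= b) -> derive1 phi t = 0.
  move=> tab; rewrite derive1E -[RHS](derive_cst (W := R) (0 : R) t (1 : R)).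
  apply: near_eq_derive; move: tab; rewrite negb_and -!ltNge => /orP[ta|bt].
    near=> s; apply: z0; rewrite negb_and -!ltNge; apply/orP; left.
    by near: s; exact: lt_nbhsl.
  near=> s; apply: z0; rewrite negb_and -!ltNge; apply/orP; right.
  by near: s; exact: lt_nbhsr.
have bd (f : R -> R) : continuous f -> (forall t, ~~ (a <= t <= b) -> f t = 0) -> exists B, forall t, `|f t| <= B.
  move=> cf f0; have [ab|ba] := leP a b; last first.
    exists 0 => t; rewrite f0 ?normr0//; apply/negP => /andP[h1 h2].
    by have := le_lt_trans (le_trans h1 h2) ba; rewrite ltxx.
  have cn : {within `[a, b], continuous (fun t => `|f t|)}.
    apply: continuous_subspaceT => t; exact: (continuous_comp (cf t) (@norm_continuous _ _ (f t))).
  have [c _ Hc] := EVT_max ab cn; exists `|f c| => t.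
  have [tI|tI] := boolP (a <= t <= b); first by apply: Hc; rewrite in_itv.
  by rewrite f0// normr0.
have [B0 HB0] := bd _ c0 z0; have [B1 HB1] := bd _ c1 z1.
exists a, b, (Num.max B0 B1); split=> //.
- exact: continuous_measurable_fun.
- exact: continuous_measurable_fun.
- by split=> t; rewrite le_max ?HB0 ?HB1 ?orbT.
Unshelve. all: by end_near. Qed.

Lemma measurable_ind (i : interval R) : measurable_fun [set: R] (\1_([set` i]) : R -> R).
Proof. exact: measurable_indic_itv. Qed.

Lemma indic_le1 (i : set R) (t : R) : `|(\1_i : R -> R) t| <= 1.
Proof. by rewrite indicE ger0_norm// lern1 leq_b1. Qed.

Lemma indic_oc_out (s t r : R) : ~~ (s <= r <= t) -> (\1_(`]s, t]%classic : set R) : R -> R) r = 0.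
Proof.
move=> h; rewrite indicE memNset//= in_itv/= => /andP[sr rt]; move: h.
by rewrite (ltW sr) rt.
Qed.

Lemma indic_cc_out (s t r : R) : ~~ (s <= r <= t) -> (\1_(`[s, t]%classic : set R) : R -> R) r = 0.
Proof. by move=> h; rewrite indicE memNset//= in_itv/=; exact/negP. Qed.

Lemma L2_sub_cube A k : measurable A -> A `<=` cube k -> L2 leb (\1_A : E -> R).
Proof.
move=> mA Ak; have mI : measurable_fun [set: E] (\1_A : E -> R) by exact: measurable_indic.
apply: L2_le mI (L2_cube k) _ => x.
rewrite !indicE; case: (boolP (x \in A)) => xA; last by rewrite normr0.
by rewrite mem_set//; apply: Ak; rewrite inE in xA.
Qed.

(** In [weak_dt] the exceptional set of points depends on the test function, so no point can be
    fixed first. Instead, [u] and [g] are integrated over a set [A] inside a cube: this gives a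
    continuous scalar function of time, to which [weak_derivative_increment] applies, and [A] is
    arbitrary. *)
Lemma weak_increment u g (s t : R) : CL2 u -> L1locL2 u -> weak_dt u g -> 0 < s <= t ->
  {ae leb, forall x, \int[mu]_r (\1_(`]s, t]%classic : set R) r * pos_ext g r x) = u t x - u s x}.
Proof.
move=> [mu0 Lu cu] L1u [L1g wk] st; have /andP[s0 st'] := st; have t0 := lt_le_trans s0 st'.
have posL r : 0 < r -> L2 leb (u r) by move=> r0; apply/inL2E; exact: Lu (ltW r0).
suff H k : {ae leb, forall x, cube k x -> \int[mu]_r (\1_(`]s, t]%classic : set R) r * pos_ext g r x) = u t x - u s x}.
  have /ae_foralln := H; apply: filterS => x Hx.
  have : (\bigcup_k cube k) x by rewrite bigcup_cube.
  by move=> [k _]; exact: Hx.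
have mD : measurable (cube k : set E) by exact: measurable_rV_box.
have LD := L2_sub_cube mD (@subset_refl _ (cube k)).
have Lts := L2B (posL t t0) (posL s s0).
have mind := measurable_ind `]s, t].
have iJ : leb.-integrable (cube k) (EFin \o (fun x => \int[mu]_r (\1_(`]s, t]%classic : set R) r * pos_ext g r x))).
  have i0 := pairing_integrable2 L1g LD mind s0 (indic_le1 _) (@indic_oc_out s t).
  have := integrableS measurableT mD (@subsetT _ _) i0; apply: eq_integrable => // x xD /=.
  by rewrite indicE xD mul1r.
have iU : leb.-integrable (cube k) (EFin \o (u t \- u s)).
  have := integrableS measurableT mD (@subsetT _ _) (L2_mul Lts LD); apply: eq_integrable => // x xD /=.
  by rewrite indicE xD mulr1.
have := integral_ae_eq mD iJ (measurable_int _ iU).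
move=> K; have {}K : ae_eq leb (cube k) (EFin \o (fun x => \int[mu]_r (\1_(`]s, t]%classic : set R) r * pos_ext g r x))) (EFin \o (u t \- u s)).
  apply: K => A AD mA; have LA := L2_sub_cube mA AD.
  rewrite -[LHS]fineK; last exact: integrable_fin_num (integrableS mD mA AD iJ).
  rewrite -[RHS]fineK; last exact: integrable_fin_num (integrableS mD mA AD iU).
  congr EFin; pose m r := \int[leb]_x (pos_ext u r x * \1_A x).
  pose n r := \int[leb]_x (pos_ext g r x * \1_A x).
  have mE r : 0 < r -> m r = ip leb (u r) (\1_A).
    by move=> r0; apply: eq_Rintegral => x _; rewrite /pos_ext r0.
  have mm (q : R -> E -> R) : L1locL2 q -> measurable_fun [set: T] (fun r => \int[leb]_x (pos_ext q r x * \1_A x)).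
    move=> Lq; apply: (measurable_Rintegral_param leb (f := fun z : T * E => unc (pos_ext q) z * \1_A z.2)).
    by apply: measurable_funM; [exact: jmeas_pos_ext Lq.1|exact: (measurableT_comp LA.1 measurable_snd)].
  have cm (r : R) : 0 < r -> {for r, continuous m}.
    move=> r0; have r0' := ltW r0.
    have cr : L2norm (u q \- u r) @[q --> r] --> 0%E.
      have := cu r r0'; rewrite (_ : within `[0, +oo[ (nbhs r) = nbhs r)//.
      apply: within_interior; rewrite /interior; near=> q.
      by rewrite /= in_itv/= andbT ltW//; near: q; exact: lt_nbhsr.
    apply/cvgrPdist_le => e e0; set c := nrm leb (\1_A : E -> R) + 1.
    have c0 : 0 < c by rewrite ltr_wpDl ?nrm_ge0.
    have ec : 0 < e / c by rewrite divr_gt0.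
    near=> q; have q0 : 0 < q by near: q; exact: lt_nbhsr.
    have Lq : (L2norm (u q \- u r)%R <= (e / c)%:E)%E.
      by near: q; exact: ((cvge0P _ (fun q => L2norm_ge0 _)).2 cr _ ec).
    have LB := L2B (posL q q0) (posL r r0).
    have nq : nrm leb (u q \- u r) <= e / c.
      by apply: nrm_le LB _; [exact: ltW|rewrite -L2norm_le// ltW].
    rewrite distrC !mE// -(ipBl (posL q q0) (posL r r0) LA).
    apply: (le_trans (cauchy_schwarz LB LA)); apply: (@le_trans _ _ (e / c * c)); last by rewrite divfK// gt_eqF.
    by apply: ler_pM => //; rewrite ?nrm_ge0// lerDl.
  have jn (a b : R) : 0 < a -> mu.-integrable `[a, b] (EFin \o n).
    move=> a0; have i0 := pairing_integrable L1g LA (measurable_ind `[a, b]) a0 (indic_le1 _) (@indic_cc_out a b).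
    have := integrableS measurableT (mitv `[a, b]) (@subsetT _ _) i0; apply: eq_integrable; first exact: mitv.
    by move=> r rI /=; rewrite indicE rI mul1r.
  have W := @weak_derivative_increment R m n s t (measurable_funTS (mm _ L1u)) cm (measurable_funTS (mm _ L1g)) jn _ st.
  have pe (q : R -> E -> R) (phi : R -> R) x : \int[mu]_r (phi r * pos_ext q r x) = \int[mu]_(r in `]0, +oo[) (phi r * q r x).
    rewrite [RHS]Rint_indic; apply: eq_Rintegral => r _; rewrite indicE /pos_ext.
    case: ifPn => r0; first by rewrite mem_set ?mul1r//= in_itv/= r0.
    by rewrite memNset ?mul0r ?mulr0//= in_itv/= andbT; exact/negP.
  have {}W : \int[mu]_(r in `]s, t]) n r = m t - m s.
    apply: W => phi tphi; have [a [b [B [a0 mphi mphi' [pB pB'] [p0 p0']]]]] := test_fun_bounded tphi.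
    have po (p q : R -> R) : (forall r, ~~ (a <= r <= b) -> p r = 0) -> \int[mu]_(r in `]0, +oo[) (p r * q r) = \int[mu]_r (p r * q r).
      move=> pz; rewrite Rint_indic; apply: eq_Rintegral => r _; rewrite indicE.
      case: (boolP (r \in `]0, +oo[%classic)) => rI; first by rewrite mul1r.
      rewrite pz ?mul0r ?mulr0//; apply/negP => /andP[ar _]; move: rI.
      by rewrite notin_setE/= in_itv/= andbT (lt_le_trans a0 ar).
    rewrite (po _ _ p0') (po _ _ p0) (pairing_fubini L1u LA mphi' a0 pB' p0') (pairing_fubini L1g LA mphi a0 pB p0).
    have i2 := pairing_integrable2 L1g LA mphi a0 pB p0.
    have i1 := pairing_integrable2 L1u LA mphi' a0 pB' p0'.
    rewrite -mulN1r -(RintegralZl _ measurableT i2); apply: (congr1 fine); apply: ae_eq_integral => //.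
    - by have /measurable_int := i1.
    - by apply/measurable_EFinP; apply: measurable_funM => //; have /measurable_int/measurable_EFinP := i2.
    have := wk phi tphi; apply: filterS => x Hx _; congr EFin; rewrite !pe Hx; ring.
  transitivity (\int[leb]_x (\1_A x * \int[mu]_r (\1_(`]s, t]%classic : set R) r * pos_ext g r x))).
    exact: (Rint_indic leb A).
  rewrite -(pairing_fubini L1g LA mind s0 (indic_le1 _) (@indic_oc_out s t)) -Rint_indic W !mE//.
  rewrite -(ipBl (posL t t0) (posL s s0) LA); apply/esym; apply: (etrans (Rint_indic leb A (u t \- u s))).
  by apply: eq_Rintegral => x _; rewrite mulrC.
apply: filterS K => x Kx Dx; by have [] := Kx Dx.
Unshelve. all: by end_near. Qed.

Lemma weak_integrable g : L1locL2 g ->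
  {ae leb, forall x, forall i k : nat, mu.-integrable [set: R] (EFin \o (fun r => \1_(`[i.+1%:R^-1, k%:R]%classic : set R) r * pos_ext g r x))}.
Proof.
move=> Lg; suff H n i k : {ae leb, forall x, cube n x -> mu.-integrable [set: R] (EFin \o (fun r => \1_(`[i.+1%:R^-1, k%:R]%classic : set R) r * pos_ext g r x))}.
  have H2 : {ae leb, forall x, forall n i k : nat, cube n x -> mu.-integrable [set: R] (EFin \o (fun r => \1_(`[i.+1%:R^-1, k%:R]%classic : set R) r * pos_ext g r x))}.
    by do 3!(apply/ae_foralln => ?); exact: H.
  apply: filterS H2 => x Hx i k; have : (\bigcup_k cube k) x by rewrite bigcup_cube.
  by move=> [n _]; exact: Hx.
have mD : measurable (cube n : set E) by exact: measurable_rV_box.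
have LD := L2_sub_cube mD (@subset_refl _ (cube n)).
have a0 : 0 < i.+1%:R^-1 :> R by [].
exact: (pairing_ae Lg LD (measurable_ind _) a0 (indic_le1 _) (@indic_cc_out _ _)).
Qed.

(** For rational end points both derivatives have the same integrals, outside one null set of
    points; there [integral0_dense] gives equality at almost every time, and [ae_swap] exchanges the
    two quantifiers. *)
Lemma weak_dt_unique u g1 g2 : CL2 u -> L1locL2 u -> weak_dt u g1 -> weak_dt u g2 ->
  {ae mu, forall t, 0 < t -> {ae leb, forall x, g1 t x = g2 t x}}.
Proof.
move=> cu Lu w1 w2; have m1 := jmeas_pos_ext w1.1.1; have m2 := jmeas_pos_ext w2.1.1.
pose D t x := pos_ext g1 t x - pos_ext g2 t x.
have mD : jmeas D by exact: jmeas_B.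
suff H : {ae leb, forall x, {ae mu, forall t, D t x = 0}}.
  have := ae_swap mD H; apply: ae_muS => t Ht t0; apply: filterS Ht => x.
  by rewrite /D /pos_ext t0 => /eqP; rewrite subr_eq0 => /eqP.
have E0 : {ae leb, forall x, forall i j k : nat, i.+1%:R^-1 <= j%:R / k.+1%:R :> R ->
    \int[mu]_r (\1_(`]i.+1%:R^-1, j%:R / k.+1%:R]%classic : set R) r * pos_ext g1 r x) =
    \int[mu]_r (\1_(`]i.+1%:R^-1, j%:R / k.+1%:R]%classic : set R) r * pos_ext g2 r x)}.
  apply/ae_foralln => i; apply/ae_foralln => j; apply/ae_foralln => k.
  have [ij|ij] := leP (i.+1%:R^-1 : R) (j%:R / k.+1%:R); last by apply: aeW => x.
  have st : 0 < (i.+1%:R^-1 : R) <= j%:R / k.+1%:R by rewrite ij andbT.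
  have := weak_increment cu Lu w1 st; have := weak_increment cu Lu w2 st.
  by apply: filterS2 => x -> ->.
have := weak_integrable w1.1; have := weak_integrable w2.1.
move: E0; apply: filterS3 => x E0 I2 I1.
suff Hi i : {ae mu, forall t, i.+1%:R^-1 < t -> D t x = 0}.
  have /(@ae_foralln _ T R mu) := Hi; apply: ae_muS => t Ht.
  have [t0|t0] := leP t 0; first by rewrite /D /pos_ext ltNge t0 subrr.
  have [i Hit] : exists i : nat, i.+1%:R^-1 < t.
    have [i _ Hi'] := near_infty_natSinv_lt (PosNum t0); exists i; exact: (Hi' i (leqnn i)).
  exact: Ht i Hit.
pose z r := \1_(`]i.+1%:R^-1, +oo[%classic : set R) r * D r x.
have iz b : mu.-integrable `[0, b] (EFin \o z).
  pose k := (Num.truncn b).+1; have bk : b <= k%:R by apply: ltW; exact: truncnS_gt.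
  have i12 := integrableB measurableT (I1 i k) (I2 i k).
  have i3 : mu.-integrable [set: R] (EFin \o (fun r => \1_(`]i.+1%:R^-1, k%:R]%classic : set R) r * D r x)).
    apply: (le_integrable measurableT _ _ i12).
      apply/measurable_EFinP; apply: measurable_funM; first exact: measurable_ind.
      exact: jmeas_x.
    move=> r _ /=; rewrite -?EFinB lee_fin -mulrBr -/(D r x) !normrM ler_wpM2r// !indicE.
    rewrite !ger0_norm// ler_nat; case: (boolP (r \in `]i.+1%:R^-1, k%:R]%classic)) => //.
    by rewrite !inE/= !in_itv/= => /andP[h1 h2]; rewrite mem_set//= in_itv/= (ltW h1).
  have := integrableS measurableT (mitv `[0, b]) (@subsetT _ _) i3; apply: eq_integrable; first exact: mitv.
  move=> r; rewrite inE/= in_itv/= => /andP[_ rb] /=; rewrite /z !indicE; congr (_ * _)%:E.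
  congr (nat_of_bool _)%:R; apply/idP/idP; rewrite !inE/= !in_itv/= andbT; first by case/andP.
  by move=> ->; rewrite (le_trans rb bk).
have z0 j k : \int[mu]_(s in `[0, j%:R / k.+1%:R]) z s = 0.
  have [ij|ij] := leP (i.+1%:R^-1 : R) (j%:R / k.+1%:R); last first.
    rewrite /Rintegral integral0_eq// => r /=; rewrite in_itv/= => /andP[_ rj].
    rewrite /z indicE memNset ?mul0r//= in_itv/= andbT => h.
    by have := lt_trans (lt_le_trans h rj) ij; rewrite ltxx.
  have E1 := E0 i j k ij.
  pose kk := (Num.truncn (j%:R / k.+1%:R : R)).+1; have bk : j%:R / k.+1%:R <= kk%:R :> R by apply: ltW; exact: truncnS_gt.
  have oc (g : R -> E -> R) : measurable_fun [set: R] (fun r => pos_ext g r x) ->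
      mu.-integrable [set: R] (EFin \o (fun r => \1_(`[i.+1%:R^-1, kk%:R]%classic : set R) r * pos_ext g r x)) ->
      mu.-integrable [set: R] (EFin \o (fun r => \1_(`]i.+1%:R^-1, j%:R / k.+1%:R]%classic : set R) r * pos_ext g r x)).
    move=> mg ig; apply: (le_integrable measurableT _ _ ig).
      by apply/measurable_EFinP; apply: measurable_funM => //; exact: measurable_ind.
    move=> r _ /=; rewrite lee_fin !normrM ler_wpM2r// !indicE !ger0_norm// ler_nat.
    case: (boolP (r \in `]i.+1%:R^-1, j%:R / k.+1%:R]%classic)) => //.
    by rewrite !inE/= !in_itv/= => /andP[h1 h2]; rewrite mem_set//= in_itv/= (ltW h1) (le_trans h2 bk).
  have o1 := oc g1 (jmeas_x x m1) (I1 i kk); have o2 := oc g2 (jmeas_x x m2) (I2 i kk).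
  transitivity (\int[mu]_r (\1_(`]i.+1%:R^-1, j%:R / k.+1%:R]%classic : set R) r * pos_ext g1 r x -
     \1_(`]i.+1%:R^-1, j%:R / k.+1%:R]%classic : set R) r * pos_ext g2 r x)).
    rewrite Rint_indic; apply: eq_Rintegral => r _; rewrite -mulrBr -/(D r x) /z mulrA; congr (_ * _).
    rewrite !indicE -natrM mulnb !mem_setE !in_itv/= andbT; congr (nat_of_bool _)%:R.
    have [h1|h1] /= := ltP (i.+1%:R^-1) r; last by rewrite andbF.
    by rewrite (ltW (lt_trans _ h1)) // andbT.
  by rewrite (RintegralB measurableT o1 o2) E1 subrr.
have := integral0_dense iz z0; apply: ae_muS => t Ht it.
have t0 : 0 < t by apply: lt_trans it.
by have := Ht t0; rewrite /z indicE mem_set ?mul1r//= in_itv/= it.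
Qed.

End weak_derivative.

(** * Convergence almost everywhere *)

Section chain.
Context d (T : measurableType d) (R : realType).
Variable m : {measure set T -> \bar R}.
Variables (v : nat -> T -> R) (w : T -> R) (s : nat -> R) (C : R).
Hypothesis C0 : 0 <= C.
Hypothesis Lv : forall i, L2 m (v i).
Hypothesis Lw : L2 m w.
Hypothesis vv : forall i j, s i <= s j -> nrm m (v j \- v i) <= C * (s j - s i).
Hypothesis vw : forall i, nrm m (v i \- w) <= C * s i.

(** The majorant is the initial distance plus the absolute increments along the list. Because the
    list is sorted, the bounds on the norms telescope to the largest value of [s]. *)
Lemma chain_majorant (l : seq nat) (i : nat) (Y0 : T -> R) : L2 m Y0 -> (forall x, 0 <= Y0 x) ->
  nrm m Y0 <= C * s i -> (forall x, `|v i x - w x| <= Y0 x) -> path (fun a b => s a <= s b) i l ->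
  exists Y, [/\ L2 m Y, forall x, Y0 x <= Y x, nrm m Y <= C * s (last i l) &
    forall j, j \in l -> forall x, `|v j x - w x| <= Y x].
Proof.
elim: l i Y0 => [|j l IH] i Y0 LY Y00 nY iY /=; first by exists Y0.
move=> /andP[sij pl].
have Lji := L2_abs (L2B (Lv j) (Lv i)).
have nji : nrm m (fun x => `|(v j \- v i) x|) = nrm m (v j \- v i).
  by rewrite /nrm; congr Num.sqrt; apply: eq_Rintegral => x _; rewrite -!expr2 sqr_normr.
have [|||Y [LY' YY nY' lY]] := IH j (Y0 \+ (fun x => `|(v j \- v i) x|)) (L2D LY Lji) _ _ _ pl.
- by move=> x /=; rewrite addr_ge0.
- apply: (le_trans (nrmD LY Lji)); rewrite nji; have := vv sij; move: nY; lra.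
- move=> x /=; have -> : v j x - w x = (v i x - w x) + (v j x - v i x) by ring.
  by apply: (le_trans (ler_normD _ _)); rewrite lerD2r.
exists Y; split=> //.
- by move=> x; apply: le_trans (YY x); rewrite /= lerDl.
- move=> k; rewrite inE => /orP[/eqP ->|/lY//] x; apply: le_trans (YY x) => /=.
  have -> : v j x - w x = (v i x - w x) + (v j x - v i x) by ring.
  by apply: (le_trans (ler_normD _ _)); rewrite lerD2r.
Qed.

(** Sorting removes any assumption on the order of the sequence, and the bound does not depend on
    the number [k] of terms. *)
Lemma chain_finite (n k : nat) (eta : R) : (forall i, (n <= i)%N -> s i <= eta) -> 0 <= eta ->
  exists Y, [/\ L2 m Y, nrm m Y <= C * eta & forall j, j \in iota n k -> forall x, `|v j x - w x| <= Y x].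
Proof.
move=> sn eta0; have tot : total (fun a b => s a <= s b) by move=> a b; exact: le_total.
have := sort_sorted tot (iota n k); have := mem_sort (fun a b => s a <= s b) (iota n k).
case: (sort _ _) => [|i l] ml /= pl.
  exists (fun=> 0); split; first exact: L2_0.
    by rewrite /nrm /ip /Rintegral integral0_eq ?sqrtr0 ?mulr_ge0// => x _; rewrite mulr0.
  by move=> j; rewrite -ml.
have Liw := L2B (Lv i) Lw.
have [|||Y [LY Y0Y nY lY]] := chain_majorant (L2_abs Liw) _ _ _ pl.
- by move=> x.
- have -> : nrm m (fun x => `|(v i \- w) x|) = nrm m (v i \- w).
    by rewrite /nrm; congr Num.sqrt; apply: eq_Rintegral => x _; rewrite -!expr2 sqr_normr.
  exact: vw.
- by move=> x.
exists Y; split=> //.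
  apply: (le_trans nY); rewrite ler_wpM2l//; apply: sn.
  have : last i l \in i :: l by exact: mem_last.
  by rewrite ml mem_iota => /andP[].
by move=> j; rewrite -ml inE => /orP[/eqP ->|/lY//].
Qed.

Lemma chain_ae : s k @[k --> \oo] --> 0 -> {ae m, forall x, v k x @[k --> \oo] --> w x}.
Proof.
move=> s0; have mv i := (Lv i).1; have mw := Lw.1.
pose A (dl : R) (j : nat) := [set x | dl < `|v j x - w x|].
have mA dl j : measurable (A dl j).
  have mf : measurable_fun [set: T] (fun x => `|v j x - w x|).
    by apply: measurableT_comp => //; exact: measurable_funB.
  have := mf measurableT _ (mitv `]dl, +oo[); rewrite setTI.
  by congr measurable; apply/seteqP; split => x; rewrite /A /= in_itv/= andbT.
(* The set where some term from [n] on is farther than [dl], written as an increasing union of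
   finite unions: Chebyshev's inequality with [chain_finite] bounds each, and continuity of the
   measure passes to the limit. *)
pose B dl n := \bigcup_k (\big[setU/set0]_(j < k) A dl (n + j)%N).
have mBk dl n k : measurable (\big[setU/set0]_(j < k) A dl (n + j)%N).
  by apply: bigsetU_measurable => j _; exact: mA.
have mB dl n : measurable (B dl n) by apply: bigcupT_measurable.
have Bk (dl eta : R) n : 0 < dl -> 0 <= eta -> (forall i, (n <= i)%N -> s i <= eta) ->
    (m (B dl n) <= ((C * eta) ^+ 2 / dl ^+ 2)%:E)%E.
  move=> dl0 eta0 sn.
  have nd : nondecreasing_seq (fun k => \big[setU/set0]_(j < k) A dl (n + j)%N).
    move=> a b ab; apply/subsetPset => x.
    rewrite -(bigcup_mkord a (fun j => A dl (n + j)%N)) -(bigcup_mkord b (fun j => A dl (n + j)%N)) => -[j /= ja Aj].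
    by exists j => //=; exact: leq_trans ja ab.
  have cm : m (\big[setU/set0]_(j < k) A dl (n + j)%N) @[k --> \oo] --> m (B dl n).
    exact: nondecreasing_cvg_mu (mBk dl n) (mB dl n) nd.
  rewrite -(cvg_lim _ cm)//; apply: lime_le; first by apply/cvg_ex; eexists; exact: cm.
  apply: nearW => k; have [Y [LY nY jY]] := chain_finite k sn eta0.
  have mY2 := measurable_sq LY.1.
  have d2 : 0 < dl ^+ 2 by rewrite exprn_gt0.
  have := le_integral_abse m measurableT mY2 d2; rewrite setTI => H.
  rewrite /= -(@lee_pmul2l _ (dl ^+ 2)%:E)// ?lte_fin//.
  rewrite -EFinM mulrC divfK ?gt_eqF//.
  apply: (@le_trans _ _ (sqint m Y)); last first.
    rewrite (sqint_nrm LY) lee_fin lerXn2r ?nnegrE ?nrm_ge0// ?mulr_ge0//.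
  apply: le_trans (_ : _ <= \int[m]_x `|(Y x ^+ 2)%:E|)%E _; last first.
    rewrite le_eqVlt; apply/orP; left; apply/eqP; apply: eq_integral => x _.
    by rewrite gee0_abs// lee_fin sqr_ge0.
  apply: le_trans H; rewrite lee_wpmul2l ?lee_fin ?sqr_ge0//; apply: le_measure.
  - by rewrite inE; exact: mBk.
  - rewrite inE; have mYa : measurable_fun [set: T] (fun x => `|(Y x ^+ 2)%:E|%E) by exact: measurableT_comp.
    have := emeasurable_fun_c_infty measurableT mYa (dl ^+ 2)%:E; rewrite setTI.
    by congr measurable; apply/seteqP; split => x.
  move=> x; rewrite -(bigcup_mkord k (fun j => A dl (n + j)%N)) => -[j /= jk]; rewrite /A /= => Ajx.
  have Yx : dl < Y x by apply: lt_le_trans Ajx (jY _ _ x); rewrite mem_iota leq_addr ltn_add2l.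
  by rewrite lee_fin ger0_norm ?sqr_ge0// lerXn2r ?nnegrE ?ltW// (lt_trans dl0 Yx).
have null (k : nat) : {ae m, forall x, exists n, ~ B k.+1%:R^-1 n x}.
  set dl := k.+1%:R^-1; have dl0 : 0 < dl :> R by rewrite invr_gt0.
  exists (\bigcap_n B dl n); split.
  - exact: bigcapT_measurable.
  - apply/eqP; rewrite eq_le measure_ge0 andbT; apply/lee_addgt0Pr => e e0; rewrite add0e.
    (* Since [eta <= 1] gives [eta ^+ 2 <= eta], this choice makes [(C * eta) ^+ 2 / dl ^+ 2] at
       most [e]; the added 1 covers [C = 0]. *)
    pose eta : R := Num.min 1 (e * dl ^+ 2 / (C ^+ 2 + 1)).
    have C1 : 0 < C ^+ 2 + 1 by rewrite ltr_wpDl ?sqr_ge0.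
    have eta0 : 0 < eta by rewrite lt_min ltr01 divr_gt0// mulr_gt0// exprn_gt0.
    have [n _ Hn] : \forall n \near \oo, s n <= eta.
      have /cvgrPdist_le /(_ eta eta0) := s0; apply: filterS => n.
      by rewrite sub0r normrN; apply: le_trans; exact: ler_norm.
    apply: (@le_trans _ _ (m (B dl n))).
      apply: le_measure; rewrite ?inE//; first exact: bigcapT_measurable.
      by move=> x; apply.
    apply: (le_trans (Bk dl eta n dl0 (ltW eta0) Hn)); rewrite lee_fin.
    have h1 : eta <= 1 by rewrite ge_min lexx.
    have h2 : eta <= e * dl ^+ 2 / (C ^+ 2 + 1) by rewrite ge_min lexx orbT.
    rewrite ler_pdivrMr ?exprn_gt0// exprMn.
    have h3 : eta ^+ 2 <= eta by rewrite expr2 ler_piMl// ltW.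
    rewrite ler_pdivlMr// in h2; apply: (@le_trans _ _ (C ^+ 2 * eta)); first by rewrite ler_wpM2l ?sqr_ge0.
    by move: h2; rewrite mulrDr mulr1 mulrC; move: (ltW eta0); lra.
  - by move=> x /= /forallNP H n _; apply: contrapT; exact: H.
have /ae_foralln := null; apply: filterS => x Hx.
apply/cvgrPdist_le => e e0; have [k _ Hk] := near_infty_natSinv_lt (PosNum e0).
have [n Hn] := Hx k; exists n => // j /= nj; rewrite distrC leNgt; apply/negP => ej.
apply: Hn; exists (j - n).+1 => //; rewrite -(bigcup_mkord _ (fun j => A k.+1%:R^-1 (n + j)%N)); exists (j - n)%N => //=.
by rewrite subnKC// /A /=; apply: lt_trans ej; exact: (Hk k (leqnn k)).
Qed.

End chain.

Section joint_limit.
Context {R : realType} {N : nat}.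
Local Notation E := 'rV[R]_N.
Local Notation T := (measurableTypeR R).
Implicit Types (G : R -> E -> R).

(** A pointwise limit chosen through the upper limit, hence jointly measurable even though
    convergence holds almost everywhere only. *)
Definition limf (G : nat -> R -> E -> R) (t : R) (x : E) : R := fine (limn_esup (fun n => (G n t x)%:E)).

Lemma jmeas_limf (G : nat -> R -> E -> R) : (forall n, jmeas (G n)) -> jmeas (limf G).
Proof.
move=> mG; apply: measurableT_comp => //.
by apply: measurable_fun_limn_esup => k; apply/measurable_EFinP; exact: mG.
Qed.

Lemma limfE (G : nat -> R -> E -> R) t x l : G n t x @[n --> \oo] --> l -> limf G t x = l.
Proof.
move=> cl; have : (G k t x)%:E @[k --> \oo] --> l%:E by apply: cvg_EFin cl; exact: nearW.
by move/cvg_limn_einf_sup => [_]; rewrite /limf => ->.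
Qed.

End joint_limit.

(** * Recovering a function from its weak derivative *)

Section time_primitive.
Context {R : realType} {N : nat}.
Local Notation E := 'rV[R]_N.
Local Notation mu := (@lebesgue_measure R).
Local Notation leb := (lebesgue_rV R N).
Local Notation T := (measurableTypeR R).
Local Notation M := (lebesgue_measure \x leb)%E.
Implicit Types (u g d G W : R -> E -> R) (h v : E -> R).

Lemma within_proper (t : R) : 0 <= t -> ProperFilter (within `[0, +oo[ (nbhs t)).
Proof.
move=> t0; split; last exact: within_filter.
by rewrite /within /= => /nbhs_singleton; apply; rewrite in_itv/= andbT.
Qed.

Lemma expR_div (e t : R) : expR (- t / e) = expR (- e^-1 * t).
Proof. by congr expR; ring. Qed.

Lemma integral_oo_obnd (p : R -> \bar R) : measurable_fun [set: R] p ->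
  (\int[mu]_(t in `](0 : R)%R, +oo[) p t = \int[mu]_(t in `[(0 : R)%R, +oo[) p t)%E.
Proof. by move=> mp; apply: integral_itv_obnd_cbnd; exact: measurable_funTS. Qed.

Lemma pos_extE g t : 0 < t -> pos_ext g t = g t.
Proof. by move=> t0; apply/funext => x; rewrite /pos_ext t0. Qed.

Lemma measurable_expw (c : R) : measurable_fun [set: T] (fun t => (expR (- c * t))%:E).
Proof. by apply/measurable_EFinP; apply: continuous_measurable_fun; exact: continuous_expRZ. Qed.

Lemma weight_wL2 (e : R) g : measurable_fun [set z : R * E | 0 < z.1] (fun z : R * E => g z.1 z.2) ->
  (\int[mu]_(t in `](0 : R)%R, +oo[) ((expR (- t / e))%:E * L2norm (g t) ^+ 2) < +oo)%E ->
  wL2 e^-1 (pos_ext g).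
Proof.
move=> mg ig; have mG := jmeas_pos_ext mg; split=> //.
rewrite -integral_oo_obnd; last by apply: emeasurable_funM; [exact: measurable_expw|exact: measurable_sqint].
apply: le_lt_trans ig; rewrite le_eqVlt; apply/orP; left; apply/eqP; apply: eq_integral => t.
rewrite inE/= in_itv/= andbT => t0; rewrite expR_div pos_extE//.
by have := L2norm_sq (g t); rewrite /= => ->.
Qed.

Definition wint2 (c : R) G : \bar R := sqint M (unc (wtG c G)).

Definition wkoc (c a b s : R) : R := expR (c / 2 * s) * \1_(`]a, b]%classic : set R) s.

Lemma L2_wkoc c a b : 0 <= c -> a <= b -> L2 mu (wkoc c a b) /\ (sqint mu (wkoc c a b) <= (expR (c * b) * (b - a))%:E)%E.
Proof.
move=> c0 ab; have mI : mu (`]a, b]%classic : set T) = (b - a)%:E.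
  have := lebesgue_measure_itv `]a, b]; rewrite /= => E1; apply: (etrans E1).
  by rewrite lte_fin; case: ltP => // ba; congr EFin; move: ab ba; lra.
have mk : measurable_fun [set: T] (wkoc c a b).
  apply: measurable_funM; last exact: measurable_indic_itv.
  by apply: continuous_measurable_fun; exact: continuous_expRZ.
have H : (sqint mu (wkoc c a b) <= (expR (c * b) * (b - a))%:E)%E.
  apply: (@le_trans _ _ (\int[mu]_s (expR (c * b) * \1_(`]a, b]%classic : set R) s)%:E)%E).
    apply: ge0_le_integral => //.
    - by move=> s _; rewrite lee_fin sqr_ge0.
    - exact: measurable_sq.
    - by apply/measurable_EFinP; apply: measurable_funM => //; exact: measurable_indic_itv.
    - move=> s _; rewrite lee_fin /wkoc indicE; case: (boolP (s \in _)) => sI; last by rewrite !mulr0 expr0n.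
      rewrite !mulr1 -expRM_natl ler_expR.
      have -> : 2%:R * (c / 2 * s) = c * s by field.
      by rewrite ler_wpM2l//; move: sI; rewrite inE/= in_itv/= => /andP[].
  have mi : measurable_fun [set: T] (fun s => (\1_(`]a, b]%classic : set R) s : R)%:E).
    by apply/measurable_EFinP; exact: measurable_indic_itv.
  under eq_integral do rewrite EFinM.
  rewrite (ge0_integralZl mu measurableT mi) ?lee_fin ?expR_ge0//.
  rewrite EFinM; apply: lee_wpmul2l; first by rewrite lee_fin expR_ge0.
  rewrite -mI; have := @integral_indic _ T R mu setT measurableT _ (mitv `]a, b]).
  by rewrite setIT => <-.
by split=> //; split=> //; apply: le_lt_trans H (ltry _).
Qed.

Lemma wkoc_wt c a b s x G : 0 <= a -> wtG c G s x * wkoc c a b s = \1_(`]a, b]%classic : set R) s * G s x.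
Proof.
move=> a0; rewrite /wtG /wkoc /wt !indicE; case: (boolP (s \in `]a, b]%classic)) => sI; last by rewrite !mulr0 mul0r.
have s0 : 0 <= s by move: sI; rewrite inE/= in_itv/= => /andP[h _]; exact: ltW (le_lt_trans a0 h).
have -> : (s \in `[(0 : R), +oo[%classic) = true by rewrite mem_setE in_itv/= andbT.
by rewrite /= !mulr1 mul1r mulrAC -expRD mulNr addNr expR0 mul1r.
Qed.

Lemma wL2_ae_int c G : 0 <= c -> wL2 c G -> {ae leb, forall x, forall b, mu.-integrable `[0, b] (EFin \o G^~ x)}.
Proof.
move=> c0 wG; have := wL2_wdata wG; apply: filterS => x [mx ix] b.
exact: (wF_integrable c0 mx ix).
Qed.

Lemma tint_diff G a b x : 0 <= a <= b -> (forall b, mu.-integrable `[0, b] (EFin \o G^~ x)) ->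
  tint G b x - tint G a x = \int[mu]_s (\1_(`]a, b]%classic : set R) s * G s x).
Proof.
move=> ab ix; rewrite -Rint_indic.
have p := prim_int 0 ix; have := prim_sub_int p ab; rewrite !add0r => ->.
by [].
Qed.

Lemma tint_diff_le c G a b : wL2 c G -> 0 <= c -> 0 <= a <= b ->
  (sqint leb (tint G b \- tint G a) <= (expR (c * b) * (b - a))%:E * wint2 c G)%E.
Proof.
move=> wG c0 ab; have /andP[a0 ab'] := ab; have mG := wG.1; have Lw := (wL2P c mG).1 wG.
have [Lk k1] := L2_wkoc c0 ab'.
have mw := jmeas_wtG c mG.
have mx : measurable_fun [set: E] (fun x => sqint mu ((wtG c G)^~ x)).
  apply: (measurable_integral_param mu (f := fun z : E * T => unc (wtG c G) (z.2, z.1) ^+ 2)).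
  apply: measurable_funX; apply: (measurableT_comp mw).
  exact: (measurable_fun_pair measurable_snd measurable_fst).
rewrite /wint2 (sqint_unc2 mw).
have K0 : 0 <= expR (c * b) * (b - a) by rewrite mulr_ge0 ?expR_ge0// subr_ge0.
rewrite -(ge0_integralZl leb measurableT mx (fun x _ => sqint_ge0 mu _)) ?lee_fin//.
apply: ae_ge0_le_integral => //.
- by move=> x _; rewrite lee_fin sqr_ge0.
- apply: measurable_sq; apply: measurable_funB; exact: jmeas_t (jmeas_tint mG).
- by move=> x _; rewrite mule_ge0 ?sqint_ge0// lee_fin.
- exact: measurable_funeM.
have := wL2_ae_int c0 wG; have := ae_L2_x Lw; apply: filterS2 => x Lx ix _.
rewrite /= (tint_diff ab ix).
have -> : \int[mu]_s (\1_(`]a, b]%classic : set R) s * G s x) = ip mu ((wtG c G)^~ x) (wkoc c a b).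
  by apply: eq_Rintegral => s _; rewrite wkoc_wt.
apply: (@le_trans _ _ ((nrm mu (wkoc c a b) ^+ 2)%:E * sqint mu ((wtG c G)^~ x))%E).
  rewrite (sqint_nrm Lx) -EFinM lee_fin -sqr_normr -exprMn mulrC lerXn2r ?nnegrE ?mulr_ge0 ?nrm_ge0//.
  exact: cauchy_schwarz.
by rewrite -(sqint_nrm Lk); apply: lee_wpmul2r => //; exact: sqint_ge0.
Qed.

(** Test functions see positive times only, so [weak_increment] starts from some [s > 0]. As [s]
    tends to 0, [u s] tends to [u 0] in L2 and the integral up to [s] tends to 0 pointwise; Fatou's
    lemma shows that the defect [D] vanishes. *)
Lemma weak_tint c u g : 0 <= c -> CL2 u -> L1locL2 u -> weak_dt u g -> wL2 c (pos_ext g) ->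
  forall t, 0 <= t -> {ae leb, forall x, u t x = u 0 x + tint (pos_ext g) t x}.
Proof.
move=> c0 cu Lu wg wG t t0; have [_ Lut cut] := cu.
have Lu2 r : 0 <= r -> L2 leb (u r) by move=> r0; apply/inL2E; exact: Lut.
set G := pos_ext g in wG *.
have aeI := wL2_ae_int c0 wG.
have [->|tn0] := eqVneq t 0.
  by apply: aeW => x; rewrite /tint set_itv1 Rintegral_set1 addr0.
have tp : 0 < t by rewrite lt_neqAle eq_sym tn0.
pose s (n : nat) : R := Num.min t n.+1%:R^-1.
have s0 n : 0 < s n <= t by rewrite lt_min tp invr_gt0 ge_min lexx /= ltr0n.
pose D := (u t \- tint G t) \- u 0.
have mD : measurable_fun [set: E] D.
  apply: measurable_funB; last exact: (Lu2 0 (lexx 0)).1.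
  by apply: measurable_funB; [exact: (Lu2 t t0).1|exact: jmeas_t (jmeas_tint wG.1)].
have eqs : {ae leb, forall x, forall n, (u (s n) \- u 0) x = D x + tint G (s n) x}.
  apply/ae_foralln => n; have /andP[sn0 snt] := s0 n.
  have := weak_increment cu Lu wg (s0 n); apply: filterS2 aeI => x ix /=.
  rewrite -(tint_diff (b := t) (a := s n)) //; last by rewrite (ltW sn0).
  by rewrite /D /= => E1; move: E1; lra.
have scvg : s n @[n --> \oo] --> 0.
  apply/cvgrPdist_le => e e0; near=> n; rewrite sub0r normrN ger0_norm; last by rewrite ltW//; have /andP[] := s0 n.
  apply: (@le_trans _ _ n.+1%:R^-1); first by rewrite ge_min lexx orbT.
  by apply: ltW; near: n; exact: near_infty_natSinv_lt (PosNum e0).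
have sq0 (e : R) : 0 < e -> (sqint leb D <= e%:E)%E.
  move=> e0; apply: (@fatou_sqint _ _ _ leb (fun n => u (s n) \- u 0)) => //.
  - move=> n; have /andP[sn0 _] := s0 n.
    by apply: measurable_funB; [exact: (Lu2 _ (ltW sn0)).1|exact: (Lu2 0 (lexx 0)).1].
  - apply: filterS2 aeI eqs => x ix ex.
    rewrite (_ : (fun n => _) = (fun n => D x + tint G (s n) x)); last by apply/funext => n; rewrite ex.
    rewrite -[X in _ --> X]addr0; apply: cvgD; first exact: cvg_cst.
    have py := prim_int 0 ix.
    have := prim_continuous t0 py => /(continuous_within_itvP _ tp)[_ + _].
    rewrite set_itv1 Rintegral_set1 addr0 => cr.
    have sp n : 0 < s n by have /andP[] := s0 n.
    have H := (cvg_at_rightP _ _ _).1 cr s (conj sp scvg).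
    by rewrite (_ : (fun n => _) = (fun n => 0 + \int[mu]_(r in `[0, s n]) G r x)) //; apply/funext => n; rewrite add0r.
  - have sw : s n @[n --> \oo] --> within `[0, +oo[ (nbhs (0 : R)).
      move=> A HA; have H1 : \forall n \near \oo, (`[(0 : R), +oo[%classic (s n) -> A (s n)) by exact: scvg _ HA.
      apply: filterS H1 => n; apply.
      by rewrite /= in_itv/= andbT ltW//; have /andP[] := s0 n.
    have := (cvge0P (within_proper (lexx 0)) (fun q => sqint_ge0 leb (u q \- u 0))).2 ((L2norm_cvg0 (within_proper (lexx 0)) _).1 (cut 0 (lexx 0))) e e0.
    exact: sw.
have D0 : sqint leb D = 0%E.
  by apply/eqP; rewrite eq_le sqint_ge0 andbT; apply/lee_addgt0Pr => e e0; rewrite add0e; exact: sq0.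
have := sqint_eq0 mD D0; apply: filterS => x; rewrite /D /= => /eqP; rewrite subr_eq0 => /eqP <-.
by rewrite subrK.
Unshelve. all: by end_near. Qed.

End time_primitive.

(** * Functions with prescribed initial value and weak derivative *)

Section time_primitive.
Context {R : realType} {N : nat}.
Local Notation E := 'rV[R]_N.
Local Notation mu := (@lebesgue_measure R).
Local Notation leb := (lebesgue_rV R N).
Local Notation T := (measurableTypeR R).
Local Notation M := (lebesgue_measure \x leb)%E.
Implicit Types (u g d G W : R -> E -> R) (h v : E -> R).

Section construct.
Variables (c : R) (u0 : E -> R) (d : R -> E -> R).
Hypothesis c0 : 0 <= c.
Hypothesis Lu0 : L2 leb u0.
Hypothesis wd : wL2 c d.

Definition uprim (t : R) (x : E) : R := u0 x + tint d t x.

Lemma jmeas_uprim : jmeas uprim.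
Proof.
apply: (@measurable_funD _ _ _ _ (fun z : T * E => u0 z.2) (unc (tint d))).
  exact: jmeas_snd Lu0.1.
exact: jmeas_tint wd.1.
Qed.

Lemma L2_uprim t : L2 leb (uprim t).
Proof. exact: L2D Lu0 (tint_L2 t wd c0). Qed.

Lemma wint2_fin : wint2 c d \is a fin_num.
Proof. by rewrite ge0_fin_numE ?sqint_ge0//; have /(wL2P c wd.1)[] := wd. Qed.

Lemma uprimB t s : uprim t \- uprim s = tint d t \- tint d s.
Proof. by apply/funext => x /=; rewrite /uprim; ring. Qed.

Lemma CL2_uprim : CL2 uprim.
Proof.
split; [by apply: measurable_funTS; exact: jmeas_uprim|by move=> t _; apply/inL2E; exact: L2_uprim|].
move=> t t0; apply/(L2norm_cvg0 (within_proper t0)); apply/(cvge0P (within_proper t0) (fun s => sqint_ge0 leb _)) => e e0; set A := fine (wint2 c d).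
have A0 : 0 <= A by apply: fine_ge0; exact: sqint_ge0.
pose k := expR (c * (t + 1)) * (A + 1); have k0 : 0 < k by rewrite mulr_gt0 ?expR_gt0// ltr_wpDl.
have dl : 0 < Num.min 1 (e / k) by rewrite lt_min ltr01 divr_gt0.
have H a b : 0 <= a <= b -> b <= t + 1 -> b - a <= e / k -> (sqint leb (tint d b \- tint d a) <= e%:E)%E.
  move=> ab bt bak; apply: (le_trans (tint_diff_le wd c0 ab)); rewrite -(fineK wint2_fin) -/A -EFinM lee_fin.
  have /andP[a0 ab'] := ab; have ba0 : 0 <= b - a by rewrite subr_ge0.
  apply: (@le_trans _ _ (expR (c * (t + 1)) * (e / k) * (A + 1))); last by rewrite /k le_eqVlt; apply/orP; left; apply/eqP; field; rewrite !gt_eqF ?expR_gt0// ltr_wpDl.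
  apply: ler_pM => //; rewrite ?mulr_ge0 ?expR_ge0// ?lerDl//.
  by apply: ler_pM => //; rewrite ?expR_ge0// ler_expR ler_wpM2l.
have nb : \forall s \near t, `|t - s| < Num.min 1 (e / k).
  exact: (nbhsx_ballx t _ dl).
rewrite /within /=; apply: filterS nb => s; rewrite lt_min => /andP[h1 h2]; rewrite /= in_itv/= andbT => s0.
rewrite uprimB; have [st|ts] := leP s t.
  rewrite sqintBC; apply: H; rewrite ?s0//; first by rewrite lerDl.
  by move: h2; rewrite ger0_norm ?subr_ge0// => /ltW.
move: h1 h2; rewrite ltr0_norm ?subr_lt0// opprB => h1 h2.
by apply: H; rewrite ?t0 ?(ltW ts)//; lra.
Qed.

Lemma measurable_L2norm G : jmeas G -> measurable_fun [set: T] (fun t => L2norm (G t)).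
Proof.
move=> mG; rewrite (_ : (fun t => _) = (fun t => sqint leb (G t) `^ 2^-1)%E); last first.
  by apply/funext => t; rewrite L2normE poweR12_sqrt// sqint_ge0.
by apply: (measurableT_comp (measurable_poweR _)); exact: measurable_sqint.
Qed.

Lemma L2norm_le1 v : (L2norm v <= 1 + sqint leb v)%E.
Proof.
have [fv|] := ltP (sqint leb v) +oo%E; last by rewrite leye_eq => /eqP ->; rewrite addeC addye ?leey.
have fn : sqint leb v \is a fin_num by rewrite ge0_fin_numE ?sqint_ge0.
have A0 : 0 <= fine (sqint leb v) by apply: fine_ge0; exact: sqint_ge0.
rewrite -(fineK fn) -EFinD L2norm_le ?addr_ge0// -[X in (X <= _)%E](fineK fn) lee_fin.
set A := fine _ in A0 *; have := sqr_ge0 A; rewrite sqrrD expr1n mul1r mulr2n; lra.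
Qed.

Lemma L1loc_sq G (b : R) : jmeas G -> (\int[mu]_(t in `[(0 : R)%R, b]) sqint leb (G t) < +oo)%E ->
  forall a, 0 < a -> (\int[mu]_(t in `[a, b]) L2norm (G t) < +oo)%E.
Proof.
move=> mG iG a a0.
have sub : `[a, b]%classic `<=` `[(0 : R), b]%classic by apply: subset_itvr; rewrite bnd_simp ltW.
apply: (@le_lt_trans _ _ (\int[mu]_(t in `[(0 : R)%R, b]) (1 + sqint leb (G t)))%E).
  apply: (@le_trans _ _ (\int[mu]_(t in `[a, b]) (1 + sqint leb (G t)))%E).
    apply: ge0_le_integral => //.
    - by move=> t _; exact: L2norm_ge0.
    - by apply: measurable_funTS; exact: measurable_L2norm.
    - by apply: measurable_funTS; apply: emeasurable_funD; [exact: measurable_cst|exact: measurable_sqint].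
    - by move=> t _; exact: L2norm_le1.
  apply: ge0_subset_integral => //.
  - by apply: measurable_funTS; apply: emeasurable_funD; [exact: measurable_cst|exact: measurable_sqint].
  - by move=> t _; rewrite adde_ge0 ?sqint_ge0.
have msq : measurable_fun `[(0 : R), b] (fun t => sqint leb (G t)) by apply: measurable_funTS; exact: measurable_sqint.
have m1 : measurable_fun `[(0 : R), b] (fun t : R => 1%:E : \bar R) by exact: measurable_cst.
rewrite (ge0_integralD mu (mitv `[(0 : R), b]) (fun _ _ => lee01) m1 (fun t _ => sqint_ge0 leb (G t)) msq).
rewrite lte_add_pinfty// integral_cst; last exact: mitv.
have := lebesgue_measure_itv `[(0 : R), b]; rewrite /= => E1.
rewrite mul1e; apply: (@le_lt_trans _ _ (if (0%:E < b%:E)%E then (b%:E - 0%:E) else 0)%E).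
  by rewrite -E1.
by case: ifP => _; rewrite ?ltry// -EFinB ltry.
Qed.

Lemma L1locL2_d : L1locL2 d.
Proof.
split; first by apply: measurable_funTS; exact: wd.1.
move=> a b a0; apply: L1loc_sq => //; first exact: wd.1.
have msq := measurable_sqint wd.1.
apply: (@le_lt_trans _ _ (\int[mu]_(t in `[(0 : R)%R, +oo[) ((expR (c * `|b|))%:E * ((expR (- c * t))%:E * sqint leb (d t))))%E).
  apply: (@le_trans _ _ (\int[mu]_(t in `[(0 : R)%R, b]) ((expR (c * `|b|))%:E * ((expR (- c * t))%:E * sqint leb (d t))))%E).
    apply: ge0_le_integral => //.
    - by move=> t _; exact: sqint_ge0.
    - exact: measurable_funTS.
    - by apply: measurable_funTS; apply: measurable_funeM; apply: emeasurable_funM => //; exact: measurable_expw.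
    - move=> t /=; rewrite in_itv/= => /andP[t0 tb]; rewrite muleA -EFinM -expRD.
      rewrite -[leLHS]mul1e; apply: lee_wpmul2r; first exact: sqint_ge0.
      rewrite lee_fin -expR0 ler_expR mulNr subr_ge0 ler_wpM2l//.
      by apply: (le_trans tb); exact: ler_norm.
  apply: ge0_subset_integral => //.
  - by apply: measurable_funTS; apply: measurable_funeM; apply: emeasurable_funM => //; exact: measurable_expw.
  - by move=> t _; rewrite !mule_ge0 ?sqint_ge0// lee_fin expR_ge0.
  - exact: subset_halfline.
rewrite (ge0_integralZl mu (mitv `[(0 : R), +oo[)).
- rewrite muleC lte_mul_pinfty ?lee_fin ?expR_ge0 ?ltry//.
  + by apply: integral_ge0 => t _; rewrite mule_ge0 ?sqint_ge0// lee_fin expR_ge0.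
  + rewrite ge0_fin_numE; first exact: wd.2.
    by apply: integral_ge0 => t _; rewrite mule_ge0 ?sqint_ge0// lee_fin expR_ge0.
- by apply: measurable_funTS; apply: emeasurable_funM => //; exact: measurable_expw.
- by move=> t _; rewrite mule_ge0 ?sqint_ge0// lee_fin expR_ge0.
- by rewrite lee_fin expR_ge0.
Qed.

Lemma L1locL2_uprim : L1locL2 uprim.
Proof.
split; first by apply: measurable_funTS; exact: jmeas_uprim.
move=> a b a0; apply: L1loc_sq => //; first exact: jmeas_uprim.
set A := fine (wint2 c d).
have A0 : 0 <= A by apply: fine_ge0; exact: sqint_ge0.
pose B : R := 2 * fine (sqint leb u0) + 2 * (expR (c * `|b|) * `|b| * A).
apply: (@le_lt_trans _ _ (\int[mu]_(t in `[(0 : R)%R, b]) B%:E)%E).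
  apply: ge0_le_integral => //.
  - by move=> t _; exact: sqint_ge0.
  - by apply: measurable_funTS; exact: measurable_sqint jmeas_uprim.
  - move=> t /=; rewrite in_itv/= => /andP[t0 tb].
    apply: (le_trans (sqintD_le leb Lu0.1 (jmeas_t t (jmeas_tint wd.1)))).
    have fu : sqint leb u0 \is a fin_num by rewrite ge0_fin_numE ?sqint_ge0//; exact: Lu0.2.
    have -> : B%:E = ((2 * fine (sqint leb u0))%:E + (2 * (expR (c * `|b|) * `|b| * A))%:E)%E by [].
    apply: leeD; first by rewrite EFinM fineK.
    rewrite EFinM; apply: lee_wpmul2l => //.
    have t0t : 0 <= (0 : R) <= t by rewrite lexx t0.
    have := tint_diff_le wd c0 t0t; rewrite (_ : tint d t \- tint d 0 = tint d t); last first.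
      by apply/funext => x /=; rewrite /tint set_itv1 Rintegral_set1 subr0.
    move=> /le_trans; apply; rewrite -(fineK wint2_fin) -/A -EFinM lee_fin subr0.
    have tb' : t <= `|b| by apply: (le_trans tb); exact: ler_norm.
    by apply: ler_wpM2r => //; apply: ler_pM => //; rewrite ?expR_ge0// ler_expR ler_wpM2l.
rewrite integral_cst; last exact: mitv.
have := lebesgue_measure_itv `[(0 : R), b]; rewrite /= => E1.
have B0 : 0 <= B by rewrite addr_ge0// mulr_ge0// ?fine_ge0 ?sqint_ge0// !mulr_ge0 ?expR_ge0.
rewrite muleC lte_mul_pinfty ?lee_fin ?ltry//.
rewrite ge0_fin_numE//; apply: (@le_lt_trans _ _ (if (0%:E < b%:E)%E then (b%:E - 0%:E) else 0)%E).
  by rewrite -E1.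
by case: ifP => _; rewrite ?ltry// -EFinB ltry.
Qed.

(** At almost every point the function is an honest primitive in time, and integration by parts
    against the test function is the product rule [prim_mul]. *)
Lemma weak_dt_uprim : weak_dt uprim d.
Proof.
split; first exact: L1locL2_d.
move=> phi tphi; have [a [b [B [a0 mphi mphi' [pB pB'] [p0 p0']]]]] := test_fun_bounded tphi.
have := wL2_ae_int c0 wd; apply: filterS => x ix.
have pu : prim (uprim^~ x) (d^~ x) := prim_int (u0 x) ix.
have pphi : prim phi (derive1 phi).
  apply: prim_derive.
    by move=> t; apply: differentiable_continuous; apply/derivable1_diffP; exact: (tphi.1 1 t).
  by move=> t; apply: DeriveDef; [exact: (tphi.1 0 t)|rewrite -derive1E].
pose b' := `|b| + 1; have b'0 : 0 <= b' by rewrite addr_ge0.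
have bb' : b < b' by rewrite (le_lt_trans (ler_norm b))// ltrDl.
have [_ /(_ b' b'0)] := prim_mul pphi pu.
rewrite (p0 b'); last by rewrite negb_and -!ltNge bb' orbT.
rewrite (p0 0); last by rewrite negb_and -!ltNge a0.
rewrite !mul0r add0r => /esym.
have i1 := integrable_mul_prim pu (pphi.1 b'); have i2 := integrable_mul_prim pphi (pu.1 b').
rewrite (RintegralD (mitv _) i1 i2).
have cut (p q : R -> R) : (forall t, ~~ (a <= t <= b) -> p t = 0) ->
    \int[mu]_(t in `[0, b']) (p t * q t) = \int[mu]_(t in `]0, +oo[) (p t * q t).
  move=> pz; rewrite [LHS]Rint_indic [RHS]Rint_indic; apply: eq_Rintegral => t _.
  have [tI|tI] := boolP (a <= t <= b); last by rewrite (pz _ tI) !mul0r !mulr0.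
  have /andP[at_ tb] := tI; have t0 := lt_le_trans a0 at_.
  by rewrite !indicE !mem_set//= in_itv/= ?t0// (ltW t0) (le_trans tb (ltW bb')).
rewrite (cut _ _ p0').
have -> : \int[mu]_(t in `[0, b']) (d t x * phi t) = \int[mu]_(t in `]0, +oo[) (phi t * d t x).
  by rewrite -(cut _ _ p0); apply: eq_Rintegral => t _; rewrite mulrC.
by move=> /eqP; rewrite addr_eq0 => /eqP.
Qed.

(** [dt] chooses some weak derivative; by uniqueness it agrees with [d] at almost every time. *)
Lemma dt_uprim : weak_dt uprim (dt uprim) /\ {ae mu, forall t, 0 < t -> {ae leb, forall x, dt uprim t x = d t x}}.
Proof.
have w : weak_dt uprim (dt uprim) by apply: (@xgetPex _ (fun _ _ => 0) [set g | weak_dt uprim g]); exists d; exact: weak_dt_uprim.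
split=> //; exact: weak_dt_unique CL2_uprim L1locL2_uprim w weak_dt_uprim.
Qed.

End construct.

End time_primitive.

(** * The problem at all frequencies *)

Section joint_frequency.
Context {R : realType} {N : nat}.
Local Notation E := 'rV[R]_N.
Local Notation mu := (@lebesgue_measure R).
Local Notation leb := (lebesgue_rV R N).
Local Notation T := (measurableTypeR R).
Local Notation M := (lebesgue_measure \x leb)%E.
Implicit Types (G W : R -> E -> R).
Variables (K sg : R) (L h0 : E -> R) (F : R -> E -> R).
Hypothesis K0 : K <= 0.
Hypothesis sg0 : 0 <= sg.
Hypothesis mL : measurable_fun [set: E] L.
Hypothesis KL : {ae leb, forall xi, K <= L xi}.
Hypothesis Lh0 : L2 leb h0.
Hypothesis Vh0 : (\int[leb]_xi (`|L xi| * h0 xi ^+ 2)%:E < +oo)%E.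
Hypothesis wF : wL2 sg F.

(** The solutions at a fixed frequency, now as functions of time and frequency. Their explicit
    formulas make them jointly measurable, whereas their equations and bounds hold for almost every
    frequency. *)
Definition gJ (e t : R) (xi : E) := gf e (L xi) (F^~ xi) t.
Definition UJ (e t : R) (xi : E) := Uf e (L xi) (h0 xi) (F^~ xi) t.
Definition ZJ (e t : R) (xi : E) := Zf e (L xi) (h0 xi) (F^~ xi) t.
Definition U0J (t : R) (xi : E) := U0f (L xi) (h0 xi) (F^~ xi) t.
Definition S2 (xi : E) := size2 sg (L xi) (h0 xi) (F^~ xi).

Lemma jmeas_exp (a : E -> R) : measurable_fun [set: E] a -> jmeas (fun t xi => expR (a xi * t)).
Proof.
move=> ma; apply: (@measurableT_comp _ _ _ _ _ _ (@expR R)).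
  by apply: continuous_measurable_fun; exact: continuous_expR.
by apply: measurable_funM; [exact: (measurableT_comp ma measurable_snd)|exact: measurable_fst].
Qed.

Lemma measurable_root (e : R) : measurable_fun [set: E] (fun xi => root_a e (L xi)) /\ measurable_fun [set: E] (fun xi => root_b e (L xi)).
Proof.
have ms : measurable_fun [set: E] (fun xi => Num.sqrt (1 + 4 * e * L xi)).
  apply: (@measurableT_comp _ _ _ _ _ _ (@Num.sqrt R)).
    by apply: continuous_measurable_fun; exact: sqrt_continuous.
  by apply: measurable_funD; [exact: measurable_cst|apply: measurable_funM => //; exact: measurable_cst].
by split; apply: measurable_funM => //; [apply: measurable_funD|apply: measurable_funB].
Qed.

Lemma measurable_Rint_halfline G : jmeas G -> measurable_fun [set: E] (fun xi => \int[mu]_(s in `[(0 : R), +oo[) G s xi).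
Proof.
move=> mG; rewrite (_ : (fun xi => _) = (fun xi => \int[mu]_s (\1_(`[(0 : R), +oo[%classic : set R) s * G s xi))); last first.
  by apply/funext => xi; rewrite Rint_indic.
apply: (measurable_Rintegral_param mu (f := fun z : E * T => \1_(`[(0 : R), +oo[%classic : set R) z.2 * G z.2 z.1)).
apply: measurable_funM; first exact: (measurableT_comp (measurable_ind _) measurable_snd).
exact: (measurableT_comp mG (measurable_fun_pair measurable_snd measurable_fst)).
Qed.

Let mF := wF.1.

Lemma jmeas_gJ e : jmeas (gJ e).
Proof.
have [ma mb] := measurable_root e.
have mE : jmeas (fun s xi => expR (- root_a e (L xi) * s) * F s xi).
  by apply: jmeas_M => //; apply: (jmeas_exp (a := fun xi => - root_a e (L xi))); exact: measurableT_comp.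
apply: measurable_funM; first exact: measurable_cst.
apply: measurable_funM; first exact: (jmeas_exp ma).
by apply: measurable_funB; [exact: jmeas_snd (measurable_Rint_halfline mE)|exact: jmeas_tint mE].
Qed.

Lemma jmeas_odesol (b : E -> R) G : measurable_fun [set: E] b -> jmeas G ->
  jmeas (fun t xi => odesol (b xi) (h0 xi) (G^~ xi) t).
Proof.
move=> mb mG; have mE : jmeas (fun s xi => expR (b xi * s) * G s xi) by apply: jmeas_M => //; exact: jmeas_exp.
apply: measurable_funM; first by apply: (jmeas_exp (a := fun xi => - b xi)); exact: measurableT_comp.
by apply: measurable_funD; [exact: jmeas_snd Lh0.1|exact: jmeas_tint mE].
Qed.

Lemma jmeas_UJ e : jmeas (UJ e).
Proof. exact: jmeas_odesol (measurable_root e).2 (jmeas_gJ e). Qed.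

Lemma jmeas_ZJ e : jmeas (ZJ e).
Proof.
apply: (@jmeas_B _ _ (gJ e) (fun t xi => root_b e (L xi) * UJ e t xi)); first exact: jmeas_gJ.
by apply: (@jmeas_M _ _ (fun _ xi => root_b e (L xi)) (UJ e)); [exact: jmeas_snd (measurable_root e).2|exact: jmeas_UJ].
Qed.

Lemma jmeas_U0J : jmeas U0J. Proof. exact: jmeas_odesol. Qed.

Lemma good_ae : {ae leb, forall xi, K <= L xi /\ wdata sg (F^~ xi)}.
Proof. by have := wL2_wdata wF; apply: filterS2 KL => xi; split. Qed.

Lemma S2_ge0 xi : 0 <= S2 xi. Proof. exact: size2_ge0. Qed.

Lemma measurable_wint : measurable_fun [set: E] (fun xi => wint sg (F^~ xi)).
Proof.
apply: (measurable_Rint_halfline (G := fun s xi => expR (- sg * s) * F s xi ^+ 2)).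
apply: (@jmeas_M _ _ (fun s _ => expR (- sg * s)) (fun s xi => F s xi ^+ 2)); last exact: measurable_funX.
by apply: jmeas_fst; apply: continuous_measurable_fun; exact: continuous_expRZ.
Qed.

Lemma measurable_S2 : measurable_fun [set: E] S2.
Proof.
apply: measurable_funD; last exact: measurable_wint.
apply: measurable_funM; last by apply: measurable_funX; exact: Lh0.1.
by apply: measurable_funD; [exact: measurable_cst|exact: measurableT_comp].
Qed.

(** The datum contributes its squared norm in V, and the forcing its weighted norm, by Tonelli. *)
Lemma integrable_S2 : leb.-integrable [set: E] (EFin \o S2).
Proof.
have i1 := L2_integrable Lh0.
have i2 : leb.-integrable [set: E] (fun xi => (`|L xi| * h0 xi ^+ 2)%:E).
  apply/integrableP; split.
    apply/measurable_EFinP; apply: measurable_funM; first exact: measurableT_comp.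
    by apply: measurable_funX; exact: Lh0.1.
  apply: le_lt_trans Vh0; rewrite le_eqVlt; apply/orP; left; apply/eqP; apply: eq_integral => xi _.
  by rewrite gee0_abs// lee_fin mulr_ge0 ?sqr_ge0.
have Lw := (wL2P sg mF).1 wF.
have i3 : leb.-integrable [set: E] (EFin \o (fun xi => wint sg (F^~ xi))).
  apply/integrableP; split; first by apply/measurable_EFinP; exact: measurable_wint.
  apply: le_lt_trans Lw.2; rewrite (sqint_unc2 Lw.1) le_eqVlt; apply/orP; left; apply/eqP.
  apply: ae_eq_integral => //.
  - by apply: measurableT_comp => //; apply/measurable_EFinP; exact: measurable_wint.
  - apply: (measurable_integral_param mu (f := fun z : E * T => unc (wtG sg F) (z.2, z.1) ^+ 2)).
    by apply: measurable_funX; apply: (measurableT_comp Lw.1); exact: (measurable_fun_pair measurable_snd measurable_fst).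
  have := wL2_wdata wF; apply: filterS => xi [mx ix] _.
  rewrite /= ger0_norm ?wint_ge0// /wint /Rintegral fineK; last exact: integrable_fin_num ix.
  rewrite integral_mkcond /sqint; apply: eq_integral => s _; rewrite /wtG exprMn wt_sq patchE indicE.
  by case: ifPn => _; rewrite ?mulr1 ?mulr0 ?mul0r.
have := integrableD measurableT (integrableD measurableT i1 i2) i3; apply: eq_integrable => // xi _ /=.
by rewrite -!EFinD; congr EFin; rewrite /S2 /size2; ring.
Qed.

Definition Stot : R := \int[leb]_xi S2 xi.

Lemma Stot_ge0 : 0 <= Stot. Proof. by apply: Rintegral_ge0 => xi _; exact: S2_ge0. Qed.

Lemma integral_le_S2 (X : E -> R) (C : R) : measurable_fun [set: E] X -> 0 <= C ->
  (forall xi, 0 <= X xi) -> {ae leb, forall xi, X xi <= C * S2 xi} -> (\int[leb]_xi (X xi)%:E <= (C * Stot)%:E)%E.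
Proof.
move=> mX C0 X0 XC; apply: (@le_trans _ _ (\int[leb]_xi (C * S2 xi)%:E)%E).
  apply: ae_ge0_le_integral => //.
  - by move=> xi _; rewrite lee_fin.
  - exact/measurable_EFinP.
  - by move=> xi _; rewrite lee_fin mulr_ge0 ?S2_ge0.
  - by apply/measurable_EFinP; apply: measurable_funM; [exact: measurable_cst|exact: measurable_S2].
  - by apply: filterS XC => xi h _; rewrite lee_fin.
have E1 := RintegralZl C measurableT integrable_S2.
rewrite -[X in (X <= _)%E]fineK; first by rewrite lee_fin -/(Rintegral _ _ _) E1.
by have := integrableZl measurableT C integrable_S2 => /(integrable_fin_num measurableT).
Qed.

Lemma wL2_growth (c k C : R) G : jmeas G -> 0 <= C -> k < c ->
  (forall t, 0 <= t -> (sqint leb (G t) <= (C * expR (k * t))%:E)%E) -> wL2 c G.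
Proof.
move=> mG C0 kc GC; split=> //; have ck : 0 < c - k by rewrite subr_gt0.
have [i1 _] := expR_tail 0 ck; have i2 := integrableZl (mitv `[(0 : R), +oo[) C i1.
have /integrableP[_] := i2; apply: le_lt_trans; apply: ge0_le_integral => //.
- by move=> t _; rewrite mule_ge0 ?sqint_ge0// lee_fin expR_ge0.
- by apply: measurable_funTS; apply: emeasurable_funM; [exact: measurable_expw|exact: measurable_sqint].
- by apply: measurableT_comp => //; have /measurable_int := i2.
- move=> t /=; rewrite in_itv/= andbT => t0.
  apply: (@le_trans _ _ ((expR (- c * t))%:E * (C * expR (k * t))%:E)%E).
    by apply: lee_wpmul2l; [rewrite lee_fin expR_ge0|exact: GC].
  rewrite -[X in (_ <= X)%E]/(`|C%:E * (expR (- (c - k) * t))%:E|%E) -!EFinM gee0_abs; last by rewrite lee_fin mulr_ge0 ?expR_ge0.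
  rewrite lee_fin le_eqVlt; apply/orP; left; apply/eqP.
  by rewrite mulrCA -expRD; congr (_ * expR _); ring.
Qed.

Section fixed_eps.
Variable e : R.
Hypothesis e0 : 0 < e.
Hypothesis er : 2 * e * rate K sg <= 1.

Lemma rate_lt : rate K sg < e^-1 /\ sg <= e^-1.
Proof.
have r1 := rate_ge1 K0 sg0.
have h : rate K sg < e^-1.
  rewrite -(ltr_pM2l e0) mulfV ?gt_eqF//; have : 0 < e * rate K sg by rewrite mulr_gt0// (lt_le_trans ltr01 r1).
  by move: er; rewrite -mulrA; lra.
by split=> //; move: h; rewrite /rate; move: K0; lra.
Qed.

Lemma wF_eps : wL2 e^-1 F.
Proof.
split; first exact: mF; apply: le_lt_trans wF.2; apply: ge0_le_integral => //.
- by move=> t _; rewrite mule_ge0 ?sqint_ge0// lee_fin expR_ge0.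
- by apply: measurable_funTS; apply: emeasurable_funM; [exact: measurable_expw|exact: measurable_sqint].
- by apply: measurable_funTS; apply: emeasurable_funM; [exact: measurable_expw|exact: measurable_sqint].
- move=> t /=; rewrite in_itv/= andbT => t0; apply: lee_wpmul2r; first exact: sqint_ge0.
  by rewrite lee_fin ler_expR !mulNr lerN2 ler_wpM2r//; exact: rate_lt.2.
Qed.

Lemma UJ_weighted t : 0 <= t -> (\int[leb]_xi ((1 + `|L xi|) * UJ e t xi ^+ 2)%:E <= (cstU K * expR (rate K sg * t) * Stot)%:E)%E.
Proof.
move=> t0; apply: integral_le_S2.
- apply: measurable_funM; first by apply: measurable_funD; [exact: measurable_cst|exact: measurableT_comp].
  by apply: measurable_funX; exact: jmeas_t (jmeas_UJ e).
- by rewrite mulr_ge0 ?expR_ge0// cstU_ge0.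
- by move=> xi; rewrite mulr_ge0 ?sqr_ge0// addr_ge0.
have := good_ae; apply: filterS => xi [KLx wx]; rewrite mulrAC.
exact: Uf_bound.
Qed.

Lemma ZJ_wL2 : wL2 e^-1 (ZJ e).
Proof.
have C0 := cstZ_ge0 K0; have C1 : 0 <= cstZ K / e by rewrite divr_ge0// ltW.
apply: (@wL2_growth _ (rate K sg) (cstZ K / e * Stot)); [exact: jmeas_ZJ|by rewrite mulr_ge0 ?Stot_ge0|exact: rate_lt.1|].
move=> t t0; rewrite mulrAC; apply: integral_le_S2.
- by apply: measurable_funX; exact: jmeas_t (jmeas_ZJ e).
- by rewrite mulr_ge0 ?expR_ge0.
- by move=> xi; exact: sqr_ge0.
have := good_ae; apply: filterS => xi [KLx wx].
have := Zf_bound K0 sg0 (h0 xi) e0 er KLx wx t0; rewrite mulrC -ler_pdivlMr// => /le_trans; apply.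
by rewrite le_eqVlt; apply/orP; left; apply/eqP; rewrite /S2; ring.
Qed.

Lemma UJ_uprim : {ae leb, forall xi, forall t, 0 <= t -> uprim h0 (ZJ e) t xi = UJ e t xi}.
Proof.
have := good_ae; apply: filterS => xi [KLx wx] t t0.
have [_ E1] := prim_Uf K0 sg0 (h0 xi) e0 er KLx wx.
by rewrite /UJ (E1 t t0) Uf0.
Qed.

Lemma L2_UJ t : 0 <= t -> L2 leb (UJ e t).
Proof.
move=> t0; split; first exact: jmeas_t (jmeas_UJ e).
apply: le_lt_trans (le_lt_trans (UJ_weighted t0) (ltry _)); apply: ge0_le_integral => //.
- by move=> xi _; rewrite lee_fin sqr_ge0.
- by apply: measurable_sq; exact: jmeas_t (jmeas_UJ e).
- apply/measurable_EFinP; apply: measurable_funM; first by apply: measurable_funD; [exact: measurable_cst|exact: measurableT_comp].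
  by apply: measurable_funX; exact: jmeas_t (jmeas_UJ e).
- by move=> xi _; rewrite lee_fin ler_peMl ?sqr_ge0// lerDl.
Qed.

End fixed_eps.

Lemma U0J_weighted t : 0 <= t -> (\int[leb]_xi ((1 + `|L xi|) * U0J t xi ^+ 2)%:E <= (cstU K * expR (rate K sg * t) * Stot)%:E)%E.
Proof.
move=> t0; apply: integral_le_S2.
- apply: measurable_funM; first by apply: measurable_funD; [exact: measurable_cst|exact: measurableT_comp].
  by apply: measurable_funX; exact: jmeas_t jmeas_U0J.
- by rewrite mulr_ge0 ?expR_ge0// cstU_ge0.
- by move=> xi; rewrite mulr_ge0 ?sqr_ge0// addr_ge0.
have := good_ae; apply: filterS => xi [KLx wx]; rewrite mulrAC.
exact: U0f_bound.
Qed.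

Lemma L2_U0J t : 0 <= t -> L2 leb (U0J t).
Proof.
move=> t0; split; first exact: jmeas_t jmeas_U0J.
apply: le_lt_trans (le_lt_trans (U0J_weighted t0) (ltry _)); apply: ge0_le_integral => //.
- by move=> xi _; rewrite lee_fin sqr_ge0.
- by apply: measurable_sq; exact: jmeas_t jmeas_U0J.
- apply/measurable_EFinP; apply: measurable_funM; first by apply: measurable_funD; [exact: measurable_cst|exact: measurableT_comp].
  by apply: measurable_funX; exact: jmeas_t jmeas_U0J.
- by move=> xi _; rewrite lee_fin ler_peMl ?sqr_ge0// lerDl.
Qed.

(** The factor 16 comes from [Uf_lip]; it also covers the factor 2 of [Uf_cvg_rate], so that one
    constant serves both hypotheses of [chain_ae]. *)
Definition cstD (t : R) : R := 16 * Num.sqrt (cstZ K) * expR (rate K sg / 2 * t) * Num.sqrt Stot.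

Lemma nrm_le_amp (X : E -> R) (C t : R) : L2 leb X -> 0 <= C ->
  {ae leb, forall xi, `|X xi| <= C * (amp K sg (L xi) (h0 xi) (F^~ xi) * expR (rate K sg / 2 * t))} ->
  nrm leb X <= C * (Num.sqrt (cstZ K) * expR (rate K sg / 2 * t) * Num.sqrt Stot).
Proof.
move=> LX C0 H; have Z0 := cstZ_ge0 K0.
apply: (nrm_le _ LX); first by rewrite !mulr_ge0 ?sqrtr_ge0 ?expR_ge0.
have -> : (C * (Num.sqrt (cstZ K) * expR (rate K sg / 2 * t) * Num.sqrt Stot)) ^+ 2 =
  C ^+ 2 * cstZ K * expR (rate K sg / 2 * t) ^+ 2 * Stot.
  by rewrite !exprMn (sqr_sqrtr Z0) (sqr_sqrtr Stot_ge0); ring.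
apply: integral_le_S2.
- by apply: measurable_funX; exact: LX.1.
- by rewrite !mulr_ge0 ?sqr_ge0.
- by move=> xi; exact: sqr_ge0.
apply: filterS H => xi H; rewrite -sqr_normr; have A0 : 0 <= amp K sg (L xi) (h0 xi) (F^~ xi) by exact: sqrtr_ge0.
apply: (@le_trans _ _ ((C * (amp K sg (L xi) (h0 xi) (F^~ xi) * expR (rate K sg / 2 * t))) ^+ 2)).
  by rewrite lerXn2r ?nnegrE// !mulr_ge0 ?expR_ge0.
rewrite !exprMn sqr_sqrtr ?mulr_ge0 ?size2_ge0// /S2 le_eqVlt; apply/orP; left; apply/eqP; ring.
Qed.

Lemma UJ_lip d e t : 0 < d -> d <= e -> 2 * e * rate K sg <= 1 -> 0 <= t ->
  nrm leb (UJ d t \- UJ e t) <= cstD t * (Num.sqrt e - Num.sqrt d).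
Proof.
move=> d0 de er t0; have e0 := lt_le_trans d0 de.
have dr : 2 * d * rate K sg <= 1.
  by apply: le_trans er; rewrite ler_wpM2r ?ler_wpM2l//; apply: le_trans (rate_ge1 K0 sg0).
have se : 0 <= 16 * (Num.sqrt e - Num.sqrt d) by rewrite mulr_ge0// subr_ge0 ler_wsqrtr.
have := nrm_le_amp (t := t) (L2B (L2_UJ d0 dr t0) (L2_UJ e0 er t0)) se.
rewrite (_ : 16 * (Num.sqrt e - Num.sqrt d) * (_ * _ * _) = cstD t * (Num.sqrt e - Num.sqrt d)); last by rewrite /cstD; ring.
apply; have := good_ae; apply: filterS => xi [KLx wx]; apply: (le_trans (Uf_lip K0 sg0 (h0 xi) d0 de er KLx wx t0)).
rewrite le_eqVlt; apply/orP; left; apply/eqP; ring.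
Qed.

Lemma UJ_rate e t : 0 < e -> 2 * e * rate K sg <= 1 -> 0 <= t ->
  nrm leb (UJ e t \- U0J t) <= cstD t * Num.sqrt e.
Proof.
move=> e0 er t0; have se : 0 <= 16 * Num.sqrt e by rewrite mulr_ge0 ?sqrtr_ge0.
have := nrm_le_amp (t := t) (L2B (L2_UJ e0 er t0) (L2_U0J t0)) se.
rewrite (_ : 16 * Num.sqrt e * (_ * _ * _) = cstD t * Num.sqrt e); last by rewrite /cstD; ring.
apply; have := good_ae; apply: filterS => xi [KLx wx]; rewrite /= distrC.
apply: (le_trans (Uf_cvg_rate K0 sg0 (h0 xi) e0 er KLx wx t0)).
have A0 : 0 <= amp K sg (L xi) (h0 xi) (F^~ xi) * Num.sqrt e * expR (rate K sg / 2 * t).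
  by rewrite !mulr_ge0 ?sqrtr_ge0 ?expR_ge0.
have -> : 16 * Num.sqrt e * (amp K sg (L xi) (h0 xi) (F^~ xi) * expR (rate K sg / 2 * t)) =
  16 * (amp K sg (L xi) (h0 xi) (F^~ xi) * Num.sqrt e * expR (rate K sg / 2 * t)) by ring.
by move: A0; lra.
Qed.

End joint_frequency.

Lemma integral_lin3 d (X : measurableType d) (R : realType) (m : {measure set X -> \bar R}) (a b k : R) (p q r : X -> R) :
  m.-integrable [set: X] (EFin \o p) -> m.-integrable [set: X] (EFin \o q) -> m.-integrable [set: X] (EFin \o r) ->
  (\int[m]_x (k * (a * p x + b * q x - r x))%:E =
   k%:E * (a%:E * \int[m]_x (p x)%:E + b%:E * \int[m]_x (q x)%:E - \int[m]_x (r x)%:E))%E.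
Proof.
move=> ip iq ir.
have i1 := integrableZl measurableT a ip; have i2 := integrableZl measurableT b iq.
have i3 := integrableD measurableT i1 i2; have i4 := integrableB measurableT i3 ir.
rewrite -(integralZl measurableT ip) -(integralZl measurableT iq) -(integralD measurableT i1 i2).
by rewrite -(integralB measurableT i3 ir) -(integralZl measurableT i4); apply: eq_integral => x _.
Qed.

(** * Admissible functions and the functional *)

Section representation.
Context {R : realType} {N : nat}.
Local Notation E := 'rV[R]_N.
Local Notation mu := (@lebesgue_measure R).
Local Notation leb := (lebesgue_rV R N).
Local Notation cabs := (@Normc.normc R).
Local Notation T := (measurableTypeR R).
Local Notation M := (lebesgue_measure \x leb)%E.
Local Notation H0 := (`[(0 : R), +oo[%classic).
Implicit Types (u g d G W v : R -> E -> R).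

Lemma uprim0 h W xi : uprim h W 0 xi = h xi.
Proof. by rewrite /uprim /tint set_itv1 Rintegral_set1 addr0. Qed.

Lemma prim_uprim c h W : 0 <= c -> wL2 c W -> {ae leb, forall xi, prim ((uprim h W)^~ xi) (W^~ xi)}.
Proof. by move=> c0 wW; have := wL2_ae_int c0 wW; apply: filterS => xi iW; exact: (prim_int (h xi) iW). Qed.

Lemma measurable_ge0_time : measurable [set z : R * E | 0 <= z.1].
Proof.
have := @measurable_fst _ _ T E measurableT _ (mitv `[(0 : R), +oo[); rewrite setTI.
by congr measurable; apply/seteqP; split=> z /=; rewrite in_itv/= andbT.
Qed.

Lemma CL2_pos_ext v : CL2 v -> jmeas (pos_ext v).
Proof.
case=> mv _ _; apply: jmeas_pos_ext; apply: (measurable_funS measurable_ge0_time _ mv).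
by move=> z /=; exact: ltW.
Qed.

Lemma CL2_L2 v t : CL2 v -> 0 <= t -> L2 leb (v t).
Proof. by case=> _ h _ t0; apply/inL2E; exact: h. Qed.

Lemma inH_weak_dt (e : R) v : inH e v -> weak_dt v (dt v) /\ wL2 e^-1 (pos_ext (dt v)).
Proof.
move=> [cv [Lv ex] iv]; have wd : weak_dt v (dt v) := xgetPex _ ex.
by split=> //; exact: weight_wL2 wd.1.1 iv.
Qed.

Variables (L u0 : E -> R) (e : R).
Hypothesis e0 : 0 < e.
Hypothesis mL : measurable_fun [set: E] L.
Hypothesis eL : {ae leb, forall xi, L (- xi) = L xi}.
Hypothesis Lu0 : L2 leb u0.
Local Notation c := (e^-1).
Let c0 : 0 <= c. Proof. by rewrite invr_ge0 ltW. Qed.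

Lemma funepos_mul (p q : E -> R) : (forall x, 0 <= q x) ->
  (fun x => (p x * q x)%:E)^\+%E = fun x => (Num.max (p x) 0 * q x)%:E.
Proof.
move=> q0; apply/funext => x; rewrite funeposE -EFin_max; congr EFin.
by rewrite maxr_pMl// mul0r.
Qed.

(** The symbol may change sign, so its positive and negative parts, both even, are used as separate
    weights in [ge0_integral_fourier]. *)
Lemma quad_formE (v : E -> R) : L2 leb v -> quad_form L v = (\int[leb]_xi (L xi * hart v xi ^+ 2)%:E)%E.
Proof.
move=> Lv; have mM (p : E -> R) : measurable_fun [set: E] p -> measurable_fun [set: E] (fun xi => Num.max (p xi) 0).
  by move=> mp; apply: measurable_maxr => //; exact: measurable_cst.
have negE (q : E -> R) : (fun x => (L x * q x)%:E)^\-%E = (fun x => ((fun x => - L x) x * q x)%:E)^\+%E.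
  by apply/funext => x; rewrite funenegE funeposE -EFinN mulNr.
have q1 (x : E) : 0 <= cabs (fourier v x) ^+ 2 by exact: sqr_ge0.
have q2 (x : E) : 0 <= hart v x ^+ 2 by exact: sqr_ge0.
rewrite /quad_form integralE [RHS]integralE !negE !funepos_mul//.
congr (_ - _)%E.
- apply: (ge0_integral_fourier (phi := fun x => Num.max (L x) 0)) => //; first exact: mM.
  + by move=> x; rewrite le_max lexx orbT.
  + by apply: filterS eL => x ->.
- apply: (ge0_integral_fourier (phi := fun x => Num.max (- L x) 0)) => //.
  + by apply: (mM (fun x => - L x)); exact: measurableT_comp.
  + by move=> x; rewrite le_max lexx orbT.
  + by apply: filterS eL => x ->.
Qed.

Lemma abs_form (v X : E -> R) : L2 leb v -> measurable_fun [set: E] X -> {ae leb, forall xi, hart v xi = X xi} ->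
  (\int[leb]_xi (`|L xi| * cabs (fourier v xi) ^+ 2)%:E = \int[leb]_xi (`|L xi| * X xi ^+ 2)%:E)%E.
Proof.
move=> Lv mX vX; rewrite (ge0_integral_fourier (phi := fun x => `|L x|)) //; first last.
- by apply: filterS eL => x ->.
- exact: measurableT_comp.
have ma (Y : E -> R) : measurable_fun [set: E] Y -> measurable_fun [set: E] (fun xi => (`|L xi| * Y xi ^+ 2)%:E).
  by move=> mY; apply/measurable_EFinP; apply: measurable_funM; [exact: measurableT_comp|exact: measurable_funX].
apply: ae_eq_integral => //; [exact: ma (L2_hart Lv).1|exact: ma|].
by apply: filterS vX => xi -> _.
Qed.

Definition rep v W := [/\ wL2 c W,
  forall t, 0 <= t -> {ae leb, forall xi, hart (v t) xi = uprim (hart u0) W t xi} &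
  {ae mu, forall t, 0 < t -> sqint leb (dt v t) = sqint leb (W t)}].

Lemma hart_uprim G W v t : wL2 c G -> wL2 c W -> L2 leb (v t) ->
  {ae mu, forall t, 0 <= t -> {ae leb, forall xi, W t xi = hart (G t) xi}} ->
  {ae leb, forall x, v t x = u0 x + tint G t x} ->
  {ae leb, forall xi, hart (v t) xi = uprim (hart u0) W t xi}.
Proof.
move=> wG wW Lv hW vG; have Lti := tint_L2 t wG c0.
have E1 : hart (v t) = hart (fun x => u0 x + 1 * tint G t x).
  apply: eq_hart => //; first exact: L2D Lu0 (L2Z 1 Lti).
  by apply: filterS vG => x ->; rewrite mul1r.
have := hartD 1 Lu0 Lti; rewrite -E1; have := hart_tint t wG wW c0 hW.
by apply: filterS2 => xi h1 h2; rewrite h2 h1 mul1r.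
Qed.

Lemma admissible_rep v : admissible L u0 e v -> exists W, rep v W.
Proof.
move=> [[Hv _] v0]; have [wd wG] := inH_weak_dt Hv; have [cv [Lv _] _] := Hv.
have [W wW hW] := wL2_hart wG; exists W; split=> //.
- move=> t t0; apply: (hart_uprim wG wW (CL2_L2 cv t0) hW).
  by have := weak_tint c0 cv Lv wd wG t0; apply: filterS2 v0 => x -> ->.
- have := ae_muI hW (wL2_ae_t wG); apply: ae_muS => t [h1 h2] t0.
  have L1 := h2 (ltW t0); rewrite -(pos_extE (dt v) t0) -(sqint_hart L1); apply: eq_sqint.
  + exact: (L2_hart L1).1.
  + exact: jmeas_t wW.1.
  + by apply: filterS (h1 (ltW t0)) => xi ->.
Qed.

Lemma sqint_wt G xi : sqint mu ((wtG c G)^~ xi) = (\int[mu]_(t in H0) (expR (- c * t) * G t xi ^+ 2)%:E)%E.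
Proof.
rewrite integral_mkcond /sqint; apply: eq_integral => s _; rewrite /wtG exprMn wt_sq patchE indicE.
by case: ifPn => _; rewrite ?mulr1 ?mulr0 ?mul0r.
Qed.

(** Hardy's inequality at almost every frequency, integrated over the frequencies. *)
Lemma wL2_uprim h W : L2 leb h -> wL2 c W -> wL2 c (uprim h W).
Proof.
move=> Lh wW; have mV := jmeas_uprim Lh wW; apply/(wL2P _ mV).
have mwV := jmeas_wtG c mV; have mwW := jmeas_wtG c wW.1; split=> //; rewrite (sqint_unc2 mwV).
have [_ fW] := (wL2P c wW.1).1 wW.
have ms G : jmeas G -> measurable_fun [set: E] (fun xi => sqint mu (G^~ xi)).
  move=> mG; apply: (measurable_integral_param mu (f := fun z : E * T => unc G (z.2, z.1) ^+ 2)).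
  by apply: measurable_funX; apply: (measurableT_comp mG); exact: (measurable_fun_pair measurable_snd measurable_fst).
have k1 : 0 <= 2 / c by rewrite divr_ge0.
have k2 : 0 <= 4 / c ^+ 2 by rewrite divr_ge0 ?sqr_ge0.
have mA : measurable_fun [set: E] (fun xi => (2 / c)%:E * (h xi ^+ 2)%:E)%E.
  by apply: emeasurable_funM; [exact: measurable_cst|exact: measurable_sq Lh.1].
have mB : measurable_fun [set: E] (fun xi => (4 / c ^+ 2)%:E * sqint mu ((wtG c W)^~ xi))%E.
  by apply: emeasurable_funM; [exact: measurable_cst|exact: ms].
apply: (@le_lt_trans _ _ (\int[leb]_xi ((2 / c)%:E * (h xi ^+ 2)%:E + (4 / c ^+ 2)%:E * sqint mu ((wtG c W)^~ xi)))%E).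
  apply: ae_ge0_le_integral => //.
  - by move=> xi _; exact: sqint_ge0.
  - exact: ms.
  - by move=> xi _; rewrite adde_ge0 ?mule_ge0 ?sqint_ge0 ?lee_fin ?sqr_ge0.
  - exact: emeasurable_funD.
  have := wL2_wdata wW; have := prim_uprim h c0 wW; apply: filterS2 => xi pV [_ iW] _.
  have cp : 0 < c by rewrite invr_gt0.
  have [iV leV] := hardy cp pV iW; rewrite !sqint_wt -(fineK (integrable_fin_num (mitv _) iV)) -(fineK (integrable_fin_num (mitv _) iW)).
  by rewrite -!EFinM -EFinD lee_fin; move: leV; rewrite uprim0.
rewrite ge0_integralD//; first last.
- by move=> xi _; rewrite mule_ge0 ?sqint_ge0.
- by move=> xi _; rewrite mule_ge0 ?lee_fin ?sqr_ge0.
rewrite !ge0_integralZl//; try exact: (ms _ mwW); try exact: measurable_sq Lh.1; try by move=> xi _; rewrite ?sqint_ge0 ?lee_fin ?sqr_ge0.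
by rewrite -(sqint_unc2 mwW) lte_add_pinfty// lte_mul_pinfty//; exact: Lh.2.
Qed.

Section functional_formula.
Variables (v W f F : R -> E -> R).
Hypothesis av : admissible L u0 e v.
Hypothesis rv : rep v W.
Hypothesis wf : wL2 c (pos_ext f).
Hypothesis wF : wL2 c F.
Hypothesis hF : {ae mu, forall t, 0 <= t -> {ae leb, forall xi, F t xi = hart (pos_ext f t) xi}}.
Let V := uprim (hart u0) W.
Let wW : wL2 c W. Proof. by case: rv. Qed.
Let wV : wL2 c V. Proof. exact: wL2_uprim (L2_hart Lu0) wW. Qed.
Let cv : CL2 v. Proof. by case: av => -[[]]. Qed.
Let Lv t (t0 : 0 <= t) : L2 leb (v t). Proof. exact: CL2_L2 cv t0. Qed.
Let hV t (t0 : 0 <= t) : {ae leb, forall xi, hart (v t) xi = V t xi}. Proof. by case: rv => _ h _; exact: h. Qed.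

Lemma abs_form_time : (\int[mu]_(t in H0) ((expR (- c * t))%:E * \int[leb]_xi (`|L xi| * V t xi ^+ 2)%:E) < +oo)%E.
Proof.
have [[_ fin] _] := av; rewrite -integral_oo_obnd; last first.
  apply: emeasurable_funM; first exact: measurable_expw.
  apply: (measurable_integral_param leb (f := fun z : T * E => `|L z.2| * unc V z ^+ 2)).
  have ma : measurable_fun [set: E] (fun xi => `|L xi|) by exact: measurableT_comp.
  by apply: measurable_funM; [exact: (jmeas_snd ma)|exact: measurable_funX wV.1].
apply: le_lt_trans fin; rewrite le_eqVlt; apply/orP; left; apply/eqP; apply: eq_integral => t.
rewrite inE/= in_itv/= andbT => t0; rewrite expR_div; congr (_ * _)%E; apply/esym.
by apply: abs_form; [exact: Lv (ltW t0)|exact: jmeas_t wV.1|exact: hV (ltW t0)].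
Qed.

(** The finite potential energy required of the members of the space gives absolute integrability,
    although the symbol has no upper bound. *)
Lemma integrable_LV2 : M.-integrable [set: T * E] (EFin \o (fun z => L z.2 * wtG c V z.1 z.2 ^+ 2)).
Proof.
have mwV := jmeas_wtG c wV.1; apply/integrable12ltyP.
  by apply/measurable_EFinP; apply: measurable_funM; [exact: jmeas_snd mL|exact: measurable_funX mwV].
apply: le_lt_trans abs_form_time; rewrite [X in (_ <= X)%E]integral_mkcond le_eqVlt; apply/orP; left; apply/eqP.
apply: eq_integral => t _; rewrite patchE; case: ifPn => tH; last first.
  apply: integral0_eq => xi _; rewrite /= /wtG /wt indicE (negbTE tH) !mulr0 mul0r expr0n mulr0.
  by rewrite normr0.
have mLV : measurable_fun [set: E] (fun xi => (`|L xi| * V t xi ^+ 2)%:E).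
  apply/measurable_EFinP; apply: measurable_funM; first exact: measurableT_comp.
  by apply: measurable_funX; exact: jmeas_t wV.1.
rewrite -ge0_integralZl//; try (by move=> xi _; rewrite lee_fin mulr_ge0 ?sqr_ge0); try by rewrite lee_fin expR_ge0.
apply: eq_integral => xi _; rewrite /= normrM (ger0_norm (sqr_ge0 _)); congr EFin.
by rewrite /wtG exprMn wt_sq indicE tH mulr1; ring.
Qed.

Definition Jjoint (z : T * E) : R :=
  e / 2 * wtG c W z.1 z.2 ^+ 2 + 2^-1 * (L z.2 * wtG c V z.1 z.2 ^+ 2) - wtG c F z.1 z.2 * wtG c V z.1 z.2.

Lemma integrable_Jjoint : M.-integrable [set: T * E] (EFin \o Jjoint).
Proof.
have LW := (wL2P c wW.1).1 wW; have LV := (wL2P c wV.1).1 wV; have LF := (wL2P c wF.1).1 wF.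
have i1 := integrableZl measurableT (e / 2) (L2_integrable LW).
have i2 := integrableZl measurableT 2^-1 integrable_LV2.
have := integrableB measurableT (integrableD measurableT i1 i2) (L2_mul LF LV).
by apply: eq_integrable => // z _ /=; rewrite -!EFinM -EFinD -EFinB.
Qed.

Lemma Jjoint_itv t xi : 0 <= t -> Jjoint (t, xi) = expR (- c * t) * (e / 2 * W t xi ^+ 2 + 2^-1 * (L xi * V t xi ^+ 2) - F t xi * V t xi).
Proof.
move=> t0; rewrite /Jjoint /= /wtG; have w2 : wt c t ^+ 2 = expR (- c * t).
  by rewrite wt_sq indicE mem_set ?mulr1//= in_itv/= t0.
by rewrite -w2; ring.
Qed.

Lemma Jjoint_out t xi : t < 0 -> Jjoint (t, xi) = 0.
Proof.
move=> t0; rewrite /Jjoint /= /wtG (_ : wt c t = 0); first by rewrite !mul0r expr0n !mulr0 addr0 subr0.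
by rewrite /wt indicE memNset ?mulr0//= in_itv/= andbT; apply/negP; rewrite -ltNge.
Qed.

Let mdv : jmeas (pos_ext (dt v)).
Proof. by case: av => -[Hv _] _; have [_ []] := inH_weak_dt Hv. Qed.

Let mI : measurable_fun [set: T] (fun t => \int[leb]_xi (L xi * V t xi ^+ 2)%:E)%E.
Proof.
apply: (measurable_integral_param leb (f := fun z : T * E => L z.2 * unc V z ^+ 2)).
by apply: measurable_funM; [exact: jmeas_snd mL|exact: measurable_funX wV.1].
Qed.

(** The integrand of the functional with [f], [v] and [dt v] extended by 0, which makes it
    measurable in time. *)
Let Phi t : \bar R := ((expR (- c * t))%:E * ((e / 2)%:E * sqint leb (pos_ext (dt v) t) +
  (2^-1)%:E * \int[leb]_xi (L xi * V t xi ^+ 2)%:E - \int[leb]_x (pos_ext f t x * pos_ext v t x)%:E))%E.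

Let mPhi : measurable_fun [set: T] Phi.
Proof.
apply: emeasurable_funM; first exact: measurable_expw.
apply: emeasurable_funB; last first.
  apply: (measurable_integral_param leb (f := fun z : T * E => unc (pos_ext f) z * unc (pos_ext v) z)).
  by apply: measurable_funM; [exact: wf.1|exact: CL2_pos_ext].
apply: emeasurable_funD; apply: emeasurable_funM => //; exact: measurable_sqint.
Qed.

Let ae_Phi : {ae mu, forall t, 0 < t -> Phi t = (\int[leb]_xi (Jjoint (t, xi))%:E)%E}.
Proof.
have h1 := ae_muI (wL2_ae_t wW) (ae_muI (wL2_ae_t wV) (ae_muI (wL2_ae_t wF) (ae_muI (wL2_ae_t wf) hF))).
have h2 := ae_integrable1 integrable_LV2.
have [_ _ h3] := rv; have := ae_muI h1 (ae_muI h2 h3).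
apply: ae_muS => t [[LW [LV [LF [Lf Ft]]]] [iLV dW]] t0; have t0' := ltW t0.
have iL : leb.-integrable [set: E] (EFin \o (fun xi => L xi * V t xi ^+ 2)).
  have := integrableZl measurableT (expR (- c * t))^-1 iLV; apply: eq_integrable => // xi _ /=.
  rewrite -EFinM; congr EFin; rewrite /wtG exprMn wt_sq indicE mem_set ?mulr1 /= ?in_itv/= ?t0'//.
  by move: (lt0r_neq0 (expR_gt0 (- c * t))); move: (expR (- c * t)) => k k0; field.
rewrite (eq_integral (fun xi => (expR (- c * t) * (e / 2 * (W t xi ^+ 2) + 2^-1 * (L xi * V t xi ^+ 2) - F t xi * V t xi))%:E)); last first.
  by move=> xi _; rewrite Jjoint_itv.
rewrite (integral_lin3 _ _ _ (L2_integrable (LW t0')) iL (L2_mul (LF t0') (LV t0'))).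
rewrite /Phi pos_extE// dW//; congr (_ * (_ - _))%E.
rewrite (pos_extE v t0) -(ipE (Lf t0') (Lv t0')) -(ipE (LF t0') (LV t0')); congr EFin.
have FE : {ae leb, forall xi, hart (pos_ext f t) xi = F t xi} by apply: filterS (Ft t0') => xi ->.
rewrite -(ip_hart (Lf t0') (Lv t0')).
exact: (eq_ip (L2_hart (Lf t0')) (LF t0') (L2_hart (Lv t0')) (LV t0') FE (hV t0')).
Qed.

(** At almost every time, Plancherel for the Hartley transform turns the integrand into the
    frequency integral of [Jjoint]. As [Jjoint] is integrable jointly, Fubini lets time be
    integrated first, at each frequency separately. *)
Lemma functionalE : functional L f e v =
  (\int[leb]_xi (\int[mu]_(t in H0) Jdens e (L xi) (F^~ xi) (V^~ xi) (W^~ xi) t))%:E /\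
  leb.-integrable [set: E] (EFin \o (fun xi => \int[mu]_(t in H0) Jdens e (L xi) (F^~ xi) (V^~ xi) (W^~ xi) t)).
Proof.
have iJ := integrable_Jjoint.
have E1 : functional L f e v = (\int[mu]_(t in `](0 : R)%R, +oo[) Phi t)%E.
  apply: eq_integral => t; rewrite inE/= in_itv/= andbT => t0.
  rewrite expR_div /Phi (pos_extE (dt v) t0) (pos_extE f t0) (pos_extE v t0) (quad_formE (Lv (ltW t0))); congr (_ * (_ + _ * _ - _))%E.
  have ma (Y : E -> R) : measurable_fun [set: E] Y -> measurable_fun [set: E] (fun xi => (L xi * Y xi ^+ 2)%:E).
    by move=> mY; apply/measurable_EFinP; apply: measurable_funM => //; exact: measurable_funX.
  apply: ae_eq_integral => //; [exact: ma (L2_hart (Lv (ltW t0))).1|exact: ma (jmeas_t t wV.1)|].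
  by apply: filterS (hV (ltW t0)) => xi -> _.
have mJ : measurable_fun [set: T] (fun t => \int[leb]_xi (Jjoint (t, xi))%:E)%E.
  by apply: (measurable_integral_param leb (f := Jjoint)); apply/measurable_EFinP; exact: measurable_int iJ.
have E2 : (\int[mu]_(t in `](0 : R)%R, +oo[) Phi t = \int[mu]_t \int[leb]_xi (Jjoint (t, xi))%:E)%E.
  rewrite (@ae_eq_integral _ T R mu _ (fun t => \int[leb]_xi (Jjoint (t, xi))%:E)%E Phi); first last.
  - by move: ae_Phi; apply: ae_muS => t h; rewrite /= in_itv/= andbT => t0; exact: h.
  - exact: measurable_funTS.
  - exact: measurable_funTS.
  - exact: mitv.
  rewrite (integral_oo_obnd mJ) integral_mkcond; apply: eq_integral => t _; rewrite patchE; case: ifPn => [_|tH]; first by [].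
  have t0 : t < 0 by rewrite ltNge; apply/negP => t0; move/negP: tH; apply; rewrite inE/= in_itv/= t0.
  apply/esym; apply: integral0_eq => xi _; congr EFin; exact: Jjoint_out.
have inner xi : \int[mu]_t Jjoint (t, xi) = \int[mu]_(t in H0) Jdens e (L xi) (F^~ xi) (V^~ xi) (W^~ xi) t.
  rewrite [RHS]Rint_indic; apply: eq_Rintegral => t _; rewrite indicE; have [t0|t0] := leP 0 t.
    by rewrite (Jjoint_itv xi t0) mem_set; [rewrite mul1r|rewrite /= in_itv/= t0].
  by rewrite (Jjoint_out xi t0) memNset; [rewrite mul0r|rewrite /= in_itv/= andbT; apply/negP; rewrite -ltNge].
have E3 : (fun xi => \int[mu]_t Jjoint (t, xi)) = (fun xi => \int[mu]_(t in H0) Jdens e (L xi) (F^~ xi) (V^~ xi) (W^~ xi) t).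
  by apply/funext => xi; exact: inner.
have i2 := integrable_Rinner2 iJ; rewrite -E3; split; last exact: i2.
rewrite E1 E2 -(EFubini1 iJ) -(RFubini iJ) /Rintegral fineK//.
exact: integrable_fin_num (integrable_Rinner1 iJ).
Qed.

End functional_formula.

(** A converse to [admissible_rep]: the inverse transform of [W] is again a Hartley transform, taken
    in a jointly measurable version and integrated in time from [u0]. *)
Lemma construct W : wL2 c W ->
  (\int[mu]_(t in `](0 : R)%R, +oo[) ((expR (- t / e))%:E *
     \int[leb]_xi (`|L xi| * uprim (hart u0) W t xi ^+ 2)%:E) < +oo)%E ->
  exists v, [/\ admissible L u0 e v, rep v W & jmeas v].
Proof.
move=> wW fin; have [d wd hd] := wL2_hart wW; exists (uprim u0 d).
have mv := jmeas_uprim Lu0 wd; have cv := CL2_uprim c0 Lu0 wd.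
have hW : {ae mu, forall t, 0 <= t -> {ae leb, forall xi, W t xi = hart (d t) xi}}.
  have := ae_muI hd (ae_muI (wL2_ae_t wW) (wL2_ae_t wd)); apply: ae_muS => t [h1 [LW Ld]] t0.
  rewrite (eq_hart (Ld t0) (L2_hart (LW t0)) (h1 t0)).
  by have := hartK (LW t0); apply: filterS => xi ->.
have hV t : 0 <= t -> {ae leb, forall xi, hart (uprim u0 d t) xi = uprim (hart u0) W t xi}.
  by move=> t0; apply: (hart_uprim wd wW (CL2_L2 cv t0) hW); exact: nearW.
have [wk dE] := dt_uprim c0 Lu0 wd.
have mdt := jmeas_pos_ext wk.1.1.
have sq : {ae mu, forall t, 0 < t -> sqint leb (dt (uprim u0 d) t) = sqint leb (W t)}.
  have := ae_muI dE (ae_muI hW (wL2_ae_t wd)); apply: ae_muS => t [h1 [h2 Ld]] t0.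
  rewrite (@eq_sqint _ _ _ leb _ (d t)); last exact: h1.
  - rewrite -(sqint_hart (Ld (ltW t0))); apply: eq_sqint; [exact: (L2_hart (Ld (ltW t0))).1|exact: jmeas_t wW.1|].
    by apply: filterS (h2 (ltW t0)) => xi ->.
  - by have := jmeas_t t mdt; rewrite pos_extE.
  - exact: jmeas_t wd.1.
have rv : rep (uprim u0 d) W by split; [exact: wW|exact: hV|exact: sq].
split; [|exact: rv|exact: mv]; split; last by apply: nearW => x; rewrite uprim0.
split.
  split=> //; first by split; [exact: L1locL2_uprim c0 Lu0 wd|exists (dt (uprim u0 d)); exact: wk].
  suff : (\int[mu]_(t in `](0 : R)%R, +oo[) ((expR (- c * t))%:E * sqint leb (pos_ext (dt (uprim u0 d)) t)) < +oo)%E.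
    apply: le_lt_trans; rewrite le_eqVlt; apply/orP; left; apply/eqP; apply: eq_integral => t; rewrite inE/= in_itv/= andbT => t0; rewrite expR_div (pos_extE _ t0); congr (_ * _)%E.
    by have := L2norm_sq (dt (uprim u0 d) t); rewrite /= => ->.
  rewrite (@ae_eq_integral _ T R mu _ (fun t => (expR (- c * t))%:E * sqint leb (W t))%E).
  - rewrite integral_oo_obnd; first exact: wW.2.
    by apply: emeasurable_funM; [exact: measurable_expw|exact: measurable_sqint wW.1].
  - exact: mitv.
  - by apply: measurable_funTS; apply: emeasurable_funM; [exact: measurable_expw|exact: measurable_sqint].
  - by apply: measurable_funTS; apply: emeasurable_funM; [exact: measurable_expw|exact: measurable_sqint wW.1].
  - by move: sq; apply: ae_muS => t h; rewrite /= in_itv/= andbT => t0; rewrite pos_extE// h.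
apply: le_lt_trans fin; rewrite le_eqVlt; apply/orP; left; apply/eqP; apply: eq_integral => t.
rewrite inE/= in_itv/= andbT => t0; congr (_ * _)%E.
apply: abs_form; [exact: CL2_L2 cv (ltW t0)|exact: jmeas_t (jmeas_uprim (L2_hart Lu0) wW)|exact: hV (ltW t0)].
Qed.

End representation.

(** * Minimizers *)

Section minimizers.
Context {R : realType} {N : nat}.
Local Notation E := 'rV[R]_N.
Local Notation mu := (@lebesgue_measure R).
Local Notation leb := (lebesgue_rV R N).
Local Notation T := (measurableTypeR R).
Local Notation H0 := (`[(0 : R), +oo[%classic).

Lemma growth_lty (c k C : R) (q : R -> \bar R) : measurable_fun [set: T] q -> 0 <= C -> k < c ->
  (forall t, 0 < t -> (0 <= q t)%E) -> (forall t, 0 < t -> (q t <= (C * expR (k * t))%:E)%E) ->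
  (\int[mu]_(t in `](0 : R)%R, +oo[) ((expR (- c * t))%:E * q t) < +oo)%E.
Proof.
move=> mq C0 kc q0 qC; have ck : 0 < c - k by rewrite subr_gt0.
have [i1 _] := expR_tail 0 ck; have i2 := integrable_obnd (integrableZl (mitv `[(0 : R), +oo[) C i1).
have /integrableP[_] := i2; apply: le_lt_trans; apply: ge0_le_integral.
- exact: mitv.
- by move=> t; rewrite /= in_itv/= andbT => t0; rewrite mule_ge0 ?q0// lee_fin expR_ge0.
- by apply: measurable_funTS; apply: emeasurable_funM; [exact: measurable_expw|exact: mq].
- by apply: measurableT_comp => //; exact: measurable_int _ i2.
- move=> t; rewrite /= in_itv/= andbT => t0.
  apply: (@le_trans _ _ ((expR (- c * t))%:E * (C * expR (k * t))%:E)%E).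
    by apply: lee_wpmul2l; [rewrite lee_fin expR_ge0|exact: qC].
  rewrite ger0_norm ?mulr_ge0 ?expR_ge0// -EFinM lee_fin le_eqVlt; apply/orP; left; apply/eqP.
  by rewrite mulrCA -expRD; congr (_ * expR _); ring.
Qed.

Lemma growth_integrable (c k C : R) (q : R -> R) : measurable_fun [set: R] q -> 0 <= C -> k < c ->
  (forall t, 0 <= t -> 0 <= q t <= C * expR (k * t)) ->
  mu.-integrable H0 (EFin \o (fun t => expR (- c * t) * q t)).
Proof.
move=> mq C0 kc qC; have ck : 0 < c - k by rewrite subr_gt0.
have [i1 _] := expR_tail 0 ck; have i2 := integrableZl (mitv `[(0 : R), +oo[) C i1.
apply: (le_integrable (mitv `[(0 : R), +oo[) _ _ i2).
  apply/measurable_EFinP; apply: measurable_funTS; apply: measurable_funM => //.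
  by apply: continuous_measurable_fun; exact: continuous_expRZ.
move=> t; rewrite /= in_itv/= andbT => /qC /andP[q0 qC'].
rewrite lee_fin !ger0_norm ?mulr_ge0 ?expR_ge0//.
apply: (@le_trans _ _ (expR (- c * t) * (C * expR (k * t)))); first by rewrite ler_wpM2l ?expR_ge0.
rewrite le_eqVlt; apply/orP; left; apply/eqP.
by rewrite mulrCA -expRD; congr (_ * expR _); ring.
Qed.

Lemma Rintegral_eq0_ae (D : interval R) (q : R -> R) : mu.-integrable [set` D] (EFin \o q) ->
  (forall t, 0 <= q t) -> \int[mu]_(t in [set` D]) q t = 0 -> {ae mu, forall t, t \in D -> q t = 0}.
Proof.
move=> iq q0 I0; have I1 : (\int[mu]_(t in [set` D]) (q t)%:E = 0)%E.
  by rewrite -(fineK (integrable_fin_num (mitv D) iq)) -/(Rintegral _ _ _) I0.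
have := (@ae_eq_integral_abs _ T R mu _ (mitv D) (EFin \o q) (measurable_int _ iq)).1.
move=> /(_ _)[]; last by move=> A [mA A0 sA]; exists A; split=> // t h; apply: sA => h'; apply: h => tD; have [] := h' tD.
by rewrite -[RHS]I1; apply: eq_integral => t _; rewrite /= ger0_norm.
Qed.

Variables (K sg e : R) (L u0 : E -> R) (f F : R -> E -> R).
Hypothesis K0 : K <= 0.
Hypothesis sg0 : 0 <= sg.
Hypothesis mL : measurable_fun [set: E] L.
Hypothesis KL : {ae leb, forall xi, K <= L xi}.
Hypothesis eL : {ae leb, forall xi, L (- xi) = L xi}.
Hypothesis Lu0 : L2 leb u0.
Local Notation h0 := (hart u0).
Hypothesis Vh0 : (\int[leb]_xi (`|L xi| * h0 xi ^+ 2)%:E < +oo)%E.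
Hypothesis wf : wL2 sg (pos_ext f).
Hypothesis wF : wL2 sg F.
Hypothesis hF : {ae mu, forall t, 0 <= t -> {ae leb, forall xi, F t xi = hart (pos_ext f t) xi}}.
Hypothesis e0 : 0 < e.
Hypothesis er : 2 * e * rate K sg <= 1.
Local Notation c := (e^-1).
Let Lh0 : L2 leb h0. Proof. exact: L2_hart. Qed.
Let c0 : 0 <= c. Proof. by rewrite invr_ge0 ltW. Qed.
Let wFc : wL2 c F. Proof. exact (wF_eps K0 sg0 wF e0 er). Qed.
Let wfc : wL2 c (pos_ext f). Proof. exact (wF_eps K0 sg0 wf e0 er). Qed.
Let wZ : wL2 c (ZJ L h0 F e). Proof. exact (ZJ_wL2 K0 sg0 mL KL Lh0 Vh0 wF e0 er). Qed.
Let kc : rate K sg < c. Proof. by have [] := rate_lt K0 sg0 e0 er. Qed.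

(** The square left over at each frequency: it measures how far [W] is from solving the first-order
    equation of the minimizer. *)
Definition Sgap W (xi : E) (t : R) : R :=
  Sdens e (root_b e (L xi)) ((gJ L F e)^~ xi) ((uprim h0 W)^~ xi) (W^~ xi) t.
Definition Jtime W (xi : E) : R := \int[mu]_(t in H0) Jdens e (L xi) (F^~ xi) ((uprim h0 W)^~ xi) (W^~ xi) t.

Lemma Sgap_ge0 W xi t : 0 <= Sgap W xi t.
Proof. by rewrite mulr_ge0 ?expR_ge0// mulr_ge0 ?sqr_ge0// divr_ge0// ltW. Qed.

Lemma gap_ae W : wL2 c W -> {ae leb, forall xi, mu.-integrable H0 (EFin \o Sgap W xi) /\
  Jtime W xi = \int[mu]_(t in H0) Sgap W xi t + Cdens e (root_b e (L xi)) ((gJ L F e)^~ xi) (h0 xi)}.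
Proof.
move=> wW; have G1 := good_ae KL wF; have G2 := wL2_wdata wFc; have G3 := wL2_wdata wW; have G4 := prim_uprim h0 c0 wW.
apply: filterS2 (filterI G1 G2) (filterI G3 G4) => xi [[KLx wx] [mFx iFx]] [[_ iW] pW].
have [[ea eb _ _ _] _] := root_props K0 sg0 e0 er KLx.
have pg := prim_gf K0 sg0 e0 er KLx wx.
have ig : mu.-integrable H0 (EFin \o (fun t => expR (- c * t) * (gJ L F e)^~ xi t ^+ 2)).
  apply: (@growth_integrable _ (rate K sg) (2 / e * size2 sg (L xi) 0 (F^~ xi))) => //.
  - by apply: measurable_funX; exact: jmeas_x xi (jmeas_gJ mL wF e).
  - by rewrite mulr_ge0 ?size2_ge0// divr_ge0// ltW.
  - by move=> t t0; rewrite sqr_ge0/=; exact: (gf_bound K0 sg0 0 e0 er KLx wx t0).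
have [_ [iS EJ]] := key_identity e0 ea eb pg mFx iFx ig pW iW.
by split=> //; rewrite /Jtime EJ uprim0.
Qed.

(** The equation [Zf = gf - root_b * Uf] makes the squared quantity vanish identically. *)
Lemma Sgap_ZJ : {ae leb, forall xi, \int[mu]_(t in H0) Sgap (ZJ L h0 F e) xi t = 0}.
Proof.
have := UJ_uprim h0 K0 sg0 KL wF e0 er; apply: filterS => xi UE.
rewrite /Rintegral integral0_eq// => t; rewrite /= in_itv/= andbT => t0; congr EFin.
rewrite /Sgap /Sdens (UE t t0) (_ : _ + _ - _ = 0); first by rewrite expr0n !mulr0.
by rewrite /ZJ /Zf /gJ /UJ; ring.
Qed.

Lemma minimizer_candidate : exists u, [/\ admissible L u0 e u, rep u0 e u (ZJ L h0 F e) & jmeas u].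
Proof.
apply: construct => //.
have mU := jmeas_UJ mL Lh0 wF e; have UE := UJ_uprim h0 K0 sg0 KL wF e0 er.
pose q t := (\int[leb]_xi (`|L xi| * uprim h0 (ZJ L h0 F e) t xi ^+ 2)%:E)%E.
have mV := jmeas_uprim Lh0 wZ; have ma : measurable_fun [set: E] (fun xi => `|L xi|) by exact: measurableT_comp.
have mq : measurable_fun [set: T] q.
  apply: (measurable_integral_param leb (f := fun z : T * E => `|L z.2| * unc (uprim h0 (ZJ L h0 F e)) z ^+ 2)).
  by apply: measurable_funM; [exact: (jmeas_snd ma)|exact: measurable_funX mV].
have C1 : 0 <= cstU K * Stot sg L h0 F by rewrite mulr_ge0 ?Stot_ge0 ?cstU_ge0.
apply: (@le_lt_trans _ _ (\int[mu]_(t in `](0 : R)%R, +oo[) ((expR (- c * t))%:E * q t))%E).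
  rewrite le_eqVlt; apply/orP; left; apply/eqP; apply: eq_integral => t _.
  by rewrite expR_div.
apply: (growth_lty mq C1 kc).
- by move=> t _; apply: integral_ge0 => xi _; rewrite lee_fin mulr_ge0 ?sqr_ge0.
- move=> t t0; apply: (@le_trans _ _ (\int[leb]_xi ((1 + `|L xi|) * UJ L h0 F e t xi ^+ 2)%:E)%E).
    apply: ae_ge0_le_integral => //.
    + by move=> xi _; rewrite lee_fin mulr_ge0 ?sqr_ge0.
    + apply/measurable_EFinP; apply: measurable_funM; first exact: ma.
      by apply: measurable_funX; exact: jmeas_t mV.
    + by move=> xi _; rewrite lee_fin mulr_ge0 ?sqr_ge0// addr_ge0.
    + apply/measurable_EFinP; apply: measurable_funM; first by apply: measurable_funD => //; exact: measurable_cst.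
      by apply: measurable_funX; exact: jmeas_t mU.
    + by move: UE; apply: filterS => xi UE _; rewrite (UE _ (ltW t0)) lee_fin ler_wpM2r ?sqr_ge0// lerDr.
  by rewrite mulrAC; exact (UJ_weighted K0 sg0 mL KL Lh0 Vh0 wF e0 er (ltW t0)).
Qed.

Section comparison.
Variables (u v W : R -> E -> R).
Hypothesis au : admissible L u0 e u.
Hypothesis ru : rep u0 e u (ZJ L h0 F e).
Hypothesis av : admissible L u0 e v.
Hypothesis rv : rep u0 e v W.
Let wW : wL2 c W. Proof. by case: rv. Qed.
Let iv := functionalE e0 mL eL Lu0 av rv wfc wFc hF.
Let iu := functionalE e0 mL eL Lu0 au ru wfc wFc hF.

(** The terms [Cdens] depend on the initial datum only and cancel between [v] and [u], so [D] is the
    integral over the frequencies of the squares of [v]. Hence [D] is nonnegative, and it vanishes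
    only if almost all the squares do. *)
Lemma gap_functional : exists2 D : R, functional L f e v = (D + fine (functional L f e u))%:E /\ functional L f e u = (fine (functional L f e u))%:E &
  0 <= D /\ (D <= 0 -> {ae leb, forall xi, \int[mu]_(t in H0) Sgap W xi t = 0}).
Proof.
have [Ev jv] := iv; have [Eu ju] := iu.
have G : {ae leb, forall xi, Jtime W xi - Jtime (ZJ L h0 F e) xi = \int[mu]_(t in H0) Sgap W xi t}.
  by apply: filterS2 (filterI (gap_ae wW) (gap_ae wZ)) Sgap_ZJ => xi [[_ ->] [_ ->]] ->; ring.
have jd : leb.-integrable [set: E] (EFin \o (fun xi => Jtime W xi - Jtime (ZJ L h0 F e) xi)).
  by have := integrableB measurableT jv ju; apply: eq_integrable.
have ID : (\int[leb]_xi `|(Jtime W xi - Jtime (ZJ L h0 F e) xi)%:E| =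
    (\int[leb]_xi (Jtime W xi - Jtime (ZJ L h0 F e) xi))%:E)%E.
  rewrite /Rintegral fineK; last exact: integrable_fin_num jd.
  apply: ae_eq_integral => //.
  - by apply: measurableT_comp => //; exact: measurable_int _ jd.
  - exact: measurable_int _ jd.
  - by apply: filterS G => xi /= -> _; rewrite ger0_norm// Rintegral_ge0// => t _; exact: Sgap_ge0.
exists (\int[leb]_xi (Jtime W xi - Jtime (ZJ L h0 F e) xi)).
  have Eu' : fine (functional L f e u) = \int[leb]_xi Jtime (ZJ L h0 F e) xi by rewrite Eu.
  rewrite Eu'; split; last exact Eu.
  by rewrite (RintegralB measurableT jv ju) subrK; exact Ev.
split; first by rewrite -lee_fin -ID; apply: integral_ge0.
move=> D0; have Z : (\int[leb]_xi `|(Jtime W xi - Jtime (ZJ L h0 F e) xi)%:E| = 0)%E.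
  by apply/eqP; rewrite eq_le integral_ge0// ID lee_fin D0.
have := (ae_eq_integral_abs leb measurableT (measurable_int _ jd)).1 Z.
by apply: filterS2 G => xi <- /(_ I) [].
Qed.

(** A square of integral 0 means that the first-order equation holds at almost every time; with the
    initial value, [odesol_unique] determines the solution. *)
Lemma gap_zero : {ae leb, forall xi, \int[mu]_(t in H0) Sgap W xi t = 0} ->
  {ae leb, forall xi, forall t, 0 <= t -> uprim h0 W t xi = UJ L h0 F e t xi}.
Proof.
move=> Z; have G1 := good_ae KL wF; have G4 := prim_uprim h0 c0 wW.
apply: filterS2 (filterI G1 G4) (filterI Z (gap_ae wW)) => xi [[KLx wx] pW] [Z0 [iS _]] t t0.
have ig := gf_int K0 sg0 e0 er KLx wx.
have := odesol_unique ig pW _ t0; rewrite uprim0; apply.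
have := @Rintegral_eq0_ae `[(0 : R), +oo[ (Sgap W xi) iS (Sgap_ge0 W xi) Z0; apply: ae_muS => s h s0.
have := h _; rewrite in_itv/= (ltW s0) => /(_ isT) /eqP; rewrite /Sgap /Sdens mulf_eq0 gt_eqF ?expR_gt0//=.
by rewrite mulf_eq0 gt_eqF ?divr_gt0//= sqrf_eq0 subr_eq0 => /eqP.
Qed.

End comparison.

Lemma minimizer_exists : exists u, [/\ minimizer L f u0 e u, rep u0 e u (ZJ L h0 F e) & jmeas u].
Proof.
have [u [au ru mu']] := minimizer_candidate; exists u; split=> //; split=> // v av.
have [W rv] := admissible_rep e0 Lu0 av.
have [D [Ev Eu] [D0 _]] := gap_functional au ru av rv.
by rewrite Ev Eu lee_fin/= lerDr.
Qed.

(** An arbitrary minimizer has no larger value than the constructed one, so its gap [D] is at most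
    0. Uniqueness and all convergence statements go through this identification. *)
Lemma minimizer_hart v : minimizer L f u0 e v ->
  forall t, 0 <= t -> {ae leb, forall xi, hart (v t) xi = UJ L h0 F e t xi}.
Proof.
move=> [av mv] t t0; have [u [[au _] ru _]] := minimizer_exists.
have [W rv] := admissible_rep e0 Lu0 av.
have [D [Ev Eu] [_ D0]] := gap_functional au ru av rv.
have le0 : D <= 0.
  by have := mv _ au; rewrite Ev Eu lee_fin/= -lerBrDr subrr.
have := gap_zero rv (D0 le0); have [_ h _] := rv; have := h t t0.
by apply: filterS2 => xi -> ->.
Qed.

Lemma minimizer_unique u v : minimizer L f u0 e u -> minimizer L f u0 e v ->
  forall t, 0 <= t -> {ae leb, forall x, v t x = u t x}.
Proof.
move=> mu' mv t t0; have [[[[cu _ _] _] _] _] := mu'; have [[[[cv _ _] _] _] _] := mv.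
apply: hart_inj; [exact: CL2_L2 cv t0|exact: CL2_L2 cu t0|].
by apply: filterS2 (minimizer_hart mu' t0) (minimizer_hart mv t0) => xi -> ->.
Qed.

End minimizers.

(** * Convergence of the minimizers *)

Section tame_trajectories.
Context {R : realType} {N : nat}.
Local Notation E := 'rV[R]_N.
Local Notation mu := (@lebesgue_measure R).
Local Notation leb := (lebesgue_rV R N).
Local Notation cabs := (@Normc.normc R).
Local Notation T := (measurableTypeR R).
Implicit Types (U u : R -> E -> R).

Lemma sqrte_le (X : \bar R) (a : R) : (0 <= X)%E -> 0 <= a -> (X <= (a ^+ 2)%:E)%E -> (sqrte X <= a%:E)%E.
Proof.
by move=> X0 a0 Xa; rewrite -[a%:E]gee0_abs ?lee_fin// -sqrte_sqr lee_sqrt ?expe_ge0 ?lee_fin// -EFin_expe.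
Qed.

Lemma VnormE (L : E -> R) (v X : E -> R) : measurable_fun [set: E] L -> {ae leb, forall xi, L (- xi) = L xi} ->
  L2 leb v -> measurable_fun [set: E] X -> {ae leb, forall xi, hart v xi = X xi} ->
  Vnorm L v = sqrte (\int[leb]_xi ((1 + `|L xi|) * X xi ^+ 2)%:E)%E.
Proof.
move=> mL eL Lv mX vX; rewrite /Vnorm (ge0_integral_fourier (phi := fun x => 1 + `|L x|)) //; first last.
- by apply: filterS eL => x ->.
- by apply: measurable_funD; [exact: measurable_cst|exact: measurableT_comp].
have ma (Y : E -> R) : measurable_fun [set: E] Y -> measurable_fun [set: E] (fun xi => ((1 + `|L xi|) * Y xi ^+ 2)%:E).
  move=> mY; apply/measurable_EFinP; apply: measurable_funM; last exact: measurable_funX.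
  by apply: measurable_funD; [exact: measurable_cst|exact: measurableT_comp].
congr sqrte; apply: ae_eq_integral => //; [exact: ma (L2_hart Lv).1|exact: ma|].
by apply: filterS vX => xi -> _.
Qed.

Variables (K sg : R) (L h0 : E -> R) (F : R -> E -> R).
Hypothesis K0 : K <= 0.
Hypothesis sg0 : 0 <= sg.
Hypothesis mL : measurable_fun [set: E] L.
Hypothesis KL : {ae leb, forall xi, K <= L xi}.
Hypothesis Lh0 : L2 leb h0.
Hypothesis Vh0 : (\int[leb]_xi (`|L xi| * h0 xi ^+ 2)%:E < +oo)%E.
Hypothesis wF : wL2 sg F.
Local Notation r := (rate K sg).
Local Notation S := (S2 sg L h0 F).

Lemma measurable_sqrt_comp (g : E -> R) : measurable_fun [set: E] g -> measurable_fun [set: E] (fun xi => Num.sqrt (g xi)).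
Proof.
move=> mg; apply: (@measurableT_comp _ _ _ _ _ _ (@Num.sqrt R)) => //.
by apply: continuous_measurable_fun; exact: sqrt_continuous.
Qed.

Lemma L2_sqrtS2 (C : R) : 0 <= C -> L2 leb (fun xi => Num.sqrt (C * S xi)).
Proof.
move=> C0; have mS : measurable_fun [set: E] (fun xi => C * S xi).
  by apply: measurable_funM; [exact: measurable_cst|exact: measurable_S2 mL Lh0 wF].
have CS0 xi : 0 <= C * S xi by rewrite mulr_ge0 ?S2_ge0.
split; first exact: measurable_sqrt_comp.
have H : (\int[leb]_xi (C * S xi)%:E <= (C * Stot sg L h0 F)%:E)%E.
  by apply: (integral_le_S2 mL Lh0 Vh0 wF mS C0 CS0); exact: nearW.
apply: le_lt_trans (le_lt_trans H (ltry _)); rewrite le_eqVlt; apply/orP; left; apply/eqP.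
by apply: eq_integral => xi _; rewrite sqr_sqrtr.
Qed.

Lemma measurable_weight (X : E -> R) : measurable_fun [set: E] X ->
  measurable_fun [set: E] (fun xi => (1 + `|L xi|) * X xi ^+ 2).
Proof.
move=> mX; apply: measurable_funM; last exact: measurable_funX.
by apply: measurable_funD; [exact: measurable_cst|exact: measurableT_comp].
Qed.

(** Exactly what dominated convergence needs in V: continuity in time at almost every frequency, and
    an integrable majorant that is locally uniform in time. The minimizers and the limit share
    it. *)
Definition tame U := jmeas U /\ {ae leb, forall xi,
  (forall b, 0 <= b -> {within `[0, b], continuous (U^~ xi)}) /\
  forall t, 0 <= t -> (1 + `|L xi|) * U t xi ^+ 2 <= cstU K * S xi * expR (r * t)}.

Lemma tame_UJ e : 0 < e -> 2 * e * r <= 1 -> tame (UJ L h0 F e).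
Proof.
move=> e0 er; split; first exact (jmeas_UJ mL Lh0 wF e).
have := good_ae KL wF; apply: filterS => xi [KLx wx]; split.
  by move=> b b0; exact: prim_continuous b0 (prim_Uf K0 sg0 (h0 xi) e0 er KLx wx).
by move=> t t0; exact: (Uf_bound K0 sg0 (h0 xi) e0 er KLx wx t0).
Qed.

Lemma prim_U0J : {ae leb, forall xi, prim ((U0J L h0 F)^~ xi) (fun t => F t xi - L xi * U0J L h0 F t xi)}.
Proof.
have := wL2_wdata wF; apply: filterS => xi [mx ix].
exact (prim_odesol (L xi) (h0 xi) (wF_integrable sg0 mx ix)).
Qed.

Lemma tame_U0J : tame (U0J L h0 F).
Proof.
split; first exact (jmeas_U0J mL Lh0 wF).
apply: filterS2 (good_ae KL wF) prim_U0J => xi [KLx wx] pU; split.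
  by move=> b b0; exact: prim_continuous b0 pU.
by move=> t t0; exact: (U0f_bound K0 sg0 (h0 xi) KLx wx t0).
Qed.

Lemma tame_lty U t : tame U -> 0 <= t -> (\int[leb]_xi ((1 + `|L xi|) * U t xi ^+ 2)%:E < +oo)%E.
Proof.
move=> [mU HU] t0; apply: (@le_lt_trans _ _ ((cstU K * expR (r * t) * Stot sg L h0 F)%:E)); last exact: ltry.
apply: (integral_le_S2 mL Lh0 Vh0 wF).
- exact: measurable_weight (jmeas_t t mU).
- by rewrite mulr_ge0 ?expR_ge0// cstU_ge0.
- by move=> xi; rewrite mulr_ge0 ?sqr_ge0// addr_ge0.
by move: HU; apply: filterS => xi [_ h]; rewrite mulrAC; exact: h.
Qed.

Lemma tame_L2 U t : tame U -> 0 <= t -> L2 leb (U t).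
Proof.
move=> tU t0; have mU := jmeas_t t tU.1; split=> //.
apply: le_lt_trans (tame_lty tU t0); apply: ge0_le_integral => //.
- by move=> xi _; rewrite lee_fin sqr_ge0.
- exact: measurable_sq.
- by apply/measurable_EFinP; exact: measurable_weight.
- by move=> xi _; rewrite lee_fin ler_peMl ?sqr_ge0// lerDl.
Qed.

(** Dominated convergence works along sequences, so a failure of continuity is first turned into a
    sequence of times [s n] tending to [t]. The weight [1 + |L|] is distributed as its square root
    [wg] on each factor. *)
Lemma tame_cont U (t eta : R) : tame U -> 0 <= t -> 0 < eta ->
  exists2 d : R, 0 < d & forall s, 0 <= s -> `|t - s| < d ->
    (\int[leb]_xi ((1 + `|L xi|) * (U s xi - U t xi) ^+ 2)%:E <= eta%:E)%E.
Proof.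
move=> [mU HU] t0 eta0; apply: contrapT => H.
have /choice[s sP] : forall n : nat, exists s : R, [/\ 0 <= s, `|t - s| < n.+1%:R^-1 &
    ~ (\int[leb]_xi ((1 + `|L xi|) * (U s xi - U t xi) ^+ 2)%:E <= eta%:E)%E].
  move=> n; apply: contrapT => Hn; apply: H; exists n.+1%:R^-1; first by rewrite invr_gt0.
  by move=> s s0 st; apply: contrapT => h; apply: Hn; exists s.
have s1 n : s n <= t + 1.
  have [_ h _] := sP n; have : n.+1%:R^-1 <= (1 : R) by rewrite invf_le1// ler1n.
  move: h; move: (n.+1%:R^-1 : R) (s n) => k sn; rewrite ltr_norml => /andP[h1 h2] h3.
  by rewrite -lerBlDl (le_trans _ h3)// -lerN2 opprB ltW.
have s0 n : 0 <= s n by have [] := sP n.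
have st : s n @[n --> \oo] --> t.
  apply/cvgrPdist_lt => a a0; have /cvgrPdist_lt /(_ a a0) := @cvg_harmonic R; apply: filterS => n.
  rewrite /= sub0r normrN ger0_norm ?invr_ge0// => h; have [_ h' _] := sP n; exact: lt_trans h' h.
pose wg xi := Num.sqrt (1 + `|L xi|).
have wg0 xi : 0 <= 1 + `|L xi| by rewrite addr_ge0.
have mw : measurable_fun [set: E] wg.
  by apply: measurable_sqrt_comp; apply: measurable_funD; [exact: measurable_cst|exact: measurableT_comp].
pose C := 4 * (cstU K * expR (r * (t + 1))).
have B0 : 0 <= cstU K * expR (r * (t + 1)) by rewrite mulr_ge0 ?expR_ge0// cstU_ge0.
have C0 : 0 <= C by rewrite mulr_ge0.
have r0 : 0 <= r by apply: le_trans (rate_ge1 K0 sg0).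
have cv : sqint leb ((fun xi => wg xi * U (s n) xi) \- (fun xi => wg xi * U t xi)) @[n --> \oo] --> 0%E.
  apply: (L2_dominated (f_ := fun n xi => wg xi * U (s n) xi) (g := fun xi => Num.sqrt (C * S xi))).
  - by move=> n; apply: measurable_funM => //; exact: jmeas_t mU.
  - by apply: measurable_funM => //; exact: jmeas_t mU.
  - exact: L2_sqrtS2.
  - move: HU; apply: filterS => xi [/(_ (t + 1)) cU _].
    have t1 : 0 <= t + 1 by rewrite addr_ge0.
    have /subspace_continuousP /(_ t) cUt := cU t1.
    have tin : [set` `[0, t + 1]] t by rewrite /= in_itv/=; apply/andP; split; [exact: t0|rewrite lerDl; exact: ler01].
    apply: cvgMr; apply: (cvg_comp _ _ _ (cUt tin)).
    move=> P /= wP; have sn : \forall n \near \oo, (fun y => [set` `[0, t + 1]] y -> P y) (s n) := st _ wP.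
    apply: filterS sn => n; apply.
    by rewrite /= in_itv/= s0 s1.
  - move=> n; move: HU; apply: filterS => xi [_ bU].
    have b2 q : 0 <= q -> q <= t + 1 -> `|wg xi * U q xi| <= Num.sqrt (cstU K * expR (r * (t + 1)) * S xi).
      move=> q0 q1; rewrite -sqrtr_sqr ler_wsqrtr// exprMn sqr_sqrtr//.
      apply: (le_trans (bU q q0)); rewrite mulrAC ler_wpM2r ?S2_ge0// ler_wpM2l ?cstU_ge0//.
      by rewrite ler_expR ler_wpM2l.
    apply: (le_trans (ler_normB _ _)).
    have -> : Num.sqrt (C * S xi) = 2 * Num.sqrt (cstU K * expR (r * (t + 1)) * S xi).
      rewrite /C -!mulrA sqrtrM//; congr (_ * _).
      by rewrite (_ : 4 = 2 ^+ 2 :> R) ?sqrtr_sqr ?ger0_norm//; ring.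
    have := b2 t t0; have := b2 _ (s0 n) (s1 n); rewrite lerDl => h1 /(_ ler01) h2.
    by apply: (le_trans (lerD h1 h2)); rewrite mulr_natl mulr2n.
have /(cvge0P (eventually_filter) (fun n => sqint_ge0 leb _)).2 /(_ eta eta0) [n _ /(_ n (leqnn n)) hn] := cv.
have [_ _] := sP n; apply; apply: le_trans hn; rewrite le_eqVlt; apply/orP; left; apply/eqP.
by apply: eq_integral => xi _; rewrite /= -mulrBr exprMn sqr_sqrtr.
Qed.

(** The rate of [Uf_cvg_rate] costs a factor [1 + |L|] in V, and [1 + |L|] times [S] need not be
    integrable. The minimum in [G] combines the rate with the uniform bound: it tends to 0 at each
    frequency and stays below the integrable [B * S]. As [G] does not depend on the time, the result
    is uniform on [[0, b]]. *)
Lemma UJ_uniform b eta : 0 <= b -> 0 < eta -> exists2 d : R, 0 < d & forall e t : R,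
  0 < e -> e < d -> 2 * e * r <= 1 -> 0 <= t -> t <= b ->
  (\int[leb]_xi ((1 + `|L xi|) * (UJ L h0 F e t xi - U0J L h0 F t xi) ^+ 2)%:E <= eta%:E)%E.
Proof.
move=> b0 eta0; pose A := 4 * cstZ K * expR (r * b); pose B := 4 * cstU K * expR (r * b).
have A0 : 0 <= A by rewrite !mulr_ge0 ?expR_ge0// cstZ_ge0.
have B0 : 0 <= B by apply: mulr_ge0; [apply: mulr_ge0 => //; exact: cstU_ge0|exact: expR_ge0].
have r0 : 0 <= r by apply: le_trans (rate_ge1 K0 sg0).
have w0 xi : 0 <= 1 + `|L xi| by rewrite addr_ge0.
pose G e xi := Num.min (A * e * (1 + `|L xi|)) B * S xi.
have G0 e xi : 0 <= e -> 0 <= G e xi.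
  by move=> e0; rewrite mulr_ge0 ?S2_ge0// le_min B0 andbT (mulr_ge0 (mulr_ge0 A0 e0) (w0 xi)).
have mG e : measurable_fun [set: E] (G e).
  apply: measurable_funM; last exact: measurable_S2 mL Lh0 wF.
  apply: measurable_minr; last exact: measurable_cst.
  by apply: measurable_funM; [exact: measurable_cst|apply: measurable_funD; [exact: measurable_cst|exact: measurableT_comp]].
have GB e xi : G e xi <= B * S xi by rewrite ler_wpM2r ?S2_ge0// ge_min lexx orbT.
have cv : sqint leb ((fun xi => Num.sqrt (G n.+1%:R^-1 xi)) \- (fun=> 0)) @[n --> \oo] --> 0%E.
  apply: (L2_dominated (f_ := fun n xi => Num.sqrt (G n.+1%:R^-1 xi)) (g := fun xi => Num.sqrt (B * S xi))).
  - by move=> n; exact: measurable_sqrt_comp.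
  - exact: measurable_cst.
  - exact: L2_sqrtS2.
  - apply: nearW => xi; rewrite -[X in _ --> X](sqrtr0 R).
    have h : G n.+1%:R^-1 xi @[n --> \oo] --> (0 : R).
      apply: (@squeeze_cvgr _ _ _ _ (fun=> 0) (fun n => (A * (1 + `|L xi|) * S xi) * n.+1%:R^-1)); last 2 first.
      + exact: cvg_cst.
      + by rewrite -[X in _ --> X](mulr0 (A * (1 + `|L xi|) * S xi)); apply: cvgMr; exact: cvg_harmonic.
      apply: nearW => n; rewrite G0 ?invr_ge0//=.
      apply: (@le_trans _ _ (A * n.+1%:R^-1 * (1 + `|L xi|) * S xi)); first by rewrite ler_wpM2r ?S2_ge0// ge_min lexx.
      by rewrite le_eqVlt; apply/orP; left; apply/eqP; ring.
    exact: (continuous_cvg _ (@sqrt_continuous R 0) h).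
  - by move=> n; apply: nearW => xi; rewrite subr0 ger0_norm ?sqrtr_ge0// ler_wsqrtr.
have /(cvge0P (eventually_filter) (fun n => sqint_ge0 leb _)).2 /(_ eta eta0) [n _ /(_ n (leqnn n)) hn] := cv.
(* [G] is nondecreasing in [e], so one term of the sequence serves all smaller parameters. *)
exists n.+1%:R^-1; first by rewrite invr_gt0.
move=> e t e0 ed er t0 tb; apply: le_trans hn.
have [mU HU] := tame_UJ e0 er; have [mV HV] := tame_U0J.
apply: ae_ge0_le_integral => //.
- by move=> xi _; rewrite lee_fin mulr_ge0 ?sqr_ge0.
- by apply/measurable_EFinP; apply: measurable_weight; apply: measurable_funB; [exact: jmeas_t mU|exact: jmeas_t mV].
- by move=> xi _; rewrite lee_fin sqr_ge0.
- by apply: measurable_sq; apply: measurable_funB; [exact: measurable_sqrt_comp|exact: measurable_cst].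
apply: filterS2 (filterI HU HV) (good_ae KL wF) => xi [[_ bU] [_ bV]] [KLx wx] _.
rewrite lee_fin /= subr0 sqr_sqrtr ?G0 ?invr_ge0//.
have S0 : 0 <= S xi by exact: S2_ge0.
have eE : expR (r * t) <= expR (r * b) by rewrite ler_expR ler_wpM2l.
rewrite /G minr_pMl// le_min; apply/andP; split.
- have am0 : 0 <= amp K sg (L xi) (h0 xi) (F^~ xi) by exact: sqrtr_ge0.
  have h : `|UJ L h0 F e t xi - U0J L h0 F t xi| <= 2 * (amp K sg (L xi) (h0 xi) (F^~ xi) * Num.sqrt e * expR (r / 2 * t)).
    by rewrite distrC; exact: (Uf_cvg_rate K0 sg0 (h0 xi) e0 er KLx wx t0).
  have h2 : (UJ L h0 F e t xi - U0J L h0 F t xi) ^+ 2 <= 4 * (cstZ K * S xi) * e * expR (r * t).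
    rewrite -sqr_normr; apply: (@le_trans _ _ ((2 * (amp K sg (L xi) (h0 xi) (F^~ xi) * Num.sqrt e * expR (r / 2 * t))) ^+ 2)).
      by rewrite lerXn2r ?nnegrE// !mulr_ge0 ?sqrtr_ge0 ?expR_ge0.
    rewrite !exprMn (sqr_sqrtr (ltW e0)) sqr_sqrtr ?mulr_ge0 ?size2_ge0 ?cstZ_ge0// le_eqVlt; apply/orP; left; apply/eqP.
    rewrite (_ : expR (r / 2 * t) ^+ 2 = expR (r * t)); first by rewrite /S2; ring.
    by rewrite expr2 -expRD; congr expR; field.
  apply: (@le_trans _ _ ((1 + `|L xi|) * (4 * (cstZ K * S xi) * e * expR (r * b)))).
    rewrite ler_wpM2l//; apply: (le_trans h2); rewrite ler_wpM2l//.
    by rewrite !mulr_ge0 ?cstZ_ge0// ltW.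
  apply: (@le_trans _ _ (A * e * (1 + `|L xi|) * S xi)); first by rewrite le_eqVlt; apply/orP; left; apply/eqP; rewrite /A; ring.
  by rewrite ler_wpM2r// ler_wpM2r// ler_wpM2l// ltW.
- have b1 := bU t t0; have b2 := bV t t0.
  have b3 : cstU K * S xi * expR (r * t) <= cstU K * S xi * expR (r * b).
    by rewrite ler_wpM2l// mulr_ge0// cstU_ge0.
  have sq (x y : R) : (x - y) ^+ 2 <= 2 * x ^+ 2 + 2 * y ^+ 2 by have := sqr_ge0 (x + y); rewrite sqrrD sqrrB; lra.
  apply: (@le_trans _ _ ((1 + `|L xi|) * (2 * UJ L h0 F e t xi ^+ 2 + 2 * U0J L h0 F t xi ^+ 2))).
    by rewrite ler_wpM2l.
  rewrite (_ : B * S xi = 4 * (cstU K * S xi * expR (r * b))); last by rewrite /B; ring.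
  rewrite mulrDr !(mulrCA _ 2); move: b1 b2 b3; lra.
Qed.

Hypothesis eL : {ae leb, forall xi, L (- xi) = L xi}.

Section realized.
Variables (u U : R -> E -> R).
Hypothesis tU : tame U.
Hypothesis Lu : forall t, 0 <= t -> L2 leb (u t).
Hypothesis hU : forall t, 0 <= t -> {ae leb, forall xi, hart (u t) xi = U t xi}.

Lemma realized_Vnorm_sub (v V : R -> E -> R) s t : jmeas V -> 0 <= s -> 0 <= t -> L2 leb (v t) ->
  {ae leb, forall xi, hart (v t) xi = V t xi} ->
  Vnorm L (u s \- v t) = sqrte (\int[leb]_xi ((1 + `|L xi|) * (U s xi - V t xi) ^+ 2)%:E)%E.
Proof.
move=> mV s0 t0 Lv hv; apply: (VnormE mL eL (L2B (Lu s0) Lv) (X := fun xi => U s xi - V t xi)).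
  by apply: measurable_funB; [exact: jmeas_t tU.1|exact: jmeas_t mV].
by apply: filterS2 (hartB (Lu s0) Lv) (filterI (hU s0) hv) => xi -> [-> ->].
Qed.

Lemma realized_inV t : 0 <= t -> inV L (u t).
Proof.
move=> t0; split; first by apply/inL2E; exact: Lu.
rewrite (abs_form mL eL (Lu t0) (jmeas_t t tU.1) (hU t0)); apply: le_lt_trans (tame_lty tU t0).
apply: ge0_le_integral => //.
- by move=> xi _; rewrite lee_fin mulr_ge0 ?sqr_ge0.
- apply/measurable_EFinP; apply: measurable_funM; first exact: measurableT_comp.
  by apply: measurable_funX; exact: jmeas_t tU.1.
- by apply/measurable_EFinP; apply: measurable_weight; exact: jmeas_t tU.1.
- by move=> xi _; rewrite lee_fin ler_wpM2r ?sqr_ge0// lerDr.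
Qed.

Lemma realized_cont (t a : R) : 0 <= t -> 0 < a ->
  exists2 d : R, 0 < d & forall s : R, 0 <= s -> `|t - s| < d -> (Vnorm L (u s \- u t)%R <= a%:E)%E.
Proof.
move=> t0 a0; have [d d0 H] := tame_cont tU t0 (exprn_gt0 2 a0); exists d => // s s0 st.
rewrite (realized_Vnorm_sub (v := u) (V := U) tU.1 s0 t0 (Lu t0) (hU t0)); apply: sqrte_le (ltW a0) (H s s0 st).
by apply: integral_ge0 => xi _; rewrite lee_fin mulr_ge0 ?sqr_ge0// addr_ge0.
Qed.

Lemma within_proper_itv b t : t \in `[(0 : R), b] -> ProperFilter (within `[0, b] (nbhs t)).
Proof.
move=> tb; split; last exact: within_filter.
by rewrite /within /= => /nbhs_singleton; apply.
Qed.

Lemma realized_CV b : CV L b u.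
Proof.
split=> t tb; have /andP[t0 _] : (0 <= t) && (t <= b) by move: tb; rewrite in_itv.
  exact: realized_inV.
apply/(cvge0P (within_proper_itv tb) (fun s => sqrte_ge0 _)) => a a0.
have [d d0 H] := realized_cont t0 a0.
have nb : \forall s \near t, `|t - s| < d by exact: (nbhsx_ballx t _ d0).
by rewrite /within /=; apply: filterS nb => s st; rewrite /= in_itv/= => /andP[s0 _]; exact: H.
Qed.

Lemma realized_CL2 : jmeas u -> CL2 u.
Proof.
move=> mu'; split; [by apply: measurable_funTS|by move=> t t0; apply/inL2E; exact: Lu|].
move=> t t0; apply/(cvge0P (within_proper t0) (fun s => L2norm_ge0 _)) => a a0.
have [d d0 H] := tame_cont tU t0 (exprn_gt0 2 a0).
have nb : \forall s \near t, `|t - s| < d by exact: (nbhsx_ballx t _ d0).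
rewrite /within /=; apply: filterS nb => s st; rewrite /= in_itv/= andbT => s0.
rewrite (L2norm_le _ (ltW a0)); apply: (le_trans _ (H s s0 st)).
rewrite -(sqint_hart (L2B (Lu s0) (Lu t0))) (@eq_sqint _ _ _ leb _ (U s \- U t)); first last.
- by apply: filterS2 (hartB (Lu s0) (Lu t0)) (filterI (hU s0) (hU t0)) => xi -> [-> ->].
- by apply: measurable_funB; exact: jmeas_t tU.1.
- exact: (L2_hart (L2B (Lu s0) (Lu t0))).1.
have mB : measurable_fun [set: E] (U s \- U t) by apply: measurable_funB; exact: jmeas_t tU.1.
apply: ge0_le_integral => //.
- by move=> xi _; rewrite lee_fin sqr_ge0.
- exact: measurable_sq.
- by apply/measurable_EFinP; exact: measurable_weight mB.
- by move=> xi _; rewrite lee_fin ler_peMl ?sqr_ge0// lerDl.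
Qed.

End realized.

End tame_trajectories.

(** * The limit problem and convergence to its solution *)

Section limit_solution.
Context {R : realType} {N : nat}.
Local Notation E := 'rV[R]_N.
Local Notation mu := (@lebesgue_measure R).
Local Notation leb := (lebesgue_rV R N).
Local Notation T := (measurableTypeR R).
Local Notation M := (lebesgue_measure \x leb)%E.
Implicit Types (u v G : R -> E -> R).

Lemma nrm_hart_sub (X Y A B : E -> R) : L2 leb X -> L2 leb Y -> L2 leb A -> L2 leb B ->
  {ae leb, forall xi, hart X xi = A xi} -> {ae leb, forall xi, hart Y xi = B xi} ->
  nrm leb (X \- Y) = nrm leb (A \- B).
Proof.
move=> LX LY LA LB XA YB; rewrite -(nrm_hart (L2B LX LY)) /nrm; congr Num.sqrt.
have h : {ae leb, forall xi, hart (X \- Y) xi = (A \- B) xi}.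
  by apply: filterS2 (hartB LX LY) (filterI XA YB) => xi -> [-> ->].
exact: (eq_ip (L2_hart (L2B LX LY)) (L2B LA LB) (L2_hart (L2B LX LY)) (L2B LA LB) h h).
Qed.

Lemma nrm_subC (X Y : E -> R) : nrm leb (X \- Y) = nrm leb (Y \- X).
Proof. by congr Num.sqrt; apply: eq_Rintegral => x _ /=; ring. Qed.

Lemma ae_swap_time G : jmeas G -> {ae mu, forall t, {ae leb, forall x, G t x = 0}} ->
  {ae leb, forall x, {ae mu, forall t, G t x = 0}}.
Proof.
move=> mG H; have E0 : sqint M (unc G) = 0%E.
  rewrite (sqint_unc mG) -[RHS](@integral0 _ T R mu setT); apply: ae_eq_integral => //.
    exact: measurable_sqint.
  move: H; apply: ae_muS => t Ht _; rewrite (@eq_sqint _ _ _ leb _ (fun=> 0)) //.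
  - by rewrite /sqint integral0_eq// => x _; rewrite expr0n.
  - exact: jmeas_t.
rewrite (sqint_unc2 mG) in E0.
have E1 : (\int[leb]_x `|sqint mu (G^~ x)| = 0)%E.
  by rewrite -[RHS]E0; apply: eq_integral => x _; rewrite gee0_abs ?sqint_ge0.
have ms : measurable_fun [set: E] (fun x => sqint mu (G^~ x)).
  apply: (measurable_integral_param mu (f := fun z : E * T => unc G (z.2, z.1) ^+ 2)).
  apply: measurable_funX; apply: (measurableT_comp mG).
  exact: (measurable_fun_pair measurable_snd measurable_fst).
have := (ae_eq_integral_abs leb measurableT ms).1 E1; apply: filterS => x /(_ I) h.
exact: (@sqint_eq0 _ T R mu _ (jmeas_x x mG) h).
Qed.

Lemma prim_balance (b : R) (y z : R -> R) (t : R) : (forall c, mu.-integrable `[0, c] (EFin \o z)) ->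
  prim y (fun s => z s - b * y s) -> 0 <= t ->
  [/\ mu.-integrable `[0, t] (EFin \o y), mu.-integrable `]0, t] (EFin \o z) &
      y t + b * \int[mu]_(s in `[0, t]) y s = y 0 + \int[mu]_(s in `]0, t]) z s].
Proof.
move=> iz py t0; have iy := prim_integrable t py; have iz' := integrable_sub_obnd (iz t); split=> //.
rewrite (Rintegral_itv_obnd_cbnd iz') (py.2 t t0) (RintegralB (mitv _) (iz t) (integrableZl (mitv _) b iy)).
by rewrite (RintegralZl b (mitv _) iy); ring.
Qed.

Lemma complex_balance (z w : R[i]) (l A B C D : R) :
  complex.Re z + l * A = complex.Re w + C -> complex.Im z + l * B = complex.Im w + D <->
  z + l%:C%C * (A +i* B)%C = w + (C +i* D)%C.
Proof.
case: z w => [zr zi] [wr wi] /= E1; split=> [E2|[_ E2]].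
  by apply/eqP; rewrite eq_complex /= !mul0r subr0 addr0 E1 E2 !eqxx.
by move: E2; rewrite mul0r addr0.
Qed.

Lemma jmeas_opp G : jmeas G -> jmeas (fun t x => G t (- x)).
Proof.
move=> mG; have h : measurable_fun [set: T * E] (fun z : T * E => (z.1, - z.2)).
  apply: measurable_fun_pair; first exact: measurable_fst.
  exact: (measurableT_comp (@measurable_oppV R N) measurable_snd).
exact: (measurableT_comp mG h).
Qed.

Lemma hft_ae (h h' : E -> R) : {ae leb, forall xi, h xi = h' xi} -> {ae leb, forall xi, hft h xi = hft h' xi}.
Proof. by move=> H; apply: filterS2 H (ae_oppV H) => xi h1 h2; rewrite /hft h1 h2. Qed.

Lemma Cmeasurable_hft (D : set (R * E)) G : jmeas G -> Cmeasurable_fun D (fun z : R * E => hft (G z.1) z.2).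
Proof.
move=> mG; have mG' := jmeas_opp mG; split; apply: measurable_funTS => /=.
  by apply: measurable_funM; [apply: measurable_funD; [exact: mG|exact: mG']|exact: measurable_cst].
rewrite (_ : (fun z => _) = (fun z : R * E => (G z.1 z.2 - G z.1 (- z.2)) * (- 2^-1))); last by apply/funext => z /=; ring.
by apply: measurable_funM; [apply: measurable_funB; [exact: mG|exact: mG']|exact: measurable_cst].
Qed.

Variables (K sg : R) (L u0 : E -> R) (f F : R -> E -> R).
Hypothesis K0 : K <= 0.
Hypothesis sg0 : 0 <= sg.
Hypothesis mL : measurable_fun [set: E] L.
Hypothesis KL : {ae leb, forall xi, K <= L xi}.
Hypothesis eL : {ae leb, forall xi, L (- xi) = L xi}.
Hypothesis Lu0 : L2 leb u0.
Local Notation h0 := (hart u0).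
Hypothesis Vh0 : (\int[leb]_xi (`|L xi| * h0 xi ^+ 2)%:E < +oo)%E.
Hypothesis wf : wL2 sg (pos_ext f).
Hypothesis wF : wL2 sg F.
Hypothesis hF : {ae mu, forall t, 0 <= t -> {ae leb, forall xi, F t xi = hart (pos_ext f t) xi}}.
Local Notation r := (rate K sg).
Local Notation U0 := (U0J L h0 F).
Let Lh0 : L2 leb h0. Proof. exact: L2_hart. Qed.
Let tU0 : tame K sg L h0 F U0. Proof. exact (tame_U0J K0 sg0 mL KL Lh0 wF). Qed.
Let LU0 t (t0 : 0 <= t) : L2 leb (U0 t). Proof. exact (tame_L2 K0 mL Lh0 Vh0 wF tU0 t0). Qed.

Lemma U0J0 : U0 0 = h0.
Proof. by apply/funext => xi; exact: odesol0. Qed.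

Lemma minimizers_ae (uu : nat -> R -> E -> R) (w : E -> R) (e : nat -> R) t :
  (forall n, 0 < e n /\ 2 * e n * r <= 1) -> (forall n, minimizer L f u0 (e n) (uu n)) ->
  e n @[n --> \oo] --> 0 -> 0 <= t -> L2 leb w -> {ae leb, forall xi, hart w xi = U0 t xi} ->
  {ae leb, forall x, uu n t x @[n --> \oo] --> w x}.
Proof.
move=> ee mm ecv t0 Lw hw.
have Lu n : L2 leb (uu n t) by have [[[[cu _ _] _] _] _] := mm n; exact: CL2_L2 cu t0.
have hu n : {ae leb, forall xi, hart (uu n t) xi = UJ L h0 F (e n) t xi}.
  by have [e0 er] := ee n; exact (minimizer_hart K0 sg0 mL KL eL Lu0 Vh0 wf wF hF e0 er (mm n) t0).
have LU n : L2 leb (UJ L h0 F (e n) t).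
  by have [e0 er] := ee n; exact (L2_UJ K0 sg0 mL KL Lh0 Vh0 wF e0 er t0).
have C0 : 0 <= cstD K sg L h0 F t by rewrite !mulr_ge0 ?sqrtr_ge0 ?expR_ge0.
apply: (@chain_ae _ _ _ leb (fun n => uu n t) w (fun n => Num.sqrt (e n)) _ C0 Lu Lw).
- move=> i j sij; have [ei _] := ee i; have [ej erj] := ee j.
  rewrite (nrm_hart_sub (Lu j) (Lu i) (LU j) (LU i) (hu j) (hu i)) nrm_subC.
  have eij : e i <= e j by rewrite -(sqr_sqrtr (ltW ei)) -(sqr_sqrtr (ltW ej)) lerXn2r ?nnegrE ?sqrtr_ge0.
  exact (UJ_lip K0 sg0 mL KL Lh0 Vh0 wF ei eij erj t0).
- move=> i; have [ei er] := ee i; rewrite (nrm_hart_sub (Lu i) Lw (LU i) (LU0 t0) (hu i) hw).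
  exact (UJ_rate K0 sg0 mL KL Lh0 Vh0 wF ei er t0).
- by rewrite -[X in _ --> X](sqrtr0 R); exact: (continuous_cvg _ (@sqrt_continuous R 0) ecv).
Qed.

(** Taking [hart (U0 t)] at each time would leave joint measurability open. The limit of jointly
    measurable minimizers along one sequence of parameters is jointly measurable, and at each time
    it agrees with [hart (U0 t)] almost everywhere. *)
Lemma limit_exists : exists u, [/\ jmeas u, forall t, 0 <= t -> L2 leb (u t) &
  forall t, 0 <= t -> {ae leb, forall xi, hart (u t) xi = U0 t xi}].
Proof.
have r1 := rate_ge1 K0 sg0; have r0 : 0 < r by exact: lt_le_trans r1.
pose e n : R := (2 * r)^-1 * n.+1%:R^-1.
have ee n : 0 < e n /\ 2 * e n * r <= 1.
  split; first by rewrite mulr_gt0// invr_gt0// mulr_gt0.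
  have -> : 2 * e n * r = n.+1%:R^-1 by rewrite /e; move: (n.+1%:R^-1 : R) => k; field; rewrite gt_eqF.
  by rewrite invf_le1// ler1n.
have /choice[uu Hu] : forall n, exists v, minimizer L f u0 (e n) v /\ jmeas v.
  move=> n; have [e0 er] := ee n; have [v [mv _ jv]] := minimizer_exists K0 sg0 mL KL eL Lu0 Vh0 wf wF hF e0 er.
  by exists v.
have ecv : e n @[n --> \oo] --> 0.
  by rewrite -[X in _ --> X](mulr0 (2 * r)^-1); apply: cvgMr; exact: cvg_harmonic.
have ju : jmeas (limf uu) by apply: jmeas_limf => n; exact: (Hu n).2.
have uE t : 0 <= t -> {ae leb, forall x, limf uu t x = hart (U0 t) x}.
  move=> t0; have LU := LU0 t0.
  have := minimizers_ae ee (fun n => (Hu n).1) ecv t0 (L2_hart LU) (hartK LU).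
  by apply: filterS => x; exact: limfE.
have Lu t : 0 <= t -> L2 leb (limf uu t).
  move=> t0; have mt := jmeas_t t ju; split=> //.
  by rewrite (eq_sqint mt (L2_hart (LU0 t0)).1 (uE t t0)); exact: (L2_hart (LU0 t0)).2.
exists (limf uu); split=> // t t0.
rewrite (eq_hart (Lu t t0) (L2_hart (LU0 t0)) (uE t t0)); exact: hartK (LU0 t0).
Qed.

(** Convergence is known at each time, for almost every point depending on the time. The upper limit
    [h] of the distances is measurable on the product and vanishes almost everywhere at each time;
    Tonelli makes it vanish almost everywhere on the product. *)
Lemma minimizers_ae_joint (uu : nat -> R -> E -> R) u (e : nat -> R) :
  (forall n, 0 < e n /\ 2 * e n * r <= 1) -> (forall n, minimizer L f u0 (e n) (uu n)) ->
  e n @[n --> \oo] --> 0 -> jmeas u -> (forall t, 0 <= t -> L2 leb (u t)) ->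
  (forall t, 0 <= t -> {ae leb, forall xi, hart (u t) xi = U0 t xi}) ->
  {ae M, forall z, 0 < z.1 -> uu n z.1 z.2 @[n --> \oo] --> u z.1 z.2}.
Proof.
move=> ee mm ecv ju Lu hu.
pose D n (z : T * E) : R := `|unc (pos_ext (uu n)) z - unc (pos_ext u) z|.
pose h (z : T * E) : \bar R := limn_esup (fun n => (D n z)%:E).
have ju' : jmeas (pos_ext u) by apply: jmeas_pos_ext; exact: measurable_funTS.
have mD n : measurable_fun [set: T * E] (D n).
  apply: measurableT_comp => //; apply: measurable_funB; last exact: ju'.
  by apply: CL2_pos_ext; have [[[[cu _ _] _] _] _] := mm n.
have mh : measurable_fun [set: T * E] h by apply: measurable_fun_limn_esup => n; exact/measurable_EFinP.
have h0' z : (0 <= h z)%E by apply: limf_esup_ge0 => [|n]; [exact: (@filter_not_empty _ (\oo : set_system nat) _)|rewrite lee_fin; exact: normr_ge0].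
have hz t : {ae leb, forall x, h (t, x) = 0%E}.
  have D0 x : D n (t, x) @[n --> \oo] --> (0 : R) -> h (t, x) = 0%E.
    move=> cl; have : (D n (t, x))%:E @[n --> \oo] --> 0%:E by apply: cvg_EFin cl; exact: nearW.
    by move/cvg_limn_einf_sup => [_].
  have [t0|t0] := ltP 0 t; last first.
    apply: nearW => x; apply: D0; rewrite (_ : (fun n => D n (t, x)) = (fun=> 0)); first exact: cvg_cst.
    by apply/funext => n; rewrite /D /unc /pos_ext /= ltNge t0 /= subrr normr0.
  have := minimizers_ae ee mm ecv (ltW t0) (Lu t (ltW t0)) (hu t (ltW t0)).
  apply: filterS => x cx; apply: D0; rewrite -[X in _ --> X](normr0 R) -(subrr (u t x)).
  apply: cvg_norm; rewrite /unc /pos_ext /= t0.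
  by apply: cvgB => //; exact: cvg_cst.
have I0 : (\int[M]_z `|h z| = 0)%E.
  have mah : measurable_fun [set: T * E] (fun z => `|h z|%E) by exact: measurableT_comp.
  rewrite (fubini_tonelli1 _ mah)//; apply: integral0_eq => t _; rewrite /fubini_F.
  apply/(ae_eq_integral_abs leb measurableT); last by move: (hz t); apply: filterS => x hx _.
  by apply: (measurableT_comp mh); exact: measurable_pair1.
have := (ae_eq_integral_abs M measurableT mh).1 I0; apply: filterS => -[t x] /(_ I) /= hx t0.
have cD : (D n (t, x))%:E @[n --> \oo] --> (0 : R)%:E.
  apply: limn_esup_le_cvg => [|n]; last by rewrite lee_fin; exact: normr_ge0.
  by move: hx; rewrite /h => ->.
have cD' : D n (t, x) @[n --> \oo] --> (0 : R) by have /fine_cvgP[_] := cD.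
apply/cvgrPdist_le => a a0; have /cvgrPdist_le /(_ a a0) := cD'; apply: filterS => n.
by rewrite sub0r normrN normr_id /unc /pos_ext /= t0 distrC.
Qed.

(** As the symbol is even, the values at [xi] and [- xi] solve the same equation, and so do their
    combinations; [a = b = 1 / 2] gives the real part of the Fourier transform, and [a = - 1 / 2],
    [b = 1 / 2] the imaginary part. *)
Lemma sym_balance : {ae leb, forall xi, forall (a b : R) (y z : R -> R) (t : R),
  (forall s, y s = a * U0 s xi + b * U0 s (- xi)) -> (forall s, z s = a * F s xi + b * F s (- xi)) -> 0 <= t ->
  [/\ mu.-integrable `[0, t] (EFin \o y), mu.-integrable `]0, t] (EFin \o z) &
      y t + L xi * \int[mu]_(s in `[0, t]) y s = a * h0 xi + b * h0 (- xi) + \int[mu]_(s in `]0, t]) z s]}.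
Proof.
have pU := prim_U0J L h0 sg0 wF; have wd := wL2_wdata wF.
apply: filterS2 (filterI pU wd) (filterI (ae_oppV (filterI pU wd)) eL) => xi [p1 [m1 i1]] [[p2 [m2 i2]] eLx].
move=> a b y z t yE zE t0; rewrite eLx in p2.
have iz c : mu.-integrable `[0, c] (EFin \o z).
  have := integrableD (mitv _) (integrableZl (mitv _) a (wF_integrable sg0 m1 i1 c)) (integrableZl (mitv _) b (wF_integrable sg0 m2 i2 c)).
  by apply: eq_integrable => [|s _ /=]; [exact: mitv|rewrite zE EFinD !EFinM].
have py : prim y (fun s => z s - L xi * y s).
  by apply: (eq_prim (primD (primZ a p1) (primZ b p2))) => s _ /=; rewrite ?zE yE//; ring.
have [i3 i4 ->] := prim_balance iz py t0; split=> //.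
by rewrite yE U0J0.
Qed.

Lemma limit_solution u : jmeas u -> (forall t, 0 <= t -> L2 leb (u t)) ->
  (forall t, 0 <= t -> {ae leb, forall xi, hart (u t) xi = U0 t xi}) -> solution L f u0 u.
Proof.
move=> ju Lu hu; split.
- exact (realized_CL2 K0 sg0 mL Lh0 Vh0 wF tU0 Lu hu ju).
- apply: (hart_inj (Lu 0 (lexx 0)) Lu0); have := hu 0 (lexx 0); rewrite U0J0; exact.
exists (fun t => hft (U0 t)), (fun t => hft (F t)); split.
- by apply: Cmeasurable_hft; exact: tU0.1.
- by apply: Cmeasurable_hft; exact: wF.1.
- move=> t t0; apply: filterS2 (fourier_hft (Lu t t0)) (hft_ae (hu t t0)) => xi -> ->; exact: erefl.
- have := ae_muI hF (wL2_ae_t wf); apply: ae_muS => t [h1 h2] t0; rewrite -(pos_extE f t0).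
  by apply: filterS2 (fourier_hft (h2 (ltW t0))) (hft_ae (h1 (ltW t0))) => xi -> ->.
apply: filterS2 (fourier_hft Lu0) sym_balance => xi -> H t t0.
have [i1 i2 E1] := H 2^-1 2^-1 (fun s => complex.Re (hft (U0 s) xi)) (fun s => complex.Re (hft (F s) xi)) t
  ltac:(by move=> s /=; ring) ltac:(by move=> s /=; ring) t0.
have [i3 i4 E2] := H (- 2^-1) 2^-1 (fun s => complex.Im (hft (U0 s) xi)) (fun s => complex.Im (hft (F s) xi)) t
  ltac:(by move=> s /=; ring) ltac:(by move=> s /=; ring) t0.
split=> //; apply complex_balance.
  by rewrite E1 /=; congr (_ + _); ring.
by rewrite E2 /=; congr (_ + _); ring.
Qed.

(** The real part minus the imaginary part of the integrated equation is the scalar equation for the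
    Hartley transform. Its right side agrees with [F] at almost every time for almost every
    frequency, after an exchange of quantifiers by [ae_swap_time], and [odesol_unique] applies. *)
Lemma solution_hart v : solution L f u0 v -> forall t, 0 <= t -> {ae leb, forall xi, hart (v t) xi = U0 t xi}.
Proof.
move=> [cv v0 [U [G [mU mG HU HG HE]]]].
pose z s xi := complex.Re (G s xi) - complex.Im (G s xi).
have mz : jmeas (pos_ext z) by apply: jmeas_pos_ext; exact: measurable_funB mG.1 mG.2.
have mF' : jmeas (pos_ext F) by apply: jmeas_pos_ext; exact: measurable_funTS wF.1.
have zF : {ae leb, forall xi, {ae mu, forall s, pos_ext z s xi - pos_ext F s xi = 0}}.
  apply: ae_swap_time; first exact: jmeas_B.
  have := ae_muI HG hF; apply: ae_muS => s [h1 h2]; have [s0|s0] := ltP 0 s; last first.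
    by apply: nearW => xi; rewrite /pos_ext ltNge s0 /= subrr.
  rewrite (pos_extE z s0) (pos_extE F s0); apply: filterS2 (h1 s0) (h2 (ltW s0)) => xi g1 g2.
  by rewrite /z g1 g2 (pos_extE f s0) /hart subrr.
move=> t t0; have hv : {ae leb, forall xi, hart (v t) xi = complex.Re (U t xi) - complex.Im (U t xi)}.
  by apply: filterS (HU t t0) => xi ->.
apply: filterS2 (filterI hv zF) (filterI HE (wL2_wdata wF)) => xi [-> zFx] [Ex [mFx iFx]].
have iF := wF_integrable sg0 mFx iFx.
pose y s := complex.Re (U s xi) - complex.Im (U s xi).
have zE s : 0 <= s -> mu.-integrable `]0, s] (EFin \o z^~ xi) -> \int[mu]_(q in `]0, s]) z q xi = \int[mu]_(q in `[0, s]) F q xi.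
  move=> s0 iz; have iF' := integrable_sub_obnd (iF s); rewrite -(Rintegral_itv_obnd_cbnd iF').
  congr fine; apply: ae_eq_integral; [exact: mitv|exact: measurable_int _ iz|exact: measurable_int _ iF'|].
  move: zFx; apply: ae_muS => q h; rewrite /= in_itv/= => /andP[q0 _]; congr EFin; apply/eqP.
  by rewrite -subr_eq0; move: h; rewrite (pos_extE z q0) (pos_extE F q0) => ->.
have bal s : 0 <= s -> mu.-integrable `[0, s] (EFin \o y) /\
    y s + L xi * \int[mu]_(q in `[0, s]) y q = h0 xi + \int[mu]_(q in `[0, s]) F q xi.
  move=> s0; have [[i1 i2] [i3 i4] EE] := Ex s s0.
  have iy := integrableB (mitv _) i1 i2; have iz := integrableB (mitv _) i3 i4; split.
    by apply: eq_integrable iy => // q _; exact: mitv.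
  have iz' : mu.-integrable `]0, s] (EFin \o z^~ xi) by apply: eq_integrable iz => // q _; exact: mitv.
  rewrite -(zE s s0 iz') (RintegralB (mitv _) i1 i2) (RintegralB (mitv _) i3 i4).
  have Er := congr1 (@complex.Re R) EE; have Ei := congr1 (@complex.Im R) EE.
  move: Er Ei; rewrite /y /hart; case: (U s xi) (fourier u0 xi) => [p q] [p' q'] /=.
  by rewrite !mul0r subr0 addr0; lra.
have iy b : mu.-integrable `[0, b] (EFin \o y).
  have [b0|b0] := leP 0 b; first exact: (bal b b0).1.
  by rewrite set_itv_ge ?integrable_set0// bnd_simp -ltNge.
have y0 : y 0 = h0 xi by have [_] := bal 0 (lexx 0); rewrite set_itv1 !Rintegral_set1 mulr0 !addr0.
have py : prim y (fun s => F s xi - L xi * y s).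
  split=> [b|s s0].
    by have := integrableB (mitv _) (iF b) (integrableZl (mitv _) (L xi) (iy b)); apply: eq_integrable => // q _; exact: mitv.
  have [_] := bal s s0; rewrite (RintegralB (mitv _) (iF s) (integrableZl (mitv _) (L xi) (iy s))).
  by rewrite (RintegralZl (L xi) (mitv _) (iy s)) y0 => h; lra.
have := odesol_unique iF py _ t0; rewrite y0; apply.
by apply: nearW => s _; rewrite subrK.
Qed.

End limit_solution.

Unset Implicit Arguments.
Set Strict Implicit.
Set Printing Implicit Defensive.

Theorem theorem3p2 (R : realType) (N : nat) (N_gt0 : (0 < N)%N)
    (Lhat : 'rV[R]_N -> R) (LhatP : multiplier_symbol Lhat)
    (schwartz_dom : forall v, schwartz v -> multiplier_dom Lhat v)
    (K : R) (K_le0 : K <= 0)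
    (K_le : {ae lebesgue_rV R N, forall xi, K <= Lhat xi})
    (f : R -> 'rV[R]_N -> R) (f_loc : L1loc f)
    (f_weight : exists2 eps1 : R, 0 < eps1 & forall eps, 0 < eps < eps1 ->
       (\int[lebesgue_measure]_(t in `]0%R, +oo[)
          ((expR (- t / eps))%:E * L2norm (f t) ^+ 2) < +oo)%E)
    (u0 : 'rV[R]_N -> R) (u0V : inV Lhat u0) :
  exists2 eps0 : R, 0 < eps0 &
    (forall eps, 0 < eps < eps0 ->
       exists2 u, minimizer Lhat f u0 eps u &
         forall v, minimizer Lhat f u0 eps v ->
           forall t, 0 <= t -> {ae lebesgue_rV R N, forall x, v t x = u t x}) /\
    exists u,
      [/\ solution Lhat f u0 u,
          forall v, solution Lhat f u0 v ->
            forall t, 0 <= t -> {ae lebesgue_rV R N, forall x, v t x = u t x} &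
          forall ueps : R -> R -> 'rV[R]_N -> R,
            (forall eps, 0 < eps < eps0 ->
               minimizer Lhat f u0 eps (ueps eps)) ->
            (forall e : nat -> R, (forall n, 0 < e n) ->
               e n @[n --> \oo] --> 0 ->
               {ae (lebesgue_measure \x lebesgue_rV R N)%E,
                forall z, 0 < z.1 ->
                  ueps (e n) z.1 z.2 @[n --> \oo] --> u z.1 z.2}) /\
            (forall T, 0 < T ->
               [/\ CV Lhat T u,
                   forall eps, 0 < eps < eps0 -> CV Lhat T (ueps eps) &
                   ereal_sup [set Vnorm Lhat (ueps eps t \- u t) | t in `[0, T]]
                     @[eps --> 0^'+] --> 0%E])].
Proof.
have [eps1 eps1_gt0 wf1] := f_weight; have [mL eL] := LhatP.
have Lu0 : L2 (lebesgue_rV R N) u0 by apply/inL2E; exact: u0V.1.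
have Vh0 : (\int[lebesgue_rV R N]_xi (`|Lhat xi| * hart u0 xi ^+ 2)%:E < +oo)%E.
  have hs : {ae lebesgue_rV R N, forall xi, hart u0 xi = hart u0 xi} by exact: nearW.
  by rewrite -(abs_form mL eL Lu0 (L2_hart Lu0).1 hs); exact: u0V.2.
(* The weight bound is assumed strictly below [eps1], so it is read at [eps1 / 2]. *)
pose sg := (eps1 / 2)^-1.
have sg0 : 0 <= sg by rewrite invr_ge0 divr_ge0// ltW.
have wf : wL2 sg (pos_ext f).
  by apply: (weight_wL2 f_loc.1); apply: wf1; move: eps1_gt0; lra.
have [F wF hF] := wL2_hart wf.
have r1 := rate_ge1 K_le0 sg0; have r0 : 0 < rate K sg by exact: lt_le_trans r1.
have Lh0 := L2_hart Lu0.
exists (2 * rate K sg)^-1; first by rewrite invr_gt0 mulr_gt0.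
have eok eps : 0 < eps < (2 * rate K sg)^-1 -> 0 < eps /\ 2 * eps * rate K sg <= 1.
  move=> /andP[e0 e1]; split=> //; rewrite mulrAC -ler_pdivlMl ?mulr_gt0// mulr1; exact: ltW.
split=> [eps /eok[e0 er]|].
  have [u [mu _ _]] := minimizer_exists K_le0 sg0 mL K_le eL Lu0 Vh0 wf wF hF e0 er.
  exists u => // v mv; exact (minimizer_unique K_le0 sg0 mL K_le eL Lu0 Vh0 wf wF hF e0 er mu mv).
have [u [ju Lu hu]] := limit_exists K_le0 sg0 mL K_le eL Lu0 Vh0 wf wF hF.
have tU := tame_U0J K_le0 sg0 mL K_le Lh0 wF.
exists u; split.
- exact (limit_solution K_le0 sg0 mL K_le eL Lu0 Vh0 wf wF hF ju Lu hu).
- move=> v sv t t0; have [cv _ _] := sv; apply: (hart_inj (CL2_L2 cv t0) (Lu t t0)).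
  by apply: filterS2 (solution_hart sg0 wF hF sv t0) (hu t t0) => xi -> ->.
move=> ueps mueps; split=> [e e_gt0 ecv|T T_gt0].
  have e00 : 0 < (2 * rate K sg)^-1 by rewrite invr_gt0 mulr_gt0.
  (* The functions [ueps eps] are minimizers below the threshold only, so the sequence is shifted to
     start where it stays below. *)
  have [n0 _ Hn0] : \forall n \near \oo, e n < (2 * rate K sg)^-1.
    by have /cvgrPdist_lt /(_ _ e00) := ecv; apply: filterS => n; rewrite sub0r normrN gtr0_norm.
  have en n : 0 < e (n + n0)%N < (2 * rate K sg)^-1 by rewrite e_gt0 Hn0//= leq_addl.
  have ecv' : e (n + n0)%N @[n --> \oo] --> 0 by rewrite cvg_shiftn.
  have := minimizers_ae_joint K_le0 sg0 mL K_le eL Lu0 Vh0 wf wF hF (fun n => eok _ (en n)) (fun n => mueps _ (en n)) ecv' ju Lu hu.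
  move=> [A [mA A0 sA]]; exists A; split=> // z hz; apply: sA => hz'; apply: hz => z0.
  by have := hz' z0; rewrite -(cvg_shiftn n0 (fun n => ueps (e n) z.1 z.2)).
have Le eps : 0 < eps < (2 * rate K sg)^-1 -> forall t, 0 <= t -> L2 (lebesgue_rV R N) (ueps eps t).
  by move=> he t t0; have [[[[cu _ _] _] _] _] := mueps _ he; exact: CL2_L2 cu t0.
have he eps (h : 0 < eps < (2 * rate K sg)^-1) t (t0 : 0 <= t) :
    {ae lebesgue_rV R N, forall xi, hart (ueps eps t) xi = UJ Lhat (hart u0) F eps t xi}.
  have [e0 er] := eok _ h.
  exact (minimizer_hart K_le0 sg0 mL K_le eL Lu0 Vh0 wf wF hF e0 er (mueps _ h) t0).
split.
- exact (realized_CV K_le0 sg0 mL Lh0 Vh0 wF eL tU Lu hu T).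
- move=> eps h; have [e0 er] := eok _ h.
  exact (realized_CV K_le0 sg0 mL Lh0 Vh0 wF eL (tame_UJ K_le0 sg0 mL K_le Lh0 wF e0 er) (Le _ h) (he _ h) T).
apply/(cvge0P (at_right_proper_filter (0 : R))) => [eps|a a0].
  (* [cvge0P] asks for nonnegativity at every [eps]; the value at time 0 bounds the supremum from
     below. *)
  apply: (@le_trans _ _ (Vnorm Lhat (ueps eps 0 \- u 0))); first exact: sqrte_ge0.
  by apply: ereal_sup_ubound; exists 0 => //=; rewrite in_itv/= lexx ltW.
have [d d0 Hd] := UJ_uniform K_le0 sg0 mL K_le Lh0 Vh0 wF (ltW T_gt0) (exprn_gt0 2 a0).
have e00 : 0 < (2 * rate K sg)^-1 by rewrite invr_gt0 mulr_gt0.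
near=> eps.
have h : 0 < eps < (2 * rate K sg)^-1.
  by apply/andP; split; near: eps; [exact: nbhs_right_gt|exact: nbhs_right_lt].
have ed : eps < d by near: eps; exact: nbhs_right_lt.
have [e0 er] := eok _ h.
apply: ge_ereal_sup => _ [t /= + <-]; rewrite in_itv/= => /andP[t0 tT].
have tE := tame_UJ K_le0 sg0 mL K_le Lh0 wF e0 er.
rewrite (realized_Vnorm_sub mL eL tE (Le _ h) (he _ h) tU.1 t0 t0 (Lu t t0) (hu t t0)).
apply: sqrte_le (ltW a0) (Hd eps t e0 ed er t0 tT).
by apply: integral_ge0 => xi _; rewrite lee_fin mulr_ge0 ?sqr_ge0// addr_ge0.
Unshelve. all: by end_near.
Qed.
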